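(* Let $Z<0$, $N\ge 2$ and $n\in\{1,\dots,N-1\}$ be fixed, and suppose $\omega>\omega_n^*$. Then the standing wave $e^{i\omega t}\Theta_{\omega,n}$ of the cubic NLS on $\mathcal G$ is: (1) orbitally stable in $H^1(\mathcal G)$ in the cases (a) $n=1$ and $N=2$; (b) $n=1$, $N>2$ and $\omega>\omega_n^\sharp$. (2) orbitally stable in $X_{\mathrm{mean}}\cap H^1(\mathcal G)$ in the cases (a) $2n=N$; (b) $2n>N$ and $\omega>2N^2/Z^2$; (c) $2n<N$ and $\omega>\omega_n^\sharp$. (3) orbitally unstable in $H^1(\mathcal G)$ in the cases (a) $2n=N$, $N>2$; (b) $2n<N$, $N>2$, $n\ge2$ and $\omega>\omega_n^\sharp$; (c) $2n<N$ and $\omega<\omega_n^\sharp$; (d) $2n>N$, $N>2$ and $\omega>2N^2/Z^2$; (e) $2n>N$ and $\omega<2N^2/Z^2$.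
   Context: Star graph: $\mathcal G$ consists of $N$ half-lines, each identified with $[L,\infty)$, $L\ge 0$, joined at the common vertex $x=L$. Functions on $\mathcal G$ are $N$-tuples $\mathbf U=(\psi_1,\dots,\psi_N)$, $\psi_j:[L,\infty)\to\mathbb C$; $L^2(\mathcal G)=\bigoplus_{j=1}^N L^2(L,\infty)$, $H^k(\mathcal G)=\bigoplus_{j=1}^N H^k(L,\infty)$ (no vertex condition). Operator: $\mathcal H_Z^{\delta'}(\psi_j)_j=(-\psi_j'')_j$, self-adjoint on $$D(\mathcal H_Z^{\delta'})=\Big\{\mathbf U\in H^2(\mathcal G):\ \psi_1'(L)=\dots=\psi_N'(L),\ \sum_{j=1}^N\psi_j(L)=Z\psi_1'(L)\Big\}.$$ Cubic NLS: $i\mathbf U_t-\mathcal H_Z^{\delta'}\mathbf U+|\mathbf U|^2\mathbf U=\mathbf 0$, with solutions in $C(\mathbb R;H^1(\mathcal G))$ understood in the Duhamel sense for the group $e^{-it\mathcal H_Z^{\delta'}}$. Subspace: $X_{\mathrm{mean}}=\{\mathbf v\in L^2(\mathcal G): v_1\equiv\dots\equiv v_n,\ v_{n+1}\equiv\dots\equiv v_N\}$. Profile $\Theta_{\omega,n}$: put $\Psi_a(x)=\sqrt{2\omega}\,\operatorname{sech}(\sqrt\omega(x-L)+a)$, $x\ge L$, and $$\alpha_n(t)=\frac nt+\frac{N-n}{\sqrt{1-t^2}},\ t\in(0,1),\qquad t_n^*=\Big(\frac{n^{2/3}}{n^{2/3}+(N-n)^{2/3}}\Big)^{1/2},\qquad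 \omega_n^*=\frac{\alpha_n(t_n^* )^2}{Z^2}=\frac{(n^{2/3}+(N-n)^{2/3})^3}{Z^2}.$$ ($t_n^*$ is the unique minimizer of $\alpha_n$.) For $\omega>\omega_n^*$ let $t_1=t_1(\omega)$ be the unique element of $(0,t_n^* )$ with $\alpha_n(t_1)=-Z\sqrt\omega$, $t_N=\sqrt{1-t_1^2}$, $a_1=\operatorname{arctanh}t_1$, $a_N=\operatorname{arctanh}t_N$, and $\Theta_{\omega,n}=(\Psi_{a_1},\dots,\Psi_{a_1},\Psi_{a_N},\dots,\Psi_{a_N})\in D(\mathcal H_Z^{\delta'})$, with $\Psi_{a_1}$ repeated $n$ times and $\Psi_{a_N}$ repeated $N-n$ times. Frequency $\omega_n^\sharp$ (used only when $2n<N$): $\omega_n^\sharp=\alpha_n(t_n^\sharp)^2/Z^2>\omega_n^*$, where $t_n^\sharp\in(0,t_n^* )$ is the unique zero in $(0,1)$ of $$\mathcal N_n(t)=N\big((N-n)t^3-n(1-t^2)^{3/2}\big)-n(N-n)(2t^2-1).$$ Orbital stability: for $X=H^1(\mathcal G)$ or $X=X_{\mathrm{mean}}\cap H^1(\mathcal G)$ (with the $H^1(\mathcal G)$ norm), $e^{i\omega t}\Theta$ is orbitally stable in $X$ if for every $\varepsilon>0$ there is $\eta>0$ such that whenever $\mathbf U_0\in X$ and $\|\mathbf U_0-\Theta\|_X<\eta$, the solution with $\mathbf U(0)=\mathbf U_0$ is globally defined for all $t\in\mathbb R$ and $\sup_{t\in\mathbb R}\inf_{\theta\in\mathbb R}\|\mathbf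 U(t)-e^{i\theta}\Theta\|_X<\varepsilon$. Otherwise it is orbitally unstable in $X$. *)

(* Defs.v *)
From HB Require Import structures.
From mathcomp Require Import all_boot all_order all_algebra.
From mathcomp Require Import all_classical all_reals all_analysis.
From mathcomp.real_closed Require Import complex.

Set Implicit Arguments.
Unset Strict Implicit.
Unset Printing Implicit Defensive.

Import Order.TTheory GRing.Theory Num.Theory numFieldNormedType.Exports.

Local Open Scope classical_set_scope.
Local Open Scope complex_scope.
Local Open Scope ring_scope.

(* A function on the star graph, as a representative of its class: only the
   values on [L, +oo) of each of the N components are relevant. *)
Definition gfun (R : realType) (N : nat) : Type := 'I_N -> R -> R[i].

Section StarGraph.
Context {R : realType} (L : R) {N : nat}.
Implicit Types U V W F G : gfun R N.

Local Notation mu := (@lebesgue_measure R).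

Definition sqnormc (z : R[i]) : R := complex.Re z ^+ 2 + complex.Im z ^+ 2.

Definition ae_eq_graph U V : Prop :=
  forall j, {ae mu, forall x, L <= x -> U j x = V j x}.

Definition L2 : set (gfun R N) := [set U | forall j,
  [/\ measurable_fun `[L, +oo[ (fun x => complex.Re (U j x)),
      measurable_fun `[L, +oo[ (fun x => complex.Im (U j x)) &
      (\int[mu]_(x in `[L, +oo[) (sqnormc (U j x))%:E < +oo)%E]].

(* Meaningful on [L2] only: [Rintegral] sends +oo to 0. *)
Definition L2norm U : R :=
  Num.sqrt (\sum_(j < N) \int[mu]_(x in `[L, +oo[) sqnormc (U j x)).

Definition Cintegral (a b : R) (g : R -> R[i]) : R[i] :=
  (\int[mu]_(x in `[a, b]) complex.Re (g x))
  +i* (\int[mu]_(x in `[a, b]) complex.Im (g x)).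

(* [U] is in H^1, represented by its absolutely continuous version on
   [L, +oo), and [V] is a version of its weak derivative.  Point values of
   elements of H^1, in particular at the vertex, refer to that version. *)
Definition H1_deriv U V : Prop :=
  [/\ L2 U, L2 V &
      forall j x, L <= x -> U j x = U j L + Cintegral L x (V j)].

Definition H1 : set (gfun R N) := [set U | exists V, H1_deriv U V].

(* The choice of version is immaterial, as any two agree a.e. on [L, +oo). *)
Definition weak_deriv U : gfun R N := xget (fun _ _ => 0) [set V | H1_deriv U V].

Definition H1norm U : R := Num.sqrt (L2norm U ^+ 2 + L2norm (weak_deriv U) ^+ 2).

(* The graph of the delta' operator between L^2 classes: the class of [U] is in
   the domain, and [F] = - U''.  Here [V] = U' is itself in H^1, hence continuous
   up to the vertex. *)
Definition deltap_graph (Z : R) U F : Prop :=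
  exists U0 V W,
    [/\ ae_eq_graph U U0, H1_deriv U0 V /\ H1_deriv V W,
        forall i j, V i L = V j L,
        forall j, \sum_(k < N) U0 k L = Z%:C * V j L &
        ae_eq_graph F (- W)].

(* [T] is the group t |-> e^{-itH}, H the delta' operator: the strongly
   continuous unitary group on L^2 with generator -iH.  By Stone's theorem it
   exists and is unique up to a.e. equality. *)
Record deltap_group (Z : R) (T : R -> gfun R N -> gfun R N) : Prop := {
  deltap_group_L2 : forall t U, L2 U -> L2 (T t U) ;
  deltap_group_linear : forall t (a : R[i]) U V, L2 U -> L2 V ->
    ae_eq_graph (T t (a *: U + V)) (a *: T t U + T t V) ;
  deltap_group_isometry : forall t U, L2 U -> L2norm (T t U) = L2norm U ;
  deltap_group0 : forall U, L2 U -> ae_eq_graph (T 0 U) U ;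
  deltap_groupD : forall s t U, L2 U -> ae_eq_graph (T (s + t) U) (T s (T t U)) ;
  deltap_group_continuous : forall U, L2 U ->
    L2norm (T t U - U) @[t --> (0 : R)] --> (0 : R) ;
  deltap_group_generator : forall U F, L2 U -> L2 F ->
    (L2norm ((h^-1)%:C *: (T h U - U) + 'i%C *: F) @[h --> (0 : R)^'] --> (0 : R)
     <-> deltap_graph Z U F)
}.

(* [G] is the Riemann integral of the L^2-valued function [F] from a to b, with
   the sign convention of oriented integrals when b < a; the nodes of the tagged
   partition are a + (b - a) u_k, and its tags a + (b - a) v_k. *)
Definition L2_integral (F : R -> gfun R N) (a b : R) G : Prop :=
  L2 G /\
  forall eps : R, 0 < eps -> exists2 delta : R, 0 < delta &
    forall (m : nat) (u v : nat -> R), u 0%N = 0 -> u m = 1 ->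
      (forall k, (k < m)%N ->
         u k <= v k <= u k.+1 /\ u k.+1 - u k < delta) ->
      L2norm (\sum_(k < m)
                ((b - a) * (u k.+1 - u k))%:C *: F (a + (b - a) * v k)
              - G) < eps.

Definition cubic U : gfun R N := fun j x => (sqnormc (U j x))%:C * U j x.

(* Global solutions in C(R; H^1) of i U_t - H U + |U|^2 U = 0, U(0) = U0:
   U(t) = e^{-itH} U0 + i \int_0^t e^{-i(t-s)H} |U(s)|^2 U(s) ds. *)
Definition global_solution (Z : R) (U0 : gfun R N) (U : R -> gfun R N) : Prop :=
  [/\ forall t, H1 (U t),
      forall t, H1norm (U s - U t) @[s --> t] --> (0 : R) &
      exists2 T, deltap_group Z T &
        forall t, exists2 I,
          L2_integral (fun s => T (t - s) (cubic (U s))) 0 t I &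
          ae_eq_graph (U t) (T t U0 + 'i%C *: I)].

Definition Xmean (n : nat) : set (gfun R N) :=
  [set U | L2 U /\
           forall i j : 'I_N, (i < n)%N = (j < n)%N ->
             {ae mu, forall x, L <= x -> U i x = U j x}].

Definition cis (theta : R) : R[i] := cos theta +i* sin theta.

(* Orbital stability of e^{i omega t} Theta in [X], a subspace of H^1. *)
Definition orbitally_stable (Z : R) (X : set (gfun R N)) (Theta : gfun R N) :
    Prop :=
  forall eps : R, 0 < eps -> exists2 eta : R, 0 < eta &
    forall U0, X U0 -> H1norm (U0 - Theta) < eta ->
      exists2 U, global_solution Z U0 U &
        (ereal_sup (range (fun t : R =>
           ereal_inf (range (fun theta : R =>
             (H1norm (U t - cis theta *: Theta))%:E)))) < eps%:E)%E.

End StarGraph.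

Section Profile.
Context {R : realType} (L Z : R) (N n : nat).

Definition sech (x : R) : R := 2 / (expR x + expR (- x)).

Definition artanh (t : R) : R := ln ((1 + t) / (1 - t)) / 2.

Definition Psi (omega a x : R) : R :=
  Num.sqrt (2 * omega) * sech (Num.sqrt omega * (x - L) + a).

Definition alpha (t : R) : R :=
  n%:R / t + (N - n)%:R / Num.sqrt (1 - t ^+ 2).

Definition t_star : R :=
  Num.sqrt (n%:R `^ (2 / 3) / (n%:R `^ (2 / 3) + (N - n)%:R `^ (2 / 3))).

Definition omega_star : R := alpha t_star ^+ 2 / Z ^+ 2.

Definition t_one (omega : R) : R :=
  xget 0 [set t | 0 < t < t_star /\ alpha t = - Z * Num.sqrt omega].

Definition Theta (omega : R) : gfun R N :=
  let a1 := artanh (t_one omega) in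
  let aN := artanh (Num.sqrt (1 - t_one omega ^+ 2)) in
  fun j x => (Psi omega (if (j < n)%N then a1 else aN) x)%:C.

Definition calN (t : R) : R :=
  N%:R * ((N - n)%:R * t ^+ 3 - n%:R * (1 - t ^+ 2) `^ (3 / 2))
  - n%:R * (N - n)%:R * (2 * t ^+ 2 - 1).

(* Used only when 2n < N, where the zero in (0, 1) is unique and below
   [t_star]. *)
Definition t_sharp : R := xget 0 [set t | 0 < t < 1 /\ calN t = 0].

Definition omega_sharp : R := alpha t_sharp ^+ 2 / Z ^+ 2.

End Profile.

Arguments Theta {R} L Z N n omega.

(* Main.v *)
(* The energy space of the graph, with the form of the operator shifted by [lam],
   is a real Hilbert space [V] on which the resolvent [B] is a bounded positive
   operator.  Stone's theorem gives the group, the cubic term is a locally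
   Lipschitz map of [V], and the conservation of mass and energy makes the flow
   global.  The standing wave is stable when the Hessian of the action is
   coercive up to multiples of <B Th, x>^2 and <J Th, x>^2; by the argument of
   Grillakis, Shatah and Strauss it is unstable when this holds up to one more
   square, that of the pairing with a negative direction.  Permutations of the
   edges commute with the flow, so both criteria may be used in the subspace of
   functions that agree on some of the edges.

   The Hessian acts on real and imaginary parts separately.  As psi' and psi do
   not vanish on an edge, - d^2 + om - 3 psi^2 and - d^2 + om - psi^2 factor, and
   the Hessian is a sum of squares of r = v' - g v plus a quadratic form in the
   vertex values.  The imaginary form is nonnegative with kernel Th.  In the real
   form the constraint <B Th, v> = 0 involves r only through the functions
   psi / tau, which leaves a quadratic form on R^N.  It is diagonal on the
   differences of vertex values inside each of the two blocks of edges, with the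
   signs of 2 t^2 - 1 and 1 - 2 t^2, where t = t_one; on vectors constant on the
   blocks its determinant has the sign of - (1 - 2 t^2) N_n(t).  As alpha_n
   decreases on (0, t_star), the frequency thresholds are t < 1 / sqrt 2 and
   t < t_sharp. *)

Require Import Defs.
From HB Require Import structures.
From mathcomp Require Import all_boot all_order all_algebra.
From mathcomp Require Import all_classical all_reals all_analysis.
From mathcomp Require Import measurable_realfun perm.
From mathcomp Require Import ring lra.
From mathcomp.real_closed Require Import complex.

Set Implicit Arguments.
Unset Strict Implicit.
Unset Printing Implicit Defensive.

Import Order.TTheory GRing.Theory Num.Theory numFieldNormedType.Exports.

Local Open Scope classical_set_scope.
Local Open Scope ring_scope.

(** * Real Hilbert spaces and differentiable curves *)

(** The scalars are real because the action is only real differentiable; multiplication by i is kept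
    as an isometry [J]. The unbounded operator H is never a map: [B] is the inverse of H + [lam], so
    H sends [B x] to [x - lam *: B x], and statements about H become statements about the bounded
    [B]. The obstacle is that a solution [u] in the energy space need not be differentiable there,
    while mass and action must be differentiated along it. The curve [w t = T (- t) (u t)] solves an
    equation with locally Lipschitz right-hand side, hence is C^1, and the isometries [T t] carry
    the quadratic quantities from [u] to [w]; only the quartic term needs its own estimate. A radial
    truncation makes the Lipschitz constant global and is removed afterwards, because the solution
    stays close to the orbit. The same group acts on two Hilbert spaces: L^2, where solutions are
    defined, and the energy space, where the Hessian is coercive. Where the Hessian has several
    negative directions, a subspace of symmetric functions is chosen that retains exactly one;
    instability there implies instability in H^1. *)

Record hilb (R : realType) := Hilb {
  hcar :> lmodType R ;
  ip : hcar -> hcar -> R ;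
  ipC : forall x y, ip x y = ip y x ;
  ipDl : forall x y z, ip (x + y) z = ip x z + ip y z ;
  ipZl : forall a x z, ip (a *: x) z = a * ip x z ;
  ip_ge0 : forall x, 0 <= ip x x ;
  ip_eq0 : forall x, ip x x = 0 -> x = 0 ;
  ip_complete : forall u : nat -> hcar,
    (forall e, 0 < e -> exists n, forall p q, (n <= p)%N -> (n <= q)%N ->
       ip (u p - u q) (u p - u q) <= e) ->
    exists l, forall e, 0 < e -> exists n, forall p, (n <= p)%N ->
       ip (u p - l) (u p - l) <= e }.
Arguments ip {R h} x y.

Section HilbertBasics.
Context {R : realType} {E : hilb R}.
Implicit Types x y z : E.

Definition nrm x : R := Num.sqrt (ip x x).

Lemma ipDr x y z : ip z (x + y) = ip z x + ip z y.
Proof. by rewrite ipC ipDl !(ipC z). Qed.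
Lemma ipZr a x z : ip z (a *: x) = a * ip z x.
Proof. by rewrite ipC ipZl (ipC z). Qed.
Lemma ipNl x z : ip (- x) z = - ip x z.
Proof. by rewrite -scaleN1r ipZl mulN1r. Qed.
Lemma ipNr x z : ip z (- x) = - ip z x.
Proof. by rewrite ipC ipNl ipC. Qed.
Lemma ipBl x y z : ip (x - y) z = ip x z - ip y z.
Proof. by rewrite ipDl ipNl. Qed.
Lemma ipBr x y z : ip z (x - y) = ip z x - ip z y.
Proof. by rewrite ipDr ipNr. Qed.
Lemma ip0l z : ip 0 z = 0.
Proof. by rewrite -(subrr (0 : E)) ipBl subrr. Qed.
Lemma ip0r z : ip z 0 = 0.
Proof. by rewrite ipC ip0l. Qed.
Definition ipE := (ipDl, ipDr, ipNl, ipNr, ipZl, ipZr).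

Lemma nrm_ge0 x : 0 <= nrm x. Proof. exact: sqrtr_ge0. Qed.
Lemma nrm2 x : nrm x ^+ 2 = ip x x.
Proof. by rewrite sqr_sqrtr ?ip_ge0. Qed.
Lemma nrm0 : nrm 0 = 0. Proof. by rewrite /nrm ip0l sqrtr0. Qed.
Lemma nrm_eq0 x : nrm x = 0 -> x = 0.
Proof. by move=> h; apply: ip_eq0; rewrite -nrm2 h expr0n. Qed.
Lemma nrmN x : nrm (- x) = nrm x.
Proof. by rewrite /nrm ipNl ipNr opprK. Qed.
Lemma nrmBC x y : nrm (x - y) = nrm (y - x).
Proof. by rewrite -opprB nrmN. Qed.
Lemma nrmZ a x : nrm (a *: x) = `|a| * nrm x.
Proof.
by rewrite /nrm ipZl ipZr mulrA -expr2 sqrtrM ?sqr_ge0// sqrtr_sqr.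
Qed.
Lemma nrm_le x (C : R) : 0 <= C -> ip x x <= C ^+ 2 -> nrm x <= C.
Proof. by move=> C0 h; rewrite -(ler_pXn2r (n := 2)) ?nnegrE ?nrm_ge0// nrm2. Qed.
Lemma nrm_ip_le x (C : R) : nrm x <= C -> ip x x <= C ^+ 2.
Proof.
move=> h; rewrite -nrm2 ler_pXn2r ?nnegrE ?nrm_ge0//.
exact: le_trans (nrm_ge0 _) h.
Qed.

Lemma CS x y : `|ip x y| <= nrm x * nrm y.
Proof.
have [->|y0] := eqVneq y 0; first by rewrite ip0r normr0 nrm0 mulr0.
have yy : 0 < ip y y.
  by rewrite lt_def ip_ge0 andbT; apply: contraNneq y0 => /ip_eq0 ->.
have := ip_ge0 (ip y y *: x - ip x y *: y).
rewrite !ipE (ipC y x) => h.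
rewrite -(ler_pXn2r (n := 2)) ?nnegrE ?mulr_ge0 ?nrm_ge0//.
rewrite real_normK ?num_real// exprMn !nrm2.
have : 0 <= ip y y * (ip x x * ip y y - ip x y ^+ 2) by nra.
by rewrite pmulr_rge0// subr_ge0.
Qed.

Lemma ip_le x y : ip x y <= nrm x * nrm y.
Proof. exact: le_trans (ler_norm _) (CS x y). Qed.

Lemma nrmD x y : nrm (x + y) <= nrm x + nrm y.
Proof.
apply: nrm_le; first by rewrite addr_ge0 ?nrm_ge0.
have := ip_le x y; rewrite !ipE (ipC y x) sqrrD !nrm2; lra.
Qed.
Lemma nrmB x y : nrm (x - y) <= nrm x + nrm y.
Proof. by rewrite -(nrmN y) nrmD. Qed.
Lemma nrm_tri z x y : nrm (x - y) <= nrm (x - z) + nrm (z - y).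
Proof. by rewrite -[x - y](subrKA z) nrmD. Qed.
Lemma nrm_sub x y : `|nrm x - nrm y| <= nrm (x - y).
Proof.
rewrite ler_norml; apply/andP; split.
  by have := nrmD (y - x) x; rewrite subrK nrmBC; lra.
by have := nrmD (x - y) y; rewrite subrK; lra.
Qed.

Lemma ip_ext x y : (forall z, ip x z = ip y z) -> x = y.
Proof.
by move=> h; apply/eqP; rewrite -subr_eq0; apply/eqP/ip_eq0; rewrite ipBl h subrr.
Qed.

Lemma small_nrm0 x (C : R) : (forall e, 0 < e -> nrm x <= C * e) -> x = 0.
Proof.
move=> h; apply: nrm_eq0; apply/eqP; rewrite eq_le nrm_ge0 andbT.
apply/ler_addgt0Pr => e e0; rewrite add0r.
have C1 : 0 < `|C| + 1 by rewrite ltr_wpDl.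
have := h (e / (`|C| + 1)) (divr_gt0 e0 C1) => /le_trans; apply.
rewrite mulrCA ger_pMr// ler_pdivrMr// mul1r.
by apply: (le_trans (ler_norm _)); rewrite lerDl.
Qed.

Lemma nrm_complete (u : nat -> E) :
  (forall e, 0 < e -> exists n, forall p q, (n <= p)%N -> (n <= q)%N ->
       nrm (u p - u q) <= e) ->
  exists l, forall e, 0 < e -> exists n, forall p, (n <= p)%N -> nrm (u p - l) <= e.
Proof.
move=> h; case: (@ip_complete _ _ u) => [e e0|l hl].
  have s0 : 0 < Num.sqrt e by rewrite sqrtr_gt0.
  have [n hn] := h _ s0.
  exists n => p q pn qn; have := nrm_ip_le (hn p q pn qn).
  by rewrite sqr_sqrtr// ltW.
exists l => e e0; have [n hn] := hl (e ^+ 2) (exprn_gt0 _ e0).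
by exists n => p pn; apply: nrm_le (hn _ pn); exact: ltW.
Qed.

End HilbertBasics.

(** Paired with an arbitrary vector, an identity between linear combinations becomes one that [ring]
    decides. *)
Ltac vring := apply: ip_ext => ?; rewrite ?(ipE, ip0l, ip0r); ring.

Section RealHilb.
Variable R : realType.
Lemma sqr_abs_le (a b : R) : 0 <= b -> a * a <= b ^+ 2 -> `|a| <= b.
Proof. by move=> b0 h; rewrite -(ger0_norm b0) -ler_sqr// !real_normK ?num_real ?expr2. Qed.
Let ler0n2 : 0 <= 2 :> R. Proof. by []. Qed.

Lemma RH_complete (u : nat -> R) :
    (forall e, 0 < e -> exists n, forall p q, (n <= p)%N -> (n <= q)%N ->
       (u p - u q) * (u p - u q) <= e) ->
    exists l, forall e, 0 < e -> exists n, forall p, (n <= p)%N ->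
       (u p - l) * (u p - l) <= e.
Proof.
move=> h.
have cu : cvgn u.
  apply: R_complete; apply: cauchy_exP => e e0.
  have e2 : 0 < (e / 2) ^+ 2 by rewrite exprn_gt0// divr_gt0.
  have [n hn] := h _ e2; exists (u n); exists n => // p /= np.
  have := sqr_abs_le (divr_ge0 (ltW e0) ler0n2) (hn n p (leqnn n) np).
  by rewrite /ball /=; lra.
exists (limn u) => e e0.
have s0 : 0 < Num.sqrt e by rewrite sqrtr_gt0.
move/cvgrPdist_le : cu => /(_ _ s0)[n _ hn]; exists n => p np.
have := hn p np => /= hp; rewrite -expr2 -(sqr_sqrtr (ltW e0)).
by rewrite -(real_normK (num_real _)) distrC !expr2 ler_pM.
Qed.

Lemma RH_eq0 (x : R) : x * x = 0 -> x = 0.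
Proof. by move/eqP; rewrite mulf_eq0 orbb => /eqP. Qed.

(** Scalar functions become curves in this one-dimensional space, so that one calculus of
    derivatives serves both. *)
Definition RH : hilb R := @Hilb R (R^o) (fun x y : R => x * y)
  (fun x y => mulrC x y) (fun x y z => mulrDl x y z)
  (fun a x z => esym (mulrA a x z)) (fun x => (sqr_ge0 x : 0 <= x * x))
  RH_eq0
  RH_complete.

Lemma nrmRH (x : R) : nrm (x : RH) = `|x|.
Proof. by rewrite /nrm /= -expr2 sqrtr_sqr. Qed.
End RealHilb.

Section Derivative.
Context {R : realType}.

(** The difference quotient is multiplied out, so that [s = t] needs no exclusion and no topology on
    [E] has to be declared. *)
Definition der (E : hilb R) (f : R -> E) (t : R) (l : E) : Prop :=
  forall e, 0 < e -> \forall s \near t, nrm (f s - f t - (s - t) *: l) <= e * `|s - t|.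
Definition cont_at (E : hilb R) (f : R -> E) (t : R) : Prop :=
  forall e, 0 < e -> \forall s \near t, nrm (f s - f t) <= e.
Definition derR (f : R -> R) (t l : R) : Prop := @der (RH R) f t l.

Lemma near_ex (t : R) (P : R -> Prop) :
  (\forall s \near t, P s) <-> exists2 d, 0 < d & forall s, `|s - t| < d -> P s.
Proof.
split=> [/nbhs_ballP[d d0 hd]|[d d0 hd]].
  by exists d => // s st; apply: hd; rewrite /ball /= distrC.
by apply/nbhs_ballP; exists d => // s; rewrite /ball /= distrC; apply: hd.
Qed.

Lemma near_dist (t d : R) : 0 < d -> \forall s \near t, `|s - t| <= d.
Proof. by move=> d0; apply/near_ex; exists d => // s /ltW. Qed.

Lemma der_cont (E : hilb R) (f : R -> E) t l : der f t l -> cont_at f t.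
Proof.
move=> h e e0.
have c0 : 0 < 1 + nrm l by rewrite ltr_pwDl// nrm_ge0.
near=> s.
have h1 : nrm (f s - f t - (s - t) *: l) <= 1 * `|s - t| by near: s; apply: h.
have h2 : `|s - t| <= e / (1 + nrm l) by near: s; apply: near_dist; rewrite divr_gt0.
have -> : f s - f t = (f s - f t - (s - t) *: l) + (s - t) *: l by rewrite subrK.
apply: le_trans (nrmD _ _) _; rewrite nrmZ.
move: h2; rewrite ler_pdivlMr// => h2; lra.
Unshelve. all: by end_near. Qed.

Lemma der_unique (E : hilb R) (f : R -> E) t l m : der f t l -> der f t m -> l = m.
Proof.
move=> h1 h2; apply/eqP; rewrite -subr_eq0; apply/eqP.
apply: (@small_nrm0 _ _ _ 2) => e e0.
have : \forall s \near t, nrm (f s - f t - (s - t) *: l) <= e * `|s - t|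
    /\ nrm (f s - f t - (s - t) *: m) <= e * `|s - t|.
  by have n1 := h1 _ e0; have n2 := h2 _ e0; near=> s; split; near: s.
case/near_ex => d0 d0_gt hd; pose d := d0 / 2.
have d_gt : 0 < d by rewrite divr_gt0.
have := hd (t + d); rewrite addrAC subrr add0r gtr0_norm//.
have -> : d < d0 by rewrite /d; lra.
move=> /(_ isT) [a b].
have : nrm (d *: (l - m)) <= 2 * e * d.
  have -> : d *: (l - m) = (f (t + d) - f t - d *: m) - (f (t + d) - f t - d *: l).
    by vring.
  apply: le_trans (nrmB _ _) _; lra.
by rewrite nrmZ gtr0_norm// mulrC ler_pM2r.
Unshelve. all: by end_near. Qed.

Lemma eq_der (E : hilb R) (f g : R -> E) t l : f =1 g -> der f t l -> der g t l.
Proof. by move=> /funext ->. Qed.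

Lemma der_cst (E : hilb R) (c : E) t : der (fun _ => c) t 0.
Proof.
by move=> e e0; near=> s; rewrite subrr scaler0 subr0 nrm0 mulr_ge0// ltW.
Unshelve. all: by end_near. Qed.

Lemma der_id t : derR (fun s => s) t 1.
Proof.
move=> e e0; near=> s; rewrite [_ *: _]mulr1 subrr nrm0 mulr_ge0// ltW//.
Unshelve. all: by end_near. Qed.

Lemma derD (E : hilb R) (f g : R -> E) t l m :
  der f t l -> der g t m -> der (fun s => f s + g s) t (l + m).
Proof.
move=> hf hg e e0; have e2 : 0 < e / 2 by rewrite divr_gt0.
near=> s.
have h1 : nrm (f s - f t - (s - t) *: l) <= e / 2 * `|s - t| by near: s; apply: hf.
have h2 : nrm (g s - g t - (s - t) *: m) <= e / 2 * `|s - t| by near: s; apply: hg.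
have -> : f s + g s - (f t + g t) - (s - t) *: (l + m) =
   (f s - f t - (s - t) *: l) + (g s - g t - (s - t) *: m).
  by vring.
apply: le_trans (nrmD _ _) _; lra.
Unshelve. all: by end_near. Qed.

Lemma der_lin (E F : hilb R) (A : {linear E -> F}) (C : R) (f : R -> E) t l :
  (forall x, nrm (A x) <= C * nrm x) ->
  der f t l -> der (fun s => A (f s)) t (A l).
Proof.
move=> hA hf e e0; have C1 : 0 < `|C| + 1 by rewrite ltr_wpDl.
near=> s.
have h : nrm (f s - f t - (s - t) *: l) <= e / (`|C| + 1) * `|s - t|.
  by near: s; apply: hf; rewrite divr_gt0.
rewrite -linearZ -!linearB; apply: le_trans (hA _) _.
apply: (@le_trans _ _ ((`|C| + 1) * nrm (f s - f t - (s - t) *: l))).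
  by rewrite ler_wpM2r ?nrm_ge0//; apply: le_trans (ler_norm _) _; rewrite lerDl.
by apply: le_trans (ler_wpM2l (ltW C1) h) _; rewrite mulrA mulrCA divff ?mulr1// gt_eqF.
Unshelve. all: by end_near. Qed.

Lemma derZ (E : hilb R) (f : R -> E) t l (a : R) :
  der f t l -> der (fun s => a *: f s) t (a *: l).
Proof.
by apply: (@der_lin E E ( *:%R a : {linear E -> E}) `|a|) => x /=; rewrite nrmZ.
Qed.

Lemma derN (E : hilb R) (f : R -> E) t l : der f t l -> der (fun s => - f s) t (- l).
Proof.
by rewrite -scaleN1r => /(derZ (-1)); apply: eq_der => s; rewrite scaleN1r.
Qed.

Lemma derB (E : hilb R) (f g : R -> E) t l m :
  der f t l -> der g t m -> der (fun s => f s - g s) t (l - m).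
Proof. by move=> hf /derN; apply: derD. Qed.

Lemma der_flip (E : hilb R) (f : R -> E) t l :
  der f (- t) l -> der (fun s => f (- s)) t (- l).
Proof.
move=> h e /(h e)/near_ex[d d0 hd]; apply/near_ex; exists d => // s st.
have -> : (s - t) *: - l = (- s - - t) *: l by rewrite scalerN -scaleNr opprB opprK addrC.
have e1 : `|- s - - t| = `|s - t| by rewrite -opprD normrN.
by have := hd (- s); rewrite e1; apply.
Qed.

Lemma der_near (E : hilb R) (f g : R -> E) t l :
  (\forall s \near t, f s = g s) -> der f t l -> der g t l.
Proof.
move=> /[dup] /nbhs_singleton fgt fg hf e e0; near=> s.
have <- : f s = g s by near: s.
by rewrite -fgt; near: s; apply: hf.
Unshelve. all: by end_near. Qed.

Lemma der_ip (E : hilb R) (f g : R -> E) t l m : der f t l -> der g t m ->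
  derR (fun s => ip (f s) (g s)) t (ip l (g t) + ip (f t) m).
Proof.
move=> hf hg e e0.
(* [A] bounds every factor that multiplies a small one: [g s] near [t], [l] and [f t]. Each of the
   three terms of the decomposition below then costs [e / 3]. *)
pose A := 1 + nrm (g t) + nrm l + nrm (f t) + nrm m.
have A1 : 1 <= A by have := (nrm_ge0 (g t), nrm_ge0 l, nrm_ge0 (f t), nrm_ge0 m); rewrite /A => -[[[]]]; lra.
have A0 : 0 < A by lra.
pose d := Num.min 1 (e / (3 * A)).
have d0 : 0 < d by rewrite lt_min ltr01 divr_gt0 ?mulr_gt0.
near=> s.
have h1 : nrm (f s - f t - (s - t) *: l) <= d * `|s - t| by near: s; apply: hf.
have h2 : nrm (g s - g t - (s - t) *: m) <= d * `|s - t| by near: s; apply: hg.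
have h3 : nrm (g s - g t) <= d by near: s; exact: (der_cont hg).
rewrite nrmRH.
set x := f s - f t - (s - t) *: l; set y := g s - g t - (s - t) *: m.
have -> : ip (f s) (g s) - ip (f t) (g t) - (s - t) *: (ip l (g t) + ip (f t) m : R^o) =
   ip x (g s) + (s - t) * ip l (g s - g t) + ip (f t) y.
  by rewrite /x /y !ipE /GRing.scale /=; ring.
have gs : nrm (g s) <= A.
  have := nrmD (g s - g t) (g t); rewrite subrK => h; apply: (le_trans h).
  have d1 : d <= 1 by rewrite ge_min lexx.
  by have := (nrm_ge0 l, nrm_ge0 (f t), nrm_ge0 m); rewrite /A => -[[]]; lra.
have dA : d * A <= e / 3.
  apply: (@le_trans _ _ (e / (3 * A) * A)); first by rewrite ler_wpM2r ?ge_min ?lexx ?orbT// ltW.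
  by rewrite invfM -!mulrA mulVf ?mulr1// gt_eqF.
have ss := normr_ge0 (s - t).
have b1 : `|ip x (g s)| <= e / 3 * `|s - t|.
  apply: (le_trans (CS _ _)); apply: (le_trans (ler_pM (nrm_ge0 _) (nrm_ge0 _) h1 gs)).
  by rewrite mulrAC ler_wpM2r.
have b2 : `|(s - t) * ip l (g s - g t)| <= e / 3 * `|s - t|.
  rewrite normrM mulrC ler_wpM2r//; apply: (le_trans (CS _ _)).
  apply: (le_trans (ler_wpM2l (nrm_ge0 _) h3)); apply: le_trans dA; rewrite mulrC ler_wpM2l ?(ltW d0)//.
  by have := (nrm_ge0 (g t), nrm_ge0 (f t), nrm_ge0 m); rewrite /A => -[[]]; lra.
have b3 : `|ip (f t) y| <= e / 3 * `|s - t|.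
  apply: (le_trans (CS _ _)); apply: (le_trans (ler_wpM2l (nrm_ge0 _) h2)).
  rewrite mulrA ler_wpM2r//; apply: le_trans dA; rewrite mulrC ler_wpM2l ?(ltW d0)//.
  by have := (nrm_ge0 (g t), nrm_ge0 l, nrm_ge0 m); rewrite /A => -[[]]; lra.
apply: (le_trans (ler_normD _ _)); have := ler_normD (ip x (g s)) ((s - t) * ip l (g s - g t)).
by lra.
Unshelve. all: by end_near. Qed.

Lemma derRP (f : R -> R) t (l : R) : derR f t l <-> is_derive t (1 : R) f l.
Proof.
split=> [h|h].
  have c : h^-1 *: ((f \o shift t) (h *: (1 : R)) - f t) @[h --> (0 : R)^'] --> l.
    apply/cvgrPdist_le => e e0; have /near_ex[d d0 hd] := h e e0.
    exists d => //= u /=; rewrite sub0r normrN => ud u0.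
    have := hd (u + t); rewrite addrK nrmRH => /(_ ud).
    rewrite /GRing.scale /= mulr1 => k.
    have un : 0 < `|u| by rewrite normr_gt0.
    rewrite -(ler_pM2r un) -normrM; apply: le_trans k; rewrite le_eqVlt; apply/orP; left.
    by rewrite -normrN; apply/eqP; congr (`| _ |); field.
  have d : derivable f t 1 by apply/cvg_ex; exists l.
  by apply: DeriveDef => //; exact/cvg_lim.
have [d <-] := h; move: d; rewrite /derivable /derive => /cvgrPdist_le d e e0.
have [r /= r0 hr] := d e e0; apply/near_ex; exists r => // s st.
rewrite nrmRH; have [->|ts] := eqVneq s t.
  by rewrite !subrr scale0r subr0 normr0 mulr0.
have st0 : s - t != 0 by rewrite subr_eq0.
have := hr (s - t); rewrite /= sub0r normrN => /(_ st st0).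
rewrite /GRing.scale /= mulr1 subrK; set L := lim _; move=> k.
have un : 0 < `|s - t| by rewrite normr_gt0.
rewrite -(ler_pM2r un) -normrM in k; apply: le_trans k; rewrite le_eqVlt; apply/orP; left.
by rewrite -normrN; apply/eqP; congr (`| _ |); field.
Qed.

Lemma derR_exp (a t : R) : derR (fun s => expR (a * s)) t (a * expR (a * t)).
Proof.
have h : is_derive t (1 : R) (fun s => a * s) a.
  by apply/derRP; have := derZ a (@der_id t); rewrite /GRing.scale /= mulr1.
by apply/derRP; rewrite mulrC; apply: (@is_derive1_comp _ expR).
Qed.

Lemma derR_le (f df : R -> R) (a b : R) : a <= b ->
  (forall t, a <= t <= b -> derR f t (df t)) ->
  (forall t, a <= t <= b -> df t <= 0) -> f b <= f a.
Proof.
rewrite le_eqVlt => /predU1P[->//|ab] hf hd.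
have d1 x : x \in `[a, b] -> is_derive x (1 : R) f (df x).
  by rewrite in_itv /= => h; apply/derRP/hf.
have h1 x : x \in `]a, b[ -> is_derive x (1 : R) f (df x).
  by move=> /subset_itv_oo_cc; exact: d1.
have h2 : {within `[a, b], continuous f}.
  apply: continuous_in_subspaceT => x; rewrite inE => /d1 [h _].
  by apply: differentiable_continuous; apply/derivable1_diffP.
have [c cab h] := MVT ab h1 h2.
rewrite -subr_le0 h mulr_le0_ge0 ?subr_ge0 ?(ltW ab)//.
by apply: hd; move: cab; rewrite in_itv /= => /andP[/ltW-> /ltW->].
Qed.

(* Pairing [f] with [f b - f a] reduces this to the real mean value theorem. *)
Lemma der_bound (E : hilb R) (f f' : R -> E) (g g' : R -> R) (a b : R) : a <= b ->
  (forall t, a <= t <= b -> der f t (f' t)) ->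
  (forall t, a <= t <= b -> derR g t (g' t)) ->
  (forall t, a <= t <= b -> nrm (f' t) <= g' t) ->
  nrm (f b - f a) <= g b - g a.
Proof.
move=> ab hf hg h; set p := f b - f a.
have H : ip (f b) p - nrm p * g b <= ip (f a) p - nrm p * g a.
  apply: (@derR_le (fun t => ip (f t) p - nrm p * g t) (fun t => ip (f' t) p + ip (f t) 0 - nrm p * g' t)) => // t tab.
    apply: (@derB (RH R)); first by apply: der_ip; [exact: hf|exact: der_cst].
    exact: (@derZ (RH R)) (hg _ tab).
  rewrite ip0r addr0; have := ip_le (f' t) p; have := h _ tab; have := nrm_ge0 p.
  by nra.
have [->|p0] := eqVneq p 0.
  rewrite nrm0 -(subrr (g a)) lerD2r.
  rewrite -lerN2; apply: (@derR_le (fun t => - g t) (fun t => - g' t)) => // t tab.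
    exact: (@derN (RH R)) (hg _ tab).
  by rewrite oppr_le0; apply: le_trans (nrm_ge0 _) (h _ tab).
have np : 0 < nrm p.
  by rewrite lt_def nrm_ge0 andbT; apply: contraNneq p0 => /nrm_eq0 ->.
rewrite -(ler_pM2l np) -expr2 nrm2 {1}/p ipBl; lra.
Qed.

Lemma der_lipschitz (E : hilb R) (f f' : R -> E) (K : R) :
  (forall t, der f t (f' t)) -> (forall t, nrm (f' t) <= K) ->
  forall s t, nrm (f t - f s) <= K * `|t - s|.
Proof.
move=> hf hK.
have H s t : s <= t -> nrm (f t - f s) <= K * (t - s).
  move=> st; rewrite mulrBr; apply: (@der_bound _ f f' (fun t => K * t) (fun=> K)) => // u _.
  by have := derZ K (@der_id u); rewrite /GRing.scale /= mulr1.
move=> s t; have [/[dup] /H h st|/ltW /[dup] /H h st] := leP s t.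
  by rewrite ger0_norm ?subr_ge0.
by rewrite nrmBC distrC ger0_norm ?subr_ge0.
Qed.

Lemma der0_cst (E : hilb R) (f : R -> E) :
  (forall t, der f t 0) -> forall s t, f s = f t.
Proof.
move=> hf s t; apply/eqP; rewrite -subr_eq0; apply/eqP/nrm_eq0/eqP; rewrite eq_le nrm_ge0 andbT.
rewrite -(mul0r `|s - t|); apply: (@der_lipschitz _ f (fun=> 0)) => // ?.
by rewrite nrm0.
Qed.

Lemma der_bound0 (E : hilb R) (f f' : R -> E) (g g' : R -> R) :
  (forall t, der f t (f' t)) ->
  (forall t, 0 <= t -> derR g t (g' t)) ->
  (forall t, nrm (f' t) <= g' `|t|) ->
  forall t, nrm (f t - f 0) <= g `|t| - g 0.
Proof.
move=> hf hg h t; have [t0|/ltW t0] := leP 0 t.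
  rewrite ger0_norm//; apply: (der_bound t0) => // u /andP[u0 _]; [exact: hg|].
  by rewrite -{2}(ger0_norm u0).
rewrite ler0_norm//; have nt0 : 0 <= - t by rewrite oppr_ge0.
have := @der_bound _ (fun s => f (- s)) (fun s => - f' (- s)) g g' 0 (- t) nt0.
rewrite opprK oppr0; apply=> u /andP[u0 _]; first exact/der_flip/hf; first exact: hg.
by rewrite nrmN -{2}(ger0_norm u0) -(normrN u).
Qed.

(** The function [ip (z t) (z t) * expR (- 2 K t)] is nonincreasing for [t >= 0] and vanishes at 0;
    negative times follow by reversal. *)
Lemma gronwall0 (E : hilb R) (z z' : R -> E) (K : R) :
  (forall t, der z t (z' t)) -> (forall t, nrm (z' t) <= K * nrm (z t)) ->
  z 0 = 0 -> forall t, z t = 0.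
Proof.
move=> + + z0.
have H (y y' : R -> E) : (forall t, der y t (y' t)) ->
  (forall t, nrm (y' t) <= K * nrm (y t)) -> y 0 = 0 -> forall t, 0 <= t -> y t = 0.
  move=> hy hK y0 t t0.
  have := @derR_le (fun s => ip (y s) (y s) * expR ((- (2 * K)) * s))
    (fun s => (ip (y' s) (y s) + ip (y s) (y' s)) * expR ((- (2 * K)) * s) +
       ip (y s) (y s) * (- (2 * K) * expR ((- (2 * K)) * s))) 0 t t0.
  rewrite y0 ip0l mul0r => h; apply: ip_eq0; apply/eqP; rewrite eq_le ip_ge0 andbT.
  rewrite -(pmulr_lle0 _ (expR_gt0 (- (2 * K) * t))); apply: h => s _.
    by apply: (@der_ip (RH R)); [apply: der_ip|apply: derR_exp].
  rewrite mulrA -mulrDl pmulr_lle0 ?expR_gt0// (ipC (y s)) -nrm2.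
  have := ip_le (y' s) (y s); have := hK s; have := nrm_ge0 (y s); nra.
move=> hz hK t; have [t0|/ltW t0] := leP 0 t; first exact: (H z z').
have := H (fun s => z (- s)) (fun s => - z' (- s)) _ _ _ (- t); rewrite opprK oppr0; apply => //.
- by move=> s; apply/der_flip/hz.
- by move=> s; rewrite nrmN; exact: hK.
- by rewrite oppr_ge0.
Qed.

End Derivative.

(** * Primitives and Riesz representation *)

Section Primitive.
Context {R : realType}.

Definition cont (E : hilb R) (f : R -> E) := forall t, cont_at f t.

Lemma cont_realP (g : R -> R) : @cont (RH R) g <-> continuous g.
Proof.
split=> h t.
  apply/cvgrPdist_le => e e0; have := h t e e0; apply: filterS => s.
  by rewrite nrmRH distrC.
move=> e e0; move/cvgrPdist_le : (h t) => /(_ e e0).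
by apply: filterS => s; rewrite nrmRH distrC.
Qed.

Lemma cont_itg (g : R -> R) (a b : R) : continuous g ->
  (@lebesgue_measure R).-integrable `[a, b] (EFin \o g).
Proof.
move=> cg; apply: continuous_compact_integrable; first exact: segment_compact.
exact: continuous_subspaceT.
Qed.

(** The fundamental theorem gives a primitive only to the right of the base point -1. Its reflection
    covers [t < 1]; the two differ by a constant between -1 and 1 and are glued at 0. *)
Lemma real_primitive (g : R -> R) : continuous g ->
  exists G, G 0 = 0 /\ forall t, derR G t (g t).
Proof.
move=> cg.
have prim (f : R -> R) : continuous f ->
    exists F : R -> R, forall t, -1 < t -> derR F t (f t).
  move=> cf; exists (fun x => \int[lebesgue_measure]_(t in `[-1, x]) f t)%R => t t1.
  have tt : t < t + 1 by rewrite ltrDl.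
  have [dF F'] := continuous_FTC1_closed tt (cont_itg _ _ cf) t1 (cf t).
  by apply/derRP; apply: (DeriveDef dF); rewrite -F' derive1E.
have [P hP] := prim g cg.
have [|Q0 hQ0] := prim (fun t => g (- t)).
  by move=> t; apply: continuous_comp; [exact: opp_continuous|exact: cg].
pose Q t := - Q0 (- t).
have hQ t : t < 1 -> derR Q t (g t).
  move=> t1; have h0 : derR Q0 (- t) (g t) by have := hQ0 (- t); rewrite ltrN2 opprK; apply.
  by have := @derN _ (RH R) _ _ _ (@der_flip _ (RH R) Q0 t (g t) h0); rewrite opprK.
have PQ t : -1 < t < 1 -> P t - P 0 = Q t - Q 0.
  have D a b : -1 < a -> a <= b -> b < 1 -> P b - Q b = P a - Q a.
    move=> a1 ab b1; have H u : a <= u <= b -> derR (fun s => P s - Q s) u 0.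
      move=> /andP[au ub]; rewrite -(subrr (g u)); apply: (@derB (RH R)).
        by apply: hP; apply: lt_le_trans a1 au.
      by apply: hQ; apply: le_lt_trans ub b1.
    apply/eqP; rewrite eq_le (derR_le ab H) => [/=|u _]; last by rewrite lexx.
    rewrite -lerN2; apply: (derR_le ab (fun u h => @derN _ (RH R) _ _ _ (H u h))) => u _.
    by rewrite oppr0.
  move=> /andP[t1 t2]; have [t0|/ltW t0] := leP 0 t.
    have := D 0 t; rewrite ltrN10 => /(_ isT t0 t2); lra.
  have := D t 0 t1 t0 ltr01; lra.
exists (fun t => if 0 <= t then P t - P 0 else Q t - Q 0); split=> [|t].
  by rewrite lexx subrr.
have shift (F : R -> R) c l : derR F t l -> derR (fun s => F s - c) t l.
  by move=> h; rewrite -[l]subr0; apply: (@derB (RH R)) => //; exact: der_cst.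
have [t1|t1] := ltP (-1) t; last first.
  apply: (@der_near _ (RH R) (fun s => Q s - Q 0)); last by apply/shift/hQ; lra.
  near=> s; rewrite ifF//; apply/negbTE; rewrite -ltNge.
  by near: s; apply: lt_nbhsl; lra.
have [t2|t2] := ltP t 1; last first.
  apply: (@der_near _ (RH R) (fun s => P s - P 0)); last by apply/shift/hP; lra.
  near=> s; rewrite ifT//; apply/ltW.
  by near: s; apply: lt_nbhsr; lra.
apply: (@der_near _ (RH R) (fun s => P s - P 0)); last by apply/shift/hP; lra.
near=> s; case: ifP => // _; apply: PQ; apply/andP; split; near: s.
  exact: lt_nbhsr.
exact: lt_nbhsl.
Unshelve. all: by end_near. Qed.

(** The representing vector minimizes [J x = ip x x / 2 - l x]. By the parallelogram identity
    minimizing sequences are Cauchy, and the first variation at the limit is the claim. *)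
Lemma riesz (E : hilb R) (l : E -> R) (C : R) :
  (forall x y, l (x + y) = l x + l y) -> (forall a x, l (a *: x) = a * l x) ->
  (forall x, `|l x| <= C * nrm x) -> exists y, forall x, l x = ip y x.
Proof.
move=> lD lZ lC; pose J x := ip x x / 2 - l x.
have Jlb x : - (C ^+ 2 / 2) <= J x.
  have := lC x; rewrite ler_norml /J -nrm2 => /andP[_]; have := sqr_ge0 (C - nrm x).
  by rewrite sqrrB; lra.
pose S := [set J x | x in [set: E]].
have iS : has_inf S.
  by split; [exists (J 0), 0|exists (- (C ^+ 2 / 2)) => _ [x _ <-]].
pose m := inf S.
have mJ x : m <= J x by apply: ge_inf; [exact: iS.2|exists x].
have /choice[u hu] (n : nat) : exists x, J x < m + n.+1%:R^-1.
  have n0 : 0 < n.+1%:R^-1 :> R by rewrite invr_gt0.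
  by have [_ [x _ <-] hx] := inf_adherent n0 iS; exists x.
have lN x : l (- x) = - l x by rewrite -scaleN1r lZ mulN1r.
have par x y : ip (x - y) (x - y) <= 4 * (J x - m) + 4 * (J y - m).
  have := mJ (2^-1 *: (x + y)).
  by rewrite /J !(ipE, lD, lZ, lN) (ipC y x); lra.
have small e : 0 < e -> exists n, forall p, (n <= p)%N -> p.+1%:R^-1 <= e :> R.
  move=> e0; exists (Num.bound e^-1) => p np.
  rewrite invf_ple ?posrE//; apply: ltW; apply: lt_le_trans (archi_boundP _) _.
    by rewrite invr_ge0 ltW.
  by rewrite ler_nat ltnW.
have [e e0|y hy] := @ip_complete _ _ u.
  have [n hn] := small (e / 8) (divr_gt0 e0 (ltr0n _ 8)); exists n => p q np nq.
  move: (par (u p) (u q)) (hn p np) (hn q nq) (hu p) (hu q).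
  move: (p.+1%:R^-1) (q.+1%:R^-1) (J (u p)) (J (u q)) => a b c d.
  by move: (ip _ _) => f; lra.
exists y => x; have H s : 0 <= s * (ip y x - l x) + s ^+ 2 * ip x x / 2.
  apply/ler_addgt0Pl => e e0.
  pose A := 1 + `|s| * nrm x; have A0 : 0 < A by rewrite ltr_pwDl ?mulr_ge0 ?nrm_ge0.
  have [n1 hn1] := small (e / 2) (divr_gt0 e0 (ltr0n _ 2)).
  have [n2 hn2] := hy ((e / 2 / A) ^+ 2) (exprn_gt0 _ (divr_gt0 (divr_gt0 e0 (ltr0n _ 2)) A0)).
  pose k := maxn n1 n2; have k1 := hn1 k (leq_maxl _ _).
  have := nrm_le (ltW (divr_gt0 (divr_gt0 e0 (ltr0n _ 2)) A0)) (hn2 k (leq_maxr _ _)).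
  rewrite ler_pdivlMr// => k2.
  have := mJ (u k + s *: x); rewrite /J !(ipE, lD, lZ, lN) (ipC x).
  have := hu k; rewrite /J => k3 k4.
  have : `|s * ip (u k - y) x| <= nrm (u k - y) * A.
    rewrite normrM mulrC; apply: (le_trans (ler_wpM2r (normr_ge0 _) (CS _ _))).
    by rewrite -mulrA ler_wpM2l ?nrm_ge0// /A mulrC lerDr.
  rewrite ler_norml ipBl => /andP[_]; move: (_.+1%:R^-1) k1 k3 => r; lra.
have [x0|x0] := eqVneq (ip x x) 0.
  by have := H 1; have := H (-1); rewrite x0; lra.
have xx : 0 < ip x x by rewrite lt_def x0 ip_ge0.
(* The minimizer of the quadratic polynomial in [H]. *)
have := H (- (ip y x - l x) / ip x x).
have -> : - (ip y x - l x) / ip x x * (ip y x - l x) +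
  (- (ip y x - l x) / ip x x) ^+ 2 * ip x x / 2 = - ((ip y x - l x) ^+ 2 / ip x x / 2) by field.
rewrite oppr_ge0 pmulr_lle0 ?invr_gt0// pmulr_lle0 ?invr_gt0// => h.
have : (ip y x - l x) ^+ 2 == 0 by rewrite eq_le h sqr_ge0.
by rewrite sqrf_eq0 subr_eq0 => /eqP.
Qed.

Lemma cont_ip (E : hilb R) (g : R -> E) (x : E) : cont g -> continuous (fun s => ip (g s) x).
Proof.
move=> cg; apply/cont_realP => t e e0; have n1 : 0 < 1 + nrm x by rewrite ltr_pwDl// nrm_ge0.
near=> s; rewrite nrmRH -ipBl; apply: (le_trans (CS _ _)).
have : nrm (g s - g t) <= e / (1 + nrm x) by near: s; apply: cg; rewrite divr_gt0.
rewrite ler_pdivlMr// => h; apply: le_trans h; rewrite ler_wpM2l ?nrm_ge0//.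
by rewrite lerDr.
Unshelve. all: by end_near. Qed.

Lemma cont_bounded (E : hilb R) (g : R -> E) (a : R) : cont g ->
  exists M, forall s, `|s| <= a -> nrm (g s) <= M.
Proof.
move=> cg; have [a0|a0] := ltP a 0.
  by exists 0 => s sa; have := normr_ge0 s; lra.
have c : continuous (fun s => nrm (g s)).
  apply/cont_realP => t e e0; have := cg t e e0; apply: filterS => s.
  by rewrite nrmRH; apply: le_trans; exact: nrm_sub.
have aa : - a <= a by lra.
have [c0 _ hc] := EVT_max aa (continuous_subspaceT c).
by exists (nrm (g c0)) => s; rewrite ler_norml => sa; apply: hc; rewrite in_itv.
Qed.

Lemma der_lip_shift (E : hilb R) (f f' : R -> E) (K : R) s t :
  (forall u, der f u (f' u)) -> (forall u, `|u - s| <= `|t - s| -> nrm (f' u) <= K) ->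
  nrm (f t - f s) <= K * `|t - s|.
Proof.
move=> hf hK; have dK u : derR (fun t => K * t) u K.
  by have := @derZ _ (RH R) _ _ _ K (@der_id _ u); rewrite /GRing.scale /= mulr1.
have [st|/ltW st] := leP s t.
  rewrite ger0_norm ?subr_ge0// mulrBr.
  apply: (@der_bound _ _ f f' (fun t => K * t) (fun=> K)) => // u /andP[su ut].
  by apply: hK; rewrite !ger0_norm ?subr_ge0//; lra.
rewrite nrmBC distrC ger0_norm ?subr_ge0// mulrBr.
apply: (@der_bound _ _ f f' (fun t => K * t) (fun=> K)) => // u /andP[su ut].
by apply: hK; rewrite !ler0_norm ?subr_le0//; lra.
Qed.

(* Weakly defined primitive: its existence is Riesz representation, its
   differentiability in norm a mean value inequality. *)
Lemma primitive (E : hilb R) (g : R -> E) : cont g ->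
  exists G, G 0 = 0 /\ forall t, der G t (g t).
Proof.
move=> cg.
have /choice[P hP] (x : E) := real_primitive (@cont_ip _ _ x cg).
have un (h : R -> R) (p q : R -> R) : p 0 = q 0 -> (forall t, derR p t (h t)) ->
    (forall t, derR q t (h t)) -> p =1 q.
  move=> pq0 hp hq t; apply/eqP; rewrite -subr_eq0.
  have := @der0_cst R (RH R) (fun s => p s - q s) _ t 0; rewrite pq0 subrr => ->//.
  by move=> u; have := @derB _ (RH R) _ _ _ _ _ (hp u) (hq u); rewrite subrr.
have H t : exists y, forall x, P x t = ip y x.
  have [M hM] := cont_bounded `|t| cg.
  apply: (@riesz _ _ (M * `|t|)).
  - move=> x y; apply: (un (fun s => ip (g s) (x + y)) (P (x + y)) (fun s => P x s + P y s)).
    + by rewrite !(hP _).1 addr0.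
    + exact: (hP _).2.
    + by move=> s; rewrite ipDr; apply: (@derD _ (RH R)); exact: (hP _).2.
  - move=> a x; apply: (un (fun s => ip (g s) (a *: x)) (P (a *: x)) (fun s => a * P x s)).
    + by rewrite !(hP _).1 mulr0.
    + exact: (hP _).2.
    + by move=> s; rewrite ipZr; apply: (@derZ _ (RH R)); exact: (hP _).2.
  - move=> x; have [h0 hx] := hP x.
    have := @der_lip_shift (RH R) (P x) _ (M * nrm x) 0 t hx.
    rewrite h0 !subr0 nrmRH mulrAC; apply=> s st; rewrite subr0 in st; rewrite nrmRH; apply: (le_trans (CS _ _)).
    by rewrite ler_wpM2r ?nrm_ge0 ?hM.
have /choice[G hG] := H; exists G.
have dG x t : derR (fun s => ip (G s) x) t (ip (g t) x).
  by have [_ /(_ t)] := hP x; congr (derR _ t _); apply/funext => s; rewrite hG.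
split=> [|t e e0]; first by apply: ip_ext => x; rewrite -hG ip0l (hP x).1.
have /near_ex[d d0 hd] := cg t e e0; apply/near_ex; exists d => // s st.
pose x := G s - G t - (s - t) *: g t.
have [x0|x0] := eqVneq x 0; first by rewrite -/x x0 nrm0 mulr_ge0 ?(ltW e0).
have nx : 0 < nrm x by rewrite lt_def nrm_ge0 andbT; apply: contraNneq x0 => /nrm_eq0 ->.
rewrite -(ler_pM2r nx) -expr2 nrm2 {1}/x.
have := @der_lip_shift (RH R) (fun s => ip (G s) x - s * ip (g t) x) (fun s => ip (g s) x - ip (g t) x)
  (e * nrm x) t s.
rewrite nrmRH -/x => h; apply: le_trans (_ : e * nrm x * `|s - t| <= _); last by rewrite mulrAC.
apply: le_trans (h _ _).
- by apply: le_trans (ler_norm _); rewrite !ipE /=; lra.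
- move=> u; apply: (@derB _ (RH R)); first exact: dG.
  by have := @derZ _ (RH R) _ _ _ (ip (g t) x) (@der_id _ u); rewrite /GRing.scale /= mulr1;
     apply: eq_der => v; rewrite mulrC.
- move=> u ut; rewrite nrmRH -ipBl; apply: (le_trans (CS _ _)); rewrite ler_wpM2r ?nrm_ge0//.
  by apply: hd; apply: le_lt_trans st.
Qed.
Lemma exp2_small (B e : R) : 0 < e -> exists n : nat, B * 2^-1 ^+ n <= e.
Proof.
move=> e0; have : (fun n => B * 2^-1 ^+ n) @ \oo --> B * 0.
  by apply: cvgMr; apply: cvg_expr; rewrite ger0_norm ?invr_ge0// invf_lt1// ltr1n.
rewrite mulr0 => /cvgr0Pnorm_le/(_ _ e0)[n _ hn]; exists n.
exact: le_trans (ler_norm _) (hn n (leqnn n)).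
Qed.

(** Picard iteration with the weight [expR (2 K |t|)], for which the integral operator halves
    distances: the solution exists on the whole line at once. Continuity of [f] is asked along
    continuous curves, because the group entering [f] later is only strongly continuous. *)
Lemma ode_lipschitz (E : hilb R) (f : R -> E -> E) (K M : R) (x0 : E) : 0 < K ->
  (forall t x y, nrm (f t x - f t y) <= K * nrm (x - y)) ->
  (forall w, cont w -> cont (fun t => f t (w t))) ->
  (forall t, nrm (f t x0) <= M) ->
  exists w, w 0 = x0 /\ forall t, der w t (f t (w t)).
Proof.
move=> K0 fK fc fM.
have /choice[Pr hPr] (g : R -> E) : exists G : R -> E,
    cont g -> G 0 = 0 /\ forall t, der G t (g t).
  have [/primitive[G hG]|nc] := pselect (cont g); first by exists G.
  by exists (fun=> 0).
pose nxt w t := x0 + Pr (fun s => f s (w s)) t.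
have dn w t : cont w -> der (nxt w) t (f t (w t)).
  move=> /fc/hPr[_ h]; rewrite -[f t (w t)]add0r; apply: derD => //; exact: der_cst.
have cn w : cont w -> cont (nxt w) by move=> cw t; apply: der_cont (dn _ _ cw).
have n0 w : cont w -> nxt w 0 = x0 by move=> /fc/hPr[h _]; rewrite /nxt h addr0.
pose w k := iter k nxt (fun=> x0).
have cw k : cont (w k).
  by elim: k => [t|k ih]; [exact: der_cont (der_cst _ _)|exact: cn].
have w0 k : w k 0 = x0 by case: k => [//|k]; exact: n0.
pose C := M / (2 * K); pose ex (t : R) := expR (2 * K * `|t|).
have K20 : 0 < 2 * K by rewrite mulr_gt0.
have M0 : 0 <= M by apply: le_trans (nrm_ge0 _) (fM 0).
have C0 : 0 <= C by rewrite divr_ge0 // ltW.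
have KC : 2 * K * C = M by rewrite /C mulrCA divff ?mulr1// gt_eqF.
have ex1 t : 1 <= ex t by rewrite -[leLHS]expR0 ler_expR mulr_ge0 // ltW.
have h0 k : 0 <= 2^-1 ^+ k :> R by rewrite exprn_ge0 ?invr_ge0.
have bd (z z' : R -> E) (c : R) : 0 <= c -> z 0 = 0 -> (forall t, der z t (z' t)) ->
    (forall t, nrm (z' t) <= 2 * K * c * ex t) -> forall t, nrm (z t) <= c * ex t.
  move=> c0 z0 hz hz' t.
  have := @der_bound0 _ _ z z' (fun t => c * expR (2 * K * t))
    (fun t => c * (2 * K * expR (2 * K * t))) hz.
  rewrite z0 => h; rewrite -[z t]subr0; apply: le_trans (h _ _ _) _.
  - by move=> s _; apply: (@derZ _ (RH R)); exact: derR_exp.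
  - by move=> s; apply: (le_trans (hz' _)); rewrite /ex le_eqVlt; apply/orP; left; apply/eqP; ring.
  - by rewrite lerBlDr lerDl mulr_ge0 ?expR_ge0.
have D k t : nrm (w k.+1 t - w k t) <= C * 2^-1 ^+ k * ex t.
  elim: k t => [|k ih].
    apply: (bd (fun t => w 1%N t - w 0%N t) (fun t => f t x0 - 0) _ (mulr_ge0 C0 (h0 _))); rewrite ?w0 ?subrr//.
      by move=> t; apply: derB; [exact: dn (cw 0%N)|exact: der_cst].
    move=> t; rewrite subr0 expr0 mulr1 KC; apply: (le_trans (fM t)).
    by rewrite ler_peMr.
  apply: (bd (fun t => w k.+2 t - w k.+1 t) (fun t => f t (w k.+1 t) - f t (w k t)) _ (mulr_ge0 C0 (h0 _))); rewrite ?w0 ?subrr//.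
    by move=> t; apply: derB; [exact: (dn (w k.+1) _ (cw _))|exact: (dn (w k) _ (cw _))].
  move=> t; apply: (le_trans (fK _ _ _)); apply: (le_trans (ler_wpM2l (ltW K0) (ih t))).
  by rewrite exprS le_eqVlt; apply/orP; left; apply/eqP; field.
have S n p t : nrm (w (n + p)%N t - w n t) <= 2 * C * (2^-1 ^+ n - 2^-1 ^+ (n + p)) * ex t.
  elim: p => [|p ih]; first by rewrite addn0 !subrr nrm0 mulr0 mul0r.
  apply: (le_trans (nrm_tri (w (n + p)%N t) _ _)); rewrite addnS.
  have := D (n + p)%N t; rewrite [2^-1 ^+ (n + p).+1]exprS; lra.
have S2 n p t : (n <= p)%N -> nrm (w p t - w n t) <= 2 * C * 2^-1 ^+ n * ex t.
  move=> np; have := S n (p - n)%N t; rewrite subnKC// => /le_trans; apply.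
  apply: ler_wpM2r; first exact: le_trans (ex1 t).
  by apply: ler_wpM2l; [rewrite mulr_ge0|rewrite lerBlDr lerDl].
have L t : exists l, forall e, 0 < e -> exists n, forall p, (n <= p)%N -> nrm (w p t - l) <= e.
  apply: nrm_complete => e e0.
  have [n hn] := exp2_small (2 * C * ex t) (divr_gt0 e0 (ltr0n _ 2)).
  exists n => p q np nq; apply: (le_trans (nrm_tri (w n t) _ _)).
  rewrite [nrm (w n t - _)]nrmBC.
  have := S2 n p t np; have := S2 n q t nq; rewrite mulrAC in hn; lra.
have /choice[W hW] := L.
have S3 n t : nrm (W t - w n t) <= 2 * C * 2^-1 ^+ n * ex t.
  apply/ler_addgt0Pl => e e0; have [m hm] := hW t e e0.
  have := hm _ (leq_maxl m n); rewrite nrmBC => h.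
  apply: (le_trans (nrm_tri (w (maxn m n) t) _ _)).
  by apply: lerD => //; apply: S2; exact: leq_maxr.
have cW : cont W.
  move=> t e e0.
  pose B := 2 * C * expR (2 * K * (`|t| + 1)).
  have [n hn] := exp2_small B (divr_gt0 e0 (ltr0n _ 3)).
  have bs s : `|s - t| <= 1 -> nrm (W s - w n s) <= e / 3.
    move=> st; apply: (le_trans (S3 n s)); apply: le_trans hn; rewrite /B mulrAC.
    apply: ler_wpM2r; first exact: h0.
    apply: ler_wpM2l; first exact: mulr_ge0.
    rewrite ler_expR; apply: ler_wpM2l; first exact: ltW.
    by have := ler_normD t (s - t); rewrite addrC subrK; lra.
  near=> s.
  have h1 : `|s - t| <= 1 by near: s; exact: near_dist.
  have h2 : nrm (w n s - w n t) <= e / 3 by near: s; apply: cw; rewrite divr_gt0.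
  have h3 : nrm (W t - w n t) <= e / 3 by apply: bs; rewrite subrr normr0.
  apply: (le_trans (nrm_tri (w n s) _ _)); have := nrm_tri (w n t) (w n s) (W t).
  by rewrite [nrm (w n t - W t)]nrmBC; have := bs s h1; lra.
have WE t : nxt W t = W t.
  apply/eqP; rewrite -subr_eq0; apply/eqP; apply: (@small_nrm0 _ _ _ 1) => e e0.
  have [n hn] := exp2_small (2 * C * ex t) e0.
  have h1 : nrm (nxt W t - w n.+1 t) <= C * 2^-1 ^+ n * ex t.
    apply: (bd (fun t => nxt W t - w n.+1 t) (fun t => f t (W t) - f t (w n t)) _ (mulr_ge0 C0 (h0 _))); rewrite ?n0 ?w0 ?subrr//.
      by move=> s; apply: derB; [exact: (dn W _ cW)|exact: (dn (w n) _ (cw _))].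
    move=> s; apply: (le_trans (fK _ _ _)); apply: (le_trans (ler_wpM2l (ltW K0) (S3 n s))).
    by rewrite le_eqVlt; apply/orP; left; apply/eqP; ring.
  have := nrm_tri (w n.+1 t) (nxt W t) (W t); rewrite [nrm (w n.+1 t - W t)]nrmBC.
  have := S3 n.+1 t; rewrite exprS; rewrite mulrAC in hn; lra.
exists W; split=> [|t]; first by rewrite -WE n0.
by apply: eq_der (dn W t cW) => s; rewrite WE.
Unshelve. all: by end_near. Qed.

End Primitive.

(** * The unitary group *)

Section Operators.
Context {R : realType}.

Definition asL (E F : hilb R) (A : E -> F) (lA : linear A) : {linear E -> F} :=
  HB.pack A (GRing.isLinear.Build _ _ _ _ A lA).
Lemma lin0 (E F : hilb R) (S : E -> F) : linear S -> S 0 = 0.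
Proof. by move=> h; exact: (linear0 (asL h)). Qed.
Lemma linD (E F : hilb R) (S : E -> F) : linear S -> forall x y, S (x + y) = S x + S y.
Proof. by move=> h; exact: (linearD (asL h)). Qed.
Lemma linZ (E F : hilb R) (S : E -> F) : linear S -> forall a x, S (a *: x) = a *: S x.
Proof. by move=> h a x; exact: (linearZ_LR (asL h)). Qed.
Lemma linN (E F : hilb R) (S : E -> F) : linear S -> forall x, S (- x) = - S x.
Proof. by move=> h; exact: (linearN (asL h)). Qed.
Lemma linB (E F : hilb R) (S : E -> F) : linear S -> forall x y, S (x - y) = S x - S y.
Proof. by move=> h; exact: (linearB (asL h)). Qed.

Lemma der_op (E F : hilb R) (A : E -> F) (C : R) (f : R -> E) t l : linear A ->
  (forall x, nrm (A x) <= C * nrm x) -> der f t l -> der (fun s => A (f s)) t (A l).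
Proof.
by move=> lA; exact: (@der_lin _ _ _ (asL lA)).
Qed.

Lemma cont_op (E F : hilb R) (A : E -> F) (C : R) (f : R -> E) t : linear A ->
  (forall x, nrm (A x) <= C * nrm x) -> cont_at f t -> cont_at (fun s => A (f s)) t.
Proof.
move=> lA bA cf e e0; have C1 : 0 < `|C| + 1 by rewrite ltr_wpDl.
have := cf (e / (`|C| + 1)) (divr_gt0 e0 C1); apply: filterS => s.
rewrite ler_pdivlMr// => h; rewrite -(linB lA); apply: le_trans (bA _) _.
apply: le_trans h; rewrite mulrC ler_wpM2l ?nrm_ge0//.
by apply: le_trans (ler_norm _) _; rewrite lerDl.
Qed.

Lemma der_shift (E : hilb R) (f : R -> E) c t l :
  der f (t + c) l -> der (fun s => f (s + c)) t l.
Proof.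
move=> h e /h/near_ex[d d0 hd]; apply/near_ex; exists d => // s st.
have e1 : s + c - (t + c) = s - t by ring.
by have := hd (s + c); rewrite e1; apply.
Qed.

Lemma der_prod (E : hilb R) (U : R -> E -> E) (f : R -> E) t l1 l2 :
  (forall s, linear (U s)) -> (forall s x, nrm (U s x) <= nrm x) ->
  der (fun s => U s (f t)) t l1 -> der f t l2 -> cont_at (fun s => U s l2) t ->
  der (fun s => U s (f s)) t (l1 + U t l2).
Proof.
move=> lU bU d1 d2 c e e0; have e3 : 0 < e / 3 by rewrite divr_gt0.
near=> s.
have h1 : nrm (U s (f t) - U t (f t) - (s - t) *: l1) <= e / 3 * `|s - t| by near: s; apply: d1.
have h2 : nrm (f s - f t - (s - t) *: l2) <= e / 3 * `|s - t| by near: s; apply: d2.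
have h3 : nrm (U s l2 - U t l2) <= e / 3 by near: s; apply: c.
have E1 : U s (f s - f t - (s - t) *: l2) = U s (f s) - U s (f t) - (s - t) *: U s l2.
  by rewrite !(linB (lU s)) (linZ (lU s)).
have -> : U s (f s) - U t (f t) - (s - t) *: (l1 + U t l2) =
  U s (f s - f t - (s - t) *: l2) + (s - t) *: (U s l2 - U t l2) +
  (U s (f t) - U t (f t) - (s - t) *: l1) by rewrite E1; vring.
apply: (le_trans (nrmD _ _)).
have := nrmD (U s (f s - f t - (s - t) *: l2)) ((s - t) *: (U s l2 - U t l2)).
have := bU s (f s - f t - (s - t) *: l2); rewrite nrmZ.
have : `|s - t| * nrm (U s l2 - U t l2) <= e / 3 * `|s - t| by rewrite mulrC ler_wpM2r.
lra.
Unshelve. all: by end_near. Qed.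

(** The difference of [fn n] and a primitive of [g] has a locally uniformly small derivative, so in
    the limit [f] differs from this primitive by a constant. *)
Lemma der_limit (E : hilb R) (fn gn : nat -> R -> E) (f g : R -> E) :
  (forall n t, der (fn n) t (gn n t)) -> cont g ->
  (forall t e, 0 < e -> exists n0, forall n, (n0 <= n)%N -> nrm (fn n t - f t) <= e) ->
  (forall a e, 0 < e -> exists n0, forall n t, (n0 <= n)%N -> `|t| <= a -> nrm (gn n t - g t) <= e) ->
  forall t, der f t (g t).
Proof.
move=> hf cg hff hgg; have [G [G0 dG]] := primitive cg.
suff E1 t : f t = G t + f 0.
  move=> t; apply: (@eq_der _ _ (fun s => G s + f 0)) => [s|]; first by rewrite [RHS]E1.
  by rewrite -[g t]addr0; apply: derD => //; exact: der_cst.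
apply/eqP; rewrite -subr_eq0; apply/eqP; apply: (@small_nrm0 _ _ _ (2 + `|t|)) => e e0.
have [n1 h1] := hff t e e0; have [n2 h2] := hff 0 e e0; have [n3 h3] := hgg `|t| e e0.
pose n := maxn n1 (maxn n2 n3).
have l1 := h1 n (leq_maxl _ _).
have l2 : nrm (fn n 0 - f 0) <= e by apply: h2; rewrite /n !leq_max leqnn orbT.
have := @der_lip_shift _ _ (fun s => fn n s - G s) (fun s => gn n s - g s) e 0 t.
rewrite G0 !subr0 => l3.
have {}l3 : nrm (fn n t - G t - fn n 0) <= e * `|t|.
  apply: l3 => [u|u]; first exact: derB.
  by rewrite subr0 => ut; apply: h3 => //; rewrite /n !leq_max leqnn !orbT.
have -> : f t - (G t + f 0) = (fn n t - G t - fn n 0) - (fn n t - f t) + (fn n 0 - f 0) by vring.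
apply: (le_trans (nrmD _ _)); have := nrmB (fn n t - G t - fn n 0) (fn n t - f t); lra.
Qed.

End Operators.

Section Stone.
Context {R : realType} {E : hilb R}.

(** [J] stands for i and [B] for the inverse of the operator shifted by [lam]. Injectivity of the
    symmetric [B] makes its range, the domain of the operator, dense. *)
Record admissible (J B : {linear E -> E}) : Prop := {
  admJJ : forall x, J (J x) = - x ;
  admJip : forall x y, ip (J x) (J y) = ip x y ;
  admBJ : forall x, B (J x) = J (B x) ;
  admBsym : forall x y, ip (B x) y = ip x (B y) ;
  admB0 : forall x, 0 <= ip (B x) x ;
  admB1 : forall x, ip (B x) x <= ip x x ;
  admBinj : forall x, B x = 0 -> x = 0 }.

(** The generator is prescribed on the range of [B]: there [ug_der] is the equation [u' = - i H u],
    because H sends [B x] to [x - lam *: B x]. *)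
Record unitary_group (J B : {linear E -> E}) (lam : R) (T : R -> E -> E) : Prop := {
  ug0 : forall x, T 0 x = x ;
  ugD : forall s t x, T (s + t) x = T s (T t x) ;
  ug_lin : forall t, linear (T t) ;
  ug_nrm : forall t x, nrm (T t x) = nrm x ;
  ugJ : forall t x, T t (J x) = J (T t x) ;
  ugB : forall t x, T t (B x) = B (T t x) ;
  ug_cont : forall x, cont (fun t => T t x) ;
  ug_der : forall x t, der (fun t => T t (B x)) t (- J (T t (x - lam *: B x))) }.

Section Fixed.
Variables (J B : {linear E -> E}) (lam : R).
Hypothesis adm : admissible J B.

Lemma Jskew x y : ip (J x) y = - ip x (J y).
Proof. by rewrite -(admJip adm x (J y)) (admJJ adm) ipNr opprK. Qed.
Lemma Jself x : ip (J x) x = 0.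
Proof. by have := Jskew x x; rewrite (ipC x); lra. Qed.
Lemma nrmJ x : nrm (J x) = nrm x.
Proof. by rewrite /nrm (admJip adm). Qed.

(** Expand the nonnegative form of [P] at [x - P x]; its term in [P (P x)] is at most
    [ip (P x) (P x)] because [P <= 1]. *)
Lemma pos_contraction (P : {linear E -> E}) : (forall x y, ip (P x) y = ip x (P y)) ->
  (forall x, 0 <= ip (P x) x) -> (forall x, ip (P x) x <= ip x x) ->
  forall x, ip (P x) (P x) <= ip (P x) x.
Proof.
move=> Ps P0 P1 x; have := P0 (x - P x); rewrite linearB !ipE (Ps (P x) x).
have := P1 (P x); rewrite (Ps (P x)); lra.
Qed.

Lemma nrm_admB x : nrm (B x) <= nrm x.
Proof.
apply: nrm_le (nrm_ge0 _) _; rewrite nrm2; apply: le_trans (admB1 adm x).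
by apply: pos_contraction; [exact: (admBsym adm)|exact: (admB0 adm)|exact: (admB1 adm)].
Qed.

Let C1 (x : E) := x - B x.
Let C1lin : linear C1.
Proof. by move=> a x y; rewrite /C1 linearP; vring. Qed.
Let CL : {linear E -> E} := HB.pack C1 (GRing.isLinear.Build _ _ _ _ C1 C1lin).
Let C n := iter n CL.

Let C_S n x : C n.+1 x = C n x - B (C n x). Proof. by []. Qed.
Let CL_sym x y : ip (CL x) y = ip x (CL y).
Proof. by rewrite /= /C1 !ipE (admBsym adm). Qed.
Let C_sym n x y : ip (C n x) y = ip x (C n y).
Proof. by elim: n x y => [//|n ih] x y; rewrite /C iterS CL_sym ih /C -iterSr. Qed.
Let CL_ge0 x : 0 <= ip (CL x) x.
Proof. by rewrite /= /C1 !ipE subr_ge0 (admB1 adm). Qed.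
Let CL_le x : ip (CL x) x <= ip x x.
Proof. by rewrite /= /C1 !ipE gerBl (admB0 adm). Qed.

(** Moments of the positive contraction [1 - B]. An even moment is the squared norm of a power and
    an odd one the quadratic form at that power, so [pos_contraction] and [1 - B <= 1] alternate in
    showing that the sequence decreases. *)
Let q x n := ip (C n x) x.
Let q_add x n m : ip (C n x) (C m x) = q x (n + m).
Proof. by rewrite C_sym /q /C iterD ipC C_sym. Qed.
Let q_even x n : q x n.*2 = ip (C n x) (C n x). Proof. by rewrite q_add addnn. Qed.
Let q_odd x n : q x n.*2.+1 = ip (CL (C n x)) (C n x).
Proof. by rewrite -[CL _]/(C n.+1 x) q_add addSn addnn. Qed.
Let q_S x n : q x n.+1 <= q x n.
Proof.
rewrite -(odd_double_half n); case: (odd n); rewrite ?add1n ?add0n.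
  rewrite -doubleS q_even q_odd; exact: (pos_contraction CL_sym CL_ge0 CL_le).
by rewrite q_even q_odd; exact: CL_le.
Qed.
Let q_ge0 x n : 0 <= q x n.
Proof.
by rewrite -(odd_double_half n); case: (odd n); rewrite ?add1n ?add0n ?q_even ?q_odd ?ip_ge0.
Qed.
Let q_mono x n m : (n <= m)%N -> q x m <= q x n.
Proof.
move=> /subnKC <-; elim: (m - n)%N => [|p ih]; first by rewrite addn0.
by rewrite addnS; apply: le_trans (q_S _ _) ih.
Qed.

(** The squared distance of two powers is a combination of moments with coefficients of sum zero,
    and the moments decrease to a limit. *)
Lemma C_cauchy x e : 0 < e -> exists n0, forall n m, (n0 <= n)%N -> (n0 <= m)%N ->
  ip (C n x - C m x) (C n x - C m x) <= e.
Proof.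
move=> e0; pose S := range (q x).
have iS : has_inf S by split; [exists (q x 0%N), 0%N|exists 0 => _ [n _ <-]].
have e2 : 0 < e / 2 by rewrite divr_gt0.
have [_ [n0 _ <-] h] := inf_adherent e2 iS.
have lb n : inf S <= q x n by apply: ge_inf; [exact: iS.2|exists n].
exists n0 => n m n0n n0m; rewrite !ipE !q_add.
have a k : (n0 <= k)%N -> q x k <= inf S + e / 2.
  by move=> hk; apply: le_trans (q_mono x hk) (ltW h).
have := a (n + n)%N (leq_trans n0n (leq_addr _ _)).
have := a (m + m)%N (leq_trans n0m (leq_addr _ _)).
have := lb (n + m)%N; have := lb (m + n)%N; lra.
Qed.

(** The limit is fixed by [1 - B], hence killed by the injective [B]. *)
Lemma C_to0 x e : 0 < e -> exists n0, forall n, (n0 <= n)%N -> nrm (C n x) <= e.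
Proof.
have [e1 e10|l hl] := @ip_complete _ _ (fun n => C n x); first exact: C_cauchy.
suff l0 : l = 0.
  move=> e0; have [n0 hn] := hl (e ^+ 2) (exprn_gt0 _ e0).
  by exists n0 => n /hn; rewrite l0 subr0; apply: nrm_le; exact: ltW.
apply: (admBinj adm); apply: (@small_nrm0 _ _ _ 3) => e1 e10.
have [n0 hn] := hl (e1 ^+ 2) (exprn_gt0 _ e10).
have a := nrm_le (ltW e10) (hn n0 (leqnn _)).
have b := nrm_le (ltW e10) (hn n0.+1 (leqnSn _)).
have -> : B l = (C n0 x - l) - (C n0.+1 x - l) - B (C n0 x - l).
  by rewrite (linearB B) C_S; vring.
apply: (le_trans (nrmB _ _)); have := nrm_admB (C n0 x - l).
have := nrmB (C n0 x - l) (C n0.+1 x - l); lra.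
Qed.

Record good (S : E -> E) : Prop := {
  good_lin : linear S ;
  goodJ : forall x, S (J x) = J (S x) ;
  good_sym : forall x y, ip (S x) y = ip x (S y) ;
  good_bd : exists2 c, 0 <= c & forall x, nrm (S x) <= c * nrm x }.

Lemma exp_flow (S : E -> E) : good S -> exists U : R -> E -> E,
  forall x, U 0 x = x /\ forall t, der (fun t => U t x) t (- J (S (U t x))).
Proof.
move=> gS; have [c c0 hc] := good_bd gS.
have lS : linear (fun x => - J (S x)).
  by move=> a x y; rewrite (good_lin gS) linearP; vring.
have bS x : nrm (- J (S x)) <= c * nrm x by rewrite nrmN nrmJ.
have H x : exists w : R -> E, w 0 = x /\ forall t, der w t (- J (S (w t))).
  apply: (@ode_lipschitz _ _ (fun _ x => - J (S x)) (c + 1) (c * nrm x)) => //.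
  - by rewrite ltr_wpDl.
  - move=> _ y z; rewrite -[_ - _](linB lS); apply: le_trans (bS _) _.
    by rewrite ler_wpM2r ?nrm_ge0// lerDl.
  - by move=> w cw t; apply: (cont_op lS bS (cw t)).
have /choice[U hU] := H; by exists (fun t x => U x t).
Qed.

Lemma flow_unique (S : E -> E) (y z : R -> E) : good S ->
  (forall t, der y t (- J (S (y t)))) -> (forall t, der z t (- J (S (z t)))) ->
  y 0 = z 0 -> y =1 z.
Proof.
move=> gS hy hz yz t; apply/eqP; rewrite -subr_eq0; apply/eqP.
have [c c0 hc] := good_bd gS.
apply: (@gronwall0 _ _ (fun t => y t - z t) (fun t => - J (S (y t)) - - J (S (z t))) c).
- by move=> s; exact: derB.
- by move=> s; rewrite opprK addrC -linearB -(linB (good_lin gS)) nrmJ (nrmBC (y s)); exact: hc.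
- by rewrite yz subrr.
Qed.

Section Flow.
Variables (S : E -> E) (U : R -> E -> E).
Hypotheses (gS : good S)
  (hU : forall x, U 0 x = x /\ forall t, der (fun t => U t x) t (- J (S (U t x)))).

Lemma flow_comm (G : E -> E) (c : R) : linear G -> (forall x, nrm (G x) <= c * nrm x) ->
  (forall x, G (J x) = J (G x)) -> (forall x, G (S x) = S (G x)) ->
  forall t x, U t (G x) = G (U t x).
Proof.
move=> lG bG GJ GS t x.
apply: (flow_unique gS (y := fun t => U t (G x)) (z := fun t => G (U t x))) => [s|s|].
- exact: (hU _).2.
- by rewrite -GS -GJ -(linN lG); apply: (der_op lG bG); exact: (hU _).2.
- by rewrite !(hU _).1.
Qed.

Lemma flow_lin t : linear (U t).
Proof.
move=> a x y.
apply: (flow_unique gS (y := fun t => U t (a *: x + y)) (z := fun t => a *: U t x + U t y)) => [s|s|].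
- exact: (hU _).2.
- have -> : - J (S (a *: U s x + U s y)) = a *: (- J (S (U s x))) + - J (S (U s y)).
    by rewrite (good_lin gS) linearP; vring.
  by apply: derD; [apply: derZ|]; exact: (hU _).2.
- by rewrite !(hU _).1.
Qed.

Lemma flow_ip t x : ip (U t x) (U t x) = ip x x.
Proof.
have := @der0_cst R (RH R) (fun t => ip (U t x) (U t x)) _ t 0; rewrite (hU x).1; apply=> s.
have := @der_ip _ _ _ _ _ _ _ ((hU x).2 s) ((hU x).2 s).
have h (u : E) : ip (J (S u)) u = 0.
  by have := Jskew (S u) u; rewrite (good_sym gS) (goodJ gS) (ipC u); lra.
by rewrite (ipC _ (- _)) !ipNl h oppr0 addr0.
Qed.

Lemma flow_nrm t x : nrm (U t x) = nrm x.
Proof. by rewrite /nrm flow_ip. Qed.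

Lemma flow_add s t x : U (s + t) x = U s (U t x).
Proof.
apply: (flow_unique gS (y := fun s => U (s + t) x) (z := fun s => U s (U t x))) => [r|r|].
- exact: (@der_shift _ _ (fun s => U s x) t r _ ((hU x).2 (r + t))).
- exact: (hU _).2.
- by rewrite add0r (hU (U t x)).1.
Qed.

End Flow.

(** Partial sums of the Neumann series in powers of [1 - B]: bounded symmetric approximations of the
    inverse of [B], with [A n (B x) = x - C n x] ([A_B]). *)
Let A := fix A n (x : E) := if n is n'.+1 then x + CL (A n' x) else 0.

Let A_good n : good (A n) /\ forall x, A n (B x) = B (A n x).
Proof.
elim: n => [|n [[l j s [c c0 b]] cB]].
  split; last by move=> x /=; rewrite linear0.
  split=> /=.
  - by move=> a x y; rewrite scaler0 addr0.
  - by move=> x; rewrite linear0.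
  - by move=> x y; rewrite ip0l ip0r.
  - by exists 0 => // x; rewrite nrm0 mul0r.
split; last by move=> x /=; rewrite /C1 cB linearD linearB.
split=> /=.
- by move=> a x y; rewrite /C1 l linearP; vring.
- by move=> x; rewrite /C1 j (admBJ adm) linearD linearB.
- by move=> x y; rewrite /C1 !ipE s (admBsym adm) s -cB.
- exists (1 + (c + c)) => [|x]; first by rewrite !addr_ge0.
  rewrite /C1; apply: (le_trans (nrmD _ _)).
  have := nrmB (A n x) (B (A n x)); have := nrm_admB (A n x); have := b x; lra.
Qed.

Let A_comm n m x : A n (A m x) = A m (A n x).
Proof.
elim: n x => [|n ih] x /=; first by rewrite (lin0 (good_lin (A_good m).1)).
rewrite (linD (good_lin (A_good m).1)) ih /C1 (linB (good_lin (A_good m).1)).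
by rewrite -(A_good m).2.
Qed.

Let A_B n x : A n (B x) = x - C n x.
Proof.
elim: n => [|n ih] /=; first by rewrite subrr.
by rewrite ih -[C1 (C n x)]/(C n.+1 x) C_S /C1 linearB; vring.
Qed.

Let G n x := A n x - lam *: x.
Let G_good n : good (G n).
Proof.
have [[l j s [c c0 b]] cB] := A_good n; split; rewrite /G.
- by move=> a x y; rewrite l; vring.
- by move=> x; rewrite j (linearB J) (linearZ_LR J).
- by move=> x y; rewrite !ipE s.
- exists (c + `|lam|) => [|x]; first by rewrite addr_ge0.
  by apply: (le_trans (nrmB _ _)); rewrite nrmZ mulrDl lerD2r.
Qed.

(** The bounded generators [- J (A n - lam)] commute and have isometric flows [U n]. These converge
    locally uniformly in time, first on the range of [B] and then by density everywhere. *)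
Theorem stone : exists T, unitary_group J B lam T.
Proof.
have /choice[U hU] (n : nat) := exp_flow (G_good n).
have Ulin n t : linear (U n t) := flow_lin (G_good n) (hU n) t.
have Unrm n t x : nrm (U n t x) = nrm x := flow_nrm (G_good n) (hU n) t x.
have UD n s t x : U n (s + t) x = U n s (U n t x) := flow_add (G_good n) (hU n) s t x.
have Uc n x : cont (fun t => U n t x) by move=> t; apply: der_cont ((hU n x).2 t).
have UJ n t x : U n t (J x) = J (U n t x).
  apply: (flow_comm (G_good n) (hU n) (c := 1)) => //; first exact: linearP.
  - by move=> y; rewrite nrmJ mul1r.
  - by move=> y; rewrite (goodJ (G_good n)).
have UB n t x : U n t (B x) = B (U n t x).
  apply: (flow_comm (G_good n) (hU n) (c := 1)) => //; first exact: linearP.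
  - by move=> y; rewrite mul1r nrm_admB.
  - by move=> y; rewrite (admBJ adm).
  - by move=> y; rewrite /G (A_good n).2 (linearB B) (linearZ_LR B).
have UA n m t x : U n t (A m x) = A m (U n t x).
  have [[l j _ [c c0 b]] cB] := A_good m.
  apply: (flow_comm (G_good n) (hU n) l b) => // y.
  by rewrite /G (linB l) (linZ l) A_comm.
have UG n m t x : U n t (G m x) = G m (U n t x).
  by rewrite /G (linB (Ulin n t)) (linZ (Ulin n t)) UA.
(* Duhamel: the curve [U n (- s) (U m s x)] has derivative of constant norm, since everything
   commutes and [lam] cancels. *)
have diff n m t x : nrm (U n t x - U m t x) <= `|t| * nrm (A n x - A m x).
  pose f s := U n (- s) (U m s x).
  have df s : der f s (U n (- s) (J (A n (U m s x) - A m (U m s x)))).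
    have -> : U n (- s) (J (A n (U m s x) - A m (U m s x))) =
        - (- J (G n (U n (- s) (U m s x)))) + U n (- s) (- J (G m (U m s x))).
      by rewrite -UG -UJ opprK -(linD (Ulin _ _)) /G; congr (U _ _ _); rewrite !(linearB J); vring.
    apply: (der_prod (U := fun s => U n (- s)) (f := fun s => U m s x)) => //.
    - by move=> r y; rewrite Unrm.
    - exact: (@der_flip _ _ (fun r => U n r (U m s x)) s _) ((hU n _).2 (- s)).
    - exact: (hU m x).2.
    - by apply: der_cont; apply: (@der_flip _ _ (fun r => U n r _) s _ ((hU n _).2 (- s))).
  have := der_lipschitz df (K := nrm (A n x - A m x)) _ 0 t.
  rewrite subr0 /f oppr0 (hU n _).1 (hU m _).1 => h.
  have -> : U n t x - U m t x = U n t (x - U n (- t) (U m t x)).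
    by rewrite (linB (Ulin _ _)) -UD subrr (hU n _).1.
  rewrite Unrm nrmBC mulrC; apply: h => s.
  by rewrite Unrm nrmJ -!UA -(linB (Ulin _ _)) Unrm.
(* With [y = A k0 x] the error [x - B y] is [C k0 x], hence small; on [B y] the two generators
   differ by [C m y - C n y], which tends to 0. *)
have UC a x e : 0 < e -> exists n0, forall n m t, (n0 <= n)%N -> (n0 <= m)%N -> `|t| <= a ->
    nrm (U n t x - U m t x) <= e.
  move=> e0; have e3 : 0 < e / 3 by rewrite divr_gt0.
  have [k0 hk] := C_to0 x e3; pose y := A k0 x.
  have xy : nrm (x - B y) <= e / 3.
    by rewrite /y -(A_good k0).2 A_B opprB addrC subrK; apply: hk.
  have a1 : 0 < `|a| + 1 by rewrite ltr_wpDl.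
  have [k1 hk1] := C_to0 y (divr_gt0 (divr_gt0 e3 (ltr0n _ 2)) a1).
  exists k1 => n m t hn hm ta.
  have -> : U n t x - U m t x = U n t (x - B y) + (U n t (B y) - U m t (B y)) - U m t (x - B y).
    by rewrite !(linB (Ulin _ _)); vring.
  apply: (le_trans (nrmB _ _)); have := nrmD (U n t (x - B y)) (U n t (B y) - U m t (B y)).
  have := diff n m t (B y); rewrite !A_B !Unrm.
  have -> : y - C n y - (y - C m y) = C m y - C n y by vring.
  have : `|t| * nrm (C m y - C n y) <= e / 3.
    apply: (@le_trans _ _ ((`|a| + 1) * (e / 3 / (`|a| + 1)))); last first.
      by rewrite mulrC divfK // gt_eqF.
    apply: ler_pM; rewrite ?nrm_ge0//.
      by apply: (le_trans ta); apply: (le_trans (ler_norm _)); rewrite lerDl.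
    apply: (le_trans (nrmB _ _)); have := hk1 n hn; have := hk1 m hm.
    have : e / 3 / (`|a| + 1) = e / 3 / 2 / (`|a| + 1) + e / 3 / 2 / (`|a| + 1).
      by rewrite -mulrDl -splitr.
    lra.
  lra.
have L tx : exists l, forall e, 0 < e -> exists n, forall p, (n <= p)%N ->
    nrm (U p tx.1 tx.2 - l) <= e.
  apply: nrm_complete => e e0; have [n0 h] := UC `|tx.1| tx.2 e e0.
  by exists n0 => p r hp hr; apply: h.
have /choice[T2 hT2] := L; pose T t x := T2 (t, x).
have hT a x e : 0 < e -> exists n0, forall n t, (n0 <= n)%N -> `|t| <= a -> nrm (U n t x - T t x) <= e.
  move=> e0; have [n0 h] := UC a x e e0; exists n0 => n t hn ta.
  apply/ler_addgt0Pl => d d0; have [n1 h1] := hT2 (t, x) d d0.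
  apply: (le_trans (nrm_tri (U (maxn n0 n1) t x) _ _)); rewrite addrC; apply: lerD.
    by apply: h1; exact: leq_maxr.
  by apply: h => //; exact: leq_maxl.
(* Lipschitz maps intertwined with every [U n] are intertwined with the limit; this transfers the
   commutation with [J] and [B]. *)
have lim (P : E -> E) t x y (c : R) : (forall u v, nrm (P u - P v) <= c * nrm (u - v)) ->
   (forall n, U n t x = P (U n t y)) -> T t x = P (T t y).
  move=> hP hPn; apply/eqP; rewrite -subr_eq0; apply/eqP.
  apply: (@small_nrm0 _ _ _ (1 + `|c|)) => e e0.
  have [n1 h1] := hT `|t| x e e0; have [n2 h2] := hT `|t| y e e0; pose n := maxn n1 n2.
  have := h1 n t (leq_maxl _ _) (lexx _); have := h2 n t (leq_maxr _ _) (lexx _) => k2 k1.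
  apply: (le_trans (nrm_tri (U n t x) _ _)); rewrite nrmBC {2}hPn mulrDl mul1r; apply: lerD => //.
  apply: (le_trans (hP _ _)); apply: (le_trans (ler_wpM2r (nrm_ge0 _) (ler_norm c))).
  by rewrite ler_wpM2l.
have Tc x : cont (fun t => T t x).
  move=> t e e0; have e3 : 0 < e / 3 by rewrite divr_gt0.
  have [n h] := hT (`|t| + 1) x _ e3.
  near=> s.
  have st : `|s - t| <= 1 by near: s; exact: near_dist.
  have k1 : nrm (U n s x - U n t x) <= e / 3 by near: s; exact: Uc.
  have k2 : nrm (U n t x - T t x) <= e / 3 by apply: h => //; rewrite lerDl.
  have k3 : nrm (U n s x - T s x) <= e / 3.
    by apply: h => //; have := ler_normD t (s - t); rewrite addrC subrK; lra.
  have -> : T s x - T t x = (U n s x - U n t x) + (U n t x - T t x) - (U n s x - T s x) by vring.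
  apply: (le_trans (nrmB _ _)); have := nrmD (U n s x - U n t x) (U n t x - T t x); lra.
exists T; split.
- move=> x; apply/eqP; rewrite -subr_eq0; apply/eqP; apply: (@small_nrm0 _ _ _ 1) => e e0.
  have [n h] := hT 0 x e e0; have := h n 0 (leqnn _); rewrite normr0 lexx => /(_ isT).
  by rewrite (hU n x).1 nrmBC mul1r.
- move=> a t x; apply/eqP; rewrite -subr_eq0; apply/eqP; apply: (@small_nrm0 _ _ _ 3) => e e0.
  have [n1 h1] := hT `|a| (T t x) e e0; have [n2 h2] := hT `|t| x e e0.
  have [n3 h3] := hT `|a + t| x e e0; pose n := maxn n1 (maxn n2 n3).
  have k1 : nrm (U n a (T t x) - T a (T t x)) <= e by apply: h1; rewrite ?leq_maxl.
  have k2 : nrm (U n t x - T t x) <= e by apply: h2; rewrite // /n !leq_max leqnn orbT.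
  have k3 : nrm (U n (a + t) x - T (a + t) x) <= e by apply: h3; rewrite // /n !leq_max leqnn !orbT.
  have -> : T (a + t) x - T a (T t x) =
      U n a (U n t x - T t x) - (U n (a + t) x - T (a + t) x) + (U n a (T t x) - T a (T t x)).
    by rewrite (linB (Ulin _ _)) -UD; vring.
  apply: (le_trans (nrmD _ _)).
  have := nrmB (U n a (U n t x - T t x)) (U n (a + t) x - T (a + t) x); rewrite Unrm; lra.
- move=> t a x y; apply/eqP; rewrite -subr_eq0; apply/eqP.
  apply: (@small_nrm0 _ _ _ (2 + `|a|)) => e e0.
  have [n1 h1] := hT `|t| x e e0; have [n2 h2] := hT `|t| y e e0.
  have [n3 h3] := hT `|t| (a *: x + y) e e0; pose n := maxn n1 (maxn n2 n3).
  have k1 : nrm (U n t x - T t x) <= e by apply: h1; rewrite ?leq_maxl.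
  have k2 : nrm (U n t y - T t y) <= e by apply: h2; rewrite // /n !leq_max leqnn orbT.
  have k3 : nrm (U n t (a *: x + y) - T t (a *: x + y)) <= e.
    by apply: h3; rewrite // /n !leq_max leqnn !orbT.
  have -> : T t (a *: x + y) - (a *: T t x + T t y) = a *: (U n t x - T t x) +
      (U n t y - T t y) - (U n t (a *: x + y) - T t (a *: x + y)).
    by rewrite (Ulin n t a x y); vring.
  apply: (le_trans (nrmB _ _)); have := nrmD (a *: (U n t x - T t x)) (U n t y - T t y).
  rewrite nrmZ; have : `|a| * nrm (U n t x - T t x) <= `|a| * e by rewrite ler_wpM2l.
  lra.
- move=> t x; apply/eqP; rewrite -subr_eq0 -normr_eq0 eq_le normr_ge0 andbT.
  apply/ler_addgt0Pl => e e0; have [n h] := hT `|t| x e e0; rewrite addr0.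
  have := h n t (leqnn _) (lexx _); rewrite nrmBC -(Unrm n t x).
  exact: le_trans (nrm_sub _ _).
- move=> t x; apply: (lim J t (J x) x 1) => [u v|n]; last exact: UJ.
  by rewrite -(linearB J) nrmJ mul1r.
- move=> t x; apply: (lim B t (B x) x 1) => [u v|n]; last exact: UB.
  by rewrite -(linearB B) mul1r nrm_admB.
- exact: Tc.
- move=> x; pose y := x - lam *: B x.
  apply: (@der_limit _ _ (fun n t => U n t (B x)) (fun n t => - J (G n (U n t (B x)))) _ (fun t => - J (T t y))).
  + by move=> n t; exact: (hU n _).2.
  + move=> t; apply: (@cont_op _ _ _ (fun z => - J z) 1 (fun t => T t y)); last exact: Tc.
      by move=> a u v; rewrite linearP; vring.
    by move=> u; rewrite nrmN nrmJ mul1r.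
  + move=> t e e0; have [n0 h] := hT `|t| (B x) e e0; exists n0 => n hn; exact: h.
  + move=> a e e0; have e2 : 0 < e / 2 by rewrite divr_gt0.
    have [n1 h1] := hT a y _ e2; have [n2 h2] := C_to0 x e2.
    exists (maxn n1 n2) => n t; rewrite geq_max => /andP[hn1 hn2] ta.
    rewrite -opprB opprK addrC nrmN -(linearB J) nrmJ -UG /G A_B.
    have -> : x - C n x - lam *: B x = y - C n x by rewrite /y; vring.
    rewrite (linB (Ulin _ _)) addrAC; apply: (le_trans (nrmB _ _)); rewrite Unrm.
    have := h1 n t hn1 ta; have := h2 n hn2; lra.
Unshelve. all: by end_near. Qed.

(** The curve [T (- s) (B (k s))] is constant. This is the tool for identifying flows: the groups on
    the two spaces, their conjugates by symmetries, and any group satisfying the definition in the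
    statement. *)
Lemma group_unique (T : R -> E -> E) (k : R -> E) : unitary_group J B lam T ->
  (forall t, der (fun t => B (k t)) t (- J (k t - lam *: B (k t)))) ->
  forall t, B (k t) = T t (B (k 0)).
Proof.
move=> gT hk t.
have h s : der (fun s => T (- s) (B (k s))) s 0.
  have -> : 0 = - (- J (T (- s) (k s - lam *: B (k s)))) + T (- s) (- J (k s - lam *: B (k s))).
    by rewrite (linN (ug_lin gT _)) opprK (ugJ gT) subrr.
  apply: (der_prod (U := fun s => T (- s)) (f := fun s => B (k s))).
  - by move=> r; exact: (ug_lin gT).
  - by move=> r y; rewrite (ug_nrm gT).
  - exact: (@der_flip _ _ (fun r => T r (B (k s))) s _) (ug_der gT _ _).
  - exact: hk.
  - move=> e e0; have := (ug_cont gT (- J (k s - lam *: B (k s))) (- s)) e e0.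
    move=> /near_ex[d d0 hd]; apply/near_ex; exists d => // r rs; apply: hd.
    by rewrite -opprD normrN.
have := der0_cst h t 0; rewrite oppr0 (ug0 gT) => <-.
by rewrite -(ugD gT) subrr (ug0 gT).
Qed.

End Fixed.
End Stone.

(** * Conservation laws of the cubic flow *)

Section NLS.
Context {R : realType} {V : hilb R}.

(** [m] is the symmetric real trilinear map with [m u u u = |u|^2 u]. In [cf_B] the vector [x]
    enters only through its L^2 norm; this is what makes the quartic energy differentiable along the
    flow. *)
Record cubic_form (J B : {linear V -> V}) (m : V -> V -> V -> V) (Cm : R) : Prop := {
  cf_lin : forall u v, linear (m u v) ;
  cf12 : forall u v w, m u v w = m v u w ;
  cf23 : forall u v w, m u v w = m u w v ;
  cf34 : forall u v w z, ip (B (m u v w)) z = ip (B (m u v z)) w ;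
  cf_nrm : forall u v w, nrm (m u v w) <= Cm * nrm u * nrm v * nrm w ;
  cf_B : forall u v x, `|ip (B (m u v x)) x| <= Cm * nrm u * nrm v * ip (B x) x ;
  cf_rot : forall (a b : R) u v w, a ^+ 2 + b ^+ 2 = 1 ->
    m (a *: u + b *: J u) (a *: v + b *: J v) (a *: w + b *: J w) =
    a *: m u v w + b *: J (m u v w) ;
  cf_J : forall u, ip (B (m u u u)) (J u) = 0 }.

Variables (J B : {linear V -> V}) (lam : R) (T : R -> V -> V).
Hypotheses (adm : admissible J B) (gT : unitary_group J B lam T).
Variables (m : V -> V -> V -> V) (Cm : R).
Hypothesis cf : cubic_form J B m Cm.
Implicit Types u v w x y z : V.

Lemma cf_C0 : 0 <= Cm \/ forall u, u = 0.
Proof.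
have [?|C0] := leP 0 Cm; first by left.
right=> u; apply: nrm_eq0; apply/eqP; rewrite eq_le nrm_ge0 andbT leNgt.
apply/negP => u0; have := le_trans (nrm_ge0 _) (cf_nrm cf u u u).
by rewrite -!mulrA nmulr_rge0// !pmulr_rle0// leNgt u0.
Qed.

Definition nl u := m u u u.
Definition q4 u v w z := ip (B (m u v w)) z.
Definition mass u := ip (B u) u.
Definition quartic u := q4 u u u u / 4.
(** [ip u u] already contains [lam] times the mass, hence the coefficient [om - lam]. *)
Definition action om u := ip u u / 2 + (om - lam) * mass u / 2 - quartic u.
Definition rot (th : R) u := cos th *: u + sin th *: J u.

Lemma q4D u v w z1 z2 : q4 u v w (z1 + z2) = q4 u v w z1 + q4 u v w z2.
Proof. exact: ipDr. Qed.
Lemma q4Z u v w z (a : R) : q4 u v w (a *: z) = a * q4 u v w z.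
Proof. exact: ipZr. Qed.
Lemma q12 u v w z : q4 u v w z = q4 v u w z. Proof. by rewrite /q4 (cf12 cf). Qed.
Lemma q23 u v w z : q4 u v w z = q4 u w v z. Proof. by rewrite /q4 (cf23 cf). Qed.
Lemma q34 u v w z : q4 u v w z = q4 u v z w. Proof. exact: cf34 cf _ _ _ _. Qed.
Lemma q4D3 u v z1 z2 w : q4 u v (z1 + z2) w = q4 u v z1 w + q4 u v z2 w.
Proof. by rewrite q34 q4D !(q34 u v w). Qed.
Lemma q4D2 u v z1 z2 w : q4 u (z1 + z2) v w = q4 u z1 v w + q4 u z2 v w.
Proof. by rewrite q23 q4D3 !(q23 u v). Qed.
Lemma q4D1 u v z1 z2 w : q4 (z1 + z2) u v w = q4 z1 u v w + q4 z2 u v w.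
Proof. by rewrite q12 q4D2 !(q12 u). Qed.
Definition q4E := (q4D1, q4D2, q4D3, q4D).

Lemma quartic_expand u d : quartic (u + d) = quartic u + ip (B (nl u)) d +
  (6 * q4 u u d d + 4 * q4 u d d d + q4 d d d d) / 4.
Proof.
rewrite -[ip _ _]/(q4 u u u d) /quartic !q4E.
rewrite ?(q12 d u) ?(q23 u d u) ?(q23 d d u) ?(q12 d u) ?(q34 u u d u) ?(q34 u d d u) ?(q34 d d d u).
rewrite ?(q23 u d u) ?(q23 d d u) ?(q12 d u) ?(q23 u d u) ?(q34 u u d u).
by field.
Qed.

Lemma massD u d : mass (u + d) = mass u + 2 * ip (B u) d + mass d.
Proof. by rewrite /mass linearD !ipE (admBsym adm d u) (ipC d); ring. Qed.

Lemma mass_ge0 u : 0 <= mass u. Proof. exact: admB0 adm _. Qed.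
Lemma mass_le u : mass u <= nrm u ^+ 2. Proof. by rewrite nrm2; exact: admB1 adm _. Qed.

Lemma q4_bound u v w z : `|q4 u v w z| <= Cm * nrm u * nrm v * nrm w * nrm z.
Proof.
apply: (le_trans (CS _ _)); rewrite ler_wpM2r ?nrm_ge0//.
by apply: le_trans (nrm_admB adm _) (cf_nrm cf _ _ _).
Qed.

Lemma rot_ip th u v : ip (rot th u) (rot th v) = ip u v.
Proof.
rewrite /rot !ipE (admJip adm) (Jskew adm u v); have := cos2Dsin2 th.
rewrite (ipC _ (J v)) => h; rewrite -[RHS]mul1r -h; ring.
Qed.
Lemma rot_lin th : linear (rot th).
Proof. by move=> a x y; rewrite /rot linearP; vring. Qed.
Lemma rot_nrm th u : nrm (rot th u) = nrm u.
Proof. by rewrite /nrm rot_ip. Qed.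
Lemma rotB th u : B (rot th u) = rot th (B u).
Proof. by rewrite /rot linearD !linearZ /= (admBJ adm). Qed.
Lemma rotJ th u : J (rot th u) = rot th (J u).
Proof. by rewrite /rot linearD !linearZ. Qed.
Lemma rotK th u : rot th (rot (- th) u) = u.
Proof.
rewrite /rot cosN sinN (linearD J) !(linearZ_LR J) (admJJ adm); have h := cos2Dsin2 th.
by apply: ip_ext => x; rewrite !ipE -[RHS]mul1r -h; ring.
Qed.
Lemma rot_nl th u : nl (rot th u) = rot th (nl u).
Proof. by rewrite /nl /rot (cf_rot cf)// cos2Dsin2. Qed.
Lemma rot_mass th u : mass (rot th u) = mass u.
Proof. by rewrite /mass rotB rot_ip. Qed.
Lemma rot_action om th u : action om (rot th u) = action om u.
Proof.
rewrite /action rot_mass rot_ip /quartic -[q4 (rot _ _) _ _ _]/(ip (B (nl (rot th u))) (rot th u)).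
by rewrite rot_nl rotB rot_ip.
Qed.

Lemma nlB u v : nl u - nl v = m u u (u - v) + m u (u - v) v + m (u - v) v v.
Proof.
have h a b := linB (cf_lin cf a b).
rewrite (cf23 cf u _ v) (cf12 cf (u - v)) (cf23 cf v (u - v)) !h /nl.
by rewrite (cf23 cf u v u) (cf23 cf v v u) (cf12 cf v u v); vring.
Qed.

Lemma nl_lip r u v : nrm u <= r -> nrm v <= r ->
  nrm (nl u - nl v) <= 3 * (Cm * r ^+ 2) * nrm (u - v).
Proof.
move=> ur vr; have [C0|z] := cf_C0; last first.
  by rewrite (z (nl u - nl v)) (z (u - v)) !nrm0 mulr0.
rewrite nlB; apply: (le_trans (nrmD _ _)); have := nrmD (m u u (u - v)) (m u (u - v) v).
have [[nu nv] nd0] := (nrm_ge0 u, nrm_ge0 v, nrm_ge0 (u - v)).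
have b a1 a2 : 0 <= a1 <= r -> 0 <= a2 <= r -> Cm * (a1 * a2) * nrm (u - v) <= Cm * r ^+ 2 * nrm (u - v).
  move=> /andP[? ?] /andP[? ?]; rewrite ler_wpM2r// ler_wpM2l// expr2; exact: ler_pM.
have := cf_nrm cf u u (u - v); have := cf_nrm cf u (u - v) v; have := cf_nrm cf (u - v) v v.
have := b _ _ (introT andP (conj nu ur)) (introT andP (conj nu ur)).
have := b _ _ (introT andP (conj nu ur)) (introT andP (conj nv vr)).
have := b _ _ (introT andP (conj nv vr)) (introT andP (conj nv vr)).
nra.
Qed.

Lemma T_ip t u v : ip (T t u) (T t v) = ip u v.
Proof.
have h x : ip (T t x) (T t x) = ip x x by rewrite -!nrm2 (ug_nrm gT).
have := h (u + v); rewrite (linD (ug_lin gT t)) !ipE !h (ipC (T t v)) (ipC v); lra.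
Qed.
Lemma TK t u : T t (T (- t) u) = u.
Proof. by rewrite -(ugD gT) subrr (ug0 gT). Qed.
Lemma T_mass t u : mass (T t u) = mass u.
Proof. by rewrite /mass -(ugB gT) T_ip. Qed.

Lemma cont_T (f : R -> V) t : cont_at f t -> cont_at (fun s => T s (f s)) t.
Proof.
move=> cf_ e e0; have e2 : 0 < e / 2 by rewrite divr_gt0.
near=> s.
have h1 : nrm (f s - f t) <= e / 2 by near: s; exact: cf_.
have h2 : nrm (T s (f t) - T t (f t)) <= e / 2 by near: s; exact: (ug_cont gT (f t) t).
have -> : T s (f s) - T t (f t) = T s (f s - f t) + (T s (f t) - T t (f t)).
  by rewrite (linB (ug_lin gT s)); vring.
apply: (le_trans (nrmD _ _)); rewrite (ug_nrm gT); lra.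
Unshelve. all: by end_near. Qed.

Lemma cont_TN (f : R -> V) t : cont_at f t -> cont_at (fun s => T (- s) (f s)) t.
Proof.
move=> cf_; have cf' : cont_at (fun s => f (- s)) (- t).
  move=> e /cf_/near_ex[d d0 h]; apply/near_ex; exists d => // s st; rewrite opprK.
  by apply: h; rewrite -normrN opprD opprK addrC -opprB normrN opprK in st * => //; rewrite opprK.
move=> e /(cont_T cf')/near_ex[d d0 h]; apply/near_ex; exists d => // s st.
have := h (- s); rewrite !opprK; apply.
by rewrite -normrN opprD !opprK.
Qed.

(* The equation in the interaction picture, w = T(-t) u: its solutions are
   C^1 in the energy space. *)
Definition nls_sol (w : R -> V) : Prop :=
  forall t, der w t (J (T (- t) (nl (T t (w t))))).

Section Conservation.
Variables (w : R -> V) (t : R).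
Let u s := T s (w s).
Hypothesis hw : der w t (J (T (- t) (nl (u t)))).

(** After smoothing by [B] the equation holds in the energy space in the classical sense; this
    replaces a regularization of the data. *)
Lemma der_Bu : der (fun s => B (u s)) t (- J (u t - lam *: B (u t) - B (nl (u t)))).
Proof.
have -> : - J (u t - lam *: B (u t) - B (nl (u t))) =
   - J (T t (w t - lam *: B (w t))) + T t (B (J (T (- t) (nl (u t))))).
  rewrite (ugB gT) (ugJ gT) TK (admBJ adm) (linB (ug_lin gT t)) (linZ (ug_lin gT t)) (ugB gT) -/(u t).
  by rewrite (linearB J); vring.
apply: (@eq_der _ _ (fun s => T s (B (w s)))) => [s|]; first by rewrite (ugB gT).
apply: (der_prod (ug_lin gT)).
- by move=> s x; rewrite (ug_nrm gT).
- exact: (ug_der gT).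
- by apply: (@der_op _ _ _ B 1) hw; [exact: linearP|move=> x; rewrite mul1r (nrm_admB adm)].
- exact: (ug_cont gT).
Qed.

Lemma der_mass : derR (fun s => mass (u s)) t 0.
Proof.
have E s : ip (B (w s)) (w s) = mass (u s) by rewrite /u T_mass.
apply: (@eq_der _ (RH R) _ _ _ _ E).
have dB : der (fun s => B (w s)) t (B (J (T (- t) (nl (u t))))).
  by apply: (@der_op _ _ _ B 1) hw; [exact: linearP|move=> x; rewrite mul1r (nrm_admB adm)].
have := der_ip dB hw; set k := J _; rewrite (admBsym adm k) (ipC k).
have -> : ip (B (w t)) k = 0.
  rewrite /k -(T_ip t) (ugJ gT) TK (ugB gT) -/(u t) (ipC _ (J _)) (Jskew adm) -(admBJ adm) -(admBsym adm).
  by rewrite (cf_J cf) oppr0.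
by rewrite addr0.
Qed.

(** The terms of order at least 2 in [d = u s - u t] are controlled by [mass d], thanks to [cf_B],
    and [mass d <= nrm (B d) * nrm d]. The first factor is [O(|s - t|)] by [der_Bu] and the second
    tends to 0, so the product is [o(|s - t|)]. *)
Lemma der_quartic : derR (fun s => quartic (u s)) t (ip (J (nl (u t))) (u t)).
Proof.
pose k := - J (u t - lam *: B (u t) - B (nl (u t))).
have -> : ip (J (nl (u t))) (u t) = ip (nl (u t)) k.
  have a1 : ip (nl (u t)) (J (B (u t))) = 0 by rewrite -(admBJ adm) -(admBsym adm) (cf_J cf).
  have a2 : ip (nl (u t)) (J (B (nl (u t)))) = 0.
    have e1 : ip (J (nl (u t))) (B (nl (u t))) = ip (nl (u t)) (J (B (nl (u t)))).
      by rewrite -(admBsym adm) (admBJ adm) ipC.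
    by have := Jskew adm (nl (u t)) (B (nl (u t))); rewrite e1; lra.
  rewrite /k !(linearB J) (linearZ_LR J) !ipE a1 a2 (Jskew adm); ring.
move=> e e0.
have cu : cont_at u t by apply: cont_T; exact: der_cont hw.
pose N := nrm (u t); pose C := (6 * `|Cm| * N ^+ 2 + 4 * `|Cm| * N + `|Cm|) / 4 * (1 + nrm k) + 1.
have N0 : 0 <= N by exact: nrm_ge0.
have C'0 : 0 <= (6 * `|Cm| * N ^+ 2 + 4 * `|Cm| * N + `|Cm|) / 4.
  by rewrite divr_ge0// !addr_ge0// !mulr_ge0// sqr_ge0.
have C0 : 0 < C by rewrite ltr_wpDl// mulr_ge0// addr_ge0// nrm_ge0.
have H : \forall s \near t, `|ip (nl (u t)) (B (u s)) - ip (nl (u t)) (B (u t)) -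
    (s - t) * ip (nl (u t)) k| <= e / 2 * `|s - t|.
  have e2 : 0 < e / 2 by rewrite divr_gt0.
  have := der_ip (der_cst (nl (u t)) t) der_Bu; rewrite ip0l add0r => /(_ _ e2).
  by apply: filterS => s; rewrite nrmRH.
have mn0 : 0 < Num.min 1 (e / 2 / C) by rewrite lt_min ltr01 divr_gt0 ?divr_gt0.
near=> s.
pose d := u s - u t.
have h0 : `|ip (nl (u t)) (B (u s)) - ip (nl (u t)) (B (u t)) - (s - t) * ip (nl (u t)) k| <= e / 2 * `|s - t|.
  by near: s; exact: H.
have h1 : nrm (B (u s) - B (u t) - (s - t) *: k) <= 1 * `|s - t| by near: s; exact: der_Bu.
have h2 : nrm d <= Num.min 1 (e / 2 / C).
  by rewrite /d; near: s; exact: (cu _ mn0).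
have d1 : nrm d <= 1 by apply: le_trans h2 _; rewrite ge_min lexx.
have d2 : nrm d * C <= e / 2.
  by rewrite -ler_pdivlMr//; apply: le_trans h2 _; rewrite ge_min lexx orbT.
have Bd : nrm (B d) <= (1 + nrm k) * `|s - t|.
  rewrite /d (linearB B); have := nrmD (B (u s) - B (u t) - (s - t) *: k) ((s - t) *: k).
  rewrite subrK nrmZ; lra.
(* One factor [B d] is Lipschitz in time and the other is merely continuous. *)
have mB : mass d <= (1 + nrm k) * `|s - t| * nrm d.
  apply: (le_trans (ip_le _ _)); by rewrite ler_wpM2r ?nrm_ge0.
have m0 := mass_ge0 d; have nd0 := nrm_ge0 d.
have bq x y : `|q4 x y d d| <= `|Cm| * nrm x * nrm y * mass d.
  apply: (le_trans (cf_B cf x y d)); rewrite !ler_wpM2r ?nrm_ge0 ?mass_ge0// ler_norm.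
  by [].
rewrite nrmRH; change (`|quartic (u s) - quartic (u t) - (s - t) * ip (nl (u t)) k| <= e * `|s - t|).
have -> : quartic (u s) = quartic (u t + d) by rewrite /d addrC subrK.
rewrite quartic_expand.
have -> : ip (B (nl (u t))) d = ip (nl (u t)) (B (u s)) - ip (nl (u t)) (B (u t)).
  by rewrite (admBsym adm) /d (linearB B) ipBr.
set r := (_ / 4 in X in `|X|); set a := ip _ (B (u s)); set b := ip _ (B (u t)).
have rb : `|r| <= (6 * `|Cm| * N ^+ 2 + 4 * `|Cm| * N + `|Cm|) / 4 * mass d.
  have k1 := bq (u t) (u t); have k2 := bq (u t) d; have k3 := bq d d.
  have n1 : `|Cm| * N * nrm d <= `|Cm| * N by rewrite ler_piMr// mulr_ge0.
  have n2 : `|Cm| * nrm d * nrm d <= `|Cm|.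
    by rewrite -mulrA ler_piMr// mulr_ile1.
  have := ler_wpM2r m0 n1; have := ler_wpM2r m0 n2 => n3 n4.
  rewrite /r normrM (ger0_norm (_ : 0 <= 4^-1)) ?invr_ge0// mulrAC ler_wpM2r ?invr_ge0//.
  apply: (le_trans (ler_normD _ _)); have := ler_normD (6 * q4 (u t) (u t) d d) (4 * q4 (u t) d d d).
  rewrite !normrM (ger0_norm (ler0n _ 6)) (ger0_norm (ler0n _ 4)); move: k1 k2; rewrite -/N; lra.
have -> : quartic (u t) + (a - b) + r - quartic (u t) - (s - t) * ip (nl (u t)) k =
  (a - b - (s - t) * ip (nl (u t)) k) + r by ring.
apply: (le_trans (ler_normD _ _)).
suff : `|r| <= e / 2 * `|s - t| by lra.
apply: (le_trans rb); have st := normr_ge0 (s - t).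
apply: (@le_trans _ _ (nrm d * C * `|s - t|)); last by rewrite ler_wpM2r.
apply: (le_trans (ler_wpM2l C'0 mB)).
have : 0 <= nrm d * `|s - t| by rewrite mulr_ge0.
rewrite /C; move: ((_ + _) / 4) => z; nra.
Unshelve. all: by end_near. Qed.

(** The quadratic part is differentiated on [w], since [T] is isometric, and the quartic part on
    [u]; both give [ip (J (nl (u t))) (u t)]. *)
Lemma der_action om : derR (fun s => action om (u s)) t 0.
Proof.
have E s : ip (w s) (w s) / 2 + (om - lam) * mass (u s) / 2 - quartic (u s) = action om (u s).
  by rewrite -(T_ip s).
apply: (@eq_der _ (RH R) _ _ _ _ E).
have h1 := @derZ _ (RH R) _ _ _ 2^-1 (der_ip hw hw).
have h2 := @derZ _ (RH R) _ _ _ ((om - lam) / 2) der_mass.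
have := @derB _ (RH R) _ _ _ _ _ (@derD _ (RH R) _ _ _ _ _ h1 h2) der_quartic.
rewrite [X in der _ _ X](_ : _ = 0); last first.
  have e1 : ip (J (T (- t) (nl (u t)))) (w t) = ip (J (nl (u t))) (u t).
    by rewrite -(T_ip t) (ugJ gT) TK.
  by rewrite /GRing.scale /= (ipC (w t)) e1; field.
by apply: eq_der => s; rewrite /GRing.scale /=; ring.
Qed.

End Conservation.

Lemma cont_sol (w : R -> V) t l : der w t l -> cont_at (fun s => T s (w s)) t.
Proof. by move=> h; apply: cont_T; exact: der_cont h. Qed.

End NLS.

(** * Global flow, stability and instability *)

Section Truncation.
Context {R : realType} {V : hilb R}.
Implicit Types u v w x y : V.

(** Radial retraction onto the ball of radius [r]. Composed with it the nonlinearity is globally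
    Lipschitz; a solution that stays in the ball solves the original equation. *)
Definition retract (r : R) u : V := if nrm u <= r then u else (r / nrm u) *: u.

Lemma retract_id r u : nrm u <= r -> retract r u = u.
Proof. by rewrite /retract => ->. Qed.

Lemma retract_nrm r u : 0 < r -> nrm (retract r u) <= r.
Proof.
move=> r0; rewrite /retract; have [//|ru] := leP (nrm u) r.
have u0 : 0 < nrm u by apply: lt_trans ru.
by rewrite nrmZ ger0_norm ?divr_ge0 ?(ltW r0) ?nrm_ge0// divfK// gt_eqF.
Qed.

Lemma retract_lip r u v : 0 < r -> nrm (retract r u - retract r v) <= 2 * nrm (u - v).
Proof.
move=> r0.
have H1 x y : nrm x <= r -> r < nrm y -> nrm (x - (r / nrm y) *: y) <= 2 * nrm (x - y).
  move=> xr ry; have y0 : 0 < nrm y by apply: lt_trans ry.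
  apply: (le_trans (nrm_tri y _ _)).
  have -> : y - (r / nrm y) *: y = (1 - r / nrm y) *: y by rewrite scalerBl scale1r.
  rewrite nrmZ ger0_norm; last by rewrite subr_ge0 ler_pdivrMr// mul1r ltW.
  rewrite mulrBl mul1r divfK ?gt_eqF//.
  by have := nrm_sub y x; rewrite (nrmBC y) ler_norml => /andP[_]; lra.
rewrite /retract; have [ur|ru] := leP (nrm u) r; have [vr|rv] := leP (nrm v) r.
- by have := nrm_ge0 (u - v); lra.
- exact: H1.
- by rewrite nrmBC (nrmBC u); exact: H1.
have u0 : 0 < nrm u by apply: lt_trans ru.
have v0 : 0 < nrm v by apply: lt_trans rv.
have -> : (r / nrm u) *: u - (r / nrm v) *: v =
    (r / nrm u) *: (u - v) + (r / nrm u * ((nrm v - nrm u) / nrm v)) *: v.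
  have E : r / nrm v = r / nrm u - r / nrm u * ((nrm v - nrm u) / nrm v).
    by field; rewrite !gt_eqF.
  by rewrite [in LHS]E; vring.
have ru1 : 0 <= r / nrm u <= 1.
  by rewrite divr_ge0 ?(ltW r0) ?(ltW u0)//= ler_pdivrMr// mul1r ltW.
case/andP: ru1 => ru0 ru1.
apply: (le_trans (nrmD _ _)); rewrite !nrmZ !normrM (ger0_norm (ltW r0)) !normfV.
rewrite !(ger0_norm (nrm_ge0 _)) -!mulrA mulVf ?gt_eqF// mulr1 !mulrA.
have := nrm_sub v u; rewrite (nrmBC v) => h.
have a1 : r / nrm u * nrm (u - v) <= nrm (u - v) by rewrite ler_piMl ?nrm_ge0.
have a2 : r / nrm u * `|nrm v - nrm u| <= nrm (u - v).
  by apply: le_trans (ler_piMl _ ru1) h; rewrite normr_ge0.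
lra.
Qed.

Lemma polar (a b : R) : exists th, a = Num.sqrt (a ^+ 2 + b ^+ 2) * cos th /\
  b = Num.sqrt (a ^+ 2 + b ^+ 2) * sin th.
Proof.
set r := Num.sqrt _; have s0 : 0 <= a ^+ 2 + b ^+ 2 by rewrite addr_ge0 ?sqr_ge0.
have r2 : r ^+ 2 = a ^+ 2 + b ^+ 2 by rewrite sqr_sqrtr.
have [r0|r0] := eqVneq r 0.
  exists 0; rewrite r0 !mul0r; move: r2; rewrite r0 expr0n /= => /esym h.
  have := sqr_ge0 a; have := sqr_ge0 b => hb ha.
  by split; apply/eqP; rewrite -sqrf_eq0; apply/eqP; lra.
have rp : 0 < r by rewrite lt_def r0 sqrtr_ge0.
pose c := a / r.
have c1 : -1 <= c <= 1.
  rewrite -ler_norml normrM normfV (gtr0_norm rp) ler_pdivrMr// mul1r.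
  by rewrite -[leRHS](gtr0_norm rp) -ler_sqr ?normr_nneg// !real_normK ?num_real// r2 lerDl sqr_ge0.
have ss : Num.sqrt (1 - c ^+ 2) = `|b| / r.
  have -> : 1 - c ^+ 2 = (b / r) ^+ 2.
    have : c ^+ 2 + (b / r) ^+ 2 = 1 by rewrite /c !expr_div_n -mulrDl -r2 divff// sqrf_eq0.
    by lra.
  by rewrite sqrtr_sqr normrM normfV (gtr0_norm rp).
have [b0|/ltW b0] := leP 0 b.
  exists (acos c); rewrite acosK ?in_itv//= sin_acos// ss ger0_norm//.
  by rewrite /c ![r * _]mulrC !divfK.
exists (- acos c); rewrite cosN sinN acosK ?in_itv//= sin_acos// ss ler0_norm//.
by rewrite /c mulNr opprK ![r * _]mulrC !divfK.
Qed.

(** Continuous induction: at the supremum of the times up to which [D <= b], the hypothesis gives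
    the better bound [a], and continuity extends [D <= b] beyond that time. *)
Lemma bootstrap (D : R -> R) (a b : R) : continuous D -> a < b -> D 0 <= a ->
  (forall t, 0 <= t -> (forall s, 0 <= s <= t -> D s <= b) -> D t <= a) ->
  forall t, 0 <= t -> D t <= a.
Proof.
move=> cD ab D0 H t1 t10; rewrite leNgt; apply/negP => Dt1.
pose S := [set t | 0 <= t <= t1 /\ forall s, 0 <= s <= t -> D s <= b].
have S0 : S 0.
  split; first by rewrite lexx.
  move=> s /andP[s0 s1]; have -> : s = 0 by apply/eqP; rewrite eq_le s0 s1.
  exact: le_trans D0 (ltW ab).
have supS : has_sup S by split; [exists 0|exists t1 => t [/andP[]]].
pose sg := sup S.
have sg0 : 0 <= sg by apply: ub_le_sup S0; exact: supS.2.
have sg1 : sg <= t1 by apply: ge_sup => [|t [/andP[]]//]; exists 0.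
have bel s : 0 <= s -> s < sg -> D s <= a.
  move=> s0 ssg; have [t [[_ tS] st]] : exists t, S t /\ s < t.
    have ssg0 : 0 < sg - s by rewrite subr_gt0.
    by have [t ? b0] := sup_adherent ssg0 supS; exists t; split=> //; move: b0; rewrite -/sg; lra.
  by apply: H => // r /andP[r0 rs]; apply: tS; rewrite r0 (le_trans rs)// ltW.
have Dsg : D sg <= a.
  have [sp|] := ltP 0 sg; last by move=> h; have -> : sg = 0 by lra.
  rewrite leNgt; apply/negP => h; have e0 : 0 < D sg - a by rewrite subr_gt0.
  move/cont_realP : cD => cD; have /near_ex[d d0 hd] := cD sg _ (divr_gt0 e0 (ltr0n _ 2)).
  pose s := Num.max (sg / 2) (sg - d / 2).
  have s1 : s < sg by rewrite gt_max; apply/andP; split; lra.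
  have s2 : sg / 2 <= s by rewrite le_max lexx.
  have s3 : sg - d / 2 <= s by rewrite le_max lexx orbT.
  have := hd s; rewrite nrmRH ltr0_norm ?subr_lt0// => k.
  have {}k : `|D s - D sg| <= (D sg - a) / 2 by apply: k; lra.
  by move: k; rewrite ler_norml; have := bel s _ s1; lra.
have st : sg < t1.
  by rewrite lt_neqAle sg1 andbT; apply: contraTneq Dsg => ->; rewrite -ltNge.
have e0 : 0 < b - a by rewrite subr_gt0.
move/cont_realP : cD => cD; have /near_ex[d d0 hd] := cD sg _ e0.
pose s := Num.min t1 (sg + d / 2).
have s1 : sg < s by rewrite lt_min st /=; lra.
have s2 : s <= t1 by rewrite ge_min lexx.
have s3 : s <= sg + d / 2 by rewrite ge_min lexx orbT.
have : S s.
  split; first by rewrite s2 andbT; lra.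
  move=> r /andP[r0 rs]; have [rsg|rsg] := ltP r sg; first by have := bel r r0 rsg; lra.
  have := hd r; rewrite nrmRH ger0_norm ?subr_ge0// => k.
  have {}k : `|D r - D sg| <= b - a by apply: k; lra.
  by move: k; rewrite ler_norml; lra.
by move=> /(ub_le_sup supS.2); rewrite -/sg; lra.
Qed.

Lemma derR_cst_on (f : R -> R) (a b : R) :
  (forall t, Num.min a b <= t <= Num.max a b -> derR f t 0) -> f b = f a.
Proof.
have H (g : R -> R) (x y : R) : x <= y -> (forall t, x <= t <= y -> derR g t 0) -> g y = g x.
  move=> xy hg; apply/eqP; rewrite eq_le (derR_le xy hg) => [/=|t _]; last by rewrite lexx.
  rewrite -lerN2; apply: (@derR_le _ (fun t => - g t) (fun=> 0) _ _ xy) => // t ht.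
  by rewrite -[0]oppr0; exact: (@derN _ (RH R) _ _ _ (hg t ht)).
have [ab|/ltW ab] := leP a b; first exact: H.
by move=> h; apply/esym/H.
Qed.

End Truncation.

Section Flow.
Context {R : realType} {V : hilb R}.
Variables (J B : {linear V -> V}) (lam : R) (T : R -> V -> V).
Hypotheses (adm : admissible J B) (gT : unitary_group J B lam T).
Variables (m : V -> V -> V -> V) (Cm : R).
Hypothesis cf : cubic_form J B m Cm.
Implicit Types u v w x y z : V.
Notation nl := (nl m).
Notation mass := (mass B).
Notation action := (action B lam m).
Notation q4 := (q4 B m).
Notation rot := (rot J).
Notation nls_sol := (nls_sol J T m).

Definition field_tr r t x := J (T (- t) (nl (retract r (T t x)))).

Let Cr2 (r : R) : 0 <= `|Cm| * r ^+ 2.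
Proof. by apply: mulr_ge0 => //; exact: sqr_ge0. Qed.

Let L r := 3 * (`|Cm| * r ^+ 2) * 2 + 1.
Let L_gt0 (r : R) : 0 < L r. Proof. by rewrite /L; have := Cr2 r; lra. Qed.

Lemma nl_retract_lip (r : R) x y : 0 < r ->
  nrm (nl (retract r x) - nl (retract r y)) <= L r * nrm (x - y).
Proof.
move=> r0; apply: (le_trans (nl_lip cf (retract_nrm _ r0) (retract_nrm _ r0))).
have h1 : 3 * (Cm * r ^+ 2) <= 3 * (`|Cm| * r ^+ 2).
  by rewrite ler_wpM2l// ler_wpM2r ?sqr_ge0// ler_norm.
have h2 : 0 <= 3 * (`|Cm| * r ^+ 2) by have := Cr2 r; lra.
have := retract_lip x y r0; have := nrm_ge0 (retract r x - retract r y).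
have := nrm_ge0 (x - y).
move: (nrm (x - y)) (nrm (retract r x - _)) => p q p0 q0 h3.
by have := ler_wpM2r q0 h1; have := ler_wpM2l h2 h3; rewrite /L; lra.
Qed.

Lemma field_lip (r : R) : 0 < r -> exists2 K, 0 < K & forall t x y,
  nrm (field_tr r t x - field_tr r t y) <= K * nrm (x - y).
Proof.
move=> r0; exists (L r) => // t x y.
rewrite /field_tr -(linearB J) (nrmJ adm) -(linB (ug_lin gT _)) (ug_nrm gT).
apply: (le_trans (nl_retract_lip _ _ r0)).
by rewrite -(linB (ug_lin gT _)) (ug_nrm gT).
Qed.

Lemma trunc_flow (r : R) u0 : 0 < r -> exists w : R -> V, w 0 = u0 /\ forall t, der w t (field_tr r t (w t)).
Proof.
move=> r0; have [K K0 hK] := field_lip r0.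
apply: (@ode_lipschitz _ _ (field_tr r) K (`|Cm| * r * r * r)) => //.
  move=> w cw t.
  have c1 : cont_at (fun s => nl (retract r (T s (w s)))) t.
    move=> e e0.
    have := (cont_T gT (cw t)) _ (divr_gt0 e0 (L_gt0 r)); apply: filterS => s.
    rewrite ler_pdivlMr// mulrC => h; exact: le_trans (nl_retract_lip _ _ r0) h.
  have := cont_TN gT c1; apply: (@cont_op _ _ _ J 1); first exact: linearP.
  by move=> x; rewrite (nrmJ adm) mul1r.
move=> t; rewrite (nrmJ adm) (ug_nrm gT); apply: (le_trans (cf_nrm cf _ _ _)).
have h := retract_nrm (T t u0) r0; have h0 := nrm_ge0 (retract r (T t u0)).
move: (nrm _) h h0 => p h h0; apply: (@le_trans _ _ (`|Cm| * p * p * p)).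
  by rewrite !ler_wpM2r// ler_norm.
by do 2 (apply: ler_pM => //; rewrite ?mulr_ge0//); exact: ler_wpM2l.
Qed.

Lemma trunc_unique (r : R) (w1 w2 : R -> V) : 0 < r -> (forall t, der w1 t (field_tr r t (w1 t))) ->
  (forall t, der w2 t (field_tr r t (w2 t))) -> w1 0 = w2 0 -> w1 =1 w2.
Proof.
move=> r0 h1 h2 h0 t; apply/eqP; rewrite -subr_eq0; apply/eqP.
have [K K0 hK] := field_lip r0.
apply: (@gronwall0 _ _ (fun t => w1 t - w2 t) (fun t => field_tr r t (w1 t) - field_tr r t (w2 t)) K) => //.
  by move=> s; exact: derB.
by rewrite h0 subrr.
Qed.

Record symmetry (P : {linear V -> V}) : Prop := {
  sym_nrm : forall x, nrm (P x) = nrm x ;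
  symJ : forall x, P (J x) = J (P x) ;
  symB : forall x, P (B x) = B (P x) ;
  sym_nl : forall x, P (nl x) = nl (P x) }.

(** Both sides solve the same linear equation, so [group_unique] applies after multiplication by the
    injective [B]. *)
Lemma sym_T P t x : symmetry P -> T t (P x) = P (T t x).
Proof.
move=> sP; apply/eqP; rewrite -subr_eq0; apply/eqP; apply: (admBinj adm).
rewrite (linearB B); apply/eqP; rewrite subr_eq0 eq_sym; apply/eqP.
rewrite -(ugB gT) -{2}(ug0 gT x).
apply: (group_unique (k := fun t => P (T t x)) gT) => s.
have -> : - J (P (T s x) - lam *: B (P (T s x))) = P (- J (T s (x - lam *: B x))).
  rewrite (linearN P) (symJ sP) (linB (ug_lin gT s)) (linZ (ug_lin gT s)) (linearB P).
  by rewrite (linearZ_LR P) (ugB gT) (symB sP).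
apply: (@eq_der _ _ (fun s => P (T s (B x)))) => [r|]; first by rewrite (ugB gT) (symB sP).
by apply: (@der_op _ _ _ P 1) (ug_der gT _ _); [exact: linearP|move=> y; rewrite mul1r (sym_nrm sP)].
Qed.

(** An isometry commutes with the retraction, so [P] maps solutions of the truncated equation to
    solutions, and uniqueness concludes. *)
Lemma trunc_sym (r : R) P (w : R -> V) : 0 < r -> symmetry P -> (forall t, der w t (field_tr r t (w t))) ->
  P (w 0) = w 0 -> forall t, P (w t) = w t.
Proof.
move=> r0 sP hw w0; apply: (trunc_unique (w1 := fun t => P (w t)) r0) => // t.
have rP x : P (retract r x) = retract r (P x).
  by rewrite /retract (sym_nrm sP); case: ifP => // _; rewrite (linearZ_LR P).
have -> : field_tr r t (P (w t)) = P (field_tr r t (w t)).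
  by rewrite /field_tr (symJ sP) -(sym_T (- t) _ sP) (sym_nl sP) rP (sym_T t _ sP).
by apply: (@der_op _ _ _ P 1) (hw t); [exact: linearP|move=> y; rewrite mul1r (sym_nrm sP)].
Qed.

Lemma sol_trunc (r : R) (w : R -> V) : (forall t, nrm (T t (w t)) <= r) -> nls_sol w ->
  forall t, der w t (field_tr r t (w t)).
Proof. by move=> b h t; rewrite /field_tr retract_id//; exact: h. Qed.

Section Orbit.
Variables (Th : V) (om : R).
(** The stationary equation [H Th + om Th = |Th|^2 Th] after application of [B]. *)
Hypothesis stat : Th + (om - lam) *: B Th = B (nl Th).

(** Second derivative of the action. Since [m] is symmetric, [3 *: m Th Th x] is the derivative of
    the nonlinearity; for a real [Th] it weighs real and imaginary parts by 3 and 1. *)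
Definition hess x y := ip x y + (om - lam) * ip (B x) y - 3 * q4 Th Th x y.

Lemma action_expand x : action om (Th + x) = action om Th + hess x x / 2
  - (4 * q4 Th x x x + q4 x x x x) / 4.
Proof.
by rewrite /action (massD adm) (quartic_expand cf) /hess -stat !ipE (ipC x Th) /mass; field.
Qed.

(** The angle is the argument of the complex pairing of [u] with [Th]. The rotated pairing is then
    real and maximal, which gives orthogonality to [J Th] and minimal distance at once. *)
Lemma phase u : exists th, ip (rot (- th) u) (J Th) = 0 /\
  forall th', nrm (rot (- th) u - Th) <= nrm (rot (- th') u - Th).
Proof.
have [th []] := polar (ip u Th) (ip u (J Th)).
set r := Num.sqrt _ => h1 h2; exists th.
have e th' : ip (rot (- th') u) Th = cos th' * ip u Th + sin th' * ip u (J Th).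
  by rewrite /rot cosN sinN !ipE (Jskew adm u); ring.
split.
  rewrite /rot cosN sinN !ipE (admJip adm) h1 h2; ring.
move=> th'; rewrite -ler_sqr ?nnegrE ?nrm_ge0// !nrm2 !ipBl !ipBr !(rot_ip adm).
rewrite !(ipC Th) !e.
have r0 : 0 <= r by exact: sqrtr_ge0.
have -> : cos th * ip u Th + sin th * ip u (J Th) = r.
  by rewrite h1 h2 -[RHS]mulr1 -(cos2Dsin2 th); ring.
have : cos th' * ip u Th + sin th' * ip u (J Th) <= r.
  rewrite h1 h2; have -> : cos th' * (r * cos th) + sin th' * (r * sin th) = r * cos (th' - th).
    by rewrite cosB; ring.
  by rewrite ler_piMr// cos_le1.
lra.
Qed.

Lemma phase_fun : exists ph : V -> R, forall u, ip (rot (- ph u) u) (J Th) = 0 /\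
  forall th', nrm (rot (- ph u) u - Th) <= nrm (rot (- th') u - Th).
Proof. by have /choice[p hp] := phase; exists p. Qed.

Definition ph := projT1 (cid phase_fun).
Lemma phJ u : ip (rot (- ph u) u) (J Th) = 0.
Proof. by case: (projT2 (cid phase_fun) u). Qed.
Lemma ph_min u th' : nrm (rot (- ph u) u - Th) <= nrm (rot (- th') u - Th).
Proof. by case: (projT2 (cid phase_fun) u). Qed.

Definition dev u := rot (- ph u) u - Th.

Lemma dev_le u th : nrm (dev u) <= nrm (u - rot th Th).
Proof.
apply: (le_trans (ph_min u th)); rewrite -(rot_nrm adm th) (linB (rot_lin J th)).
by rewrite (rotK adm).
Qed.
Lemma devE u : nrm (dev u) = nrm (u - rot (ph u) Th).
Proof. by rewrite -(rot_nrm adm (ph u)) (linB (rot_lin J _)) (rotK adm). Qed.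
(** The chosen phase [ph] need not be continuous, but the norm of [dev u] is the distance from [u]
    to the orbit, so it is 1-Lipschitz. *)
Lemma dev_lip u v : `|nrm (dev u) - nrm (dev v)| <= nrm (u - v).
Proof.
have H x y : nrm (dev x) - nrm (dev y) <= nrm (x - y).
  have := dev_le x (ph y); have := nrm_tri y x (rot (ph y) Th); rewrite -devE; lra.
by rewrite ler_norml; have := H u v; have := H v u; rewrite (nrmBC v); lra.
Qed.
Lemma dev_cont (f : R -> V) : cont f -> continuous (fun t => nrm (dev (f t))).
Proof.
move=> cf_; apply/cont_realP => t e e0; have := cf_ t e e0; apply: filterS => s h.
by rewrite nrmRH; apply: le_trans (dev_lip _ _) h.
Qed.
Lemma dev_bound u : nrm u <= nrm Th + nrm (dev u).
Proof.
rewrite devE; have := nrmD (u - rot (ph u) Th) (rot (ph u) Th).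
by rewrite subrK (rot_nrm adm); lra.
Qed.
Lemma dev_action u : action om (Th + dev u) = action om u.
Proof. by rewrite addrC subrK (rot_action lam adm cf). Qed.
Lemma dev_mass u : mass (Th + dev u) = mass u.
Proof. by rewrite addrC subrK (rot_mass adm). Qed.
Lemma dev_J u : ip (J Th) (dev u) = 0.
Proof. by rewrite /dev ipC ipBl phJ (ipC Th) (Jself adm) subrr. Qed.

Lemma dev_Y P u : symmetry P -> P Th = Th -> P u = u -> P (dev u) = dev u.
Proof.
by move=> sP PT Pu; rewrite /dev linearB PT /rot linearD !linearZ_LR/= (symJ sP) Pu.
Qed.

Lemma hessD x y z : hess (x + y) z = hess x z + hess y z.
Proof. by rewrite /hess linearD !ipE (q4D3 cf); ring. Qed.
Lemma hessC x y : hess x y = hess y x.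
Proof. by rewrite /hess (ipC x) (admBsym adm x) (ipC x) (q34 cf). Qed.
Lemma hessZ a x z : hess (a *: x) z = a * hess x z.
Proof. by rewrite /hess (linearZ_LR B) !ipE (q34 cf) q4Z (q34 cf); ring. Qed.

Lemma action_rest : exists2 C, 0 <= C & forall x, nrm x <= 1 ->
  `|action om (Th + x) - action om Th - hess x x / 2| <= C * nrm x ^+ 3.
Proof.
exists (`|Cm| * nrm Th + `|Cm|) => [|x x1]; first by rewrite addr_ge0// mulr_ge0// nrm_ge0.
rewrite action_expand.
have x0 := nrm_ge0 x; have h := ler_norm Cm; have T0 := nrm_ge0 Th.
have x3 : 0 <= nrm x ^+ 3 by rewrite exprn_ge0.
have k1 := q4_bound adm cf Th x x x; have k2 := q4_bound adm cf x x x x.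
have l1 : Cm * nrm Th * nrm x * nrm x * nrm x <= `|Cm| * nrm Th * nrm x ^+ 3.
  have -> : Cm * nrm Th * nrm x * nrm x * nrm x = Cm * (nrm Th * nrm x ^+ 3) by ring.
  by rewrite -mulrA ler_wpM2r// mulr_ge0.
have l2 : Cm * nrm x * nrm x * nrm x * nrm x <= `|Cm| * nrm x ^+ 3.
  apply: (@le_trans _ _ (`|Cm| * nrm x ^+ 3 * nrm x)).
    have -> : Cm * nrm x * nrm x * nrm x * nrm x = Cm * (nrm x ^+ 3 * nrm x) by ring.
    by rewrite -mulrA ler_wpM2r// mulr_ge0.
  by rewrite ler_piMr// mulr_ge0.
move: k1 k2; rewrite !ler_norml; lra.
Qed.

Lemma cont_bound_at0 : exists2 C, 0 <= C & forall x, nrm x <= 1 ->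
  `|mass (Th + x) - mass Th| <= C * nrm x /\ `|action om (Th + x) - action om Th| <= C * nrm x.
Proof.
have [C C0 hC] := action_rest.
pose Dh := 1 + `|om - lam| + 3 * (`|Cm| * nrm Th ^+ 2).
have Dh0 : 0 <= Dh.
  by rewrite /Dh; have := normr_ge0 (om - lam); have := Cr2 (nrm Th); lra.
have hh x : `|hess x x| <= Dh * nrm x ^+ 2.
  have m1 := mass_ge0 adm x; have m2 := mass_le adm x.
  have k := q4_bound adm cf Th Th x x; have x2 := sqr_ge0 (nrm x).
  have l : Cm * nrm Th * nrm Th * nrm x * nrm x <= `|Cm| * nrm Th ^+ 2 * nrm x ^+ 2.
    have -> : Cm * nrm Th * nrm Th * nrm x * nrm x = Cm * (nrm Th ^+ 2 * nrm x ^+ 2) by ring.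
    by rewrite -mulrA ler_wpM2r ?ler_norm// mulr_ge0 ?sqr_ge0.
  have m3 : `|(om - lam) * mass x| <= `|om - lam| * nrm x ^+ 2.
    by rewrite normrM (ger0_norm m1) ler_wpM2l.
  rewrite /hess -nrm2 -/(mass x) /Dh.
  move: k m3; rewrite !ler_norml; lra.
exists (2 * nrm Th + 1 + C + Dh) => [|x x1]; first by have := nrm_ge0 Th; lra.
have x0 := nrm_ge0 x; have T0 := nrm_ge0 Th.
have x2 : nrm x ^+ 2 <= nrm x by rewrite expr2 ler_piMr.
have x3 : nrm x ^+ 3 <= nrm x by rewrite exprS ler_piMr// (le_trans x2).
have x20 := sqr_ge0 (nrm x).
split.
  have k1 : `|ip (B Th) x| <= nrm Th * nrm x.
    by apply: (le_trans (CS _ _)); rewrite ler_wpM2r// (nrm_admB adm).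
  have m1 := mass_ge0 adm x; have m2 := mass_le adm x.
  rewrite (massD adm); move: k1; rewrite !ler_norml.
  have : 0 <= (C + Dh) * nrm x by rewrite mulr_ge0// addr_ge0.
  lra.
have := hC x x1; have := hh x; have := ler_wpM2l C0 x3; have := ler_wpM2l Dh0 x2.
have : 0 <= (2 * nrm Th + 1) * nrm x by rewrite mulr_ge0//; lra.
rewrite !ler_norml; lra.
Qed.

Section Stability.
Variables (I : Type) (P : I -> {linear V -> V}).
Hypotheses (sP : forall i, symmetry (P i)) (PTh : forall i, P i Th = Th).
Let Y u := forall i, P i u = u.

(** The phase removes the component along [J Th]. Conservation of mass determines [ip (B Th) x] up
    to the initial mass defect and a term quadratic in [x], so its square is absorbed for small [x]
    and coercivity bounds [x] by the initial errors. The frequency need not be adjusted to the mass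
    of the datum. *)
Theorem orbital_stability (c K : R) : 0 < c -> 0 <= K ->
  (forall x, Y x -> c * nrm x ^+ 2 <= hess x x + K * ip (B Th) x ^+ 2 + K * ip (J Th) x ^+ 2) ->
  forall eps, 0 < eps -> exists2 eta, 0 < eta & forall u0, Y u0 -> nrm (u0 - Th) < eta ->
    exists w : R -> V, [/\ w 0 = u0, nls_sol w & forall t, exists th, nrm (T t (w t) - rot th Th) <= eps].
Proof.
move=> c0 K0 coer eps eps0.
have [C3 C30 hC3] := action_rest; have [C1 C10 hC1] := cont_bound_at0.
(* [A] collects the cubic remainder of the action and the quartic term coming from the mass; [rho]
   is small enough for both to cost at most half of the coercivity. *)
pose A := 2 * C3 + K / 2; have A0 : 0 <= A by rewrite /A; lra.
pose rho := Num.min 1 (c / 2 / (A + 1)).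
have rho0 : 0 < rho by rewrite lt_min ltr01 !divr_gt0//; lra.
have rho1 : rho <= 1 by rewrite ge_min lexx.
have rhoA : A * rho <= c / 2.
  have : rho * (A + 1) <= c / 2 by rewrite -ler_pdivlMr ?ge_min ?lexx ?orbT//; lra.
  by lra.
pose B2 := (2 / c) * (2 + K / 2); have B20 : 0 < B2 by rewrite mulr_gt0 ?divr_gt0//; lra.
have key u e1 : Y u -> 0 <= e1 <= 1 -> nrm (dev u) <= rho ->
    `|mass u - mass Th| <= e1 -> action om u - action om Th <= e1 ->
    nrm (dev u) ^+ 2 <= B2 * e1.
  move=> Yu /andP[e10 e11]; set x := dev u => xr hm ha.
  have x0 := nrm_ge0 x; have x1 : nrm x <= 1 by apply: le_trans rho1.
  have Yx : Y x by move=> i; apply: dev_Y.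
  have := coer x Yx; rewrite dev_J expr0n mulr0 addr0.
  have hh := hC3 x x1; move: hh; rewrite dev_action => hh.
  have m2 := mass_le adm x; have m1 := mass_ge0 adm x.
  (* By [massD], twice this pairing is the mass defect minus [mass x]. *)
  have e2 : ip (B Th) x ^+ 2 <= (e1 + nrm x ^+ 4) / 2.
    have : `|2 * ip (B Th) x| <= e1 + nrm x ^+ 2.
      have : 2 * ip (B Th) x = (mass u - mass Th) - mass x.
        by rewrite -[mass u](dev_mass) -/x (massD adm); ring.
      by move=> ->; apply: (le_trans (ler_normB _ _)); rewrite (ger0_norm m1) lerD.
    move=> h; have : (2 * ip (B Th) x) ^+ 2 <= (e1 + nrm x ^+ 2) ^+ 2.
      by rewrite -real_normK ?num_real// ler_sqr ?nnegrE// addr_ge0 ?sqr_ge0.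
    have -> : nrm x ^+ 4 = (nrm x ^+ 2) ^+ 2 by rewrite -exprM.
    have := sqr_ge0 (e1 - nrm x ^+ 2); have : e1 ^+ 2 <= e1 by rewrite expr2 ler_piMr.
    by rewrite !sqrrD !sqrrN exprMn; lra.
  have x3 : nrm x ^+ 3 <= rho * nrm x ^+ 2 by rewrite exprS ler_wpM2r ?sqr_ge0.
  have x4 : nrm x ^+ 4 <= rho * nrm x ^+ 2.
    rewrite (exprD _ 2 2) ler_wpM2r ?sqr_ge0// expr2; apply: le_trans xr.
    by rewrite ler_piMr.
  have k1 := ler_wpM2l C30 x3; have k2 := ler_wpM2l K0 x4; have k3 := ler_wpM2l K0 e2.
  have k4 := ler_wpM2r (sqr_ge0 (nrm x)) rhoA.
  move=> k; have : c / 2 * nrm x ^+ 2 <= (2 + K / 2) * e1.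
    move: hh; rewrite ler_norml => /andP[hh _]; rewrite /A in k4; lra.
  rewrite -ler_pdivlMl; last by rewrite divr_gt0.
  by rewrite /B2 invf_div mulrA.
pose e := Num.min eps rho / 2.
have e0 : 0 < e by rewrite divr_gt0// lt_min eps0.
have mn1 : Num.min eps rho <= eps by rewrite ge_min lexx.
have mn2 : Num.min eps rho <= rho by rewrite ge_min lexx orbT.
have e_eps : e < eps by rewrite /e; lra.
have e_rho : e < rho by rewrite /e; lra.
pose e1 := Num.min 1 (e ^+ 2 / B2).
have e10 : 0 < e1 by rewrite lt_min ltr01 divr_gt0 ?exprn_gt0.
have e11 : 0 <= e1 <= 1 by rewrite (ltW e10) ge_min lexx.
have e1B : B2 * e1 <= e ^+ 2.
  by rewrite mulrC -ler_pdivlMr// ge_min lexx orbT.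
pose eta := Num.min e (e1 / (C1 + 1)).
have eta0 : 0 < eta by rewrite lt_min e0 divr_gt0//; lra.
exists eta => // u0 Yu0 hu0.
have eta1 : eta <= 1 by rewrite ge_min; apply/orP; left; lra.
have hC : C1 * nrm (u0 - Th) <= e1.
  have : nrm (u0 - Th) * (C1 + 1) <= e1.
    rewrite -ler_pdivlMr; last by lra.
    by apply: (le_trans (ltW hu0)); rewrite ge_min lexx orbT.
  by have := nrm_ge0 (u0 - Th); lra.
have [a1 a2] := hC1 (u0 - Th) (le_trans (ltW hu0) eta1); have TE : Th + (u0 - Th) = u0 by rewrite addrC subrK.
rewrite TE in a1 a2.
pose r := nrm Th + 1; have r0 : 0 < r by rewrite ltr_wpDl// nrm_ge0.
have [w [w0 hw]] := trunc_flow u0 r0.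
pose u t := T t (w t).
have cu : cont u by move=> t; apply: (cont_T gT); exact: der_cont (hw t).
have Yu t : Y (u t).
  by move=> i; rewrite -(sym_T t _ (sP i)) (trunc_sym r0 (sP i) hw)// w0 Yu0.
have loc t : nrm (dev (u t)) <= rho -> der w t (J (T (- t) (nl (u t)))).
  move=> h; have := hw t; rewrite /field_tr retract_id//.
  by apply: (le_trans (dev_bound _)); rewrite lerD2l (le_trans h).
have Du0 : nrm (dev (u 0)) <= e.
  apply: (le_trans (dev_le (u 0) 0)); rewrite /rot cos0 sin0 scale1r scale0r addr0.
  by rewrite /u (ug0 gT) w0; apply: (le_trans (ltW hu0)); rewrite ge_min lexx.
(* Mass and action are only known to be conserved while the solution is [rho]-close to the orbit,
   where the truncation is inactive; the conclusion [e < rho] closes the bootstrap. *)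
have fin t : (forall q, Num.min 0 t <= q <= Num.max 0 t -> nrm (dev (u q)) <= rho) ->
    nrm (dev (u t)) <= e.
  move=> h; have hm : mass (u t) = mass (u 0).
    by apply: (@derR_cst_on _ (fun q => mass (u q))) => q /h/loc hq; exact: (der_mass adm gT cf hq).
  have ha : action om (u t) = action om (u 0).
    by apply: (@derR_cst_on _ (fun q => action om (u q))) => q /h/loc hq; exact: (der_action adm gT cf hq).
  have U0 : u 0 = u0 by rewrite /u (ug0 gT) w0.
  rewrite -ler_sqr ?nnegrE ?nrm_ge0 ?(ltW e0)//; apply: le_trans e1B.
  apply: key => //; rewrite ?hm ?ha ?U0.
  - by apply: h; rewrite ge_min lexx orbT le_max lexx orbT.
  - exact: le_trans a1 hC.
  - exact: le_trans (ler_norm _) (le_trans a2 hC).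
have cd : continuous (fun t => nrm (dev (u t))) := dev_cont cu.
have small t : nrm (dev (u t)) <= e.
  have [t0|/ltW t0] := leP 0 t.
    apply: (bootstrap cd e_rho Du0 _ t0) => {t0}t t0 ht; apply: fin => q.
    by rewrite (min_idPl t0) (max_idPr t0); exact: ht.
  rewrite -(opprK t); apply: (@bootstrap _ (fun t => nrm (dev (u (- t)))) e rho) => //.
  - move=> x; apply: (@continuous_comp _ _ _ (fun t : R => - t) (fun t => nrm (dev (u t)))).
      exact: opp_continuous.
    exact: cd.
  - by rewrite oppr0.
  - move=> q q0 hq; have q0' : - q <= 0 by rewrite oppr_le0.
    apply: fin => p; rewrite (min_idPr q0') (max_idPl q0') => /andP[p1 p2].
    by have := hq (- p); rewrite opprK; apply; rewrite oppr_ge0 p2 lerNl.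
  - by rewrite oppr_ge0.
exists w; split=> // [t|t].
  by apply: loc; apply: le_trans (small t) (ltW e_rho).
exists (ph (u t)); rewrite -devE.
exact: le_trans (small t) (ltW e_eps).
Qed.

End Stability.

(* Grillakis-Shatah-Strauss: when [y] is the only negative direction, the
   functional A(u) = Im <u, y> conj <u, Th> is monotone, with a rate bounded
   below, along solutions of action less than that of [Th]. *)
Section Instability.
Variables (I : Type) (P : I -> {linear V -> V}).
Hypotheses (sP : forall i, symmetry (P i)) (PTh : forall i, P i Th = Th).
Let Y u := forall i, P i u = u.
Variable y : V.
Hypotheses (Yy : Y y) (yTh : ip (B Th) y = 0) (yJTh : ip (B Th) (J y) = 0)
  (y_neg : hess y y < 0).

(** [J] applied to the gradient of the action for the inner product of [V]. The velocity of [B u] is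
    [- k u] plus the rotation [om *: J (B u)]. *)
Let k u := J (u + (om - lam) *: B u - B (nl u)).
Let F a b := ip a (J y) * ip b Th + ip b (J y) * ip a Th
           - ip a y * ip b (J Th) - ip b y * ip a (J Th).
Let D u := - F (k u) (B u).
Let A u := ip (B u) (J y) * ip (B u) Th - ip (B u) y * ip (B u) (J Th).

Lemma F_rot th a b : F (rot th a) (rot th b) = F a b.
Proof.
rewrite /F /rot !ipE (Jskew adm a y) (Jskew adm b y) (Jskew adm a Th) (Jskew adm b Th) !(admJip adm).
have h := cos2Dsin2 th; rewrite -[RHS]mul1r -h; ring.
Qed.

Lemma k_rot th u : k (rot th u) = rot th (k u).
Proof.
rewrite /k (rot_nl cf) !(rotB adm) -(linZ (rot_lin J th)) -(linD (rot_lin J th)) -(linB (rot_lin J th)).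
by rewrite rotJ.
Qed.

Lemma D_rot th u : D (rot th u) = D u.
Proof. by rewrite /D k_rot (rotB adm) F_rot. Qed.

Lemma der_A (w : R -> V) t : der w t (J (T (- t) (nl (T t (w t))))) ->
  derR (fun s => A (T s (w s))) t (D (T t (w t))).
Proof.
move=> /(der_Bu adm gT) h; set u := T t (w t) in h *.
have hd z := der_ip h (der_cst z t).
have := @derB _ (RH R) _ _ _ _ _ (@der_ip _ (RH R) _ _ _ _ _ (hd (J y)) (hd Th))
  (@der_ip _ (RH R) _ _ _ _ _ (hd y) (hd (J Th))).
move=> H; apply: (@eq_ind R _ (fun l => derR (fun s => A (T s (w s))) t l) H); rewrite /= !ip0r !addr0.
(* The rotation part drops out of the derivative of [A], as [A] is invariant under rotations. *)
have -> : - J (u - lam *: B u - B (nl u)) = - k u + om *: J (B u).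
  by rewrite /k !linearB !linearD !linearZ_LR; vring.
rewrite /D /F -/u; move: (k u) (B u) => v b.
by rewrite !ipE !(admJip adm) !(Jskew adm b); ring.
Qed.

(** To first order [D (Th + x)] is [- mass Th * hess x y]. The other linear contributions vanish
    because [B Th] is orthogonal to [y], [J y] and [J Th]. *)
Lemma D_expand : exists2 C, 0 <= C & forall x, nrm x <= 1 ->
  `|D (Th + x) + mass Th * hess x y| <= C * nrm x ^+ 2.
Proof.
pose lx x := x + (om - lam) *: B x - 3 *: B (m Th Th x).
pose rx x := - (3 *: B (m Th x x) + B (nl x)).
have kE x : k (Th + x) = J (lx x + rx x).
  congr (J _); rewrite linearD scalerDr.
  have -> : nl (Th + x) = nl Th + 3 *: m Th Th x + 3 *: m Th x x + nl x.
    have lin a b := linD (cf_lin cf a b).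
    rewrite /nl !lin !(cf23 cf _ (Th + x)) !lin !(cf12 cf (Th + x)) !(cf23 cf _ (Th + x)) !lin.
    rewrite ?(cf12 cf x Th) ?(cf23 cf Th x Th) ?(cf23 cf x x Th) ?(cf12 cf x Th).
    by vring.
  rewrite !linearD !linearZ_LR -stat /lx /rx; vring.
pose Cl := 1 + `|om - lam| + 3 * (`|Cm| * nrm Th ^+ 2); pose Cr := 3 * (`|Cm| * nrm Th) + `|Cm|.
have T0 := nrm_ge0 Th; have y0 := nrm_ge0 y.
have Cl0 : 0 <= Cl by rewrite /Cl; have := normr_ge0 (om - lam); have := Cr2 (nrm Th); lra.
have Cr0 : 0 <= Cr by rewrite /Cr; have := normr_ge0 Cm; have := mulr_ge0 (normr_ge0 Cm) T0; lra.
have M0 := mass_ge0 adm Th.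
exists (mass Th * (Cr * nrm y) + 4 * ((Cl + Cr) * nrm y * nrm Th)) => [|x x1].
  by do ?[apply: addr_ge0|apply: mulr_ge0].
have x0 := nrm_ge0 x.
have bl : nrm (lx x) <= Cl * nrm x.
  have b1 : nrm (B (m Th Th x)) <= `|Cm| * nrm Th ^+ 2 * nrm x.
    apply: (le_trans (nrm_admB adm _)); apply: (le_trans (cf_nrm cf _ _ _)).
    have -> : Cm * nrm Th * nrm Th * nrm x = Cm * (nrm Th ^+ 2 * nrm x) by ring.
    by rewrite -mulrA ler_wpM2r ?ler_norm// mulr_ge0 ?sqr_ge0.
  have b2 : `|om - lam| * nrm (B x) <= `|om - lam| * nrm x by rewrite ler_wpM2l ?(nrm_admB adm).
  apply: (le_trans (nrmB _ _)); have := nrmD x ((om - lam) *: B x).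
  rewrite !nrmZ (ger0_norm (ler0n _ 3)) /Cl; lra.
have br : nrm (rx x) <= Cr * nrm x ^+ 2.
  have b1 : nrm (B (m Th x x)) <= `|Cm| * nrm Th * nrm x ^+ 2.
    apply: (le_trans (nrm_admB adm _)); apply: (le_trans (cf_nrm cf _ _ _)).
    have -> : Cm * nrm Th * nrm x * nrm x = Cm * (nrm Th * nrm x ^+ 2) by ring.
    by rewrite -mulrA ler_wpM2r ?ler_norm// mulr_ge0 ?sqr_ge0.
  have b2 : nrm (B (nl x)) <= `|Cm| * nrm x ^+ 2.
    apply: (le_trans (nrm_admB adm _)); apply: (le_trans (cf_nrm cf _ _ _)).
    have -> : Cm * nrm x * nrm x * nrm x = Cm * (nrm x ^+ 2 * nrm x) by ring.
    apply: (@le_trans _ _ (`|Cm| * (nrm x ^+ 2 * nrm x))).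
      by rewrite ler_wpM2r ?ler_norm// mulr_ge0 ?sqr_ge0.
    by rewrite ler_wpM2l// ler_piMr ?sqr_ge0.
  rewrite nrmN; apply: (le_trans (nrmD _ _)); rewrite nrmZ (ger0_norm (ler0n _ 3)) /Cr; lra.
have [z zE] : exists z, z = lx x + rx x by eexists.
have bz : nrm z <= (Cl + Cr) * nrm x.
  rewrite zE; apply: (le_trans (nrmD _ _)); rewrite mulrDl; apply: lerD => //; apply: (le_trans br).
  by rewrite ler_wpM2l// expr2 ler_piMr.
have TJ : ip (B Th) (J Th) = 0.
  by have := Jskew adm (B Th) Th; rewrite -(admBJ adm) (admBsym adm) (ipC (J Th)); lra.
have E1 : D (Th + x) + mass Th * hess x y = - (mass Th * ip (rx x) y) - ip z y * ip (B x) Th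
    + ip (B x) (J y) * ip z (J Th) - ip z (J y) * ip (B x) (J Th) + ip (B x) y * ip z Th.
  rewrite /D kE -zE /F (linearD B) !ipDl yTh yJTh TJ !(admJip adm) (Jskew adm z Th) (Jskew adm z y).
  have -> : hess x y = ip (lx x) y by rewrite /hess /lx !ipE.
  have -> : ip (rx x) y = ip z y - ip (lx x) y by rewrite zE ipDl; ring.
  by rewrite -/(mass Th); ring.
have pr a b : nrm a = nrm y -> nrm b = nrm Th ->
    `|ip z a * ip (B x) b| <= (Cl + Cr) * nrm y * nrm Th * nrm x ^+ 2 /\
    `|ip z b * ip (B x) a| <= (Cl + Cr) * nrm y * nrm Th * nrm x ^+ 2.
  move=> ay bT; have hz v : `|ip z v| <= (Cl + Cr) * nrm x * nrm v.
    by apply: (le_trans (CS _ _)); rewrite ler_wpM2r ?nrm_ge0.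
  have hB v : `|ip (B x) v| <= nrm x * nrm v.
    by apply: (le_trans (CS _ _)); rewrite ler_wpM2r ?nrm_ge0 ?(nrm_admB adm).
  split; rewrite normrM; apply: (le_trans (ler_pM (normr_ge0 _) (normr_ge0 _) (hz _) (hB _)));
    by rewrite ay bT le_eqVlt; apply/orP; left; apply/eqP; ring.
have [p1 _] := pr y Th erefl erefl; have [_ p2] := pr (J y) (J Th) (nrmJ adm _) (nrmJ adm _).
have [p3 _] := pr (J y) (J Th) (nrmJ adm _) (nrmJ adm _); have [_ p4] := pr y Th erefl erefl.
have p5 : `|mass Th * ip (rx x) y| <= mass Th * (Cr * nrm y) * nrm x ^+ 2.
  rewrite normrM (ger0_norm M0) -mulrA ler_wpM2l//; apply: (le_trans (CS _ _)).
  by rewrite mulrAC ler_wpM2r.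
rewrite E1 (mulrC (ip (B x) (J y))) (mulrC (ip (B x) y)).
move: p1 p2 p3 p4 p5; rewrite !ler_norml; lra.
Qed.

Lemma contB (f g : R -> V) t : cont_at f t -> cont_at g t -> cont_at (fun s => f s - g s) t.
Proof.
move=> hf hg e e0; have e2 : 0 < e / 2 by rewrite divr_gt0.
near=> s.
have h1 : nrm (f s - f t) <= e / 2 by near: s; exact: hf.
have h2 : nrm (g s - g t) <= e / 2 by near: s; exact: hg.
have -> : f s - g s - (f t - g t) = (f s - f t) - (g s - g t) by vring.
apply: (le_trans (nrmB _ _)); lra.
Unshelve. all: by end_near. Qed.

Lemma cont_nl (f : R -> V) t : cont_at f t -> cont_at (fun s => nl (f s)) t.
Proof.
move=> hf e e0; pose r := nrm (f t) + 1; have r0 : 0 < r by rewrite ltr_wpDl// nrm_ge0.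
have e1 : 0 < e / L r by rewrite divr_gt0.
near=> s.
have h1 : nrm (f s - f t) <= 1 by near: s; exact: hf.
have h2 : nrm (f s - f t) <= e / L r by near: s; exact: hf.
have h3 : nrm (f s) <= r by have := nrmD (f s - f t) (f t); rewrite subrK /r; lra.
have h4 : nrm (f t) <= r by rewrite lerDl.
have := nl_retract_lip (f s) (f t) r0; rewrite !retract_id// => /le_trans; apply.
by rewrite mulrC -ler_pdivlMr.
Unshelve. all: by end_near. Qed.

Lemma D_cont (f : R -> V) : cont f -> continuous (fun t => D (f t)).
Proof.
move=> cf_.
have cB : cont (fun t => B (f t)).
  by move=> t; apply: (@cont_op _ _ _ B 1) (cf_ t); [exact: linearP|move=> x; rewrite mul1r (nrm_admB adm)].
have ck : cont (fun t => k (f t)).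
  move=> t; apply: (@cont_op _ _ _ J 1) => [|x|]; [exact: linearP|by rewrite mul1r (nrmJ adm)|].
  apply: contB.
    apply: (@cont_op _ _ _ (fun x => x + (om - lam) *: B x) (1 + `|om - lam|)) (cf_ t).
      by move=> a u v; rewrite linearP; vring.
    move=> x; apply: (le_trans (nrmD _ _)); rewrite nrmZ mulrDl mul1r lerD2l.
    by rewrite ler_wpM2l// (nrm_admB adm).
  apply: (@cont_op _ _ _ B 1); [exact: linearP|by move=> x; rewrite mul1r (nrm_admB adm)|].
  exact: cont_nl.
have k1 x := @cont_ip _ _ _ x ck; have k2 x := @cont_ip _ _ _ x cB.
move=> t; rewrite /D /F; apply: cvgN; apply: cvgB; first apply: cvgB; first apply: cvgD.
- by apply: cvgM; [exact: k1|exact: k2].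
- by apply: cvgM; [exact: k2|exact: k1].
- by apply: cvgM; [exact: k1|exact: k2].
- by apply: cvgM; [exact: k2|exact: k1].
Qed.

Hypothesis Th_mass : 0 < mass Th.

(** The datum [Th + de *: y] has an action deficit of order [de ^ 2]. Near the orbit coercivity
    turns the deficit into a lower bound for [|hess x y|], hence for [|D|]. By continuity [D] keeps
    its sign, so [A] grows linearly, although it is bounded near the orbit. *)
Theorem orbital_instability (c K : R) : 0 < c -> 0 <= K ->
  (forall x, Y x -> c * nrm x ^+ 2 <= hess x x + K * ip (B Th) x ^+ 2
     + K * ip (J Th) x ^+ 2 + K * hess x y ^+ 2) ->
  ~ (forall eps, 0 < eps -> exists2 eta, 0 < eta &
      forall u0, Y u0 -> nrm (u0 - Th) < eta -> exists w : R -> V,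
       [/\ w 0 = u0, nls_sol w & forall t, exists th, nrm (T t (w t) - rot th Th) <= eps]).
Proof.
move=> c0 K0 coer stab.
have [C3 C30 hC3] := action_rest; have [C5 C50 hC5] := D_expand.
have T0 := nrm_ge0 Th; have y0 := nrm_ge0 y; have my0 := mass_ge0 adm y.
pose M := mass Th; have M_gt0 : 0 < M := Th_mass.
pose G := 2 * C3 + K / 2; have G0 : 0 <= G by rewrite /G; lra.
pose H := 2 * K / c; have H0 : 0 <= H by rewrite divr_ge0 ?mulr_ge0// ltW.
pose rho := Num.min 1 (Num.min (c / 2 / (G + 1)) (M / 2 / ((C5 + 1) * (H + 1)))).
have G1 : 0 < G + 1 by lra.
have CH : 0 < (C5 + 1) * (H + 1) by rewrite mulr_gt0//; lra.
have rho0 : 0 < rho by rewrite !lt_min ltr01 !divr_gt0.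
have rho1 : rho <= 1 by rewrite ge_min lexx.
have rhoG : G * rho <= c / 2.
  have : rho * (G + 1) <= c / 2 by rewrite -ler_pdivlMr ?ge_min ?lexx ?orbT.
  by lra.
have rhoM : (C5 + 1) * (H + 1) * rho <= M / 2.
  by rewrite mulrC -ler_pdivlMr ?ge_min ?lexx ?orbT.
(* The quadratic part of the action loses [2 * kap * de ^+ 2]; one half pays for the cubic
   remainder. *)
pose kap := - hess y y / 4; have kap0 : 0 < kap by rewrite divr_gt0// oppr_gt0.
have [eta eta0 he] := stab rho rho0.
(* Sum of all quantities that [de] has to beat, so that the three bounds on [de * Z] give every
   smallness condition used below. *)
pose Z := 1 + nrm y + C3 * nrm y ^+ 3 + K / 2 * mass y ^+ 2.
have y3 : 0 <= C3 * nrm y ^+ 3 by rewrite mulr_ge0// exprn_ge0.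
have my2 : 0 <= K / 2 * mass y ^+ 2 by rewrite mulr_ge0 ?sqr_ge0// divr_ge0.
have Z0 : 0 < Z by rewrite /Z; lra.
pose de := Num.min 1 (Num.min (eta / 2) kap) / Z.
have min0 : 0 < Num.min 1 (Num.min (eta / 2) kap) by rewrite !lt_min ltr01 kap0 divr_gt0.
have de0 : 0 < de by rewrite divr_gt0.
have deZ : de * Z = Num.min 1 (Num.min (eta / 2) kap) by rewrite divfK// gt_eqF.
have dZ1 : de * Z <= 1 by rewrite deZ ge_min lexx.
have dZe : de * Z <= eta / 2 by rewrite deZ !ge_min lexx orbT.
have dZk : de * Z <= kap by rewrite deZ !ge_min lexx !orbT.
have dle (a : R) : a <= Z -> de * a <= de * Z by move=> h; rewrite ler_wpM2l// ltW.
have d1 : de <= 1 by have := dle 1; rewrite mulr1 /Z => h; apply: le_trans (h _) dZ1; lra.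
have ny : nrm (de *: y) = de * nrm y by rewrite nrmZ gtr0_norm.
have dy : de * nrm y <= de * Z by apply: dle; rewrite /Z; lra.
pose u0 := Th + de *: y.
have Yu0 : Y u0 by move=> i; rewrite linearD PTh linearZ_LR/= Yy.
have u0T : u0 - Th = de *: y by rewrite /u0 addrC addKr.
have [|w [w0 hw orb]] := he u0 Yu0; first by rewrite u0T ny; lra.
pose u t := T t (w t).
have dr t : nrm (dev (u t)) <= rho.
  by have [th h] := orb t; apply: le_trans (dev_le _ th) h.
have cu : cont u by move=> t; apply: (cont_T gT); exact: der_cont (hw t).
pose r := nrm Th + 1; have r0 : 0 < r by rewrite ltr_wpDl.
have ur t : nrm (u t) <= r.
  by apply: (le_trans (dev_bound _)); rewrite lerD2l; exact: le_trans (dr t) rho1.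
have Yu t : Y (u t).
  move=> i; rewrite -(sym_T t _ (sP i)) (trunc_sym r0 (sP i) (sol_trunc ur hw))//.
  by rewrite w0 Yu0.
have U0 : u 0 = u0 by rewrite /u (ug0 gT) w0.
have hm t : mass (u t) = M + de ^+ 2 * mass y.
  have -> : mass (u t) = mass (u 0).
    by apply: (@derR_cst_on _ (fun q => mass (u q))) => q _; exact: (der_mass adm gT cf (hw q)).
  by rewrite U0 (massD adm) ipZr yTh -/M /mass linearZ_LR ipZl ipZr; ring.
have ha t : action om (u t) - action om Th <= - (kap * de ^+ 2).
  have -> : action om (u t) = action om (u 0).
    by apply: (@derR_cst_on _ (fun q => action om (u q))) => q _; exact: (der_action adm gT cf (hw q)).
  have := hC3 (de *: y); rewrite ny => /(_ (le_trans dy dZ1)); rewrite -/u0 -U0.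
  rewrite hessZ hessC hessZ ler_norml => /andP[_].
  have : de ^+ 2 * (de * (C3 * nrm y ^+ 3)) <= de ^+ 2 * kap.
    rewrite ler_wpM2l ?sqr_ge0//; apply: le_trans dZk; apply: dle; rewrite /Z; lra.
  have -> : C3 * (de * nrm y) ^+ 3 = de ^+ 2 * (de * (C3 * nrm y ^+ 3)) by ring.
  have -> : de * (de * hess y y) = - (4 * kap * de ^+ 2) by rewrite /kap; field.
  lra.
clear rho0 eta0 min0 dZ1 dZe deZ ny dy Z0 G1 CH w0 U0 T0 stab he.
have key t : c / 2 * nrm (dev (u t)) ^+ 2 + kap * de ^+ 2 <= K * hess (dev (u t)) y ^+ 2.
  set x := dev (u t); have x0 := nrm_ge0 x; have xr := dr t; rewrite -/x in xr.
  have x1 := le_trans xr rho1.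
  have Yx : Y x by move=> i; apply: (dev_Y (sP i) (PTh i)); exact: Yu.
  have := coer x Yx; rewrite dev_J expr0n mulr0 addr0.
  have := hC3 x x1; rewrite dev_action ler_norml => /andP[hh _]; have hat := ha t.
  have m2 := mass_le adm x; have m1 := mass_ge0 adm x.
  have e2 : ip (B Th) x ^+ 2 <= (de ^+ 4 * mass y ^+ 2 + nrm x ^+ 4) / 2.
    have E2 : 2 * ip (B Th) x = de ^+ 2 * mass y - mass x.
      by have := dev_mass (u t); rewrite -/x (massD adm) hm -/M; move=> hdm; lra.
    have mx2 : mass x ^+ 2 <= nrm x ^+ 4.
      by rewrite (exprM _ 2 2) ler_sqr ?nnegrE// sqr_ge0.
    have : (2 * ip (B Th) x) ^+ 2 <= 2 * ((de ^+ 2 * mass y) ^+ 2 + mass x ^+ 2).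
      by rewrite E2; move: (de ^+ 2 * mass y) (mass x) => a1 a2; have := sqr_ge0 (a1 + a2); rewrite sqrrB sqrrD; lra.
    have -> : (de ^+ 2 * mass y) ^+ 2 = de ^+ 4 * mass y ^+ 2 by ring.
    by rewrite exprMn; lra.
  have x3 : nrm x ^+ 3 <= rho * nrm x ^+ 2 by rewrite exprS ler_wpM2r ?sqr_ge0.
  have x4 : nrm x ^+ 4 <= rho * nrm x ^+ 2.
    rewrite (exprD _ 2 2) ler_wpM2r ?sqr_ge0// expr2; apply: le_trans xr.
    by rewrite ler_piMr.
  have k1 := ler_wpM2l C30 x3; have k2 := ler_wpM2l K0 x4; have k3 := ler_wpM2l K0 e2.
  have k4 := ler_wpM2r (sqr_ge0 (nrm x)) rhoG.
  have k5 : K / 2 * (de ^+ 4 * mass y ^+ 2) <= kap * de ^+ 2.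
    have -> : K / 2 * (de ^+ 4 * mass y ^+ 2) = de * (K / 2 * mass y ^+ 2) * de * de ^+ 2 by ring.
    rewrite ler_wpM2r ?sqr_ge0//; apply: (@le_trans _ _ (de * (K / 2 * mass y ^+ 2))).
      by rewrite ler_piMr// mulr_ge0// ltW.
    by apply: le_trans dZk; apply: dle; rewrite /Z; lra.
  rewrite /G in k4; lra.
clear d1 y0 my0 G0 rhoG y3 my2 dZk dle hC3 coer C30 hm ha.
(* By [key], [|hess x y|] is at least [de * Num.sqrt (kap / (K + 1))]; the remainder in [D_expand]
   takes at most half of [M * |hess x y|]. *)
pose be := M / 2 * (de * Num.sqrt (kap / (K + 1))).
have K1 : 0 < K + 1 by lra.
have s0 : 0 < Num.sqrt (kap / (K + 1)) by rewrite sqrtr_gt0 divr_gt0.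
have be0 : 0 < be by apply: mulr_gt0; [rewrite divr_gt0|apply: mulr_gt0].
have Dbig t : be <= `|D (u t)|.
  set b := hess (dev (u t)) y.
  have kt := key t; rewrite -/b in kt; have n2 := sqr_ge0 (nrm (dev (u t))).
  have b1 : nrm (dev (u t)) ^+ 2 <= H * b ^+ 2.
    rewrite /H mulrAC ler_pdivlMr//; have : 0 <= kap * de ^+ 2 by rewrite mulr_ge0 ?sqr_ge0// ltW.
    by lra.
  have b2 : kap / (K + 1) * de ^+ 2 <= b ^+ 2.
    rewrite mulrAC ler_pdivrMr//; have : 0 <= c / 2 * nrm (dev (u t)) ^+ 2 by rewrite mulr_ge0// divr_ge0// ltW.
    by have := sqr_ge0 b; lra.
  have b3 : de * Num.sqrt (kap / (K + 1)) <= `|b|.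
    have bs : 0 <= de * Num.sqrt (kap / (K + 1)) by rewrite mulr_ge0// ltW.
    rewrite -ler_sqr ?nnegrE// exprMn sqr_sqrtr; last by rewrite divr_ge0// ltW.
    by rewrite real_normK ?num_real// mulrC.
  have b4 : C5 * nrm (dev (u t)) ^+ 2 <= M / 2 * `|b|.
    have nr := dr t; have n0 := nrm_ge0 (dev (u t)).
    have : nrm (dev (u t)) <= (H + 1) * `|b|.
      have hb : 0 <= (H + 1) * `|b| by rewrite mulr_ge0//; lra.
      rewrite -ler_sqr ?nnegrE//.
      rewrite exprMn real_normK ?num_real//; apply: (le_trans b1).
      by rewrite ler_wpM2r ?sqr_ge0// sqrrD; have := sqr_ge0 H; lra.
    move=> nb; have nn : nrm (dev (u t)) ^+ 2 <= rho * ((H + 1) * `|b|) by rewrite expr2 ler_pM.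
    have e1 := ler_wpM2r (normr_ge0 b) rhoM.
    apply: le_trans e1; apply: (@le_trans _ _ ((C5 + 1) * (rho * ((H + 1) * `|b|)))).
      by apply: ler_pM => //; rewrite lerDl.
    by rewrite le_eqVlt; apply/orP; left; apply/eqP; ring.
  have := hC5 (dev (u t)) (le_trans (dr t) rho1).
  have -> : D (Th + dev (u t)) = D (u t) by rewrite /dev addrC subrK D_rot.
  rewrite -/M -/b => h.
  have : M * `|b| <= `|D (u t)| + C5 * nrm (dev (u t)) ^+ 2.
    rewrite -(gtr0_norm M_gt0) -normrM.
    have := ler_normB (D (u t) + M * b) (D (u t)); rewrite addrC addKr; lra.
  have : be <= M / 2 * `|b| by rewrite /be ler_wpM2l// ltW// divr_gt0.
  lra.
clear key K0 K1 c0 de0 kap0 s0 C50 H0 rhoM rho1 M_gt0.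
have cD : continuous (fun t => D (u t)) := D_cont cu.
have bA t : `|A (u t)| <= 2 * (r ^+ 2 * (nrm y * nrm Th)).
  have hB v : `|ip (B (u t)) v| <= r * nrm v.
    apply: (le_trans (CS _ _)); rewrite ler_wpM2r ?nrm_ge0//.
    exact: le_trans (nrm_admB adm _) (ur t).
  have p (a b : V) : nrm a = nrm y -> nrm b = nrm Th ->
      `|ip (B (u t)) a * ip (B (u t)) b| <= r ^+ 2 * (nrm y * nrm Th).
    move=> <- <-; rewrite normrM; apply: (le_trans (ler_pM (normr_ge0 _) (normr_ge0 _) (hB _) (hB _))).
    by rewrite le_eqVlt; apply/orP; left; apply/eqP; ring.
  have := p (J y) Th (nrmJ adm _) erefl; have := p y (J Th) erefl (nrmJ adm _).
  by rewrite /A !ler_norml; lra.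
(* A change of sign would produce a zero of [D], against [Dbig]. *)
have sgn : (forall t, 0 <= t -> be <= D (u t)) \/ (forall t, 0 <= t -> D (u t) <= - be).
  have nz t : D (u t) <> 0 by move=> h; have := Dbig t; rewrite h normr0; lra.
  have ivt t : 0 <= t -> Num.min (D (u 0)) (D (u t)) <= 0 <= Num.max (D (u 0)) (D (u t)) -> False.
    by move=> t0 /(IVT t0 (continuous_subspaceT cD))[q _ /nz].
  have cas t : be <= D (u t) \/ D (u t) <= - be.
    by have := Dbig t; rewrite ler_normr => /orP[]; [left|right; lra].
  have [p0|p0] := cas 0; [left|right] => t t0.
    have [//|q] := cas t; exfalso; apply: (ivt t t0).
    by apply/andP; split; rewrite ?ge_min ?le_max; apply/orP; [right|left]; lra.
  have [q|//] := cas t; exfalso; apply: (ivt t t0).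
  by apply/andP; split; rewrite ?ge_min ?le_max; apply/orP; [left|right]; lra.
have dA t : derR (fun s => A (u s)) t (D (u t)) := der_A (hw t).
pose W := 2 * (r ^+ 2 * (nrm y * nrm Th)); have W0 : 0 <= W by apply: le_trans (bA 0).
(* A time at which linear growth of rate [be] exceeds [2 * W], the largest possible oscillation of
   [A]. *)
pose t1 := (2 * W + 1) / be; have t10 : 0 <= t1 by rewrite divr_ge0 ?(ltW be0)//; lra.
have bt : be * t1 = 2 * W + 1 by rewrite mulrC divfK// gt_eqF.
have did (a : R) q : derR (fun s => a * s) q a.
  by have := @derZ _ (RH R) _ _ _ a (@der_id R q); rewrite /GRing.scale /= mulr1.
have := bA 0; have := bA t1; rewrite -/W !ler_norml => h1 h2.
have [sp|sp] := sgn.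
  have : be * t1 - A (u t1) <= be * 0 - A (u 0).
    apply: (@derR_le _ (fun s => be * s - A (u s)) (fun s => be - D (u s)) 0 t1 t10) => q /andP[q0 _].
      exact: (@derB _ (RH R) _ _ _ _ _ (did be q) (dA q)).
    by rewrite subr_le0 sp.
  by rewrite mulr0; lra.
have : A (u t1) + be * t1 <= A (u 0) + be * 0.
  apply: (@derR_le _ (fun s => A (u s) + be * s) (fun s => D (u s) + be) 0 t1 t10) => q /andP[q0 _].
    exact: (@derD _ (RH R) _ _ _ _ _ (dA q) (did be q)).
  by have := sp q q0; lra.
by rewrite mulr0; lra.
Qed.

End Instability.
End Orbit.
End Flow.

(* Separated quotient of a complete semi-inner product space: the class of [x]
   is represented by the functional [s x _], so that no quotient type is needed. *)
Section Separation.
Context {R : realType} (X : lmodType R) (D : X -> Prop) (s : X -> X -> R).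

Record semi_hilbert : Prop := {
  shD : forall a x y, D x -> D y -> D (a *: x + y) ;
  sh0 : D 0 ;
  shC : forall x y, D x -> D y -> s x y = s y x ;
  shl : forall a x y z, D x -> D y -> D z -> s (a *: x + y) z = a * s x z + s y z ;
  sh_ge0 : forall x, D x -> 0 <= s x x ;
  sh_complete : forall u : nat -> X, (forall n, D (u n)) ->
    (forall e, 0 < e -> exists n, forall p q, (n <= p)%N -> (n <= q)%N ->
       s (u p - u q) (u p - u q) <= e) ->
    exists2 l, D l & forall e, 0 < e -> exists n, forall p, (n <= p)%N ->
       s (u p - l) (u p - l) <= e }.

(** The value 0 outside [D] is a convention that makes two vectors with the same pairings against
    [D] have equal images. *)
Definition sep_emb (x : X) : X -> R := fun y => if `[< D y >] then s x y else 0.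
Definition sep_pred : {pred (X -> R)} := fun f => `[< exists2 x, D x & f = sep_emb x >].

Hypothesis sh : semi_hilbert.

Lemma sep_emb_lin a x y : D x -> D y ->
  sep_emb (a *: x + y) = a *: sep_emb x + sep_emb y.
Proof.
move=> Dx Dy; apply/funext => z; rewrite /sep_emb !fctE; case: asboolP => Dz.
  by rewrite (shl sh).
by rewrite scaler0 addr0.
Qed.

Lemma sep_emb0 : sep_emb 0 = 0.
Proof.
by have := sep_emb_lin (-1) (sh0 sh) (sh0 sh); rewrite scaler0 addr0 scaleN1r addNr.
Qed.

Lemma sep_closed : submod_closed sep_pred.
Proof.
split; first by apply/asboolP; exists 0; [exact: (sh0 sh)|rewrite sep_emb0].
move=> a f g /asboolP[x Dx ->] /asboolP[y Dy ->]; apply/asboolP.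
by exists (a *: x + y); [exact: (shD sh)|rewrite sep_emb_lin].
Qed.

End Separation.

Record sep (R : realType) (X : lmodType R) (D : X -> Prop) (s : X -> X -> R)
    (sh : semi_hilbert D s) :=
  Sep { sep_val :> X -> R ; sep_valP : sep_val \in sep_pred D s }.
Arguments sep_val {R X D s sh}.

Section SepType.
Context {R : realType} (X : lmodType R) (D : X -> Prop) (s : X -> X -> R)
  (sh : semi_hilbert D s).
HB.instance Definition _ := [isSub for @sep_val R X D s sh].
HB.instance Definition _ := [Choice of sep sh by <:].
HB.instance Definition _ :=
  GRing.SubChoice_isSubLmodule.Build R (X -> R) (sep_pred D s) (sep sh) (sep_closed sh).

Definition sep_rep (q : sep sh) : X := xget 0 [set x | D x /\ sep_val q = sep_emb D s x].
Lemma sep_repP q : D (sep_rep q) /\ sep_val q = sep_emb D s (sep_rep q).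
Proof.
rewrite /sep_rep; case: xgetP => [x _ //|h].
by have /asboolP[x Dx E] := sep_valP q; case: (h x).
Qed.
Lemma sep_repD q : D (sep_rep q). Proof. by case: (sep_repP q). Qed.
Local Hint Resolve sep_repD : core.

Lemma sep_cls_subproof x : D x -> sep_emb D s x \in sep_pred D s.
Proof. by move=> Dx; apply/asboolP; exists x. Qed.
Definition sep_cls (x : X) : sep sh :=
  if pselect (D x) is left Dx then Sep sh (sep_cls_subproof Dx) else 0.

Lemma sep_clsE x : D x -> sep_val (sep_cls x) = sep_emb D s x.
Proof. by rewrite /sep_cls; case: pselect. Qed.

Lemma sep_inj (p q : sep sh) : sep_val p = sep_val q -> p = q.
Proof. exact: val_inj. Qed.

Lemma sep_repK q : sep_cls (sep_rep q) = q.
Proof. by apply: sep_inj; rewrite sep_clsE//; case: (sep_repP q). Qed.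

Definition sep_ip (p q : sep sh) : R := s (sep_rep p) (sep_rep q).

Lemma sep_emb_eq x x' y : D x -> D x' -> D y -> sep_emb D s x = sep_emb D s x' -> s x y = s x' y.
Proof. by move=> _ _ Dy /(congr1 (fun f => f y)); rewrite /sep_emb; case: asboolP. Qed.

Lemma sep_ip_val p y : D y -> s (sep_rep p) y = sep_val p y.
Proof. by move=> Dy; have [_ ->] := sep_repP p; rewrite /sep_emb; case: asboolP. Qed.

Lemma sep_ip_cls x y : D x -> D y -> sep_ip (sep_cls x) (sep_cls y) = s x y.
Proof.
move=> Dx Dy; rewrite /sep_ip sep_ip_val// sep_clsE// /sep_emb.
case: asboolP => [Dr|/(_ (sep_repD _))//].
rewrite (shC sh)// sep_ip_val// sep_clsE// /sep_emb; case: asboolP => // _.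
exact: (shC sh).
Qed.

Lemma sep_val_lin a (p q : sep sh) z : sep_val (a *: p + q) z = a * sep_val p z + sep_val q z.
Proof. by []. Qed.

Lemma sep_cls_lin a x y : D x -> D y -> sep_cls (a *: x + y) = a *: sep_cls x + sep_cls y.
Proof.
move=> Dx Dy; apply: sep_inj; apply/funext => z; rewrite sep_val_lin !sep_clsE//; last exact: (shD sh).
by rewrite sep_emb_lin.
Qed.

Lemma sep_cls0 : sep_cls 0 = 0.
Proof.
have := sep_cls_lin (-1) (sh0 sh) (sh0 sh).
by rewrite scaler0 addr0 scaleN1r addNr.
Qed.

Lemma sep_eqP x y : D x -> D y -> (sep_cls x = sep_cls y <-> forall z, D z -> s x z = s y z).
Proof.
move=> Dx Dy; split=> [/(congr1 sep_val)|h].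
  by rewrite !sep_clsE// => E z Dz; apply: sep_emb_eq.
apply: sep_inj; rewrite !sep_clsE//; apply/funext => z; rewrite /sep_emb.
by case: asboolP => // /h.
Qed.

Lemma semi_CS0 x y : D x -> D y -> s x x = 0 -> s x y = 0.
Proof.
move=> Dx Dy xx; have q (r : R) : 0 <= 2 * r * s x y + s y y.
  have Dr := shD sh r Dx Dy; have := sh_ge0 sh Dr.
  rewrite (shl sh)// (shC sh Dx Dr) (shC sh Dy Dr) !(shl sh)// xx (shC sh Dy Dx); lra.
have [//|n0] := eqVneq (s x y) 0; have yy := sh_ge0 sh Dy.
have := q (- (s y y + 1) / (2 * s x y)).
have -> : 2 * (- (s y y + 1) / (2 * s x y)) * s x y = - (s y y + 1) by field.
lra.
Qed.

Lemma sep_ipC p q : sep_ip p q = sep_ip q p.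
Proof. by apply: (shC sh); exact: sep_repD. Qed.
Lemma sep_ip_l a p q z : sep_ip (a *: p + q) z = a * sep_ip p z + sep_ip q z.
Proof. by rewrite /sep_ip !sep_ip_val //. Qed.
Lemma sep_ip_ge0 p : 0 <= sep_ip p p. Proof. exact: (sh_ge0 sh). Qed.
Lemma sep_ip_eq0 p : sep_ip p p = 0 -> p = 0.
Proof.
move=> h; rewrite -(sep_repK p) -sep_cls0; apply/sep_eqP; [exact: sep_repD|exact: (sh0 sh)|].
move=> z Dz; rewrite (semi_CS0 (sep_repD p) Dz h) (semi_CS0 (sh0 sh) Dz)//.
have := shl sh (-1) (sh0 sh) (sh0 sh) (sh0 sh); rewrite scaler0 addr0; lra.
Qed.
Lemma sep_ipDl p q z : sep_ip (p + q) z = sep_ip p z + sep_ip q z.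
Proof. by rewrite -{1}(scale1r p) sep_ip_l mul1r. Qed.
Lemma sep_ipZl a p z : sep_ip (a *: p) z = a * sep_ip p z.
Proof.
rewrite -{1}(addr0 (a *: p)) sep_ip_l; have := sep_ipDl 0 0 z; rewrite addr0; lra.
Qed.

Lemma sep_complete (u : nat -> sep sh) :
  (forall e, 0 < e -> exists n, forall p q, (n <= p)%N -> (n <= q)%N ->
       sep_ip (u p - u q) (u p - u q) <= e) ->
    exists l, forall e, 0 < e -> exists n, forall p, (n <= p)%N ->
       sep_ip (u p - l) (u p - l) <= e.
Proof.
have E x y : D x -> D y -> sep_ip (sep_cls x - sep_cls y) (sep_cls x - sep_cls y) = s (x - y) (x - y).
  move=> Dx Dy; have Dxy : D (x - y) by have := shD sh (-1) Dy Dx; rewrite scaleN1r addrC.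
  rewrite -sep_ip_cls//; congr sep_ip;
    by rewrite -[y in RHS]scale1r -scaleNr addrC addrC [in RHS]addrC sep_cls_lin// scaleN1r addrC.
move=> h; have [n||l Dl hl] := sh_complete sh (u := fun n => sep_rep (u n)).
- exact: sep_repD.
- move=> e /h[n hn]; exists n => p q np nq.
  by rewrite -E ?sep_repK ?hn//; exact: sep_repD.
exists (sep_cls l) => e /hl[n hn]; exists n => p np.
by rewrite -(sep_repK (u p)) E ?hn//; exact: sep_repD.
Qed.

Definition sepH : hilb R := @Hilb R (sep sh) sep_ip sep_ipC sep_ipDl sep_ipZl
  sep_ip_ge0 sep_ip_eq0 sep_complete.

End SepType.

(** * Square integrable functions on the half-line *)

Section Integrable.
Context {R : realType}.
Notation mu := (@lebesgue_measure R).
Implicit Types (f g h : R -> R) (A : set R).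

Lemma ae_filter : Filter (almost_everywhere mu).
Proof. exact: ae_filter_ringOfSetsType. Qed.
Lemma aeS (P Q : R -> Prop) : (forall x, P x -> Q x) ->
  {ae mu, forall x, P x} -> {ae mu, forall x, Q x}.
Proof. by move=> PQ h; exact: (@filterS _ _ ae_filter P Q PQ h). Qed.
Lemma aeI (P Q : R -> Prop) : {ae mu, forall x, P x} -> {ae mu, forall x, Q x} ->
  {ae mu, forall x, P x /\ Q x}.
Proof. by move=> p q; exact: (@filterI _ _ ae_filter P Q p q). Qed.

Definition itg A f := mu.-integrable A (EFin \o f).

Lemma itg_meas A f : itg A f -> measurable_fun A f.
Proof. by move=> /integrableP[/measurable_EFinP]. Qed.

Lemma itg_le A f g : measurable A -> measurable_fun A f ->
  (forall x, A x -> `|f x| <= g x) -> itg A g -> itg A f.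
Proof.
move=> mA mf fg ig; move: ig; apply: le_integrable => //; first exact/measurable_EFinP.
move=> x Ax /=; rewrite lee_fin; apply: (le_trans (fg x Ax)); exact: ler_norm.
Qed.

Lemma itg_eq A f g : (forall x, A x -> f x = g x) -> measurable A -> itg A f -> itg A g.
Proof.
move=> fg mA; apply: eq_integrable => // x; rewrite inE => Ax /=.
by rewrite fg.
Qed.

Lemma itgD A f g : measurable A -> itg A f -> itg A g -> itg A (fun x => f x + g x).
Proof. by move=> mA; exact: integrableD. Qed.
Lemma itgZ A (a : R) f : measurable A -> itg A f -> itg A (fun x => a * f x).
Proof. by move=> mA; exact: integrableZl. Qed.
Lemma itgN A f : measurable A -> itg A f -> itg A (fun x => - f x).
Proof. by move=> mA; exact: integrableN. Qed.
Lemma itgB A f g : measurable A -> itg A f -> itg A g -> itg A (fun x => f x - g x).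
Proof. by move=> mA hf hg; apply: itgD => //; exact: itgN. Qed.
Lemma itg0 A : measurable A -> itg A (fun=> 0).
Proof. by move=> mA; exact: integrable0. Qed.
Lemma itg_norm A f : measurable A -> itg A f -> itg A (fun x => `|f x|).
Proof. by move=> mA; exact: integrable_norm. Qed.
Lemma itgS A B f : measurable A -> measurable B -> B `<=` A -> itg A f -> itg B f.
Proof. by move=> mA mB BA; apply: integrableS. Qed.

Lemma int_lin A (a : R) f g : measurable A -> itg A f -> itg A g ->
  \int[mu]_(x in A) (a * f x + g x) = a * \int[mu]_(x in A) f x + \int[mu]_(x in A) g x.
Proof.
move=> mA hf hg; rewrite RintegralD ?RintegralZl//; exact: itgZ.
Qed.
Lemma intD A f g : measurable A -> itg A f -> itg A g ->
  \int[mu]_(x in A) (f x + g x) = \int[mu]_(x in A) f x + \int[mu]_(x in A) g x.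
Proof. by move=> mA hf hg; rewrite RintegralD. Qed.
Lemma intZ A (a : R) f : measurable A -> itg A f ->
  \int[mu]_(x in A) (a * f x) = a * \int[mu]_(x in A) f x.
Proof. by move=> mA hf; rewrite RintegralZl. Qed.
Lemma intB A f g : measurable A -> itg A f -> itg A g ->
  \int[mu]_(x in A) (f x - g x) = \int[mu]_(x in A) f x - \int[mu]_(x in A) g x.
Proof. by move=> mA hf hg; rewrite RintegralB. Qed.
Lemma int_eq A f g : (forall x, A x -> f x = g x) ->
  \int[mu]_(x in A) f x = \int[mu]_(x in A) g x.
Proof. by move=> fg; apply: eq_Rintegral => x; rewrite inE => /fg. Qed.
Lemma int_ge0 A f : (forall x, A x -> 0 <= f x) -> 0 <= \int[mu]_(x in A) f x.
Proof. by move=> h; apply: Rintegral_ge0. Qed.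
Lemma int_le A f g : measurable A -> itg A f -> itg A g -> (forall x, A x -> f x <= g x) ->
  \int[mu]_(x in A) f x <= \int[mu]_(x in A) g x.
Proof. by move=> mA hf hg h; apply: le_Rintegral. Qed.
Lemma int_norm A f : measurable A -> itg A f ->
  `|\int[mu]_(x in A) f x| <= \int[mu]_(x in A) `|f x|.
Proof. by move=> mA hf; apply: le_normr_Rintegral. Qed.
Lemma int_subset A B f : measurable A -> measurable B -> B `<=` A -> itg A f ->
  (forall x, A x -> 0 <= f x) -> \int[mu]_(x in B) f x <= \int[mu]_(x in A) f x.
Proof.
move=> mA mB BA hf f0; have E : A = B `|` (A `\` B) by rewrite setDUK.
have dj : [disjoint B & A `\` B] by apply/disj_setPS => x [Bx []].
have -> : \int[mu]_(x in A) f x = \int[mu]_(x in B) f x + \int[mu]_(x in A `\` B) f x.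
  rewrite -Rintegral_setU//; first by rewrite -E.
    exact: measurableD.
  by rewrite -E.
by rewrite lerDl; apply: int_ge0 => x [Ax _]; exact: f0.
Qed.

End Integrable.

Section L2.
Context {R : realType} (L : R).
Notation mu := (@lebesgue_measure R).
Notation D := (`[L, +oo[%classic : set R).
Implicit Types f g h : R -> R.

Let mD : measurable D. Proof. exact: measurable_itv. Qed.

Definition sq2 f := measurable_fun D f /\ itg D (fun x => f x ^+ 2).
Definition sip f g := \int[mu]_(x in D) (f x * g x).

Lemma sq2_mul f g : sq2 f -> sq2 g -> itg D (fun x => f x * g x).
Proof.
move=> [mf if_] [mg ig]; apply: (itg_le mD _ _ (itgD mD if_ ig)).
  exact: measurable_funM.
move=> x _; rewrite ler_norml; have := sqr_ge0 (f x + g x); have := sqr_ge0 (f x - g x).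
have := sqr_ge0 (f x); have := sqr_ge0 (g x).
by rewrite sqrrB sqrrD; move=> *; apply/andP; split; lra.
Qed.

Lemma sq2_lin a f g : sq2 f -> sq2 g -> sq2 (fun x => a * f x + g x).
Proof.
move=> hf hg; have [[mf if_] [mg ig]] := (hf, hg); split.
  by apply: measurable_funD => //; apply: measurable_funM.
apply: (@itg_eq _ _ (fun x => a ^+ 2 * f x ^+ 2 + (2 * a * (f x * g x) + g x ^+ 2))).
- by move=> x _; ring.
- exact: mD.
- by apply: itgD => //; [exact: itgZ|apply: itgD => //; apply: itgZ => //; exact: sq2_mul].
Qed.

Lemma sq2_0 : sq2 (fun=> 0).
Proof.
split; first exact: measurable_cst.
by apply: itg_eq (itg0 mD) => // x _; rewrite expr0n.
Qed.

Lemma sq2Z a f : sq2 f -> sq2 (fun x => a * f x).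
Proof.
move=> hf; have := sq2_lin a hf sq2_0; congr sq2; apply/funext => x; exact: addr0.
Qed.
Lemma sq2D f g : sq2 f -> sq2 g -> sq2 (fun x => f x + g x).
Proof.
by move=> hf hg; have := sq2_lin 1 hf hg; congr sq2; apply/funext => x; rewrite mul1r.
Qed.
Lemma sq2B f g : sq2 f -> sq2 g -> sq2 (fun x => f x - g x).
Proof.
move=> hf hg; have := sq2_lin (-1) hg hf; congr sq2; apply/funext => x; rewrite mulN1r addrC//.
Qed.

Lemma sipC f g : sip f g = sip g f.
Proof. by apply: int_eq => x _; exact: mulrC. Qed.
Lemma sip_lin a f g h : sq2 f -> sq2 g -> sq2 h ->
  sip (fun x => a * f x + g x) h = a * sip f h + sip g h.
Proof.
move=> hf hg hh; rewrite -int_lin//; [|exact: sq2_mul|exact: sq2_mul].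
by apply: int_eq => x _; ring.
Qed.
Lemma sip_ge0 f : 0 <= sip f f.
Proof. by apply: int_ge0 => x _; exact: sqr_ge0. Qed.

Lemma sipE f : sq2 f -> (\int[mu]_(x in D) (f x ^+ 2)%:E = (sip f f)%:E)%E.
Proof.
move=> [mf if_]; rewrite /sip /Rintegral.
have -> : (fun x => (f x * f x)%:E) = (fun x => (f x ^+ 2)%:E) by [].
by rewrite fineK//; exact: integrable_fin_num if_.
Qed.

Lemma sip_ae0 f : sq2 f -> sip f f = 0 -> {ae mu, forall x, L <= x -> f x = 0}.
Proof.
move=> hf h; have [mf if_] := hf.
have : ae_eq mu D (fun x => (f x ^+ 2)%:E) (cst 0%E).
  apply/ae_eq_integral_abs => //.
    exact/measurable_EFinP/measurable_funX.
  rewrite -[RHS]/(0%:E) -h -sipE//; apply: eq_integral => x _.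
  by rewrite gee0_abs// lee_fin sqr_ge0.
apply: aeS => x /= H Lx; have : D x by rewrite /= in_itv /= Lx.
by move=> /H/eqP; rewrite eqe sqrf_eq0 => /eqP.
Qed.

Lemma ae_sq2 f g : measurable_fun D f -> sq2 g -> {ae mu, forall x, L <= x -> f x = g x} -> sq2 f.
Proof.
move=> mf [mg ig] fg; split=> //; apply/integrableP; split.
  exact/measurable_EFinP/measurable_funX.
have /integrableP[mg2 ] := ig.
have -> : (\int[mu]_(x in D) `|(g x ^+ 2)%:E| =
   \int[mu]_(x in D) `|(f x ^+ 2)%:E|)%E.
  apply: ae_eq_integral => //.
  - exact: measurableT_comp.
  - by apply: measurableT_comp => //; exact/measurable_EFinP/measurable_funX.
  - by apply: aeS fg => x fgx; rewrite /= in_itv /= andbT => Lx; rewrite fgx.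
by [].
Qed.

Lemma ae_int f g : itg D f -> itg D g -> {ae mu, forall x, L <= x -> f x = g x} ->
  \int[mu]_(x in D) f x = \int[mu]_(x in D) g x.
Proof.
move=> hf hg fg; rewrite /Rintegral; congr fine; apply: ae_eq_integral => //.
- by apply/measurable_EFinP; exact: itg_meas hf.
- by apply/measurable_EFinP; exact: itg_meas hg.
- by apply: aeS fg => x fgx; rewrite /= in_itv /= andbT => /fgx ->.
Qed.

(* Along a subsequence with squared increments at most 4^-k, the function
   [sum_k 2^k (f_(k+1) - f_k)^2] is integrable, hence finite a.e., which forces
   pointwise convergence; Fatou's lemma then gives convergence in norm. *)
Lemma riesz_fischer (u : nat -> R -> R) : (forall n, sq2 (u n)) ->
  (forall e, 0 < e -> exists n, forall p q, (n <= p)%N -> (n <= q)%N ->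
     sip (fun x => u p x - u q x) (fun x => u p x - u q x) <= e) ->
  exists2 g, sq2 g & forall e, 0 < e -> exists n, forall p, (n <= p)%N ->
     sip (fun x => u p x - g x) (fun x => u p x - g x) <= e.
Proof.
move=> hu cau.
have pw (k : nat) : exists n, forall p q, (n <= p)%N -> (n <= q)%N ->
    sip (fun x => u p x - u q x) (fun x => u p x - u q x) <= 16^-1 ^+ k.
  by apply: cau; rewrite exprn_gt0.
have /choice[N hN] := pw.
pose n k := (k + \max_(i < k.+1) N i)%N.
have nN k : (N k <= n k)%N.
  by apply: leq_trans (leq_addl _ _); exact: (leq_bigmax (Ordinal (ltnSn k))).
have nS k : (n k <= n k.+1)%N.
  by apply: leq_add => //; rewrite [X in (_ <= X)%N]big_ord_recr leq_maxl.
pose g k := u (n k); pose d k x := g k.+1 x - g k x.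
have hd k : sq2 (d k) by apply: sq2B; exact: hu.
have dk k : sip (d k) (d k) <= 16^-1 ^+ k.
  by apply: hN; [exact: leq_trans (nN k) (nS k)|exact: nN].
(* The squared norm of [d k] is at most [16^-1 ^+ k], so the integral of [t k] is at most
   [4^-1 ^+ k]; finiteness of the sum at [x] bounds [|d k x|] by a multiple of [2^-1 ^+ k]. *)
pose t k x := (4 ^+ k * d k x ^+ 2)%:E.
have t0 k x : D x -> (0 <= t k x)%E by move=> _; rewrite lee_fin; apply: mulr_ge0 (sqr_ge0 _); exact: exprn_ge0.
have mt k : measurable_fun D (t k).
  by apply/measurable_EFinP/measurable_funM => //; apply: measurable_funX; exact: (hd k).1.
pose S x := (\sum_(0 <= k <oo) t k x)%E.
have iS : (\int[mu]_(x in D) S x <= 2%:E)%E.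
  rewrite integral_nneseries//; apply: lime_le.
    by apply: is_cvg_nneseries => k _ _; apply: integral_ge0 => x; exact: t0.
  apply: nearW => m; apply: (@le_trans _ _ (2 - 2 * 4^-1 ^+ m)%:E); last first.
    by rewrite lee_fin gerBl mulr_ge0 ?exprn_ge0.
  elim: m => [|m ih]; first by rewrite big_nil expr0 mulr1 subrr.
  rewrite big_nat_recr//=; apply: (le_trans (leeD ih _)).
    apply: (_ : (_ <= (4^-1 ^+ m)%:E)%E).
    have -> : (\int[mu]_(x in D) t m x = (4 ^+ m * sip (d m) (d m))%:E)%E.
      rewrite EFinM -(sipE (hd m)) -ge0_integralZl_EFin//;
        first [by move=> x _; rewrite lee_fin sqr_ge0 | by rewrite exprn_ge0
          | by apply/measurable_EFinP/measurable_funX; exact: (hd m).1].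
    rewrite lee_fin; apply: (le_trans (ler_wpM2l (exprn_ge0 _ _) (dk m))) => //.
    by rewrite -exprMn le_eqVlt; apply/orP; left; apply/eqP; congr (_ ^+ _); field.
  rewrite -EFinD lee_fin exprS; have : 0 <= 4^-1 ^+ m :> R by rewrite exprn_ge0.
  lra.
have S0 x : D x -> (0 <= S x)%E by move=> Dx; apply: nneseries_ge0 => k _ _; exact: t0.
have mS : measurable_fun D S.
  have := @ge0_emeasurable_sum _ _ R D t xpredT (fun k x Dx _ => t0 k x Dx) (fun k _ => mt k).
  by [].
have Sfin : {ae mu, forall x, D x -> S x \is a fin_num}.
  apply: integrable_ae => //; apply/integrableP; split=> //.
  apply: le_lt_trans (ltry 2); apply: le_trans iS.
  rewrite le_eqVlt; apply/orP; left; apply/eqP; apply: eq_integral => x; rewrite inE => Dx.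
  by rewrite gee0_abs// S0.
have conv x : D x -> S x \is a fin_num -> exists l : R, g k x @[k --> \oo] --> l.
  move=> Dx fS; have SE : S x = (fine (S x))%:E by rewrite fineK.
  have dle k : `|d k x| <= (1 + fine (S x)) * 2^-1 ^+ k.
    have h : 4 ^+ k * d k x ^+ 2 <= fine (S x).
      rewrite -lee_fin -SE; apply: le_trans (@nneseries_lim_ge _ (fun k => t k x) xpredT 0%N k.+1 _).
        by rewrite big_nat_recr//= leeDr// sume_ge0// => i _; exact: t0.
      by move=> i _ _; exact: t0.
    have s0 : 0 <= fine (S x) by apply: le_trans h; rewrite mulr_ge0 ?sqr_ge0 ?exprn_ge0.
    rewrite exprVn ler_pdivlMr ?exprn_gt0//.
    have h2 : (`|d k x| * 2 ^+ k) ^+ 2 <= fine (S x).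
      rewrite exprMn real_normK ?num_real// -exprM mulnC exprM mulrC.
      by have -> : 2 ^+ 2 = 4 :> R by ring.
    have := sqr_ge0 (`|d k x| * 2 ^+ k - 1); rewrite sqrrB; move: h2.
    set z := _ * _; have z0 : 0 <= z by rewrite mulr_ge0// exprn_ge0.
    move=> h2 h3; rewrite leNgt; apply/negP => h4.
    have : (1 + fine (S x)) * (1 + fine (S x)) <= z * z by apply: ler_pM => //; try apply: ltW => //; lra.
    move: h2; rewrite expr2 => ? ?; have : 0 <= fine (S x) * fine (S x) by exact: mulr_ge0.
    lra.
  have /cvg_ex[l hl] : cvgn (series (fun k => d k x)).
    apply: normed_cvg; apply: (@series_le_cvg _ _ (geometric (1 + fine (S x)) 2^-1)) => //.
    - by move=> k; exact: normr_ge0.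
    - by move=> k; apply: le_trans (dle k); exact: normr_ge0.
    - apply: is_cvg_geometric_series; rewrite ger0_norm ?invr_ge0//; lra.
  exists (g 0%N x + l).
  have E : (fun k => g k x) = (fun k => g 0%N x + series (fun k => d k x) k).
    by apply/funext => k; rewrite /series /= telescope_sumr// addrC subrK.
  by rewrite E; apply: cvgD => //; exact: cvg_cst.
(* A limit superior is measurable without further argument; almost everywhere it is the limit. *)
pose G x := fine (limn_esup (fun k => (g k x)%:E)).
have gG : {ae mu, forall x, D x -> g k x @[k --> \oo] --> G x}.
  apply: aeS Sfin => x Sx Dx; have [l hl] := conv x Dx (Sx Dx).
  have hl' : (g k x)%:E @[k --> \oo] --> l%:E by apply: cvg_EFin => //; apply: nearW.
  by rewrite /G (cvg_limn_einf_sup hl').2.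
have mG : measurable_fun D G.
  apply: measurableT_comp; first exact: fine_measurable.
  by apply: measurable_fun_limn_esup => k; apply/measurable_EFinP; exact: (hu _).1.
have ngek k : (k <= n k)%N by exact: leq_addr.
have mG2 p : measurable_fun D (fun x => ((u p x - G x) ^+ 2)%:E).
  by apply/measurable_EFinP/measurable_funX/measurable_funB => //; exact: (hu p).1.
have fat p (e : R) : (forall q, (p <= q)%N -> sip (fun x => u p x - u q x) (fun x => u p x - u q x) <= e) ->
    (\int[mu]_(x in D) ((u p x - G x) ^+ 2)%:E <= e%:E)%E.
  move=> hp.
  have mf k : measurable_fun D (fun x => ((u p x - g k x) ^+ 2)%:E).
    by apply/measurable_EFinP/measurable_funX/measurable_funB; exact: (hu _).1.
  have pos k x : D x -> (0 <= ((u p x - g k x) ^+ 2)%:E)%E by rewrite lee_fin sqr_ge0.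
  have F := @fatou _ _ R mu D mD (fun k x => ((u p x - g k x) ^+ 2)%:E) mf pos.
  have E : (\int[mu]_(x in D) ((u p x - G x) ^+ 2)%:E =
      \int[mu]_(x in D) limn_einf (fun k => ((u p x - g k x) ^+ 2)%:E))%E.
    apply: ae_eq_integral => //; first exact: mG2.
      apply: measurableT_comp; first exact: oppe_measurable.
      by apply: measurable_fun_limn_esup => k; apply: measurableT_comp (mf k); exact: oppe_measurable.
    apply: aeS gG => x h Dx; apply/esym.
    have h' : ((u p x - g k x) ^+ 2)%:E @[k --> \oo] --> ((u p x - G x) ^+ 2)%:E.
      apply: cvg_EFin; first exact: nearW.
      have hb : u p x - g k x @[k --> \oo] --> u p x - G x by apply: cvgB (h Dx); exact: cvg_cst.
      exact: (cvgM hb hb).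
    exact: (cvg_limn_einf_sup h').1.
  rewrite E; apply: le_trans F _.
  rewrite limn_einf_lim; apply: lime_le; first exact: is_cvg_einfs.
  apply: nearW => k; apply: ereal_inf_le; exists (\int[mu]_(x in D) ((u p x - g (maxn k p) x) ^+ 2)%:E)%E.
    by exists (maxn k p) => //=; rewrite leq_maxl.
  rewrite sipE; last by apply: sq2B; exact: hu.
  by rewrite lee_fin; apply: hp; rewrite /g; apply: leq_trans (ngek _); rewrite leq_maxr.
have G2 p (e : R) : (forall q, (p <= q)%N -> sip (fun x => u p x - u q x) (fun x => u p x - u q x) <= e) ->
    sq2 (fun x => u p x - G x).
  move=> /fat fp; split; first by apply: measurable_funB => //; exact: (hu p).1.
  apply/integrableP; split; first exact: mG2.
  apply: le_lt_trans (ltry e); apply: le_trans fp; rewrite le_eqVlt; apply/orP; left; apply/eqP.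
  by apply: eq_integral => x _; rewrite /= ger0_norm// sqr_ge0.
have sG : sq2 G.
  have [p hp] := cau 1 ltr01; have hp' := G2 p 1 (fun q => hp p q (leqnn p)).
  have := sq2B (hu p) hp'; congr sq2; apply/funext => x; ring.
exists G => // e e0; have [p hp] := cau e e0; exists p => q pq.
have hq r : (q <= r)%N -> sip (fun x => u q x - u r x) (fun x => u q x - u r x) <= e.
  by move=> qr; apply: hp => //; exact: leq_trans qr.
by rewrite -lee_fin -sipE; [exact: fat|exact: G2 hq].
Qed.

End L2.

(** * Absolutely continuous functions *)

Section AbsolutelyContinuous.
Context {R : realType} (L : R).
Notation mu := (@lebesgue_measure R).
Notation D := (`[L, +oo[%classic : set R).
Implicit Types f g h p q : R -> R.
Let mD : measurable D. Proof. exact: measurable_itv. Qed.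

Definition Int (a b : R) g := \int[mu]_(x in `[a, b]) g x.
Definition loc g := forall M, itg `[L, M] g.

Lemma loc_sub g a b : loc g -> L <= a -> itg `[a, b] g.
Proof.
move=> lg La; apply: itgS (lg b) => //.
by apply: subset_itvr; rewrite bnd_simp.
Qed.

Lemma itg_loc g : itg D g -> loc g.
Proof. by move=> hg M; apply: itgS hg => //; exact: subset_itvl. Qed.

Lemma Int_split g a b c : loc g -> L <= a -> a <= b -> b <= c ->
  Int a c g = Int a b g + Int b c g.
Proof.
move=> lg La ab bc; have E := @Rintegral_itvB _ g (BLeft a) (BRight c) b (loc_sub c lg La).
have h : itg `]b, c] g by apply: itgS (loc_sub c lg La) => //; apply: subset_itvr; rewrite bnd_simp.
rewrite /Int; apply/eqP; rewrite addrC -subr_eq E ?bnd_simp//; apply/eqP.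
exact: Rintegral_itv_obnd_cbnd.
Qed.

Lemma Int_tail g b : itg D g -> L <= b ->
  \int[mu]_(x in D) g x = Int L b g + \int[mu]_(x in `[b, +oo[) g x.
Proof.
move=> lg Lb; have E := @Rintegral_itvB _ g (BLeft L) (BInfty _ false) b lg.
have h : itg `]b, +oo[ g by apply: itgS lg => //; apply: subset_itvr; rewrite bnd_simp.
rewrite /Int; apply/eqP; rewrite addrC -subr_eq E ?bnd_simp//; apply/eqP.
exact: Rintegral_itv_obnd_cbnd.
Qed.

Lemma Int0 g a : Int a a g = 0.
Proof. by rewrite /Int set_itv1 Rintegral_set1. Qed.

Lemma Int_ge0 g a b : (forall x, a <= x -> 0 <= g x) -> 0 <= Int a b g.
Proof. by move=> h; apply: int_ge0 => x /=; rewrite in_itv => /andP[/h]. Qed.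

Lemma Int_cst a b c : a <= b -> Int a b (fun=> c) = c * (b - a).
Proof.
move=> ab; rewrite /Int Rintegral_cst//= lebesgue_measure_itv /= lte_fin.
by move: ab; rewrite le_eqVlt => /predU1P[->|->//]; rewrite ltxx subrr.
Qed.

Lemma locD g h : loc g -> loc h -> loc (fun x => g x + h x).
Proof. by move=> lg lh M; apply: itgD. Qed.
Lemma locZ a g : loc g -> loc (fun x => a * g x).
Proof. by move=> lg M; apply: itgZ. Qed.
Lemma loc_norm g : loc g -> loc (fun x => `|g x|).
Proof. by move=> lg M; apply: itg_norm. Qed.
Lemma loc_cst c : loc (fun=> c).
Proof.
move=> M; apply/integrableP; split.
  exact/measurable_EFinP/measurable_cst.
rewrite (_ : (fun=> _) = cst `|c%:E|%E)// integral_cst//= lebesgue_measure_itv /=.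
by case: ifP => _; rewrite ?mule0// -EFinB -EFinM ltry.
Qed.
Lemma loc_le g h : measurable_fun D g -> (forall x, L <= x -> `|g x| <= h x) -> loc h -> loc g.
Proof.
move=> mg gh lh M; apply: itg_le (lh M) => //.
  by apply: measurable_funS mg => //; exact: subset_itvl.
by move=> x /=; rewrite in_itv => /andP[/gh].
Qed.
Lemma loc_meas g : loc g -> measurable_fun D g.
Proof.
move=> lg; have -> : D = \bigcup_n `[L, L + n%:R]%classic.
  rewrite eqEsubset; split=> x /=; rewrite ?in_itv/= ?andbT.
    move=> Lx; exists (Num.truncn (x - L)).+1 => //=; rewrite in_itv /= Lx /=.
    have := truncnS_gt (x - L); lra.
  by move=> [n _] /=; rewrite in_itv => /andP[].
by apply/measurable_fun_bigcup => // n; exact: itg_meas (lg _).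
Qed.
Lemma sq2_loc g : sq2 L g -> loc g.
Proof.
move=> [mg ig]; apply: (loc_le mg _ (locD (loc_cst 1) (itg_loc ig))) => x _.
have := sqr_ge0 (`|g x| - 1); rewrite sqrrB real_normK ?num_real//; have := sqr_ge0 (g x); lra.
Qed.

Lemma IntD g h a b : loc g -> loc h -> L <= a ->
  Int a b (fun x => g x + h x) = Int a b g + Int a b h.
Proof. by move=> lg lh La; rewrite /Int intD//; exact: loc_sub. Qed.
Lemma IntZ c g a b : loc g -> L <= a -> Int a b (fun x => c * g x) = c * Int a b g.
Proof. by move=> lg La; rewrite /Int intZ//; exact: loc_sub. Qed.
Lemma IntB g h a b : loc g -> loc h -> L <= a ->
  Int a b (fun x => g x - h x) = Int a b g - Int a b h.
Proof. by move=> lg lh La; rewrite /Int intB//; exact: loc_sub. Qed.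
Lemma Int_eq g h a b : (forall x, a <= x <= b -> g x = h x) -> Int a b g = Int a b h.
Proof. by move=> gh; apply: int_eq => x /=; rewrite in_itv => /gh. Qed.
Lemma Int_le g h a b : loc g -> loc h -> L <= a -> (forall x, a <= x <= b -> g x <= h x) ->
  Int a b g <= Int a b h.
Proof.
move=> lg lh La gh; apply: int_le => //; try exact: loc_sub.
Qed.
Lemma Int_norm g a b : loc g -> L <= a -> `|Int a b g| <= Int a b (fun x => `|g x|).
Proof. by move=> lg La; apply: int_norm => //; exact: loc_sub. Qed.
Lemma Int_abs_le g a b c : loc g -> L <= a -> a <= b -> b <= c ->
  `|Int a b g| <= Int a c (fun x => `|g x|).
Proof.
move=> lg La ab bc; apply: (le_trans (Int_norm _ lg La)).
by rewrite (@Int_split _ a b c) ?lerDl ?Int_ge0//; exact: loc_norm.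
Qed.
(** Nonnegativity of the integral of [(g - c) ^ 2], where [c] is the mean of [g]. *)
Lemma Int_CS g a b : sq2 L g -> L <= a -> a < b ->
  Int a b g ^+ 2 <= (b - a) * Int a b (fun x => g x ^+ 2).
Proof.
move=> hg La ab; have lg := sq2_loc hg; have lg2 := itg_loc hg.2.
pose c := Int a b g / (b - a); have ba : 0 < b - a by rewrite subr_gt0.
have : 0 <= Int a b (fun x => (g x ^+ 2 + c ^+ 2) - 2 * c * g x).
  by apply: Int_ge0 => x _; have := sqr_ge0 (g x - c); rewrite sqrrB; lra.
have l1 := loc_cst (c ^+ 2); have l2 := locD lg2 l1; have l3 := locZ (2 * c) lg.
rewrite IntB// IntD// Int_cst ?(ltW ab)// IntZ//.
have -> : Int a b g = c * (b - a) by rewrite /c divfK// gt_eqF.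
move=> h; have := ler_wpM2l (ltW ba) h; lra.
Qed.

(** Absolute continuity in integrated form, as in [H1_deriv]; product rule and integration by parts
    then never differentiate [f] pointwise. *)
Definition AC f g := loc g /\ forall x, L <= x -> f x = f L + Int L x g.

Lemma AC_inc f g a b : AC f g -> L <= a -> a <= b -> f b - f a = Int a b g.
Proof.
move=> [lg h] La ab; rewrite h ?(le_trans La)// (h a)// (@Int_split g L a b)//; ring.
Qed.
Lemma AC_lin c f g f' g' : AC f g -> AC f' g' -> AC (fun x => c * f x + f' x) (fun x => c * g x + g' x).
Proof.
move=> [lg h] [lg' h']; split; first by apply: locD => //; exact: locZ.
by move=> x Lx; rewrite IntD ?IntZ//; [rewrite h// h'//; ring|exact: locZ].
Qed.
Lemma AC_prim g c : loc g -> AC (fun x => c + Int L x g) g.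
Proof. by move=> lg; split=> // x _; rewrite Int0 addr0. Qed.
Lemma AC_dist f g a y b : AC f g -> L <= a -> a <= y -> y <= b ->
  `|f y - f a| <= Int a b (fun x => `|g x|).
Proof. by move=> ac La ay yb; rewrite (AC_inc ac)//; apply: Int_abs_le => //; exact: ac.1. Qed.
Lemma AC_cont f g M : AC f g -> L <= M -> {within `[L, M], continuous f}.
Proof.
move=> [lg h] LM; have c := parameterized_integral_continuous LM (lg M).
have : {within `[L, M], continuous (fun x => f L + Int L x g)}.
  by move=> x; apply: cvgD; [exact: cvg_cst|exact: c].
apply: subspace_eq_continuous => x; rewrite inE /= in_itv => /andP[Lx _] /=.
exact/esym/(h x Lx).
Qed.
Lemma AC_meas f g : AC f g -> measurable_fun D f.
Proof.
move=> ac; have -> : D = \bigcup_n `[L, L + n%:R]%classic.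
  rewrite eqEsubset; split=> x /=; rewrite ?in_itv/= ?andbT.
    move=> Lx; exists (Num.truncn (x - L)).+1 => //=; rewrite in_itv /= Lx /=.
    have := truncnS_gt (x - L); lra.
  by move=> [n _] /=; rewrite in_itv => /andP[].
apply/measurable_fun_bigcup => // n.
by apply: subspace_continuous_measurable_fun => //; apply: (AC_cont ac); rewrite lerDl.
Qed.
Lemma AC_mul_loc f g h : AC f g -> loc h -> loc (fun x => f x * h x).
Proof.
move=> ac lh M; have [LM|ML] := leP L M; last first.
  by rewrite set_itv_ge -?leNgt ?bnd_simp// -?ltNge//; exact: integrable_set0.
apply: (@itg_le _ _ _ (fun x => (`|f L| + Int L M (fun x => `|g x|)) * `|h x|)) => //.
- apply: measurable_funM; first by apply: measurable_funS (AC_meas ac) => //; exact: subset_itvl.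
  exact: itg_meas (lh M).
- move=> x /=; rewrite in_itv => /andP[Lx xM]; rewrite normrM ler_wpM2r//.
  have := AC_dist ac (lexx L) Lx xM; have := ler_normD (f L) (f x - f L).
  by rewrite [f L + _]addrC subrK; lra.
- by apply: itgZ => //; apply: itg_norm.
Qed.

(* The increments of the defect [f^2 - 2 \int f g] are quadratic in those of the
   continuous function [\int |g|], hence vanish under repeated bisection. *)
Lemma AC_sqr f g : AC f g -> AC (fun x => f x ^+ 2) (fun x => 2 * (f x * g x)).
Proof.
move=> ac; have lg := ac.1; have lfg := AC_mul_loc ac lg; have lG := loc_norm lg.
split; first exact: locZ.
pose m a b := Int a b (fun x => `|g x|).
have m0 a b : 0 <= m a b by apply: Int_ge0.
pose d a b := f b ^+ 2 - f a ^+ 2 - 2 * Int a b (fun x => f x * g x).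
have dD a b c : L <= a -> a <= b -> b <= c -> d a c = d a b + d b c.
  by move=> La ab bc; rewrite /d (@Int_split _ a b c)//; ring.
have d2 a b : L <= a -> a <= b -> `|d a b| <= 2 * m a b ^+ 2.
  move=> La ab.
  have -> : d a b = Int a b (fun x => (f b + f a) * g x - 2 * (f x * g x)).
    rewrite IntB ?IntZ//; [|exact: locZ|exact: locZ].
    by rewrite -(AC_inc ac)// /d; ring.
  have l1 : loc (fun x => (f b + f a) * g x - 2 * (f x * g x)).
    by move=> M; apply: itgB => //; exact: itgZ.
  apply: (le_trans (Int_norm _ l1 La)).
  have -> : 2 * m a b ^+ 2 = Int a b (fun x => 2 * m a b * `|g x|) by rewrite IntZ// expr2 mulrA.
  apply: Int_le => //; [exact: loc_norm|exact: locZ|move=> x /andP[ax xb]].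
  rewrite (_ : _ - _ = ((f b - f x) + - (f x - f a)) * g x); last by ring.
  rewrite normrM ler_wpM2r//; apply: (le_trans (ler_normD _ _)); rewrite normrN.
  have h1 : `|f x - f a| <= m a b by apply: AC_dist.
  have h2 : `|f b - f x| <= m a b.
    have := AC_dist ac (le_trans La ax) xb (lexx b).
    have := @Int_split _ a x b lG La ax xb; have := m0 a x; rewrite /m; lra.
  lra.
have dk k : forall a b, L <= a -> a <= b -> `|d a b| <= 2 * m a b ^+ 2 * 2^-1 ^+ k.
  elim: k => [|k ih] a b La ab; first by rewrite expr0 mulr1; exact: d2.
  have cm : {within `[a, b], continuous (fun x => Int L x (fun x => `|g x|))}.
    have := AC_cont (AC_prim 0 lG) (le_trans La ab).
    have -> : (fun x => 0 + Int L x (fun x => `|g x|)) = (fun x => Int L x (fun x => `|g x|)).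
      by apply/funext => x; rewrite add0r.
    by apply: continuous_subspaceW; apply: subset_itvr; rewrite bnd_simp.
  have mab : Int L a (fun x => `|g x|) + m a b = Int L b (fun x => `|g x|) by rewrite -Int_split.
  have ab0 := m0 a b.
  have [|c] := @IVT _ _ a b (Int L a (fun x => `|g x|) + m a b / 2) ab cm.
    by rewrite /= ge_min le_max; apply/andP; split; apply/orP; [left|right]; lra.
  rewrite in_itv => /andP[ac' cb] E.
  have m1 : m a c = m a b / 2.
    by have := @Int_split _ L a c lG (lexx L) La ac'; rewrite E /m; lra.
  have m2 : m c b = m a b / 2 by have := @Int_split _ a c b lG La ac' cb; rewrite -/(m _ _) -/(m _ _) -/(m _ _) m1; lra.
  rewrite (dD a c b)//; apply: (le_trans (ler_normD _ _)).
  apply: (le_trans (lerD (ih a c La ac') (ih c b (le_trans La ac') cb))).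
  by rewrite m1 m2 [_ ^+ k.+1]exprS le_eqVlt; apply/orP; left; apply/eqP; field.
move=> x Lx; rewrite IntZ//; apply/eqP; rewrite -subr_eq0 -normr_le0 leNgt; apply/negP => h.
have [k hk] := exp2_small (2 * m L x ^+ 2) (divr_gt0 h (ltr0n _ 2)).
have := le_trans (dk k L x (lexx L) Lx) hk; rewrite /d.
have -> : f x ^+ 2 - f L ^+ 2 - 2 * Int L x (fun x => f x * g x) = f x ^+ 2 - (f L ^+ 2 + 2 * Int L x (fun x => f x * g x)) by ring.
move: h; set z := `| _ |; lra.
Qed.

(** Polarization of [AC_sqr]. *)
Lemma AC_mul f g f' g' : AC f g -> AC f' g' ->
  AC (fun x => f x * f' x) (fun x => g x * f' x + f x * g' x).
Proof.
move=> a1 a2; have l1 := AC_mul_loc a2 a1.1; have l2 := AC_mul_loc a1 a2.1.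
have := AC_lin (-1) (AC_lin 1 (AC_sqr a1) (AC_sqr a2)) (AC_sqr (AC_lin 1 a1 a2)).
have z : AC (fun=> 0) (fun=> 0) by split=> [|x Lx]; [exact: loc_cst|rewrite Int_cst// mul0r addr0].
move=> /(fun H => AC_lin 2^-1 H z).
by congr AC; apply/funext => x; field.
Qed.

End AbsolutelyContinuous.

Lemma loc_base {R : realType} (L x : R) (g : R -> R) : loc L g -> L <= x -> loc x g.
Proof. by move=> lg Lx M; exact: loc_sub lg Lx. Qed.

(** * The Sobolev space of the half-line *)

Section SobolevHalfLine.
Context {R : realType} (L : R).
Notation mu := (@lebesgue_measure R).
Notation D := (`[L, +oo[%classic : set R).
Implicit Types f g h p q : R -> R.
Let mD : measurable D. Proof. exact: measurable_itv. Qed.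
Notation loc := (loc L). Notation AC := (AC L). Notation sq2 := (sq2 L). Notation sip := (sip L).

Lemma D_bigcup : D = \bigcup_n `[L, L + n%:R]%classic.
Proof.
rewrite eqEsubset; split=> x /=; rewrite ?in_itv/= ?andbT.
  move=> Lx; exists (Num.truncn (x - L)).+1 => //=; rewrite in_itv /= Lx /=.
  have := truncnS_gt (x - L); lra.
by move=> [n _] /=; rewrite in_itv => /andP[].
Qed.

Lemma nonneg_exhaust h : measurable_fun D h -> (forall x, L <= x -> 0 <= h x) ->
  (\int[mu]_(x in `[L, (L + n%:R)%R]) (h x)%:E)%E @[n --> \oo] --> (\int[mu]_(x in D) (h x)%:E)%E.
Proof.
move=> mh h0.
rewrite D_bigcup; apply: ge0_nondecreasing_set_cvg_integral => //.
- by move=> m n mn; apply/subsetPset; apply: subset_itvl; rewrite bnd_simp lerD2l ler_nat.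
- by move=> n; apply/measurable_EFinP; apply: measurable_funS mh => //; exact: subset_itvl.
- by move=> n x /=; rewrite in_itv lee_fin => /andP[/h0].
Qed.

Lemma tail_le h b : itg D h -> L <= b ->
  `|\int[mu]_(x in D) h x - Int L b h| <=
  \int[mu]_(x in D) `|h x| - Int L b (fun x => `|h x|).
Proof.
move=> ih Lb; have ih' := itg_norm mD ih.
have E : \int[mu]_(x in D) h x - Int L b h = \int[mu]_(x in `[b, +oo[) h x.
  by have := Int_tail ih Lb; set u := Int _ _ _; lra.
have -> : \int[mu]_(x in D) `|h x| - Int L b (fun x => `|h x|) = \int[mu]_(x in `[b, +oo[) `|h x|.
  by have := Int_tail ih' Lb; set u := Int _ _ _; lra.
rewrite E; apply: int_norm => //; apply: itgS ih => //; apply: subset_itvr; rewrite bnd_simp//.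
Qed.

Lemma tail_cvg h (e : R) : itg D h -> 0 < e -> exists n : nat, forall b : R, L + n%:R <= b ->
  `|\int[mu]_(x in D) h x - Int L b h| <= e.
Proof.
move=> ih e0; have ih' := itg_norm mD ih; have lh := itg_loc ih'.
have C : Int L (L + n%:R) (fun x => `|h x|) @[n --> \oo] --> \int[mu]_(x in D) `|h x|.
  apply: fine_cvg; rewrite fineK; last exact: integrable_fin_num ih'.
  exact: nonneg_exhaust (itg_meas ih') (fun x _ => normr_ge0 (h x)).
have /cvgrPdist_le/(_ e e0)[n _ hn] := C.
exists n => b nb; have Lb : L <= b by apply: le_trans nb; rewrite lerDl.
apply: (le_trans (tail_le ih Lb)); apply: le_trans (hn n (leqnn n)).
apply: le_trans (ler_norm _); rewrite lerD2l lerN2.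
by rewrite (@Int_split _ L _ L (L + n%:R) b)// ?lerDl// Int_ge0.
Qed.

Lemma ibp_infty_arith (X H hL K I1 I2 A A1 A2 e : R) :
  `|X - K| <= e -> `|H - I1| <= e -> `|H - (I1 + I2)| <= e -> `|A - A1| <= e ->
  `|A - (A1 + A2)| <= e -> `|I2 - (hL + K)| <= A2 -> `|X + hL| <= 5 * e.
Proof.
rewrite !ler_norml => /andP[? ?] /andP[? ?] /andP[? ?] /andP[? ?] /andP[? ?] /andP[? ?].
by apply/andP; split; lra.
Qed.

(** The point is that [h] vanishes at infinity. Its mean over [[b, b + 1]] is small because [h] is
    integrable, and [h b] differs from that mean by at most the integral of [|k|] there. *)
Lemma ibp_infty h k : AC h k -> itg D h -> itg D k -> \int[mu]_(x in D) k x = - h L.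
Proof.
move=> ac ih ik; apply/eqP; rewrite -subr_eq0 opprK -normr_le0 leNgt; apply/negP => z0.
set z := `| _ | in z0; have e0 : 0 < z / 8 by rewrite divr_gt0.
have [n1 h1] := tail_cvg ik e0; have [n2 h2] := tail_cvg ih e0.
have [n3 h3] := tail_cvg (itg_norm mD ik) e0.
pose b := L + (n1 + n2 + n3)%:R; have Lb : L <= b by rewrite lerDl.
have [b1 b2 b3] : [/\ L + n1%:R <= b, L + n2%:R <= b & L + n3%:R <= b].
  by rewrite /b !natrD; have := ler0n R n1; have := ler0n R n2; have := ler0n R n3; split; lra.
have bb : b <= b + 1 by rewrite lerDl.
have lh := itg_loc ih.
have hb : `|Int b (b + 1) h - h b| <= Int b (b + 1) (fun x => `|k x|).
  have E : Int b (b + 1) h - h b = Int b (b + 1) (fun x => h x - h b).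
    by rewrite (IntB _ lh (loc_cst L (h b)))// Int_cst//; ring.
  have l1 : loc (fun x => h x - h b) by move=> M; apply: itgB => //; exact: loc_cst.
  rewrite E; apply: (le_trans (Int_norm _ l1 Lb)).
  pose c := Int b (b + 1) (fun x => `|k x|).
  have Ec : c = Int b (b + 1) (fun=> c) by rewrite Int_cst//; ring.
  rewrite -/c [leRHS]Ec; apply: (Int_le (loc_norm l1) (loc_cst L c) Lb) => x /andP[bx xb].
  exact: AC_dist ac Lb bx xb.
have l3 := h3 _ (le_trans b3 bb); rewrite (Int_split (loc_norm ac.1) (lexx L) Lb bb) in l3.
have l2 := h2 _ (le_trans b2 bb); rewrite (Int_split lh (lexx L) Lb bb) in l2.
rewrite (ac.2 b Lb) in hb.
have := ibp_infty_arith (h1 b b1) (h2 b b2) l2 (h3 b b3) l3 hb; rewrite -/z; lra.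
Qed.

Definition H1s f g := [/\ AC f g, sq2 f & sq2 g].

Lemma H1s_lin a f g f' g' : H1s f g -> H1s f' g' ->
  H1s (fun x => a * f x + f' x) (fun x => a * g x + g' x).
Proof. by move=> [a1 b1 c1] [a2 b2 c2]; split; [exact: AC_lin|exact: sq2_lin|exact: sq2_lin]. Qed.
Lemma H1s0 : H1s (fun=> 0) (fun=> 0).
Proof.
split; [|exact: sq2_0|exact: sq2_0].
by split=> [|x Lx]; [exact: loc_cst|rewrite Int_cst// mul0r addr0].
Qed.

Lemma Int_sip_le f b c : sq2 f -> L <= b -> b <= c -> Int b c (fun x => f x ^+ 2) <= sip f f.
Proof.
move=> hf Lb bc; apply: int_subset => //; last by move=> x _; exact: sqr_ge0.
  by apply: subset_itv; rewrite ?bnd_simp.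
exact: hf.2.
Qed.

(** Average over [y] in [[x, x + l]] the inequality between [f x] and [f y] plus an increment. The
    length [l] is free: a short one makes the contribution of the derivative as small as desired. *)
Lemma H1s_sup f g (x l : R) : H1s f g -> L <= x -> 0 < l ->
  f x ^+ 2 <= 2 / l * sip f f + 2 * l * sip g g.
Proof.
move=> [ac hf hg] Lx l0; have xl : x < x + l by rewrite ltrDl.
have l2 := itg_loc hf.2.
have P y : x <= y <= x + l -> f x ^+ 2 <= 2 * f y ^+ 2 + 2 * (l * sip g g).
  move=> /andP[xy yl].
  have h : Int x y g ^+ 2 <= l * sip g g.
    have [->|/negPf xy'] := eqVneq x y; first by rewrite Int0 expr0n mulr_ge0 ?sip_ge0// ltW.
    have {}xy' : x < y by rewrite lt_neqAle xy' xy.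
    apply: (le_trans (Int_CS hg Lx xy')); apply: ler_pM => //.
    - by rewrite subr_ge0.
    - by apply: Int_ge0 => z _; exact: sqr_ge0.
    - lra.
    - exact: Int_sip_le.
  have := AC_inc ac Lx xy; have := sqr_ge0 (f y + Int x y g); rewrite sqrrD => h1 h2.
  have -> : f x = f y - Int x y g by rewrite -h2; ring.
  rewrite sqrrB; lra.
have : Int x (x + l) (fun=> f x ^+ 2) <= Int x (x + l) (fun y => 2 * f y ^+ 2 + 2 * (l * sip g g)).
  by apply: (@Int_le _ L) => //; [exact: loc_cst|apply: locD; [exact: locZ|exact: loc_cst]].
have l1 : loc (fun y => 2 * f y ^+ 2) by exact: locZ.
rewrite (IntD _ l1 (loc_cst _ _))// (IntZ _ _ l2)//.
have xl' := ltW xl; have := Int_sip_le hf Lx xl'; rewrite !Int_cst//.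
have -> : x + l - x = l by ring.
move=> h1 h2; rewrite -(ler_pM2r l0); apply: (le_trans h2).
rewrite (_ : (2 / l * sip f f + _) * l = 2 * sip f f + 2 * (l * sip g g) * l); last by field; rewrite gt_eqF.
lra.
Qed.

Lemma H1s_ibp f g f' g' : H1s f g -> H1s f' g' -> sip g f' + sip f g' = - (f L * f' L).
Proof.
move=> [a1 f1 g1] [a2 f2 g2].
rewrite -(ibp_infty (AC_mul a1 a2)).
- by rewrite /sip -intD//; [exact: sq2_mul g1 f2|exact: sq2_mul f1 g2].
- exact: sq2_mul.
- by apply: itgD => //; [exact: sq2_mul g1 f2|exact: sq2_mul f1 g2].
Qed.

Lemma H1s_bdd f g : H1s f g -> exists2 C, 0 <= C & forall x, L <= x -> `|f x| <= C.
Proof.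
move=> hfg; exists (1 + (2 / 1 * sip f f + 2 * 1 * sip g g)).
  by have := (sip_ge0 L f, sip_ge0 L g); move=> [? ?]; lra.
move=> x Lx; have := H1s_sup hfg Lx ltr01; have := sqr_ge0 (`|f x| - 1).
by rewrite sqrrB real_normK ?num_real//; have := sqr_ge0 (f x); lra.
Qed.

Lemma sq2_bdd_mul f g C : measurable_fun D f -> (forall x, L <= x -> `|f x| <= C) -> sq2 g ->
  sq2 (fun x => f x * g x).
Proof.
move=> mf fC [mg ig]; split; first exact: measurable_funM.
apply: (@itg_le _ _ _ (fun x => C ^+ 2 * g x ^+ 2)) => //; last exact: itgZ.
  by apply: measurable_funX; exact: measurable_funM.
move=> x /=; rewrite in_itv andbT => Lx; rewrite ger0_norm ?sqr_ge0// exprMn ler_wpM2r ?sqr_ge0//.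
rewrite -[f x ^+ 2]real_normK ?num_real// ler_sqr ?nnegrE ?fC//.
exact: le_trans (fC x Lx).
Qed.

Lemma H1s_mul f g f' g' : H1s f g -> H1s f' g' ->
  H1s (fun x => f x * f' x) (fun x => g x * f' x + f x * g' x).
Proof.
move=> h1 h2; have [a1 f1 g1] := h1; have [a2 f2 g2] := h2.
have [C1 _ b1] := H1s_bdd h1; have [C2 _ b2] := H1s_bdd h2.
have m1 := sq2_bdd_mul (AC_meas a1) b1; have m2 := sq2_bdd_mul (AC_meas a2) b2.
split; [exact: AC_mul|exact: m1|apply: sq2D; last exact: m1].
by have := m2 g g1; congr sq2; apply/funext => x; exact: mulrC.
Qed.

(** Almost everywhere differentiability of the integral, applied to [g] cut off outside [[L, L + n]]
    so that it is integrable on the line. *)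
Lemma Int0_ae0 g : loc g -> (forall x, L <= x -> Int L x g = 0) -> {ae mu, forall x, L <= x -> g x = 0}.
Proof.
move=> lg hg.
have aeL : {ae mu, forall x : R, x <> L}.
  by exists [set L]; split=> //; [exact: lebesgue_measure_set1|move=> x /= /contrapT].
have H n : {ae mu, forall x, L <= x < L + n%:R -> g x = 0}.
  pose gn := g \_ `[L, L + n%:R].
  have ign : itg setT gn.
    by rewrite /itg -restrict_EFin; apply/integrable_restrict => //=; rewrite setTI; exact: lg.
  have locn : locally_integrable [set: R] gn by apply: integrable_locally => //; exact: lg.
  have ign' y : itg `[L, y] gn by apply: itgS ign => //; exact: measurable_itv.
  have F := @FTC1 R gn (BLeft L) ign' locn.
  apply: aeS (aeI F aeL) => x [H xL] /andP[Lx xn].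
  have [|dx E] := H; first by rewrite /= lte_fin lt_neqAle Lx andbT eq_sym; exact/eqP.
  have gx : gn x = g x by rewrite /gn patchE ifT// inE /= in_itv /= Lx ltW.
  have d1 : derR (fun y => \int[mu]_(t in `[L, y]) gn t) x (g x).
    by apply/derRP; rewrite -gx -E derive1E; exact: derivableP.
  apply: (@der_unique _ (RH R) _ x _ _ d1).
  apply: (@der_near _ (RH R) (fun=> 0)); last exact: der_cst.
  near=> y; have yn : y < L + n%:R by near: y; exact: lt_nbhsl.
  have [Ly|yL] := leP L y; last by rewrite set_itv_ge ?Rintegral_set0// bnd_simp -ltNge.
  rewrite -(hg y Ly); apply: int_eq => t /=; rewrite in_itv /= => /andP[Lt ty].
  by rewrite /gn patchE ifT// inE /= in_itv /= Lt /= (le_trans ty)// ltW.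
apply: (@aeS _ (fun x => forall n : nat, L <= x < L + n%:R -> g x = 0)).
  move=> x hx Lx; apply: (hx (Num.truncn (x - L)).+1); rewrite Lx /=.
  have := truncnS_gt (x - L); lra.
exact/ae_foralln.
Unshelve. all: by end_near. Qed.

Lemma AC_uniq f g g' : AC f g -> AC f g' -> {ae mu, forall x, L <= x -> g x = g' x}.
Proof.
move=> [l h] [l' h'].
have ll : loc (fun x => g x - g' x) by move=> M; apply: itgB.
apply: aeS (Int0_ae0 ll _) => [x H Lx|x Lx]; first by apply/eqP; rewrite -subr_eq0 H.
by rewrite (IntB _ l l')//; have := h x Lx; rewrite h'//; lra.
Qed.

Lemma ae0_sip0 f : {ae mu, forall x, L <= x -> f x = 0} -> sq2 f -> sip f f = 0.
Proof.
move=> f0 hf; rewrite /sip (@ae_int _ L _ (fun=> 0)) ?Rintegral_cst ?mul0r//; first exact: hf.2.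
  exact: itg0.
by apply: aeS f0 => x h /h ->; rewrite mul0r.
Qed.

Lemma ae_Int f g a b : loc f -> loc g -> L <= a -> {ae mu, forall x, L <= x -> f x = g x} ->
  Int a b f = Int a b g.
Proof.
move=> lf lg La fg; rewrite /Int /Rintegral; congr fine; apply: ae_eq_integral => //.
- by apply/measurable_EFinP; exact: itg_meas (loc_sub _ lf La).
- by apply/measurable_EFinP; exact: itg_meas (loc_sub _ lg La).
- by apply: aeS fg => x fgx; rewrite /= in_itv => /andP[ax _]; rewrite fgx// (le_trans La).
Qed.

Lemma AC_loc f g : AC f g -> loc f.
Proof.
move=> ac M; have := AC_mul_loc ac (loc_cst L 1) M; apply: itg_eq => // x _; exact: mulr1.
Qed.

Lemma cont_ae0 f g : AC f g -> {ae mu, forall x, L <= x -> f x = 0} -> forall x, L <= x -> f x = 0.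
Proof.
move=> ac f0 x Lx; have lf := AC_loc ac; have lG := loc_norm ac.1.
apply/eqP; rewrite -normr_le0 leNgt; apply/negP => fx.
have [b xb hb] : exists2 b, x < b & Int x b (fun y => `|g y|) <= `|f x| / 2.
  have [h|h] := leP (Int x (x + 1) (fun y => `|g y|)) (`|f x| / 2).
    by exists (x + 1) => //; rewrite ltrDl.
  have x1 : x <= x + 1 by rewrite lerDl.
  have := AC_cont (AC_prim 0 (loc_base lG Lx)) x1.
  have -> : (fun y => 0 + Int x y (fun y => `|g y|)) = (fun y => Int x y (fun y => `|g y|)).
    by apply/funext => y; rewrite add0r.
  move=> cm; have [|c] := @IVT _ _ x (x + 1) (`|f x| / 2) x1 cm.
    by rewrite Int0 ge_min le_max; apply/andP; split; apply/orP; [left|right]; lra.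
  rewrite in_itv /= => /andP[xc cx] E; exists c; last by rewrite E.
  rewrite lt_neqAle xc andbT; apply/eqP => xc'; move: E; rewrite -xc' Int0; lra.
have : Int x b (fun=> `|f x| / 2) <= Int x b (fun y => `|f y|).
  apply: (Int_le (loc_cst _ _) (loc_norm lf) Lx) => y /andP[xy yb].
  have := AC_dist ac Lx xy yb; have := ler_normB (f y) (f y - f x).
  have -> : f y - (f y - f x) = f x by ring.
  lra.
have -> : Int x b (fun y => `|f y|) = 0.
  rewrite (@ae_Int _ (fun=> 0) _ _ (loc_norm lf) (loc_cst L 0) Lx); first by rewrite Int_cst ?mul0r ?ltW.
  by apply: aeS f0 => y h /h ->; rewrite normr0.
have f2 : 0 < `|f x| / 2 * (b - x) by rewrite mulr_gt0 ?subr_gt0// divr_gt0.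
by rewrite (Int_cst _ (ltW xb)) => h; have := lt_le_trans f2 h; rewrite ltxx.
Qed.

Lemma Int_right0 h M x : (forall y, M < y -> h y = 0) -> Int M x h = 0.
Proof.
move=> h0; have [xM|Mx] := leP x M.
  move: xM; rewrite le_eqVlt => /predU1P[->|xM]; first by rewrite Int0.
  by rewrite /Int set_itv_ge ?Rintegral_set0// bnd_simp -ltNge.
have i0 : itg `]M, x] h.
  by apply: itg_eq (itg0 (measurable_itv `]M, x])) => // y /=; rewrite in_itv => /andP[/h0 ->].
rewrite /Int -Rintegral_itv_obnd_cbnd// (@int_eq _ _ _ (fun=> 0)) ?Rintegral_cst ?mul0r//.
by move=> y /=; rewrite in_itv => /andP[/h0 ->].
Qed.

Lemma Int_supp h M : itg D h -> L <= M -> (forall y, M < y -> h y = 0) ->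
  \int[mu]_(x in D) h x = Int L M h.
Proof.
move=> ih LM h0; rewrite (Int_tail ih LM).
have i0 : itg `]M, +oo[ h.
  by apply: itg_eq (itg0 (measurable_itv `]M, +oo[)) => // y /=; rewrite in_itv andbT => /h0 ->.
rewrite -Rintegral_itv_obnd_cbnd// (@int_eq _ `]M, +oo[%classic _ (fun=> 0)) ?Rintegral_cst ?mul0r ?addr0//.
by move=> y /=; rewrite in_itv andbT => /h0 ->.
Qed.

Definition cut (M : R) (w : R -> R) : R -> R := fun x => \1_(`]-oo, M]%classic) x * w x.

Lemma cutE M w x : cut M w x = if x <= M then w x else 0.
Proof.
rewrite /cut indicE mem_setE in_itv /=; case: (x <= M); first by rewrite mul1r.
by rewrite mul0r.
Qed.

Lemma cut_sq2 M w : sq2 w -> sq2 (cut M w).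
Proof.
apply: (@sq2_bdd_mul _ _ 1); first by apply: measurable_indic; exact: measurable_itv.
by move=> x _; rewrite indicE ger0_norm ?ler0n// lern1 leq_b1.
Qed.

Lemma cut_cst_sq2 M (c : R) : sq2 (cut M (fun=> c)).
Proof.
split; first by apply: measurable_funM => //; apply: measurable_indic; exact: measurable_itv.
have l0 : itg `[L, M] (fun=> c ^+ 2) by exact: loc_cst.
have : itg D ((fun=> c ^+ 2) \_ `[L, M]).
  rewrite /itg -restrict_EFin; apply/integrable_restrict => //.
  by rewrite setIidr//; exact: subset_itvl.
apply: itg_eq => // x; rewrite /= in_itv /= andbT => Lx.
by rewrite cutE patchE mem_setE in_itv /= Lx /=; case: (x <= M) => //; rewrite expr0n.
Qed.

Lemma cut_AC_sq2 f g M : AC f g -> sq2 (cut M f).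
Proof.
move=> ac; pose C := `|f L| + Int L M (fun x => `|g x|).
have b x : L <= x -> `|cut M f x| <= cut M (fun=> C) x.
  move=> Lx; rewrite !cutE; case: ifPn => [xM|_]; last by rewrite normr0.
  have := AC_dist ac (lexx L) Lx xM; have := ler_normD (f L) (f x - f L).
  by rewrite [f L + _]addrC subrK /C; lra.
have mc : measurable_fun D (cut M f).
  apply: measurable_funM; last exact: AC_meas ac.
  by apply: measurable_indic; exact: measurable_itv.
split=> //; apply: (itg_le mD _ _ (cut_cst_sq2 M C).2); first exact: measurable_funX.
move=> x; rewrite /= in_itv andbT => Lx.
rewrite ger0_norm ?sqr_ge0// -[leLHS]real_normK ?num_real// ler_sqr ?nnegrE ?b//.
exact: le_trans (b x Lx).
Qed.

Section TestFunction.
Variables (w : R -> R) (M : R).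
Hypotheses (LM : L <= M) (hw : sq2 (cut M w)) (w0 : Int L M w = 0).

Lemma Int_cut x : x <= M -> Int L x (cut M w) = Int L x w.
Proof. by move=> xM; apply: Int_eq => y /andP[_ yx]; rewrite cutE ifT// (le_trans yx). Qed.

Lemma Int_cut_out x : M <= x -> Int L x (cut M w) = 0.
Proof.
move=> Mx; rewrite (Int_split (sq2_loc hw) (lexx L) LM Mx) Int_cut// w0 add0r.
by apply: Int_right0 => y My; rewrite cutE leNgt My.
Qed.

(** As [w] has integral 0 over [[L, M]], its primitive vanishes at both ends and remains 0 beyond
    [M]. *)
Lemma cut_test : H1s (fun x => Int L x (cut M w)) (cut M w).
Proof.
have ac : AC (fun x => Int L x (cut M w)) (cut M w).
  by split=> [|x _]; [exact: sq2_loc hw|rewrite Int0 add0r].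
split=> //; have := cut_AC_sq2 M ac; congr sq2; apply/funext => x; rewrite cutE.
by case: leP => // /ltW Mx; rewrite Int_cut_out.
Qed.

Lemma cut_sip f : sq2 f -> sip f (cut M w) = Int L M (fun x => f x * w x).
Proof.
move=> hf; rewrite /sip (@Int_supp _ M)//; first last.
- by move=> y My; rewrite cutE leNgt My mulr0.
- exact: sq2_mul.
by apply: Int_eq => x /andP[_ xM]; rewrite cutE xM.
Qed.
End TestFunction.

(** With [Q] a primitive of [q], the test function is the primitive of [w = p - Q - c], where [c]
    gives [w] mean zero on [[L, M]]. The hypothesis then says that the integral of [w ^ 2] over
    [[L, M]] is 0. *)
Lemma dbr_local p q M : L < M -> sq2 p -> sq2 q ->
  (forall f g, H1s f g -> f L = 0 -> sip p g + sip q f = 0) ->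
  exists c, {ae mu, forall x, L <= x <= M -> p x = c + Int L x q}.
Proof.
move=> LM' hp hq h; have LM := ltW LM'; have lq := sq2_loc hq; have lp := sq2_loc hp.
pose Q x := Int L x q; have acQ : AC Q q by split=> // x _; rewrite /Q Int0 add0r.
have lQ := AC_loc acQ; have ML0 : 0 < M - L by rewrite subr_gt0.
pose c := Int L M (fun x => p x - Q x) / (M - L); pose w x := p x - Q x - c.
have lpQ : loc (fun x => p x - Q x) by move=> b; apply: itgB.
have lw : loc w by move=> b; apply: itgB => //; exact: loc_cst.
have w0 : Int L M w = 0.
  by rewrite (IntB _ lpQ (loc_cst L c))// Int_cst// /c divfK ?subrr// gt_eqF.
have hw : sq2 (cut M w).
  have := sq2B (sq2B (cut_sq2 M hp) (cut_AC_sq2 M acQ)) (cut_cst_sq2 M c).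
  congr sq2; apply/funext => x; rewrite /cut /w; ring.
have ht := cut_test LM hw w0; have [act sqt _] := ht.
have E := h _ _ ht (Int0 _ L); rewrite (cut_sip LM hw hp) in E.
have Eq : sip q (fun x => Int L x (cut M w)) = - Int L M (fun x => Q x * w x).
  rewrite /sip (@Int_supp _ M)//; first last.
  - by move=> y My; rewrite Int_cut_out ?mulr0// ltW.
  - exact: sq2_mul.
  have acP := AC_mul acQ act; have := acP.2 M LM.
  have l1 : loc (fun x => q x * Int L x (cut M w)) by exact: itg_loc (sq2_mul hq sqt).
  have l2 : loc (fun x => Q x * cut M w x) by apply: AC_mul_loc acQ (sq2_loc hw).
  rewrite (IntD _ l1 l2)// Int_cut_out// Int0 !mulr0 add0r => Z.
  have -> : Int L M (fun x => Q x * w x) = Int L M (fun x => Q x * cut M w x).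
    by apply: Int_eq => x /andP[_ xM]; rewrite cutE xM.
  lra.
have W0 : sip (cut M w) (cut M w) = 0.
  rewrite (cut_sip LM hw) //.
  have l1 : loc (fun x => p x * cut M w x) by exact: itg_loc (sq2_mul hp hw).
  have l2 : loc (fun x => Q x * cut M w x) by apply: AC_mul_loc acQ (sq2_loc hw).
  have l3 := locZ c (sq2_loc hw).
  have -> : Int L M (fun x => cut M w x * w x) =
     Int L M (fun x => (p x * cut M w x - Q x * cut M w x) - c * cut M w x).
    by apply: Int_eq => x /andP[_ xM]; rewrite cutE xM /w; ring.
  have l4 : loc (fun x => p x * cut M w x - Q x * cut M w x) by move=> b; apply: itgB.
  rewrite (IntB _ l4 l3)// (IntB _ l1 l2)// (IntZ _ _ (sq2_loc hw))// Int_cut// w0 mulr0 subr0.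
  have e1 f : Int L M (fun x => f x * cut M w x) = Int L M (fun x => f x * w x).
    by apply: Int_eq => x /andP[_ xM]; rewrite cutE xM.
  by rewrite !e1; move: E; rewrite Eq; lra.
exists c; apply: aeS (sip_ae0 hw W0) => x H /andP[Lx xM].
by move: (H Lx); rewrite cutE xM /w /Q; lra.
Qed.

(* Only test functions vanishing at [L] are used, hence no boundary condition on [P]. *)
Lemma du_bois_reymond p q : sq2 p -> sq2 q ->
  (forall f g, H1s f g -> f L = 0 -> sip p g + sip q f = 0) ->
  exists2 P, H1s P q & {ae mu, forall x, L <= x -> p x = P x}.
Proof.
move=> hp hq h.
have LM (n : nat) : L < L + n.+1%:R by rewrite ltrDl.
have /choice[c hc] : forall n : nat, exists c, {ae mu, forall x, L <= x <= L + n.+1%:R -> p x = c + Int L x q}.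
  by move=> n; apply: dbr_local.
(* All the local identities hold on [[L, L + 1]], which fixes the constant. *)
have cc n : c n = c 0%N.
  have z : {ae mu, forall x, L <= x -> cut (L + 1) (fun=> c n - c 0%N) x = 0}.
    apply: aeS (aeI (hc n) (hc 0%N)) => x [hn h0] Lx; rewrite cutE; case: ifPn => // xL.
    have n1 : 1 <= n.+1%:R :> R by rewrite ler1n.
    have := h0; rewrite Lx xL => /(_ isT); rewrite hn ?Lx /=; [lra|].
    by apply: le_trans xL _; rewrite lerD2l.
  have := ae0_sip0 z (cut_cst_sq2 _ _); rewrite cut_sip ?lerDl//; try exact: cut_cst_sq2.
  have -> : Int L (L + 1) (fun x => cut (L + 1) (fun=> c n - c 0%N) x * (c n - c 0%N)) = (c n - c 0%N) ^+ 2.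
    rewrite (@Int_eq _ _ (fun=> (c n - c 0%N) ^+ 2)); last by move=> x /andP[_ xM]; rewrite cutE xM.
    by rewrite Int_cst ?lerDl//; ring.
  by move/eqP; rewrite sqrf_eq0 subr_eq0 => /eqP.
have ac : AC (fun x => c 0%N + Int L x q) q by apply: AC_prim; exact: sq2_loc.
have ae : {ae mu, forall x, L <= x -> p x = c 0%N + Int L x q}.
  apply: (@aeS _ (fun x => forall n : nat, L <= x <= L + n.+1%:R -> p x = c 0%N + Int L x q)).
    move=> x hx Lx; apply: (hx (Num.truncn (x - L))); rewrite Lx /=.
    have := truncnS_gt (x - L); lra.
  by apply/ae_foralln => m; apply: aeS (hc m) => x; rewrite cc.
exists (fun x => c 0%N + Int L x q) => //; split=> //.
by apply: (ae_sq2 (AC_meas ac) hp); apply: aeS ae => x H /H.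
Qed.

(** The case [p = 0] of [du_bois_reymond]: the continuous representative [P] of 0 has derivative
    [q]. *)
Lemma H1s_dense q : sq2 q -> (forall f g, H1s f g -> f L = 0 -> sip q f = 0) ->
  {ae mu, forall x, L <= x -> q x = 0}.
Proof.
move=> hq h; have h' f g : H1s f g -> f L = 0 -> sip (fun=> 0) g + sip q f = 0.
  move=> hfg f0; rewrite (h f g)// addr0 /sip (@int_eq _ _ _ (fun=> 0)) ?Rintegral_cst ?mul0r//.
  by move=> x _; rewrite mul0r.
have [P [ac _ _] P0] := du_bois_reymond (sq2_0 L) hq h'.
have PP := cont_ae0 ac; apply: Int0_ae0; first exact: sq2_loc.
have P0' : {ae mu, forall x, L <= x -> P x = 0} by apply: aeS P0 => x H /H.
move=> x Lx; have := ac.2 x Lx; rewrite !(PP P0')//; lra.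
Qed.

Lemma H1s_complete (u v : nat -> R -> R) : (forall n, H1s (u n) (v n)) ->
  (forall e : R, 0 < e -> exists n, forall p q : nat, (n <= p)%N -> (n <= q)%N ->
     sip (fun x => u p x - u q x) (fun x => u p x - u q x) <= e /\
     sip (fun x => v p x - v q x) (fun x => v p x - v q x) <= e) ->
  exists f g, H1s f g /\ forall e : R, 0 < e -> exists n, forall p : nat, (n <= p)%N ->
     sip (fun x => u p x - f x) (fun x => u p x - f x) <= e /\
     sip (fun x => v p x - g x) (fun x => v p x - g x) <= e.
Proof.
move=> huv cau.
have [f0 hf0 cf] : exists2 g, sq2 g & forall e : R, 0 < e -> exists n, forall p : nat, (n <= p)%N ->
     sip (fun x => u p x - g x) (fun x => u p x - g x) <= e.
  apply: riesz_fischer => [n|e /cau[n hn]]; first by case: (huv n).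
  by exists n => p q np nq; case: (hn p q np nq).
have [g hg cg] : exists2 g, sq2 g & forall e : R, 0 < e -> exists n, forall p : nat, (n <= p)%N ->
     sip (fun x => v p x - g x) (fun x => v p x - g x) <= e.
  apply: riesz_fischer => [n|e /cau[n hn]]; first by case: (huv n).
  by exists n => p q np nq; case: (hn p q np nq).
(* the relation [sip f0 phi' + sip g phi = 0] passes to the limit *)
have [|P hP fP] := @du_bois_reymond f0 g hf0 hg.
  move=> phi psi hphi phi0; have [_ h1 h2] := hphi.
  have E n : sip (u n) psi + sip (v n) phi = 0.
    have := H1s_ibp (huv n) hphi; rewrite phi0 mulr0 oppr0; lra.
  (* An additive Cauchy-Schwarz inequality: expand the squares of [a + e b] and [a - e b] and divide
     by [2 * e]. *)
  have CS1 (a b : R -> R) (e : R) : sq2 a -> sq2 b -> 0 < e -> sip a a <= e ^+ 2 -> `|sip a b| <= e * (1 + sip b b).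
    move=> ha hb e0 ae; have S (r : R) : 0 <= sip a a + 2 * r * sip a b + r ^+ 2 * sip b b.
      have := sip_ge0 L (fun x => r * b x + a x).
      rewrite (sip_lin r hb ha (sq2_lin r hb ha)) sipC [sip a _]sipC (sip_lin r hb ha hb) (sip_lin r hb ha ha) [sip b a]sipC; lra.
    have b0 := sip_ge0 L b; have e2 : 0 < 2 * e by rewrite mulr_gt0.
    have e3 : 0 <= e ^+ 2 * sip b b by rewrite mulr_ge0 ?sqr_ge0.
    have sp := S e; have sm := S (- e); rewrite sqrrN in sm.
    by rewrite ler_norml; apply/andP; split; rewrite -(ler_pM2l e2); lra.
  have lim : forall e : R, 0 < e -> `|sip f0 psi + sip g phi| <= e * (2 + sip psi psi + sip phi phi).
    move=> e e0; have e20 : 0 < e ^+ 2 by rewrite exprn_gt0.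
    have [n1 k1] := cf _ e20; have [n2 k2] := cg _ e20; pose n := maxn n1 n2.
    have [_ un vn] := huv n.
    have := CS1 _ _ e (sq2B un hf0) h2 e0 (k1 n (leq_maxl _ _)).
    have := CS1 _ _ e (sq2B vn hg) h1 e0 (k2 n (leq_maxr _ _)).
    have E1 (a b c : R -> R) : sq2 a -> sq2 b -> sq2 c -> sip (fun x => a x - b x) c = sip a c - sip b c.
      move=> ha hb hc; have := sip_lin (-1) hb ha hc.
      have -> : (fun x => -1 * b x + a x) = (fun x => a x - b x) by apply/funext => x; ring.
      move=> ->; ring.
    rewrite !E1//; have := E n; rewrite !ler_norml.
    move=> ? /andP[? ?] /andP[? ?]; apply/andP; split; lra.
  apply/eqP; rewrite -normr_le0 leNgt; apply/negP => z0.
  have k0 : 0 < 2 + sip psi psi + sip phi phi by have := sip_ge0 L psi; have := sip_ge0 L phi; lra.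
  have := lim _ (divr_gt0 (divr_gt0 z0 (ltr0n R 2)) k0); rewrite divfK ?gt_eqF//.
  by move: z0; set z := `| _ |; lra.
exists P, g; split=> // e e0; have [n1 h1] := cf e e0; have [n2 h2] := cg e e0.
exists (maxn n1 n2) => p; rewrite geq_max => /andP[np1 np2]; split; last exact: h2.
have up : sq2 (u p) by case: (huv p).
have sP : sq2 P by case: hP.
suff -> : sip (fun x => u p x - P x) (fun x => u p x - P x) = sip (fun x => u p x - f0 x) (fun x => u p x - f0 x) by exact: h1.
apply: ae_int; [exact: sq2_mul (sq2B up sP) (sq2B up sP)|exact: sq2_mul (sq2B up hf0) (sq2B up hf0)|].
by apply: aeS fP => x H /H ->.
Qed.

End SobolevHalfLine.

(** * Energy space of the star graph *)

Definition lin_of (R : realType) (U V : lmodType R) (f : U -> V) (lf : linear f) :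
  {linear U -> V} := HB.pack f (GRing.isLinear.Build R U V *:%R f lf).

Section FiniteSums.
Context {R : realType} {K : finType}.
Implicit Types F G : K -> R.

Lemma sum_lin (a : R) F G : \sum_k (a * F k + G k) = a * \sum_k F k + \sum_k G k.
Proof. by rewrite big_split mulr_sumr. Qed.

Lemma term_le_sum F k : (forall k, 0 <= F k) -> F k <= \sum_k F k.
Proof. by move=> F0; rewrite (bigD1 k)//= lerDl sumr_ge0. Qed.

Lemma sum_cvg0 (F : K -> nat -> R) :
  (forall k (e : R), 0 < e -> exists n, forall p, (n <= p)%N -> F k p <= e) ->
  forall e : R, 0 < e -> exists n, forall p, (n <= p)%N -> \sum_k F k p <= e.
Proof.
move=> h e e0; have e1 : 0 < e / (#|K|%:R + 1) by rewrite divr_gt0// ltr_wpDl.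
have /choice[n hn] k := h k _ e1.
exists (\sum_k n k)%N => p np; apply: (@le_trans _ _ (\sum_(k : K) e / (#|K|%:R + 1))).
  by apply: ler_sum => k _; apply: hn; apply: leq_trans np; rewrite (bigD1 k)//= leq_addr.
rewrite sumr_const -[_ *+ _]mulr_natr mulrAC ler_pdivrMr ?ltr_wpDl//.
by rewrite mulrDr mulr1 lerDl ltW.
Qed.

Lemma sum_sqr_le F : (\sum_k F k) ^+ 2 <= #|K|%:R * \sum_k F k ^+ 2.
Proof.
set S := \sum_k F k; set Q := \sum_k F k ^+ 2.
have I j : \sum_k (F j - F k) ^+ 2 = - 2 * S * F j + (#|K|%:R * F j ^+ 2 + Q).
  rewrite (eq_bigr (fun k => (- 2 * F j) * F k + (F j ^+ 2 + F k ^+ 2))); last by move=> k _; ring.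
  by rewrite sum_lin big_split /= sumr_const -/S -/Q -[F j ^+ 2 *+ _]mulr_natl; ring.
have : 0 <= \sum_j \sum_k (F j - F k) ^+ 2.
  by apply: sumr_ge0 => j _; apply: sumr_ge0 => k _; exact: sqr_ge0.
rewrite (eq_bigr _ (fun j _ => I j)) sum_lin sum_lin sumr_const -/S -/Q -[Q *+ _]mulr_natl.
rewrite expr2; lra.
Qed.
End FiniteSums.

Section GraphSpaces.
Context {R : realType} (L Z : R) (N : nat).
Hypothesis Z0 : Z < 0.
Notation mu := (@lebesgue_measure R).
Notation D := (`[L, +oo[%classic : set R).
Notation sq2 := (sq2 L). Notation sip := (sip L). Notation H1s := (H1s L).

(* The component [(j, false)] (resp. [(j, true)]) is the real (resp. imaginary)
   part on the edge [j]. *)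
Definition comp : finType := ('I_N * bool)%type.
Definition field_ : lmodType R := comp -> R -> R^o.
Implicit Types u v w : field_.

Definition L2D u := forall k, sq2 (u k).
Definition L2s u v : R := \sum_k sip (u k) (v k).

Lemma L2_semi : semi_hilbert L2D L2s.
Proof.
split.
- by move=> a u v hu hv k; exact: (sq2_lin a (hu k) (hv k)).
- by move=> k; exact: sq2_0.
- by move=> u v _ _; apply: eq_bigr => k _; exact: sipC.
- by move=> a u v w hu hv hw; rewrite -sum_lin; apply: eq_bigr => k _; exact: sip_lin.
- by move=> u _; apply: sumr_ge0 => k _; exact: sip_ge0.
move=> u hu cau.
have H k : exists2 g, sq2 g & forall e : R, 0 < e -> exists n, forall p, (n <= p)%N ->
     sip (fun x => u p k x - g x) (fun x => u p k x - g x) <= e.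
  apply: riesz_fischer => [n|e e0]; first exact: hu.
  have [n hn] := cau e e0; exists n => p q np nq; apply: le_trans (hn p q np nq).
  exact: (@term_le_sum _ _ (fun k => sip ((u p - u q) k) ((u p - u q) k)) k (fun k => sip_ge0 _ _)).
have /choice[l hl] : forall k, exists g, sq2 g /\ forall e : R, 0 < e -> exists n, forall p, (n <= p)%N ->
     sip (fun x => u p k x - g x) (fun x => u p k x - g x) <= e.
  by move=> k; have [g h1 h2] := H k; exists g.
exists l; first by move=> k; exact: (hl k).1.
by apply: sum_cvg0 => k; exact: (hl k).2.
Qed.

Definition pair_ : lmodType R := (field_ * field_)%type.
Definition H1D (p : pair_) := forall k, H1s (p.1 k) (p.2 k).
(** [H1s_sup] with length [- Z / (4 * N)] bounds the negative vertex term by half of the derivative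
    part plus [8 N ^ 2 / Z ^ 2] times the mass; the extra 1 gives control of the mass itself. *)
Definition lam : R := 1 + 8 * N%:R ^+ 2 / Z ^+ 2.
Definition vsum u (b : bool) : R := \sum_(j < N) u (j, b) L.
(** The form of H + [lam]. It imposes no condition at the vertex: both delta' conditions are natural
    boundary conditions of the term in [Z^-1]. *)
Definition H1a (p q : pair_) : R :=
  L2s p.2 q.2 + lam * L2s p.1 q.1 + Z^-1 * \sum_(b : bool) vsum p.1 b * vsum q.1 b.
Definition H1n (p : pair_) : R := L2s p.1 p.1 + L2s p.2 p.2.

Lemma lam_ge1 : 1 <= lam.
Proof.
by rewrite /lam lerDl; apply: divr_ge0; [apply: mulr_ge0 => //; exact: sqr_ge0|exact: sqr_ge0].
Qed.

Lemma H1D1 (p : pair_) : H1D p -> L2D p.1. Proof. by move=> h k; case: (h k). Qed.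
Lemma H1D2 (p : pair_) : H1D p -> L2D p.2. Proof. by move=> h k; case: (h k). Qed.

Lemma L2s_ge0 u : 0 <= L2s u u.
Proof. by apply: sumr_ge0 => k _; exact: sip_ge0. Qed.

Lemma L2s_term u k : sip (u k) (u k) <= L2s u u.
Proof. exact: (@term_le_sum _ _ (fun k => sip (u k) (u k)) k (fun k => sip_ge0 _ _)). Qed.

Lemma vsum_lin a u v b : vsum (a *: u + v) b = a * vsum u b + vsum v b.
Proof. exact: sum_lin. Qed.

Lemma vsum_le (p : pair_) (l : R) : 0 < l -> H1D p ->
  \sum_(b : bool) vsum p.1 b ^+ 2 <= N%:R * (2 / l * L2s p.1 p.1 + 2 * l * L2s p.2 p.2).
Proof.
move=> l0 hp; apply: (@le_trans _ _ (\sum_(b : bool) N%:R * \sum_(j < N) p.1 (j, b) L ^+ 2)).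
  by apply: ler_sum => b _; have := sum_sqr_le (fun j : 'I_N => p.1 (j, b) L); rewrite card_ord.
rewrite -mulr_sumr ler_wpM2l// exchange_big/=.
rewrite (pair_big xpredT xpredT (fun (j : 'I_N) (b : bool) => p.1 (j, b) L ^+ 2))/=.
rewrite /L2s !mulr_sumr -big_split /=; apply: ler_sum => -[j b] _.
exact: H1s_sup (hp (j, b)) (lexx L) l0.
Qed.

Lemma H1a_ge (p : pair_) : H1D p -> L2s p.2 p.2 / 2 + L2s p.1 p.1 <= H1a p p.
Proof.
move=> hp; have [N0|N1] := posnP N.
  have e u v : L2s u v = 0 by apply: big1 => -[[j hj] b] _; exfalso; rewrite N0 in hj.
  have -> : H1a p p = 0.
    rewrite /H1a !e !mulr0 !add0r big1 ?mulr0// => b _.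
    by rewrite /vsum big1 ?mul0r// => -[j hj]; exfalso; rewrite N0 in hj.
  by rewrite !e mul0r addr0.
have N0 : 0 < N%:R :> R by rewrite ltr0n.
have Zn : 0 < - Z by rewrite oppr_gt0.
have Zn0 : Z != 0 by rewrite lt_eqF.
have l0 : 0 < - Z / (4 * N%:R) by rewrite divr_gt0// mulr_gt0.
have := vsum_le l0 hp; set S := \sum_b vsum p.1 b ^+ 2.
have -> : H1a p p = L2s p.2 p.2 + lam * L2s p.1 p.1 + Z^-1 * S by [].
set A := L2s p.1 p.1; set B := L2s p.2 p.2 => h.
have Zi : Z^-1 < 0 by rewrite invr_lt0.
have : Z^-1 * (N%:R * (2 / (- Z / (4 * N%:R)) * A + 2 * (- Z / (4 * N%:R)) * B)) <= Z^-1 * S by rewrite ler_wnM2l// ltW.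
have -> : Z^-1 * (N%:R * (2 / (- Z / (4 * N%:R)) * A + 2 * (- Z / (4 * N%:R)) * B)) =
  - (8 * N%:R ^+ 2 / Z ^+ 2) * A - B / 2 by field; rewrite Zn0 gt_eqF.
rewrite /lam; lra.
Qed.

Lemma H1a_le (p : pair_) : H1a p p <= lam * H1n p.
Proof.
rewrite /H1a /H1n.
have : Z^-1 * \sum_(b : bool) vsum p.1 b * vsum p.1 b <= 0.
  apply: mulr_le0_ge0; first by rewrite invr_le0 ltW.
  by apply: sumr_ge0 => b _; exact: sqr_ge0.
have := ler_wpM2r (L2s_ge0 p.2) lam_ge1; rewrite mul1r; lra.
Qed.

Lemma H1a_norm (p : pair_) : H1D p -> H1n p <= 2 * H1a p p.
Proof. by move=> /H1a_ge; rewrite /H1n; have := L2s_ge0 p.1; have := L2s_ge0 p.2; lra. Qed.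

Lemma L2s_lin a u v w : L2D u -> L2D v -> L2D w -> L2s (a *: u + v) w = a * L2s u w + L2s v w.
Proof. exact: (shl L2_semi). Qed.

Lemma field_linE a u v k : (a *: u + v) k = (fun x => a * u k x + v k x).
Proof. by []. Qed.

Lemma field_subE u v k : (u - v) k = (fun x => u k x - v k x).
Proof. by []. Qed.

(* Conversion through the product module is too slow unless the pairs are
   destructed first. *)
Lemma pair_lin1 a (p q : pair_) : (a *: p + q).1 = a *: p.1 + q.1.
Proof. by case: p => p1 p2; case: q => q1 q2 /=; reflexivity. Qed.

Lemma pair_lin2 a (p q : pair_) : (a *: p + q).2 = a *: p.2 + q.2.
Proof. by case: p => p1 p2; case: q => q1 q2 /=; reflexivity. Qed.

Lemma pair_sub1 (p q : pair_) : (p - q).1 = p.1 - q.1.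
Proof. by case: p => p1 p2; case: q => q1 q2 /=; reflexivity. Qed.

Lemma pair_sub2 (p q : pair_) : (p - q).2 = p.2 - q.2.
Proof. by case: p => p1 p2; case: q => q1 q2 /=; reflexivity. Qed.

Lemma H1D_lin a (p q : pair_) : H1D p -> H1D q -> H1D (a *: p + q).
Proof.
move=> hp hq k; rewrite pair_lin1 pair_lin2 !field_linE.
exact: (H1s_lin a (hp k) (hq k)).
Qed.

Lemma H1_semi : semi_hilbert H1D H1a.
Proof.
split.
- exact: H1D_lin.
- by move=> k; exact: H1s0.
- move=> p q hp hq; rewrite /H1a (shC L2_semi (H1D2 hp) (H1D2 hq)) (shC L2_semi (H1D1 hp) (H1D1 hq)).
  by congr (_ + _ * _); apply: eq_bigr => b _; exact: mulrC.
- move=> a p q r hp hq hr; rewrite /H1a pair_lin1 pair_lin2.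
  rewrite (L2s_lin a (H1D1 hp) (H1D1 hq) (H1D1 hr)) (L2s_lin a (H1D2 hp) (H1D2 hq) (H1D2 hr)).
  have -> : \sum_b vsum (a *: p.1 + q.1) b * vsum r.1 b =
     a * (\sum_b vsum p.1 b * vsum r.1 b) + \sum_b vsum q.1 b * vsum r.1 b.
    by rewrite -sum_lin; apply: eq_bigr => b _; rewrite vsum_lin; ring.
  ring.
- by move=> p /H1a_ge; have := L2s_ge0 p.1; have := L2s_ge0 p.2; lra.
move=> u hu cau.
have H k : exists f g, H1s f g /\ forall e : R, 0 < e -> exists n, forall p : nat, (n <= p)%N ->
     sip (fun x => (u p).1 k x - f x) (fun x => (u p).1 k x - f x) <= e /\
     sip (fun x => (u p).2 k x - g x) (fun x => (u p).2 k x - g x) <= e.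
  apply: H1s_complete => [n|e e0]; first exact: hu.
  have [n hn] := cau (e / 2) (divr_gt0 e0 (ltr0n _ 2)); exists n => p q np nq.
  have hpq : H1D (u p - u q) by have := H1D_lin (-1) (hu q) (hu p); rewrite scaleN1r addrC.
  have b := le_trans (H1a_norm hpq) (ler_wpM2l (ler0n R 2) (hn p q np nq)).
  have {b} : H1n (u p - u q) <= e by apply: le_trans b _; rewrite mulrC divfK.
  rewrite /H1n pair_sub1 pair_sub2 => b.
  have t1 := L2s_term ((u p).1 - (u q).1) k; have t2 := L2s_term ((u p).2 - (u q).2) k.
  rewrite !field_subE in t1 t2.
  have b1 : L2s ((u p).1 - (u q).1) ((u p).1 - (u q).1) <= e by apply: le_trans b; rewrite lerDl L2s_ge0.
  have b2 : L2s ((u p).2 - (u q).2) ((u p).2 - (u q).2) <= e by apply: le_trans b; rewrite lerDr L2s_ge0.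
  by split; [exact: le_trans t1 b1|exact: le_trans t2 b2].
have /choice[f hf] := H; have /choice[g hg] := hf.
exists ((f, g) : pair_); first by move=> k; case: (hg k).
move=> e e0; have l1 : 0 < e / (2 * lam) by rewrite divr_gt0// mulr_gt0// (lt_le_trans ltr01 lam_ge1).
have c1 k (e' : R) : 0 < e' -> exists n, forall m : nat, (n <= m)%N -> sip (((u m).1 - f) k) (((u m).1 - f) k) <= e'.
  by move=> /(hg k).2[n hn]; exists n => m /hn[]; rewrite field_subE.
have c2 k (e' : R) : 0 < e' -> exists n, forall m : nat, (n <= m)%N -> sip (((u m).2 - g) k) (((u m).2 - g) k) <= e'.
  by move=> /(hg k).2[n hn]; exists n => m /hn[]; rewrite field_subE.
have [n1 h1] := sum_cvg0 c1 l1; have [n2 h2] := sum_cvg0 c2 l1.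
exists (maxn n1 n2) => p; rewrite geq_max => /andP[/h1 b1 /h2 b2].
apply: (le_trans (H1a_le _)); rewrite /H1n pair_sub1 pair_sub2 mulrC -ler_pdivlMr ?(lt_le_trans ltr01 lam_ge1)//.
apply: (le_trans (lerD b1 b2)); rewrite le_eqVlt; apply/orP; left; apply/eqP; field.
by rewrite gt_eqF// (lt_le_trans ltr01 lam_ge1).
Qed.

Definition HH : hilb R := sepH L2_semi.
Definition VV : hilb R := sepH H1_semi.
Definition clsH (u : field_) : HH := sep_cls L2_semi u.
Definition clsV (p : pair_) : VV := sep_cls H1_semi p.
Definition repH (x : HH) : field_ := sep_rep x.
Definition repV (q : VV) : pair_ := sep_rep q.
(** Two representatives of a class agree at every point of [[L, +oo[], by continuity ([clsV_eq]).
    Hence point values make sense on [VV] and identities in [VV] are proved pointwise with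
    [ev_ext]. *)
Definition ev (q : VV) : field_ := (repV q).1.

Lemma repHD x : L2D (repH x). Proof. exact: sep_repD. Qed.
Lemma repVD q : H1D (repV q). Proof. exact: sep_repD. Qed.
Lemma repHK x : clsH (repH x) = x. Proof. exact: sep_repK. Qed.
Lemma repVK q : clsV (repV q) = q. Proof. exact: sep_repK. Qed.
Lemma ipH_cls u v : L2D u -> L2D v -> ip (clsH u) (clsH v) = L2s u v.
Proof. exact: sep_ip_cls. Qed.
Lemma ipV_cls (p q : pair_) : H1D p -> H1D q -> ip (clsV p) (clsV q) = H1a p q.
Proof. exact: sep_ip_cls. Qed.
Lemma clsH_lin a u v : L2D u -> L2D v -> clsH (a *: u + v) = a *: clsH u + clsH v.
Proof. exact: sep_cls_lin. Qed.
Lemma clsV_lin a (p q : pair_) : H1D p -> H1D q -> clsV (a *: p + q) = a *: clsV p + clsV q.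
Proof. exact: sep_cls_lin. Qed.

Definition aeqL (f g : R -> R) := {ae mu, forall x, L <= x -> f x = g x}.

Lemma clsH_eq u v : L2D u -> L2D v -> (clsH u = clsH v <-> forall k, aeqL (u k) (v k)).
Proof.
move=> hu hv; split=> [E k|E].
  have hw : L2D (u - v) by have := shD L2_semi (-1) hv hu; rewrite scaleN1r addrC.
  have : L2s (u - v) (u - v) = 0.
    rewrite -ipH_cls// (_ : clsH (u - v) = 0) ?ip0l//.
    by have := clsH_lin (-1) hv hu; rewrite E !scaleN1r addNr addrC.
  move=> s0; have : sip ((u - v) k) ((u - v) k) = 0.
    apply/eqP; rewrite eq_le sip_ge0 andbT -s0.
    exact: (@term_le_sum _ _ (fun k => sip ((u - v) k) ((u - v) k)) k (fun k => sip_ge0 _ _)).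
  move=> /(sip_ae0 (hw k)); apply: aeS => x h /h; rewrite /= => {}h.
  by apply/eqP; rewrite -subr_eq0; apply/eqP.
apply/sep_eqP => // w hw; apply: eq_bigr => k _; apply: ae_int; [exact: sq2_mul|exact: sq2_mul|].
by apply: aeS (E k) => x h /h ->.
Qed.

Lemma clsV_eq (p q : pair_) : H1D p -> H1D q ->
  (clsV p = clsV q <-> forall k x, L <= x -> p.1 k x = q.1 k x).
Proof.
move=> hp hq; have hr : H1D (p - q) by have := H1D_lin (-1) hq hp; rewrite scaleN1r addrC.
split=> [E k x Lx|E].
  have : H1n (p - q) = 0.
    apply/eqP; rewrite eq_le; apply/andP; split; last by rewrite addr_ge0// L2s_ge0.
    apply: (le_trans (H1a_norm hr)); rewrite -ipV_cls// (_ : clsV (p - q) = 0) ?ip0l ?mulr0//.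
    by have := clsV_lin (-1) hq hp; rewrite E !scaleN1r addNr addrC.
  rewrite /H1n pair_sub1 pair_sub2 => s0.
  have s1 : sip ((p.1 - q.1) k) ((p.1 - q.1) k) = 0.
    apply/eqP; rewrite eq_le sip_ge0 andbT.
    by apply: (le_trans (L2s_term _ k)); rewrite -s0 lerDl L2s_ge0.
  have [a b _] := hr k; rewrite pair_sub1 in a b; have := cont_ae0 a (sip_ae0 b s1) Lx.
  by rewrite field_subE => h; apply/eqP; rewrite -subr_eq0; apply/eqP.
apply/sep_eqP => // r hr'; rewrite /H1a.
have e1 k : aeqL (p.1 k) (q.1 k) by apply: nearW => x; exact: E.
have e2 k : aeqL (p.2 k) (q.2 k).
  have [[lp ap] _ _] := hp k; have [aq _ _] := hq k; apply: AC_uniq aq; split=> // x Lx.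
  by rewrite -!E//; exact: ap.
have i u v w : L2D u -> L2D v -> L2D w -> (forall k, aeqL (u k) (v k)) -> L2s u w = L2s v w.
  move=> hu hv hw e; apply: eq_bigr => k _; apply: ae_int; [exact: sq2_mul|exact: sq2_mul|].
  by apply: aeS (e k) => x h /h ->.
rewrite (i p.2 q.2)//; try exact: H1D2.
rewrite (i p.1 q.1)//; try exact: H1D1.
by congr (_ + _ * _); apply: eq_bigr => b _; congr (_ * _); apply: eq_bigr => j _; apply: E.
Qed.

Lemma evE (p : pair_) k x : H1D p -> L <= x -> ev (clsV p) k x = p.1 k x.
Proof. by move=> hp; apply: (clsV_eq (repVD _) hp).1; exact: repVK. Qed.
Lemma ev_lin a q r k x : L <= x -> ev (a *: q + r) k x = a * ev q k x + ev r k x.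
Proof.
move=> Lx; rewrite -{1}(repVK q) -{1}(repVK r) -clsV_lin; try exact: repVD.
have h : H1D (a *: repV q + repV r) by apply: H1D_lin; exact: repVD.
by rewrite (evE k h Lx) pair_lin1 field_linE.
Qed.
Lemma ev_ext q r : (forall k x, L <= x -> ev q k x = ev r k x) -> q = r.
Proof. by move=> h; rewrite -(repVK q) -(repVK r); apply/clsV_eq => //; exact: repVD. Qed.

End GraphSpaces.

(** * Embedding, resolvent and complex structure of the graph spaces *)

Section Operators.
Context {R : realType} (L Z : R) (N : nat).
Hypothesis Z0 : Z < 0.
Notation mu := (@lebesgue_measure R).
Notation D := (`[L, +oo[%classic : set R).
Notation sq2 := (sq2 L). Notation sip := (sip L). Notation H1s := (H1s L).
Notation HH := (HH L N). Notation VV := (VV L N Z0).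
Notation clsH := (@clsH R L N). Notation clsV := (@clsV R L Z N Z0).
Notation L2D := (@L2D R L N). Notation H1D := (@H1D R L N).
Notation L2s := (@L2s R L N). Notation H1a := (@H1a R L Z N).
Notation comp := (comp N). Notation field_ := (@field_ R N). Notation lam := (lam Z N).

Lemma L2s_pair (u v : field_) :
  L2s u v = \sum_(j < N) (sip (u (j, false)) (v (j, false)) + sip (u (j, true)) (v (j, true))).
Proof.
rewrite /L2s (eq_bigr (fun j => \sum_(b : bool) sip (u (j, b)) (v (j, b)))); last first.
  by move=> j _; rewrite big_bool addrC.
by rewrite pair_bigA /=; apply: eq_bigr => -[j b] _.
Qed.

Lemma H1a_L2 (p : pair_ N) : H1D p -> L2s p.1 p.1 <= H1a p p.
Proof. by move=> /(H1a_ge Z0); apply: le_trans; rewrite lerDr divr_ge0// L2s_ge0. Qed.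

Lemma evD (q : VV) : L2D (ev q). Proof. exact: H1D1 (repVD q). Qed.
Lemma L2D_lin a (u v : field_) : L2D u -> L2D v -> L2D (a *: u + v).
Proof. exact: (shD (L2_semi L N)). Qed.

Definition iot (q : VV) : HH := clsH (ev q).

Lemma ae_on (f g : R -> R) : (forall x, L <= x -> f x = g x) -> aeqL L f g.
Proof. by move=> h; apply: nearW => x; exact: h. Qed.

Lemma iot_lin : linear iot.
Proof.
move=> a q r; rewrite /iot -clsH_lin; try exact: evD.
apply/clsH_eq; [exact: evD|by apply: L2D_lin; exact: evD|move=> k].
by apply: ae_on => x Lx; rewrite ev_lin.
Qed.
Lemma iot_cls p : H1D p -> iot (clsV p) = clsH p.1.
Proof.
move=> hp; apply/clsH_eq; [exact: evD|exact: H1D1 hp|move=> k].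
by apply: ae_on => x Lx; rewrite evE.
Qed.
Lemma ip_iot q r : ip (iot q) (iot r) = L2s (ev q) (ev r).
Proof. by apply: ipH_cls; exact: evD. Qed.
Lemma ipV (q r : VV) : ip q r = H1a (repV q) (repV r).
Proof. by rewrite -{1}(repVK q) -{1}(repVK r); apply: ipV_cls; exact: repVD. Qed.
Lemma iot_ip q : ip (iot q) (iot q) <= ip q q.
Proof. by rewrite ip_iot ipV; apply: H1a_L2; exact: repVD. Qed.
Lemma iot_nrm q : nrm (iot q) <= nrm q.
Proof. by apply: nrm_le; rewrite ?nrm_ge0// nrm2 iot_ip. Qed.
Lemma iot_nrm1 q : nrm (iot q) <= 1 * nrm q. Proof. by rewrite mul1r iot_nrm. Qed.

Lemma iot_inj q : iot q = 0 -> q = 0.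
Proof.
move=> h; have s0 : L2s (ev q) (ev q) = 0 by rewrite -ip_iot h ip0l.
have e k : aeqL L (ev q k) (fun=> 0).
  apply: (sip_ae0 (evD q k)); apply/eqP; rewrite eq_le sip_ge0 andbT -s0; exact: L2s_term.
have a k := let: And3 a _ _ := repVD q k in a.
apply: ev_ext => k x Lx; have -> : ev q k x = 0 := cont_ae0 (a k) (e k) Lx.
have := ev_lin 0 q 0 k Lx; rewrite scale0r addr0 mul0r add0r => E.
by have := ev_lin (-1) (0 : VV) 0 k Lx; rewrite scaler0 addr0; lra.
Qed.

Lemma riesz_iot (x : HH) : exists y : VV, forall q, ip x (iot q) = ip y q.
Proof.
apply: (@riesz _ _ (fun q => ip x (iot q)) (nrm x)).
- by move=> q r; rewrite (linD iot_lin) ipE.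
- by move=> a q; rewrite (linZ iot_lin) ipE.
- by move=> q; apply: (le_trans (CS _ _)); rewrite ler_wpM2l ?nrm_ge0 ?iot_nrm.
Qed.
(** Adjoint of the embedding [iot] for the energy inner product: [adj x] is the weak solution of
    [(H + lam) y = x]. The two compositions with [iot] are the resolvent on L^2 and on the energy
    space. *)
Definition adj (x : HH) : VV := xget 0 [set y | forall q, ip x (iot q) = ip y q].
Lemma adjP x q : ip (adj x) q = ip x (iot q).
Proof. by rewrite /adj; case: xgetP => [y _ ->//|h]; have [y hy] := riesz_iot x; case: (h y). Qed.
Lemma adj_lin : linear adj.
Proof. by move=> a x y; apply: ip_ext => q; rewrite adjP !ipDl !ipZl !adjP. Qed.
Lemma adj_nrm x : nrm (adj x) <= nrm x.
Proof.
have [/eqP|n0] := boolP (nrm (adj x) == 0); first by move=> ->; exact: nrm_ge0.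
have n1 : 0 < nrm (adj x) by rewrite lt_neqAle eq_sym n0 nrm_ge0.
rewrite -(ler_pM2r n1) -expr2 nrm2 adjP; apply: (le_trans (ip_le _ _)).
by rewrite ler_wpM2l ?nrm_ge0 ?iot_nrm.
Qed.
Lemma BHlin : linear (fun x => iot (adj x)).
Proof. by move=> a x y; rewrite adj_lin iot_lin. Qed.
Lemma BVlin : linear (fun q => adj (iot q)).
Proof. by move=> a x y; rewrite iot_lin adj_lin. Qed.
Definition BH : {linear HH -> HH} := lin_of BHlin.
Definition BV : {linear VV -> VV} := lin_of BVlin.
Lemma BHE x : BH x = iot (adj x). Proof. by []. Qed.
Lemma BVE q : BV q = adj (iot q). Proof. by []. Qed.

Definition Jf (u : field_) : field_ := fun k x => if k.2 then u (k.1, false) x else - u (k.1, true) x.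
Lemma Jf_lin a (u v : field_) : Jf (a *: u + v) = a *: Jf u + Jf v.
Proof.
apply/funext => -[j b]; apply/funext => x; rewrite /Jf !fctE /=; case: b => //=.
by rewrite opprD scalerN.
Qed.
Lemma JfJf u : Jf (Jf u) = - u.
Proof. by apply/funext => -[j b]; apply/funext => x; rewrite /Jf !fctE /=; case: b. Qed.
Lemma sq2N f : sq2 f -> sq2 (fun x => - f x).
Proof. by move=> h; have := sq2Z (-1) h; congr sq2; apply/funext => x; rewrite mulN1r. Qed.
Lemma H1sN f g : H1s f g -> H1s (fun x => - f x) (fun x => - g x).
Proof.
move=> h; have := H1s_lin (-1) h (H1s0 L); congr H1s; apply/funext => x; rewrite mulN1r addr0//.
Qed.
Lemma JfL2 u : L2D u -> L2D (Jf u).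
Proof. by move=> h [j []]; [exact: h|exact: sq2N (h (j, true))]. Qed.
Lemma Jf_L2s u v : L2s (Jf u) (Jf v) = L2s u v.
Proof.
rewrite !L2s_pair; apply: eq_bigr => j _; rewrite addrC; congr (_ + _).
by apply: int_eq => x _; rewrite /Jf /=; ring.
Qed.
Lemma Jf_ae u v : (forall k, aeqL L (u k) (v k)) -> forall k, aeqL L (Jf u k) (Jf v k).
Proof.
move=> h [j []]; first exact: h.
by apply: aeS (h (j, true)) => x hx Lx; rewrite /Jf /= hx.
Qed.
Lemma JfH1 p : H1D p -> H1D ((Jf p.1, Jf p.2) : pair_ N).
Proof. by move=> h [j []] /=; [exact: h|exact: H1sN (h (j, true))]. Qed.
Lemma vsumJ u b : vsum L (Jf u) b = if b then vsum L u false else - vsum L u true.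
Proof. by case: b => //=; rewrite /vsum /Jf /= sumrN. Qed.

Definition JHf (x : HH) : HH := clsH (Jf (repH x)).
Lemma JH_cls u : L2D u -> JHf (clsH u) = clsH (Jf u).
Proof.
move=> hu; apply/clsH_eq; [apply: JfL2; exact: repHD|exact: JfL2|apply: Jf_ae].
by apply/clsH_eq => //; [exact: repHD|exact: repHK].
Qed.
Lemma JH_lin : linear JHf.
Proof.
move=> a x y; rewrite /JHf -clsH_lin; try by apply: JfL2; exact: repHD.
rewrite -Jf_lin -(JH_cls (L2D_lin a (repHD x) (repHD y))).
by rewrite (clsH_lin _ (repHD x) (repHD y)) !repHK.
Qed.
Definition JH : {linear HH -> HH} := lin_of JH_lin.

Definition JVf (q : VV) : VV := clsV (Jf (repV q).1, Jf (repV q).2).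
Lemma evJ q k x : L <= x -> ev (JVf q) k x = Jf (ev q) k x.
Proof. by move=> Lx; rewrite evE//; apply: JfH1; exact: repVD. Qed.
Lemma JV_lin : linear JVf.
Proof.
move=> a q r; apply: ev_ext => -[j b] x Lx; rewrite ev_lin// !evJ// /Jf /=.
by case: b; rewrite ev_lin//; ring.
Qed.
Definition JV : {linear VV -> VV} := lin_of JV_lin.

Lemma JV_ip q r : ip (JV q) (JV r) = ip q r.
Proof.
rewrite [LHS](ipV_cls Z0 (JfH1 (repVD q)) (JfH1 (repVD r))) ipV /H1a /= !Jf_L2s.
congr (_ + _ * _); rewrite !big_bool /= !vsumJ /=; ring.
Qed.

Lemma iotJ q : iot (JV q) = JH (iot q).
Proof.
rewrite [RHS]JH_cls; last exact: evD.
apply/clsH_eq; [exact: evD|by apply: JfL2; exact: evD|move=> k].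
by apply: ae_on => x Lx; rewrite evJ.
Qed.

Lemma JH_ip x y : ip (JH x) (JH y) = ip x y.
Proof.
rewrite [LHS]ipH_cls; try by apply: JfL2; exact: repHD.
by rewrite Jf_L2s -ipH_cls ?repHK; try exact: repHD.
Qed.

Lemma JHJH x : JH (JH x) = - x.
Proof.
have -> : JH (JH x) = clsH (Jf (Jf (repH x))) := JH_cls (JfL2 (repHD x)).
have E0 : clsH 0 = 0 := sep_cls0 (L2_semi L N).
rewrite JfJf -scaleN1r -[-1 *: _]addr0 (clsH_lin _ (repHD x) (sh0 (L2_semi L N))) E0 repHK.
by rewrite addr0 scaleN1r.
Qed.

Lemma JVJV q : JV (JV q) = - q.
Proof.
apply: ev_ext => -[j b] x Lx; rewrite evJ// /Jf /=.
have E k : ev (- q) k x = - ev q k x.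
  have := ev_lin (-1) q 0 k Lx; have := ev_lin 0 q 0 k Lx.
  by rewrite scale0r addr0 mul0r add0r scaleN1r addr0; have := ev_lin (-1) (0 : VV) 0 k Lx; rewrite scaler0 addr0; lra.
by case: b; rewrite evJ// E.
Qed.

Lemma adjJ x : adj (JH x) = JV (adj x).
Proof.
apply: ip_ext => q; rewrite adjP.
have -> : ip (JV (adj x)) q = - ip (adj x) (JV q).
  by rewrite -(JV_ip (adj x) (JV q)) JVJV !ipE opprK.
rewrite adjP iotJ.
by rewrite -(JH_ip x (JH (iot q))) JHJH !ipE opprK.
Qed.

(** Density of the energy space in L^2, tested with functions supported on a single component; it
    gives the injectivity of [BH]. *)
Lemma sq2_dense (x : HH) : (forall q : VV, ip x (iot q) = 0) -> x = 0.
Proof.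
move=> h; rewrite -(repHK x) -(sep_cls0 (L2_semi L N)); apply/clsH_eq.
- exact: repHD.
- exact: sh0 (L2_semi L N).
move=> k; apply: (H1s_dense (repHD x k)) => f g hfg f0.
pose p : pair_ N := ((fun k' => if k' == k then f else fun=> 0), (fun k' => if k' == k then g else fun=> 0)).
have hp : H1D p by move=> k' /=; case: (k' == k) => //; exact: H1s0.
have := h (clsV p); rewrite iot_cls// -{1}(repHK x) ipH_cls; [|exact: repHD|exact: H1D1 hp].
rewrite /L2s (bigD1 k)//= eqxx big1 ?addr0// => k' /negPf /= ->.
by rewrite /sip (@int_eq _ _ _ (fun=> 0)) ?Rintegral_cst ?mul0r// => t _; rewrite mulr0.
Qed.

Lemma admH : admissible JH BH.
Proof.
split.
- exact: JHJH.
- exact: JH_ip.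
- by move=> x; rewrite !BHE adjJ iotJ.
- by move=> x y; rewrite ipC BHE -(adjP y) BHE -(adjP x) ipC.
- by move=> x; rewrite ipC BHE -(adjP x) ip_ge0.
- move=> x; rewrite ipC BHE -(adjP x) -!nrm2 ler_sqr ?nnegrE ?nrm_ge0//; exact: adj_nrm.
- move=> x; rewrite BHE => /iot_inj a0; apply: sq2_dense => q.
  by rewrite -adjP a0 ip0l.
Qed.

Lemma admV : admissible JV BV.
Proof.
split.
- exact: JVJV.
- exact: JV_ip.
- by move=> x; rewrite !BVE iotJ adjJ.
- by move=> x y; rewrite !BVE adjP [RHS]ipC adjP ipC.
- by move=> x; rewrite BVE adjP ip_ge0.
- by move=> x; rewrite BVE adjP iot_ip.
- by move=> x; rewrite BVE => a0; apply: iot_inj; apply: (ip_eq0); rewrite -adjP a0 ip0l.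
Qed.

Lemma massE q : mass BV q = L2s (ev q) (ev q).
Proof. by rewrite /mass BVE adjP ip_iot. Qed.
Lemma ipBE q r : ip (BV q) r = L2s (ev q) (ev r).
Proof. by rewrite BVE adjP ip_iot. Qed.

(** The groups are built separately by [stone]; the image under [iot] of the energy group solves the
    L^2 equation, so [group_unique] identifies it with the other. *)
Lemma groups : exists TH TV, [/\ unitary_group JH BH lam TH, unitary_group JV BV lam TV &
  forall t q, iot (TV t q) = TH t (iot q)].
Proof.
have [TH gH] := stone lam admH; have [TV gV] := stone lam admV.
exists TH, TV; split=> // t q; apply/eqP; rewrite -subr_eq0; apply/eqP; apply: (admBinj admH).
rewrite (linearB BH); apply/eqP; rewrite subr_eq0; apply/eqP; rewrite -(ugB gH) -{2}(ug0 gV q).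
apply: (group_unique (k := fun t => iot (TV t q)) gH) => s.
have E r : BH (iot r) = iot (BV r) by [].
apply: (@eq_der _ _ (fun s => iot (TV s (BV q)))) => [r|]; first by rewrite E (ugB gV).
have -> : - JH (iot (TV s q) - lam *: BH (iot (TV s q))) = iot (- JV (TV s (q - lam *: BV q))).
  rewrite E -(linZ iot_lin) -(linB iot_lin) -iotJ -(linN iot_lin).
  by rewrite (linB (ug_lin gV s)) (linZ (ug_lin gV s)) (ugB gV).
exact: der_op iot_lin iot_nrm1 (ug_der gV q s).
Qed.

End Operators.

(** * The cubic term *)

Section Algebra.
Context {R : realType} (L : R).
Notation sq2 := (sq2 L). Notation sip := (sip L). Notation H1s := (H1s L).
Implicit Types f g : R -> R.

(** A bound of the H^1 norm that hides the derivative, so that products are estimated without naming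
    theirs. *)
Definition bdH f (M : R) := exists2 g, H1s f g & sip f f + sip g g <= M ^+ 2.

Lemma bdH_sup f M x : 0 <= M -> bdH f M -> L <= x -> `|f x| <= 2 * M.
Proof.
move=> M0 [g hg b] Lx; have := H1s_sup hg Lx ltr01; rewrite divr1 mulr1 -mulrDr => h.
rewrite -[leRHS]ger0_norm ?mulr_ge0// -ler_sqr ?nnegrE// !real_normK ?num_real//.
apply: (le_trans h); rewrite exprMn; have := ler_wpM2l (ler0n R 2) b; have := sqr_ge0 M; lra.
Qed.

Lemma sip_sum_le f g : sq2 f -> sq2 g ->
  sip (fun x => f x + g x) (fun x => f x + g x) <= 2 * sip f f + 2 * sip g g.
Proof.
move=> hf hg; rewrite /sip -!intZ// -?intD//; first last.
- exact: sq2_mul.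
- exact: sq2_mul.
- by apply: itgZ => //; exact: sq2_mul.
- by apply: itgZ => //; exact: sq2_mul.
apply: int_le => //.
- by apply: sq2_mul; exact: sq2D.
- by apply: itgD => //; apply: itgZ => //; exact: sq2_mul.
- by move=> x _; have := sqr_ge0 (f x - g x); rewrite sqrrB; lra.
Qed.

Lemma sip_mul_le f g C : 0 <= C -> measurable_fun `[L, +oo[ f -> (forall x, L <= x -> `|f x| <= C) -> sq2 g ->
  sip (fun x => f x * g x) (fun x => f x * g x) <= C ^+ 2 * sip g g.
Proof.
move=> C0 mf fC hg; rewrite /sip -intZ//; last exact: sq2_mul.
apply: int_le => //.
- by have hh := sq2_bdd_mul mf fC hg; exact: (sq2_mul hh hh).
- by apply: itgZ => //; exact: sq2_mul.
- move=> x; rewrite /= in_itv /= andbT => Lx.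
  rewrite (_ : _ * _ = f x ^+ 2 * (g x * g x)); last by ring.
  apply: ler_wpM2r; first exact: sqr_ge0.
  by rewrite -[f x ^+ 2]real_normK ?num_real// ler_sqr ?nnegrE ?fC.
Qed.

(** The sup bounds [2 * M] and [2 * M'] give 4 for the product and [2 * (4 + 4)] for its derivative,
    in units of [(M * M') ^ 2]; their sum 20 is below [6 ^ 2]. *)
Lemma bdH_mul f g M M' : 0 <= M -> 0 <= M' -> bdH f M -> bdH g M' ->
  bdH (fun x => f x * g x) (6 * (M * M')).
Proof.
move=> M0 M0' bf bg; have sf := fun x => bdH_sup (x := x) M0 bf; have sg := fun x => bdH_sup (x := x) M0' bg.
have [f' hf nf] := bf; have [g' hg ng] := bg.
have [af qf qf'] := hf; have [ag qg qg'] := hg.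
exists (fun x => f' x * g x + f x * g' x); first exact: H1s_mul.
have M2 : 0 <= 2 * M by rewrite mulr_ge0. have M2' : 0 <= 2 * M' by rewrite mulr_ge0.
have b1 := sip_mul_le M2 (AC_meas af) sf qg.
have b2 := sip_mul_le M2 (AC_meas af) sf qg'.
have b3 := sip_mul_le M2' (AC_meas ag) sg qf'.
have e3 : (fun x => g x * f' x) = (fun x => f' x * g x) by apply/funext => x; exact: mulrC.
rewrite e3 in b3.
have s1 : sq2 (fun x => f' x * g x) by rewrite -e3; exact: sq2_bdd_mul (AC_meas ag) sg qf'.
have s2 : sq2 (fun x => f x * g' x) by exact: sq2_bdd_mul (AC_meas af) sf qg'.
have := sip_sum_le s1 s2.
have c1 : (2 * M) ^+ 2 * sip g g <= 4 * (M * M') ^+ 2.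
  rewrite !exprMn -natrX -mulrA ler_wpM2l// ler_wpM2l ?sqr_ge0//.
  by apply: le_trans ng; rewrite lerDl sip_ge0.
have c2 : (2 * M) ^+ 2 * sip g' g' <= 4 * (M * M') ^+ 2.
  rewrite !exprMn -natrX -mulrA ler_wpM2l// ler_wpM2l ?sqr_ge0//.
  by apply: le_trans ng; rewrite lerDr sip_ge0.
have c3 : (2 * M') ^+ 2 * sip f' f' <= 4 * (M * M') ^+ 2.
  rewrite [M * M']mulrC !exprMn -natrX -mulrA ler_wpM2l// ler_wpM2l ?sqr_ge0//.
  by apply: le_trans nf; rewrite lerDr sip_ge0.
move: b1 b2 b3 c1 c2 c3; rewrite [(6 * _) ^+ 2]exprMn.
have := sqr_ge0 (M * M'); set W := (M * M') ^+ 2.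
set t1 := _ * sip g g; set t2 := _ * sip g' g'; set t3 := _ * sip f' f'.
set u1 := sip _ _; set u2 := sip _ _; set u3 := sip _ _; set u4 := sip _ _; lra.
Qed.

Lemma bdH_add f g M M' : 0 <= M -> 0 <= M' -> bdH f M -> bdH g M' ->
  bdH (fun x => f x + g x) (2 * (M + M')).
Proof.
move=> M0 M0' [f' hf nf] [g' hg ng].
have [af qf qf'] := hf; have [ag qg qg'] := hg.
exists (fun x => f' x + g' x).
  by have := H1s_lin 1 hf hg; congr H1s; apply/funext => x; rewrite mul1r.
have := sip_sum_le qf qg; have := sip_sum_le qf' qg'.
have := mulr_ge0 M0 M0'; rewrite [(2 * _) ^+ 2]exprMn sqrrD.
have := sqr_ge0 M; have := sqr_ge0 M'; lra.
Qed.

Lemma bdH_scale (a : R) f M : 0 <= M -> bdH f M -> bdH (fun x => a * f x) (`|a| * M).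
Proof.
move=> M0 [f' hf nf]; have [af qf qf'] := hf.
have E (h : R -> R) : sq2 h -> sip (fun x => a * h x) (fun x => a * h x) = a ^+ 2 * sip h h.
  move=> qh; rewrite /sip -intZ//; last exact: sq2_mul.
  by apply: int_eq => x _; ring.
exists (fun x => a * f' x).
  by have := H1s_lin a hf (H1s0 L); congr H1s; apply/funext => x; rewrite addr0.
by rewrite !E// -mulrDr exprMn real_normK ?num_real// ler_wpM2l ?sqr_ge0.
Qed.
End Algebra.

Section Cubic.
Context {R : realType} (L Z : R) (N : nat).
Hypothesis Z0 : Z < 0.
Notation sq2 := (sq2 L). Notation sip := (sip L). Notation H1s := (H1s L).
Notation HH := (HH L N). Notation VV := (VV L N Z0).
Notation clsV := (@clsV R L Z N Z0).
Notation H1D := (@H1D R L N). Notation bdH := (bdH L).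
Notation L2s := (@L2s R L N). Notation H1a := (@H1a R L Z N).
Notation comp := (comp N). Notation field_ := (@field_ R N). Notation lam := (lam Z N).
Notation JV := (JV L N Z0). Notation BV := (BV L N Z0).

(** A total map, so that formulas for functions define vectors without carrying a proof of
    membership; by [toVP] the choice of derivative is immaterial. *)
Definition toV (f : field_) : VV := clsV (xget 0 [set p | H1D p /\ p.1 = f]).
Lemma toVP (f : field_) (g : field_) : (forall k, H1s (f k) (g k)) -> toV f = clsV (f, g).
Proof.
move=> hg; have hp : H1D ((f, g) : pair_ N) by exact: hg.
rewrite /toV; case: xgetP => [p _ [hp' E]|h]; last by case: (h (f, g)).
by apply/clsV_eq => // k x Lx; rewrite E.
Qed.
Lemma ev_toV f k x : (forall k, exists M, bdH (f k) M) -> L <= x -> ev (toV f) k x = f k x.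
Proof.
move=> h Lx; have /choice[g hg] : forall k, exists g, H1s (f k) g.
  by move=> k'; have [M [g hg _]] := h k'; exists g.
by rewrite (toVP hg) evE.
Qed.
Lemma lam0 : 0 <= lam. Proof. exact: le_trans ler01 (lam_ge1 Z N). Qed.
Lemma toV_nrm f M : 0 <= M -> (forall k, bdH (f k) M) -> nrm (toV f) <= (1 + lam * #|comp|%:R) * M.
Proof.
move=> M0 h; have l0 := lam0.
have /choice[g hg] : forall k, exists g, H1s (f k) g /\ sip (f k) (f k) + sip g g <= M ^+ 2.
  by move=> k'; have [g h1 h2] := h k'; exists g.
have hg1 k : H1s (f k) (g k) by case: (hg k).
have c0 : 0 <= lam * #|comp|%:R by rewrite mulr_ge0.
apply: nrm_le; first by rewrite mulr_ge0// addr_ge0.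
have hp : H1D ((f, g) : pair_ N) by exact: hg1.
rewrite (toVP hg1) (ipV_cls Z0 hp hp); apply: (le_trans (H1a_le _ Z0 _)).
have : H1n L ((f, g) : pair_ N) <= #|comp|%:R * M ^+ 2.
  rewrite /H1n /L2s -big_split /= mulr_natl -sumr_const; apply: ler_sum => k _.
  by case: (hg k).
move=> /(ler_wpM2l l0) b; apply: (le_trans b); rewrite exprMn mulrA ler_wpM2r ?sqr_ge0//.
by rewrite expr2; move: c0; set c := lam * _ => c0; have := mulr_ge0 c0 c0; lra.
Qed.

Lemma ev_bdH (q : VV) k : bdH (ev q k) (2 * nrm q).
Proof.
exists ((repV q).2 k); first exact: repVD.
rewrite exprMn nrm2 ipV; have := H1a_norm Z0 (repVD q); rewrite /H1n.
have := L2s_term L (repV q).1 k; have := L2s_term L (repV q).2 k.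
have := ip_ge0 q; rewrite ipV -/(ev q); lra.
Qed.
Lemma ev_sup (q : VV) k x : L <= x -> `|ev q k x| <= 4 * nrm q.
Proof.
move=> Lx; have := bdH_sup _ (ev_bdH q k) Lx.
have -> : 2 * (2 * nrm q) = 4 * nrm q by ring.
by apply; rewrite mulr_ge0 ?nrm_ge0.
Qed.

Definition dot (u v : field_) (j : 'I_N) (x : R) : R :=
  u (j, false) x * v (j, false) x + u (j, true) x * v (j, true) x.
(** Real polarization of [|u|^2 u], the product [dot] being the real inner product of the two
    complex values. *)
Definition mf (u v w : field_) : field_ := fun k x =>
  3^-1 * ((dot u v k.1 x * w k x + dot v w k.1 x * u k x) + dot u w k.1 x * v k x).
Definition mV (u v w : VV) : VV := toV (mf (ev u) (ev v) (ev w)).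

Lemma dot_bdH : exists2 C : R, 0 <= C &
  forall (u v : VV) j, bdH (dot (ev u) (ev v) j) (C * (nrm u * nrm v)).
Proof.
exists (2 * (6 * 4 + 6 * 4)); first by rewrite mulr_ge0// addr_ge0.
move=> u v j; have u0 := nrm_ge0 u; have v0 := nrm_ge0 v; have uv0 := mulr_ge0 u0 v0.
have u2 : 0 <= 2 * nrm u by rewrite mulr_ge0. have v2 : 0 <= 2 * nrm v by rewrite mulr_ge0.
have b k := bdH_mul u2 v2 (ev_bdH u k) (ev_bdH v k).
have m0 : 0 <= 6 * (2 * nrm u * (2 * nrm v)) by rewrite mulr_ge0// mulr_ge0.
have := bdH_add m0 m0 (b (j, false)) (b (j, true)).
by congr bdH; ring.
Qed.

Lemma mf_bdH : exists2 C : R, 0 <= C &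
  forall (u v w : VV) k, bdH (mf (ev u) (ev v) (ev w) k) (C * (nrm u * nrm v * nrm w)).
Proof.
have [C C0 hC] := dot_bdH; pose C1 := 12 * C; have C10 : 0 <= C1 by rewrite mulr_ge0.
exists (3^-1 * (10 * C1)); first by rewrite !mulr_ge0.
move=> u v w k; have u0 := nrm_ge0 u; have v0 := nrm_ge0 v; have w0 := nrm_ge0 w.
have T (a b c : VV) : bdH (fun x => dot (ev a) (ev b) k.1 x * ev c k x) (C1 * (nrm a * nrm b * nrm c)).
  have a0 := nrm_ge0 a; have b0 := nrm_ge0 b; have c0 := nrm_ge0 c; have ab := mulr_ge0 a0 b0.
  have m1 : 0 <= C * (nrm a * nrm b) by rewrite mulr_ge0. have m2 : 0 <= 2 * nrm c by rewrite mulr_ge0.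
  have := bdH_mul m1 m2 (hC a b k.1) (ev_bdH c k).
  by rewrite /C1; congr bdH; ring.
have W0 : 0 <= nrm u * nrm v * nrm w by rewrite !mulr_ge0.
have T1 := T u v w; have T2 := T v w u; have T3 := T u w v.
have e2 : nrm v * nrm w * nrm u = nrm u * nrm v * nrm w by ring.
have e3 : nrm u * nrm w * nrm v = nrm u * nrm v * nrm w by ring.
rewrite e2 in T2; rewrite e3 in T3; set W := nrm u * nrm v * nrm w in W0 T1 T2 T3 *.
have m1 : 0 <= C1 * W by rewrite mulr_ge0.
have s12 := bdH_add m1 m1 T1 T2; have m2 : 0 <= 2 * (C1 * W + C1 * W) by rewrite mulr_ge0// addr_ge0.
have s := bdH_add m2 m1 s12 T3.
have m3 : 0 <= 2 * (2 * (C1 * W + C1 * W) + C1 * W) by rewrite mulr_ge0// addr_ge0.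
have E : 3^-1 * (10 * C1) * W = 3^-1 * (2 * (2 * (C1 * W + C1 * W) + C1 * W)) by ring.
by have := bdH_scale 3^-1 m3 s; rewrite E ger0_norm ?invr_ge0.
Qed.

Lemma evm u v w k x : L <= x -> ev (mV u v w) k x = mf (ev u) (ev v) (ev w) k x.
Proof. by have [C _ hC] := mf_bdH; apply: ev_toV => k'; eexists; exact: hC. Qed.

Lemma evZ (a : R) (q : VV) k x : L <= x -> ev (a *: q) k x = a * ev q k x.
Proof.
move=> Lx; have := ev_lin a q 0 k Lx; have := ev_lin (-1) (0 : VV) 0 k Lx.
by rewrite scaler0 !addr0; lra.
Qed.
Lemma evD_ (q r : VV) k x : L <= x -> ev (q + r) k x = ev q k x + ev r k x.
Proof. by move=> Lx; have := ev_lin 1 q r k Lx; rewrite scale1r mul1r. Qed.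

Lemma m_sq2 (u v w : VV) k : sq2 (mf (ev u) (ev v) (ev w) k).
Proof. by have [C _ hC] := mf_bdH; have [g [_ h _] _] := hC u v w k. Qed.

Lemma L2s_int (u v : field_) : L2D L u -> L2D L v ->
  L2s u v = \sum_(j < N) \int[lebesgue_measure]_(x in `[L, +oo[) dot u v j x.
Proof.
by move=> hu hv; rewrite L2s_pair; apply: eq_bigr => j _; rewrite /sip -intD//; exact: sq2_mul.
Qed.

Lemma dot_itg (u v : field_) j : L2D L u -> L2D L v -> itg `[L, +oo[ (dot u v j).
Proof. by move=> hu hv; apply: itgD => //; exact: sq2_mul. Qed.

Lemma L2s_evm u v w (z : field_) : L2s (ev (mV u v w)) z = L2s (mf (ev u) (ev v) (ev w)) z.
Proof.
apply: eq_bigr => k _; apply: int_eq => x; rewrite /= in_itv /= andbT => Lx.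
by rewrite evm.
Qed.

Lemma six_terms (a1 a2 a3 a4 a5 a6 w c : R) : 0 <= w -> 0 <= c ->
  `|a1| <= 16 * w -> `|a2| <= 16 * w -> `|a3| <= 16 * w -> `|a4| <= 16 * w ->
  `|a5| <= 16 * w -> `|a6| <= 16 * w ->
  `|3^-1 * (a1 + a2) + 2 / 3 * (a3 + a4 + a5 + a6)| <= c + 64 * w.
Proof.
move=> w0 c0.
by rewrite !ler_norml => /andP[? ?] /andP[? ?] /andP[? ?] /andP[? ?] /andP[? ?] /andP[? ?]; apply/andP; split; lra.
Qed.

(** [C1] is the constant of the norm estimate, so that [cf_nrm] and [cf_B] hold with the single
    constant [C1 + 64]. *)
Lemma cubic_pointwise (U V a b c d x y C1 : R) : 0 <= U -> 0 <= V -> 0 <= C1 ->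
  `|a| <= 4 * U -> `|b| <= 4 * U -> `|c| <= 4 * V -> `|d| <= 4 * V ->
  `|3^-1 * ((a * c + b * d) * x + (c * x + d * y) * a + (a * x + b * y) * c) * x +
    3^-1 * ((a * c + b * d) * y + (c * x + d * y) * b + (a * x + b * y) * d) * y| <=
  (C1 + 64) * U * V * (x * x + y * y).
Proof.
move=> U0 V0 C0 ha hb hc hd; have UV := mulr_ge0 U0 V0.
have P (p q : R) : `|p| <= 4 * U -> `|q| <= 4 * V -> `|p * q| <= 16 * (U * V).
  by move=> hp hq; rewrite normrM; apply: (le_trans (ler_pM _ _ hp hq)) => //; lra.
have xy : 0 <= x * x + y * y by rewrite addr_ge0// -expr2 sqr_ge0.
have h1 : `|x * y| * 2 <= x * x + y * y.
  rewrite normrM; have := sqr_ge0 (`|x| - `|y|); rewrite sqrrB !real_normK ?num_real//; rewrite !expr2; lra.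
set W := U * V in UV P; set S := x * x + y * y in xy h1.
have E : 3^-1 * ((a * c + b * d) * x + (c * x + d * y) * a + (a * x + b * y) * c) * x +
    3^-1 * ((a * c + b * d) * y + (c * x + d * y) * b + (a * x + b * y) * d) * y =
  3^-1 * ((a * c) * S + (b * d) * S) + 2 / 3 * ((a * c) * (x * x) + (b * d) * (y * y) + (a * d) * (x * y) + (b * c) * (x * y)).
  by rewrite /S; field.
have x2 : x * x <= S by rewrite /S lerDl -expr2 sqr_ge0. have y2 : y * y <= S by rewrite /S lerDr -expr2 sqr_ge0.
have x0 : 0 <= x * x by rewrite -expr2 sqr_ge0. have y0 : 0 <= y * y by rewrite -expr2 sqr_ge0.
have Q (p q t : R) : `|p| <= 4 * U -> `|q| <= 4 * V -> `|t| <= S -> `|p * q * t| <= 16 * (W * S).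
  by move=> hp hq ht; rewrite normrM mulrA; apply: ler_pM => //; exact: P.
have q1 := Q _ _ S ha hc; have q2 := Q _ _ S hb hd; have q3 := Q _ _ (x * x) ha hc.
have q4 := Q _ _ (y * y) hb hd; have q5 := Q _ _ (x * y) ha hd; have q6 := Q _ _ (x * y) hb hc.
rewrite (ger0_norm xy) in q1 q2; rewrite (ger0_norm x0) in q3; rewrite (ger0_norm y0) in q4.
have xy' : `|x * y| <= S by have := normr_ge0 (x * y); lra.
have {}q1 := q1 (lexx _); have {}q2 := q2 (lexx _); have {}q3 := q3 x2; have {}q4 := q4 y2.
have {}q5 := q5 xy'; have {}q6 := q6 xy'.
have WS : 0 <= C1 * (W * S) by rewrite !mulr_ge0.
rewrite E (_ : (C1 + 64) * U * V * S = C1 * (W * S) + 64 * (W * S)); last by rewrite /W; ring.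
have WS0 : 0 <= W * S by rewrite mulr_ge0.
exact: six_terms.
Qed.

Lemma rot_dot (a b p q r s : R) : a ^+ 2 + b ^+ 2 = 1 ->
  (a * p + b * - q) * (a * r + b * - s) + (a * q + b * p) * (a * s + b * r) = p * r + q * s.
Proof. by move=> h; rewrite -[RHS]mul1r -h; ring. Qed.

Lemma ipB_m (u v w z : VV) : ip (BV (mV u v w)) z =
  \sum_(j < N) \int[lebesgue_measure]_(x in `[L, +oo[) dot (mf (ev u) (ev v) (ev w)) (ev z) j x.
Proof.
rewrite ipBE L2s_evm L2s_int//; last exact: evD.
by move=> k; exact: m_sq2.
Qed.

Lemma cf34_ u v w z : ip (BV (mV u v w)) z = ip (BV (mV u v z)) w.
Proof.
apply: (etrans (ipB_m u v w z)); apply: (etrans _ (esym (ipB_m u v z w))).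
by apply: eq_bigr => j _; apply: int_eq => x _; rewrite /mf /dot /=; ring.
Qed.

Lemma cf_B_ (C1 : R) u v x : 0 <= C1 ->
  `|ip (BV (mV u v x)) x| <= (C1 + 64) * nrm u * nrm v * ip (BV x) x.
Proof.
move=> C10; have Em : ip (BV x) x = _ := etrans (ipBE x x) (L2s_int (evD x) (evD x)).
suff key p q : p = \sum_(j < N) \int[lebesgue_measure]_(y in `[L, +oo[) dot (mf (ev u) (ev v) (ev x)) (ev x) j y ->
    q = \sum_(j < N) \int[lebesgue_measure]_(y in `[L, +oo[) dot (ev x) (ev x) j y ->
    `|p| <= (C1 + 64) * nrm u * nrm v * q by exact: key (ipB_m u v x x) Em.
move=> -> ->.
have hm : L2D L (mf (ev u) (ev v) (ev x)) by move=> k; exact: m_sq2.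
rewrite mulr_sumr; apply: (le_trans (ler_norm_sum _ _ _)); apply: ler_sum => j _.
have i1 := dot_itg j hm (evD x); have i2 := dot_itg j (evD x) (evD x).
rewrite -intZ//; apply: (le_trans (int_norm _ i1)) => //.
apply: int_le => //; [exact: itg_norm|exact: itgZ|].
move=> t; rewrite /= in_itv /= andbT => Lt.
exact: cubic_pointwise (nrm_ge0 u) (nrm_ge0 v) C10 (ev_sup u _ Lt) (ev_sup u _ Lt) (ev_sup v _ Lt) (ev_sup v _ Lt).
Qed.

Lemma cf_rot_ (a b : R) u v w : a ^+ 2 + b ^+ 2 = 1 ->
  mV (a *: u + b *: JV u) (a *: v + b *: JV v) (a *: w + b *: JV w) =
    a *: mV u v w + b *: JV (mV u v w).
Proof.
move=> ab; apply: ev_ext => -[j c] t Lt.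
rewrite !evD_// !evZ// evm// evJ// /Jf /mf /dot /= !evD_// !evZ// !evJ// /Jf /= !evm// /mf /dot /=.
rewrite !(rot_dot _ _ _ _ ab); case: c; ring.
Qed.

Lemma cf_J_ u : ip (BV (mV u u u)) (JV u) = 0.
Proof.
rewrite ipB_m; apply: big1 => j _; rewrite (@int_eq _ _ _ (fun=> 0)) ?Rintegral_cst ?mul0r// => x.
rewrite /= in_itv /= andbT => Lx; rewrite /dot !evJ// /Jf /mf /dot /=; ring.
Qed.

Lemma cubic_cf : exists Cm, cubic_form JV BV mV Cm.
Proof.
have [C C0 hC] := mf_bdH; pose C1 := (1 + lam * #|comp|%:R) * C.
have C10 : 0 <= C1 by apply: mulr_ge0 C0; apply: addr_ge0 => //; exact: mulr_ge0 lam0 _.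
exists (C1 + 64); split.
- by move=> u v a w w'; apply: ev_ext => k x Lx; rewrite ev_lin// !evm// /mf /dot !ev_lin//; ring.
- by move=> u v w; apply: ev_ext => k x Lx; rewrite !evm// /mf /dot; ring.
- by move=> u v w; apply: ev_ext => k x Lx; rewrite !evm// /mf /dot; ring.
- exact: cf34_.
- move=> u v w; have W0 : 0 <= nrm u * nrm v * nrm w by rewrite !mulr_ge0 ?nrm_ge0.
  apply: (le_trans (toV_nrm (mulr_ge0 C0 W0) (hC u v w))).
  rewrite mulrA -/C1; move: W0; set a := nrm u; set b := nrm v; set c := nrm w => W0.
  have -> : (C1 + 64) * a * b * c = C1 * (a * b * c) + 64 * (a * b * c) by ring.
  by rewrite lerDl mulr_ge0.
- by move=> u v x; exact: cf_B_.
- exact: cf_rot_.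
- exact: cf_J_.
Qed.

End Cubic.

(** * Classes of functions on the graph *)

Section Conversion.
Context {R : realType} (L Z : R) (N : nat).
Hypothesis Z0 : Z < 0.
Notation mu := (@lebesgue_measure R).
Notation D := (`[L, +oo[%classic : set R).
Notation sq2 := (sq2 L). Notation sip := (sip L). Notation H1s := (H1s L).
Notation HH := (HH L N). Notation VV := (VV L N Z0).
Notation clsH := (@clsH R L N). Notation clsV := (@clsV R L Z N Z0).
Notation L2D := (@L2D R L N). Notation H1D := (@H1D R L N).
Notation L2s := (@L2s R L N). Notation H1a := (@H1a R L Z N).
Notation comp := (comp N). Notation field_ := (@field_ R N). Notation lam := (lam Z N).
Notation JV := (JV L N Z0). Notation BV := (BV L N Z0). Notation JH := (JH L N). Notation BH := (BH L N Z0).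
Notation gfun := (gfun R N).
Implicit Types U F W : gfun.
Let mD : measurable D. Proof. exact: measurable_itv. Qed.

Definition fo U : field_ := fun k x => if k.2 then complex.Im (U k.1 x) else complex.Re (U k.1 x).
Definition gf (u : field_) : gfun := fun j x => (u (j, false) x +i* u (j, true) x)%C.

Lemma gfK u : fo (gf u) = u.
Proof. by apply/funext => -[j b]; apply/funext => x; rewrite /fo /gf /=; case: b. Qed.

Lemma foD U F : fo (U + F) = fo U + fo F.
Proof.
apply/funext => -[j b]; apply/funext => x; rewrite /fo !fctE /=.
by case: b; case: (U j x) => a c; case: (F j x).
Qed.
Lemma foZ (a : R[i]) U : fo (a *: U) = complex.Re a *: fo U + complex.Im a *: Jf (fo U).
Proof.
apply/funext => -[j b]; apply/funext => x; rewrite /fo /Jf !fctE /=.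
case: b; case: a => a a'; case: (U j x) => c c' /=; rewrite /GRing.scale /=; ring.
Qed.
Lemma fo0 : fo 0 = 0.
Proof. by apply/funext => -[j b]; apply/funext => x; rewrite /fo /=; case: b. Qed.
Lemma foN U : fo (- U) = - fo U.
Proof.
apply/funext => -[j b]; apply/funext => x; rewrite /fo !fctE /=.
by case: b; case: (U j x).
Qed.

Lemma complex_eqP (z w : R[i]) : z = w <-> complex.Re z = complex.Re w /\ complex.Im z = complex.Im w.
Proof. by case: z => a b; case: w => c d /=; split=> [[-> ->]//|[-> ->]]. Qed.

Lemma ae_graphP U F : ae_eq_graph L U F <-> forall k, aeqL L (fo U k) (fo F k).
Proof.
split=> [h [j b]|h j].
  by apply: aeS (h j) => x hx Lx; rewrite /fo /= hx.
apply: aeS (aeI (h (j, false)) (h (j, true))) => x [hr hi] Lx.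
by apply/complex_eqP; split; [exact: hr|exact: hi].
Qed.

Lemma L2P U : Defs.L2 L U <-> L2D (fo U).
Proof.
split=> [h [j b]|h j].
  have [mr mi fin] := h j.
  have ms : measurable_fun D (fun x => complex.Re (U j x) ^+ 2 + complex.Im (U j x) ^+ 2).
    by apply: measurable_funD; exact: measurable_funX.
  have its : itg D (fun x => complex.Re (U j x) ^+ 2 + complex.Im (U j x) ^+ 2).
    apply/integrableP; split; first exact/measurable_EFinP.
    apply: le_lt_trans fin; rewrite le_eqVlt; apply/orP; left; apply/eqP.
    by apply: eq_integral => x _; rewrite /= ger0_norm// addr_ge0 ?sqr_ge0.
  rewrite /fo /=; case: b; split=> //; apply: (itg_le mD _ _ its); try exact: measurable_funX.
    by move=> x _; rewrite ger0_norm ?sqr_ge0// lerDr sqr_ge0.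
  by move=> x _; rewrite ger0_norm ?sqr_ge0// lerDl sqr_ge0.
have [mr ir] := h (j, false); have [mi ii] := h (j, true); rewrite /fo /= in mr ir mi ii.
split=> //; have /integrableP[_] := itgD mD ir ii; apply: le_lt_trans.
rewrite le_eqVlt; apply/orP; left; apply/eqP; apply: eq_integral => x _.
by rewrite /= ger0_norm// addr_ge0 ?sqr_ge0.
Qed.

Lemma L2normE U : Defs.L2 L U -> L2norm L U = nrm (clsH (fo U)).
Proof.
move=> /L2P hU; rewrite /L2norm /nrm ipH_cls//; congr Num.sqrt.
rewrite L2s_pair; apply: eq_bigr => j _; rewrite -intD//; first exact: sq2_mul.
exact: sq2_mul.
Qed.

Lemma H1_derivP U F : H1_deriv L U F <-> H1D ((fo U, fo F) : pair_ N).
Proof.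
split=> [[/L2P hU /L2P hF h] [j b]|h].
  split; [split; first exact: sq2_loc (hF (j, b))|exact: hU|exact: hF].
  by move=> x Lx /=; rewrite /fo /= (h j x Lx) /Int; case: b => /=; case: (U j L).
split; [by apply/L2P => k; case: (h k)|by apply/L2P => k; case: (h k)|move=> j x Lx].
have [[_ hr] _ _] := h (j, false); have [[_ hi] _ _] := h (j, true).
move: (hr x Lx) (hi x Lx); rewrite /fo /=.
case: (U j x) => a a'; case: (U j L) => c c' /= -> ->.
by [].
Qed.

Lemma H1P U : H1 L U -> exists F, H1D ((fo U, fo F) : pair_ N).
Proof. by move=> [F /H1_derivP h]; exists F. Qed.

Definition toVg U : VV := toV L Z0 (fo U).
Lemma H1_bdH U : H1 L U -> forall k, exists M, bdH L (fo U k) M.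
Proof.
move=> /H1P[F h] k; exists (1 + (sip (fo U k) (fo U k) + sip (fo F k) (fo F k))).
exists (fo F k); first exact: h.
have := sip_ge0 L (fo U k); have := sip_ge0 L (fo F k); set a := sip _ _; set b := sip _ _ => a0 b0.
have : 0 <= (b + a) ^+ 2 by exact: sqr_ge0.
rewrite !sqrrD; have := mulr_ge0 b0 a0; lra.
Qed.
Lemma ev_toVg U k x : H1 L U -> L <= x -> ev (toVg U) k x = fo U k x.
Proof. by move=> hU Lx; apply: ev_toV => //; exact: H1_bdH. Qed.
Lemma gf_ev_H1 (q : VV) : H1 L (gf (ev q)).
Proof. by exists (gf (repV q).2); apply/H1_derivP; rewrite !gfK; exact: repVD. Qed.
Lemma toVgK (q : VV) : toVg (gf (ev q)) = q.
Proof. by apply: ev_ext => k x Lx; rewrite ev_toVg ?gfK//; exact: gf_ev_H1. Qed.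
Lemma H1_L2 U : H1 L U -> Defs.L2 L U.
Proof. by case=> F []. Qed.
Lemma iot_toVg U : H1 L U -> iot (toVg U) = clsH (fo U).
Proof.
move=> hU; apply/clsH_eq; [exact: evD|exact/L2P/H1_L2|move=> k].
by apply: ae_on => x Lx; rewrite ev_toVg.
Qed.

Lemma H1norm_le U : H1 L U -> H1norm L U <= 2 * nrm (toVg U) /\ nrm (toVg U) <= lam * H1norm L U.
Proof.
move=> hU; have hW : H1_deriv L U (weak_deriv L U).
  by rewrite /weak_deriv; case: xgetP => [W _ //|h]; case: hU => F hF; case: (h F).
have hp : H1D ((fo U, fo (weak_deriv L U)) : pair_ N) by apply/H1_derivP.
have E : toVg U = clsV (fo U, fo (weak_deriv L U)) by apply: toVP.
have [/L2P hU2 /L2P hW2 _] := hW.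
have nE : H1norm L U ^+ 2 = H1n L ((fo U, fo (weak_deriv L U)) : pair_ N).
  rewrite /H1norm sqr_sqrtr ?addr_ge0 ?sqr_ge0//.
  rewrite (L2normE (proj2 (L2P _) hU2)) (L2normE (proj2 (L2P _) hW2)).
  by congr (_ + _); rewrite nrm2 ipH_cls.
have n0 : 0 <= H1norm L U by exact: sqrtr_ge0.
have l1 := lam_ge1 Z N; have l0 : 0 <= lam by exact: le_trans l1.
have v0 := nrm_ge0 (toVg U).
have v2 : nrm (toVg U) ^+ 2 = H1a ((fo U, fo (weak_deriv L U)) : pair_ N) ((fo U, fo (weak_deriv L U)) : pair_ N).
  by rewrite nrm2 E ipV_cls.
split; rewrite -ler_sqr ?nnegrE ?mulr_ge0//.
  rewrite nE exprMn v2; have := H1a_norm Z0 hp; have := ip_ge0 (toVg U); rewrite -nrm2 v2; lra.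
rewrite v2 exprMn nE; apply: (le_trans (H1a_le _ Z0 _)); apply: ler_wpM2r.
  by rewrite addr_ge0 ?L2s_ge0.
by rewrite expr2 ler_peMl.
Qed.

Lemma AC_ae f g g' : AC L f g -> loc L g' -> aeqL L g g' -> AC L f g'.
Proof.
by move=> [l h] l' e; split=> // x Lx; rewrite h// (ae_Int x l l' (lexx L) e).
Qed.

Lemma exists_test : exists f g, H1s f g /\ f L = 1.
Proof.
pose w := cut (L + 1) (fun=> -1 : R); have hw : sq2 w := cut_cst_sq2 L _ _.
have ac := AC_prim 1 (sq2_loc hw); have L1 : L <= L + 1 by rewrite lerDl.
exists (fun x => 1 + Int L x w), w; split; last by rewrite Int0 addr0.
split=> //; have := cut_AC_sq2 (L + 1) ac; congr sq2; apply/funext => x; rewrite cutE.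
case: leP => // /ltW xL; rewrite (Int_split (sq2_loc hw) (lexx L) L1 xL).
have -> : Int L (L + 1) w = Int L (L + 1) (fun=> -1) by apply: Int_eq => y /andP[_ yM]; rewrite /w cutE yM.
rewrite Int_cst// (@Int_right0 _ w); first by ring.
by move=> y yL; rewrite /w cutE leNgt yL.
Qed.

Lemma vsum_fo U b : vsum L (fo U) b =
  if b then complex.Im (\sum_(j < N) U j L) else complex.Re (\sum_(j < N) U j L).
Proof.
have Rm : {morph (@complex.Re R) : x y / x + y} by case=> ? ? [].
have Im : {morph (@complex.Im R) : x y / x + y} by case=> ? ? [].
by case: b; rewrite ?(big_morph _ Rm (erefl _)) ?(big_morph _ Im (erefl _)).
Qed.

Lemma L2s_ae (u v w : field_) : L2D u -> L2D v -> L2D w -> (forall k, aeqL L (u k) (v k)) -> L2s u w = L2s v w.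
Proof.
move=> hu hv hw e; apply: eq_bigr => k _; apply: ae_int; [exact: sq2_mul|exact: sq2_mul|].
by apply: aeS (e k) => x h /h ->.
Qed.

Lemma sipNl f g : sq2 f -> sq2 g -> sip (fun x => - f x) g = - sip f g.
Proof.
move=> hf hg; rewrite -mulN1r -intZ//; last exact: sq2_mul.
by apply: int_eq => x _; ring.
Qed.

(** Green's formula: the delta' conditions make the boundary terms of the integration by parts
    cancel against the vertex term of the form. *)
Lemma form_ibp (p r : pair_ N) (w : field_) : H1D p -> H1D r -> (forall k, H1s (p.2 k) (w k)) ->
  (forall j b, vsum L p.1 b = Z * p.2 (j, b) L) ->
  H1a p r = lam * L2s p.1 r.1 - L2s w r.1.
Proof.
move=> hp hr hw bc; have Zn0 : Z != 0 by rewrite lt_eqF.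
have E : L2s w r.1 + L2s p.2 r.2 = - \sum_k p.2 k L * r.1 k L.
  rewrite /L2s -big_split -sumrN; apply: eq_bigr => k _.
  exact: H1s_ibp (hw k) (hr k).
have B : Z^-1 * \sum_b vsum L p.1 b * vsum L r.1 b = \sum_k p.2 k L * r.1 k L.
  rewrite (eq_bigr (fun k : comp => p.2 (k.1, k.2) L * r.1 (k.1, k.2) L)); last by case.
  rewrite -(pair_bigA _ (fun j b => p.2 (j, b) L * r.1 (j, b) L)) /= exchange_big mulr_sumr /=.
  apply: eq_bigr => b _; rewrite {2}/vsum mulrA mulr_sumr; apply: eq_bigr => j _.
  by rewrite (bc j) mulrA mulVf// mul1r.
rewrite /H1a B; move: E; set a := L2s w _; set c := L2s p.2 _; set d := \sum_k _; lra.
Qed.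

(** By [form_ibp], the regular version of [U] represents the functional that defines [adj] at
    [F + lam U]. *)
Lemma graph_domain U F : Defs.L2 L U -> Defs.L2 L F ->
  deltap_graph L Z U F -> clsH (fo U) = BH (clsH (fo F) + lam *: clsH (fo U)).
Proof.
move=> /L2P hU /L2P hF [U0 [V [W [/ae_graphP UU0 [/H1_derivP h1 /H1_derivP h2] bc1 bc2 /ae_graphP FW]]]].
have hU0 : L2D (fo U0) := H1D1 h1. have hW : L2D (fo W) := H1D2 h2.
have hr : L2D (lam *: fo U + fo F) by exact: L2D_lin.
have E1 : clsH (fo F) + lam *: clsH (fo U) = clsH (lam *: fo U + fo F) by rewrite clsH_lin// addrC.
have bc j b : vsum L (fo U0) b = Z * fo V (j, b) L.
  rewrite vsum_fo (bc2 j) /fo /=; case: b; case: (V j L) => x y /=; ring.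
have Ea : adj Z0 (clsH (lam *: fo U + fo F)) = clsV (fo U0, fo V).
  apply: ip_ext => q; rewrite adjP -(repVK q) iot_cls; last exact: repVD.
  have hq1 : L2D (repV q).1 := H1D1 (repVD q).
  rewrite ipH_cls// ipV_cls//; last exact: repVD.
  rewrite (form_ibp h1 (repVD q) h2)// (L2s_lin _ hU hF hq1) /=.
  rewrite (L2s_ae hU hU0 hq1 UU0) ; congr (_ + _).
  have hN : L2D (fo (- W)) by move=> k; rewrite foN; exact: sq2N (hW k).
  rewrite (L2s_ae hF hN hq1 FW) foN /L2s -sumrN; apply: eq_bigr => k _; exact: sipNl (hW k) (hq1 k).
rewrite E1 BHE Ea iot_cls//=; apply/clsH_eq => //.
Qed.

(** The weak equation is tested on one component at a time. Tests vanishing at [L] give, by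
    [du_bois_reymond], a derivative that is itself in H^1; a test with value 1 at [L] then yields
    the vertex condition. *)
Lemma domain_graph U F : Defs.L2 L U -> Defs.L2 L F ->
  clsH (fo U) = BH (clsH (fo F) + lam *: clsH (fo U)) -> deltap_graph L Z U F.
Proof.
move=> /L2P hU /L2P hF E; have Zn0 : Z != 0 by rewrite lt_eqF.
have hx : L2D (lam *: fo U + fo F) by exact: L2D_lin.
set x : field_ := lam *: fo U + fo F in hx.
have E1 : clsH (fo F) + lam *: clsH (fo U) = clsH x by rewrite clsH_lin// addrC.
rewrite E1 BHE in E; set y := adj Z0 (clsH x) in E.
have hp := repVD y; set p := repV y in hp.
have pU := (clsH_eq (H1D1 hp) hU).1 (esym E).
pose q : field_ := fun k t => lam * p.1 k t - x k t.
have hp1 : L2D p.1 := H1D1 hp. have hp2 : L2D p.2 := H1D2 hp.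
have hq : L2D q by move=> k; apply: sq2B (hx k); exact: sq2Z (hp1 k).
have key k f g : H1s f g -> sip (p.2 k) g + sip (q k) f + Z^-1 * (vsum L p.1 k.2 * f L) = 0.
  move=> hfg; have [_ hf hg] := hfg.
  pose r : pair_ N := ((fun k' => if k' == k then f else fun=> 0), (fun k' => if k' == k then g else fun=> 0)).
  have hr : H1D r by move=> k' /=; case: (k' == k) => //; exact: H1s0.
  have single (u : field_) (h : R -> R) : L2s u (fun k' => if k' == k then h else fun=> 0) = sip (u k) h.
    rewrite /L2s (bigD1 k)//= eqxx big1 ?addr0// => k' /negPf ->.
    by rewrite /sip (@int_eq _ _ _ (fun=> 0)) ?Rintegral_cst ?mul0r// => t _; rewrite mulr0.
  have : H1a p r = L2s x r.1.
    have e1 : ip y (clsV r) = H1a p r by rewrite -[y in LHS]repVK; exact: ipV_cls.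
    have e2 : ip (clsH x) (iot (clsV r)) = L2s x r.1.
      by rewrite (iot_cls Z0 hr); exact: (ipH_cls hx (H1D1 hr)).
    by rewrite -e1 -e2; exact: adjP.
  rewrite /H1a !single.
  have -> : \sum_b vsum L p.1 b * vsum L r.1 b = vsum L p.1 k.2 * f L.
    rewrite (bigD1 k.2)//= [X in _ + X]big1 ?addr0 => [|b bk].
      congr (_ * _); rewrite /vsum (bigD1 k.1)//= -surjective_pairing eqxx big1 ?addr0// => j jk.
      by case: eqP => // jk'; move: jk; rewrite -jk' eqxx.
    rewrite [vsum L r.1 b]big1 ?mulr0// => j _ /=.
    by case: eqP => // jk; move: bk; rewrite -jk eqxx.
  have -> : sip (q k) f = lam * sip (p.1 k) f - sip (x k) f.
    have e1 := sip_lin (-1) (hx k) (sq2Z lam (hp1 k)) hf.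
    have e2 := sip_lin lam (hp1 k) (sq2_0 L) hf.
    have e0 : sip (fun=> 0) f = 0.
      by rewrite /sip (@int_eq _ _ _ (fun=> 0)) ?Rintegral_cst ?mul0r// => t _; rewrite mul0r.
    have -> : sip (q k) f = sip (fun t => -1 * x k t + lam * p.1 k t) f.
      by apply: int_eq => t _; rewrite /q; ring.
    rewrite e1; have -> : sip (fun t => lam * p.1 k t) f = sip (fun t => lam * p.1 k t + 0) f.
      by apply: int_eq => t _; rewrite addr0.
    by rewrite e2 e0; ring.
  set a := sip (p.2 k) g; set b := sip (p.1 k) f; set c := sip (x k) f; set d := Z^-1 * _; lra.
have /choice[P hP] : forall k, exists P, H1s P (q k) /\ aeqL L (p.2 k) P.
  move=> k; have [f g hfg f0|P h1 h2] := du_bois_reymond (hp2 k) (hq k).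
    by have := key k f g hfg; rewrite f0 !mulr0 addr0.
  by exists P.
have bc k : vsum L p.1 k.2 = Z * P k L.
  have [f [g [hfg f1]]] := exists_test; have [hPk hae] := hP k.
  have := key k f g hfg; have := H1s_ibp hPk hfg; rewrite f1 !mulr1.
  have -> : sip (P k) g = sip (p.2 k) g.
    have [_ sP _] := hPk; have [_ _ sg] := hfg.
    by apply: ae_int; [exact: sq2_mul|exact: sq2_mul (hp2 k) sg|apply: aeS hae => t h /h ->].
  set a := sip (q k) f; set b := sip (p.2 k) g; set v := vsum _ _ _ => e1 e2.
  have : P k L = Z^-1 * v by lra.
  by move=> ->; rewrite mulVKf.
exists (gf p.1), (gf P), (gf q); split.
- by apply/ae_graphP => k; rewrite gfK; apply: aeS (pU k) => t h /h ->.
- split; apply/H1_derivP; rewrite !gfK => k; last exact: (hP k).1.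
  have [a b c] := hp k; have [[_ sP _] ae] := hP k; split=> //.
  exact: AC_ae a (sq2_loc sP) ae.
- move=> i j; have e k : P k L = Z^-1 * vsum L p.1 k.2 by rewrite bc mulKf.
  by rewrite /gf !e.
- move=> j; apply/complex_eqP.
  have := vsum_fo (gf p.1) false; have := vsum_fo (gf p.1) true; rewrite gfK => <- <-.
  by rewrite (bc (j, false)) (bc (j, true)) /gf /=; split; ring.
- apply/ae_graphP => k; rewrite foN gfK; apply: aeS (pU k) => t h Lt.
  rewrite /q /x /= !fctE (h Lt) /GRing.scale /=; ring.
Qed.

End Conversion.

(** * Riemann sums of continuous curves *)

Section RiemannSums.
Context {R : realType} {E : hilb R}.

Lemma cont_unif (f : R -> E) (a b e : R) : cont f -> 0 < e ->
  exists2 d, 0 < d & forall s t : R, a <= s <= b -> `|s - t| <= d -> nrm (f s - f t) <= e.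
Proof.
move=> cf e0; have e2 : 0 < e / 2 by rewrite divr_gt0.
have : \forall d \near 0^'+, forall s : R, `[a, b]%classic s -> forall t, `|s - t| <= d -> nrm (f s - f t) <= e.
  have /compact_near_coveringP nc := @segment_compact R a b; apply: nc => x _.
  have /near_ex[d d0 hd] := cf x (e / 2) e2.
  have d2 : 0 < d / 3 by rewrite divr_gt0.
  near=> s d' => t st; apply: (le_trans (nrm_tri (f x) _ _)).
  have sx : `|s - x| <= d / 3 by near: s; exact: near_dist.
  have dd : d' <= d / 3 by near: d'; exact: nbhs_right_le.
  have h1 : nrm (f s - f x) <= e / 2 by apply: hd; apply: le_lt_trans sx _; lra.
  have h2 : nrm (f x - f t) <= e / 2.
    rewrite nrmBC; apply: hd; rewrite distrC; apply: (le_lt_trans (ler_distD s _ _)).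
    rewrite /= in st; rewrite (distrC x s); apply: le_lt_trans (lerD sx st) _; lra.
  lra.
move=> h; near (0 : R)^'+ => d; exists d => // s t st; have h' : forall s : R, `[a, b]%classic s -> forall t, `|s - t| <= d -> nrm (f s - f t) <= e by near: d.
by apply: h'; rewrite /= in_itv.
Unshelve. all: by end_near. Qed.

Lemma der_arg_scale (f : R -> E) (c t : R) l : der f (c * t) l -> der (fun s => f (c * s)) t (c *: l).
Proof.
move=> h e e0; have c1 : 0 < `|c| + 1 by rewrite ltr_wpDl.
have /near_ex[d d0 hd] := h _ (divr_gt0 e0 c1); apply/near_ex.
exists (d / (`|c| + 1)); first by rewrite divr_gt0.
move=> s st; have E1 : `|c * s - c * t| = `|c| * `|s - t| by rewrite -mulrBr normrM.
have b : `|c * s - c * t| < d.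
  by rewrite E1; move: st; rewrite ltr_pdivlMr// mulrDr mulr1 mulrC; have := normr_ge0 (s - t); lra.
have := hd _ b; rewrite -mulrBr scalerA [_ * c]mulrC mulrBr E1 => {}hd; apply: (le_trans hd).
rewrite mulrA ler_wpM2r// mulrAC ler_pdivrMr// ler_wpM2l ?ltW//; lra.
Qed.

(** On a subinterval with tagged value [c], the curve [F s - s *: c] has derivative at most [e] in
    norm, so the errors add up to at most [e]. *)
Lemma riemann_sum (F g : R -> E) (e : R) : (forall t, der F t (g t)) -> cont g -> 0 < e ->
  exists2 d : R, 0 < d & forall m (u v : nat -> R), u 0%N = 0 -> u m = 1 ->
    (forall k, (k < m)%N -> u k <= v k <= u k.+1 /\ u k.+1 - u k < d) ->
    nrm (\sum_(k < m) (u k.+1 - u k) *: g (v k) - (F 1 - F 0)) <= e.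
Proof.
move=> dF cg e0; have [d d0 hd] := cont_unif (-1) 2 cg e0; exists d => // m u v u0 um h.
have mono k : (k <= m)%N -> 0 <= u k.
  elim: k => [|k ih] km; first by rewrite u0.
  by have [/andP[h1 h2] _] := h k km; have := ih (ltnW km); lra.
have mono2 k : (k <= m)%N -> u (m - k)%N <= 1.
  elim: k => [|k ih] km; first by rewrite subn0 um.
  have mk : (m - k.+1 < m)%N by rewrite ltn_subrL (leq_trans _ km).
  have [/andP[h1 h2] _] := h _ mk; rewrite subnSK// in h2.
  by have := ih (ltnW km); lra.
have le1 k : (k <= m)%N -> u k <= 1 by move=> km; rewrite -(subKn km); apply: mono2; rewrite leq_subr.
have -> : F 1 - F 0 = \sum_(k < m) (F (u k.+1) - F (u k)).
  by rewrite -(big_mkord xpredT (fun k => F (u k.+1) - F (u k))) telescope_sumr// um u0.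
rewrite -sumrB; have : \sum_(k < m) (u k.+1 - u k) * e <= e.
  rewrite -mulr_suml -(big_mkord xpredT (fun k => u k.+1 - u k)) telescope_sumr// um u0 subr0 mul1r//.
apply: le_trans; elim/big_ind2: _ => [|x1 x2 y1 y2 h1 h2|k _]; first by rewrite nrm0.
  exact: le_trans (nrmD _ _) (lerD h1 h2).
have [/andP[h1 h2] h3] := h k (ltn_ord k); have uu := le_trans h1 h2.
pose c := g (v k); have df s : der (fun s => F s - s *: c) s (g s - c).
  apply: derB => //; rewrite -[c in der _ _ c]scale1r.
  apply: (@der_op _ (RH R) _ (fun s : R => s *: c) (nrm c) (fun s => s)).
  - by move=> a x y; rewrite scalerDl scalerA.
  - by move=> x; rewrite nrmZ mulrC -nrmRH.
  - exact: der_id.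
have de s : derR (fun s => e * s) s e.
  by have := @derZ _ (RH R) _ _ _ e (@der_id _ s); rewrite /GRing.scale /= mulr1.
have := der_bound uu (fun s _ => df s) (fun s _ => de s).
have b s : u k <= s <= u k.+1 -> nrm (g s - c) <= e.
  move=> /andP[s1 s2]; apply: hd.
    have := mono k (ltnW (ltn_ord k)); have := le1 k.+1 (ltn_ord k) => ? ?; apply/andP; split; lra.
  by rewrite ler_norml; apply/andP; split; lra.
move=> /(_ b); rewrite -mulrBr mulrC.
have -> : F (u k.+1) - u k.+1 *: c - (F (u k) - u k *: c) =
   - ((u k.+1 - u k) *: g (v k) - (F (u k.+1) - F (u k))) by rewrite -/c; vring.
by rewrite nrmN.
Qed.
End RiemannSums.

Section Classes.
Context {R : realType} (L Z : R) (N : nat).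
Hypothesis Z0 : Z < 0.
Notation HH := (HH L N). Notation VV := (VV L N Z0).
Notation clsH := (@clsH R L N). Notation L2D := (@L2D R L N).
Notation gfun := (gfun R N). Notation lam := (lam Z N).
Notation JV := (JV L N Z0). Notation BV := (BV L N Z0). Notation JH := (JH L N). Notation BH := (BH L N Z0).
Implicit Types U F W G : gfun.
Notation fL2 := (Defs.L2 L).

Definition cg U : HH := clsH (fo U).
Definition rg (x : HH) : gfun := gf (repH x).

Lemma rg_L2 x : fL2 (rg x). Proof. by apply/L2P; rewrite gfK; exact: repHD. Qed.
Lemma rgK x : cg (rg x) = x. Proof. by rewrite /cg gfK repHK. Qed.
Lemma L2_lin (a : R[i]) U F : fL2 U -> fL2 F -> fL2 (a *: U + F).
Proof.
move=> /L2P hU /L2P hF; apply/L2P; rewrite foD foZ -addrA; apply: L2D_lin => //.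
by apply: L2D_lin => //; exact: JfL2.
Qed.
Lemma L2_0 : fL2 (0 : gfun).
Proof. by apply/L2P; rewrite fo0; exact: sh0 (L2_semi L N). Qed.
Lemma L2Z (a : R[i]) U : fL2 U -> fL2 (a *: U).
Proof. by move=> h; rewrite -[_ *: _]addr0; exact: L2_lin L2_0. Qed.
Lemma L2D_ U F : fL2 U -> fL2 F -> fL2 (U + F).
Proof. by move=> hU hF; rewrite -[U]scale1r; exact: L2_lin. Qed.
Lemma L2B U F : fL2 U -> fL2 F -> fL2 (U - F).
Proof. by move=> hU hF; rewrite addrC -scaleN1r; exact: L2_lin. Qed.
Lemma cg_lin (a : R[i]) U F : fL2 U -> fL2 F ->
  cg (a *: U + F) = complex.Re a *: cg U + complex.Im a *: JH (cg U) + cg F.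
Proof.
move=> /L2P hU /L2P hF; rewrite /cg foD foZ -addrA.
rewrite clsH_lin//; last by apply: L2D_lin => //; exact: JfL2.
rewrite clsH_lin//; last exact: JfL2.
by rewrite -[JH _]/(JHf _) (JH_cls hU) addrA.
Qed.
Lemma cg0 : cg (0 : gfun) = 0. Proof. by rewrite /cg fo0; exact: sep_cls0. Qed.
Lemma cgZ (r : R) U : fL2 U -> cg (r%:C%C *: U) = r *: cg U.
Proof. by move=> h; have := cg_lin r%:C%C h L2_0; rewrite !addr0 cg0 addr0 /= scale0r addr0. Qed.
Lemma cgI U : fL2 U -> cg ('i%C *: U) = JH (cg U).
Proof. by move=> h; have := cg_lin 'i%C h L2_0; rewrite !addr0 cg0 addr0 /= scale0r add0r scale1r. Qed.
Lemma cgD U F : fL2 U -> fL2 F -> cg (U + F) = cg U + cg F.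
Proof. by move=> hU hF; have := cg_lin 1 hU hF; rewrite !scale1r /= scale0r addr0. Qed.
Lemma cgB U F : fL2 U -> fL2 F -> cg (U - F) = cg U - cg F.
Proof.
move=> hU hF; have := cg_lin (-1) hF hU; rewrite !scaleN1r addrC => ->.
have -> : complex.Im (-1 : R[i]) = 0 by rewrite /= oppr0.
by rewrite scale0r addr0 addrC.
Qed.
Lemma cg_sum m (F : 'I_m -> gfun) : (forall k, fL2 (F k)) ->
  fL2 (\sum_k F k) /\ cg (\sum_k F k) = \sum_k cg (F k).
Proof.
move=> h; elim/big_rec2: _ => [|k x U _ [hU <-]]; first by rewrite cg0; split=> //; exact: L2_0.
by rewrite cgD//; split=> //; exact: L2D_.
Qed.
Lemma cg_eq U F : fL2 U -> fL2 F -> (ae_eq_graph L U F <-> cg U = cg F).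
Proof.
move=> /L2P hU /L2P hF; split; first by move/ae_graphP/(clsH_eq hU hF).
by move/(clsH_eq hU hF)/ae_graphP.
Qed.
Lemma L2norm_cg U : fL2 U -> L2norm L U = nrm (cg U). Proof. exact: L2normE. Qed.

(** An affine change of variable to [[0, 1]] reduces the claim to [riemann_sum]; the factor [b - a]
    carries the sign when [b < a]. *)
Lemma L2_integralP (F : R -> gfun) (f P : R -> HH) (a b : R) G :
  (forall s, fL2 (F s)) -> (forall s, cg (F s) = f s) -> (forall s, der P s (f s)) -> cont f ->
  fL2 G -> (L2_integral L F a b G <-> cg G = P b - P a).
Proof.
move=> hF cF dP cf hG.
pose phi r := P (a + (b - a) * r); pose g r := (b - a) *: f (a + (b - a) * r).
have dphi r : der phi r (g r).
  apply: (@der_arg_scale _ _ (fun s => P (a + s))).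
  apply: (@eq_der _ _ (fun s => P (s + a))) => [s|]; first by rewrite addrC.
  by apply: der_shift; rewrite addrC; exact: dP.
have cgg : cont g.
  move=> r; apply: (@cont_op _ _ _ (fun x : HH => (b - a) *: x) `|b - a| (fun r => f (a + (b - a) * r))).
  - by move=> c x y; rewrite scalerDr !scalerA mulrC.
  - by move=> x; rewrite nrmZ.
  - move=> e e0; have /near_ex[d d0 hd] := cf (a + (b - a) * r) e e0; apply/near_ex.
    have c1 : 0 < `|b - a| + 1 by rewrite ltr_wpDl.
    exists (d / (`|b - a| + 1)); first by rewrite divr_gt0.
    move=> s st; apply: hd; rewrite opprD addrACA subrr add0r -mulrBr normrM.
    by move: st; rewrite ltr_pdivlMr// mulrDr mulr1 mulrC; have := normr_ge0 (s - r); lra.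
have E m (u v : nat -> R) : fL2 (\sum_(k < m) ((b - a) * (u k.+1 - u k))%:C%C *: F (a + (b - a) * v k)) /\
   cg (\sum_(k < m) ((b - a) * (u k.+1 - u k))%:C%C *: F (a + (b - a) * v k)) =
   \sum_(k < m) (u k.+1 - u k) *: g (v k).
  have [h1 h2] := @cg_sum m (fun k => ((b - a) * (u k.+1 - u k))%:C%C *: F (a + (b - a) * v k)) (fun k => L2Z _ (hF _)).
  split=> //; rewrite h2; apply: eq_bigr => k _; rewrite cgZ// cF /g scalerA mulrC//.
have phi1 : phi 1 = P b by rewrite /phi mulr1 addrC subrK.
have phi0 : phi 0 = P a by rewrite /phi mulr0 addr0.
have conv (e : R) : 0 < e -> exists2 d : R, 0 < d & forall m (u v : nat -> R), u 0%N = 0 -> u m = 1 ->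
    (forall k, (k < m)%N -> u k <= v k <= u k.+1 /\ u k.+1 - u k < d) ->
    nrm (cg (\sum_(k < m) ((b - a) * (u k.+1 - u k))%:C%C *: F (a + (b - a) * v k)) - (P b - P a)) <= e.
  move=> e0; have [d d0 hd] := riemann_sum dphi cgg e0; exists d => // m u v u0 um h.
  by rewrite (E m u v).2 -phi1 -phi0; exact: hd.
split=> [[_ h]|EG].
  apply/eqP; rewrite -subr_eq0; apply/eqP; apply: (@small_nrm0 _ _ _ 2) => e e0.
  have [d1 d10 hd1] := h e e0; have [d2 d20 hd2] := conv e e0.
  (* A uniform partition finer than both moduli compares the two limits on one Riemann sum. *)
  have [m hm] : exists m : nat, m.+1%:R^-1 < Num.min d1 d2.
    have dm : 0 < (Num.min d1 d2)^-1 by rewrite invr_gt0 lt_min d10 d20.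
    exists (Num.truncn (Num.min d1 d2)^-1).
    by rewrite invf_plt ?posrE ?lt_min ?d10 ?d20 ?ltr0n//; exact: truncnS_gt.
  pose u k : R := k%:R / m.+1%:R.
  have u0 : u 0%N = 0 by rewrite /u mul0r.
  have um : u m.+1 = 1 by rewrite /u divff// pnatr_eq0.
  have uk k : u k.+1 - u k = m.+1%:R^-1 by rewrite /u -mulrBl -natrB// subSnn mul1r.
  have up k : u k <= u k.+1 by rewrite -subr_ge0 uk invr_ge0.
  have := hd1 m.+1 u u u0 um (fun k _ => conj (introT andP (conj (lexx _) (up k))) _).
  have := hd2 m.+1 u u u0 um (fun k _ => conj (introT andP (conj (lexx _) (up k))) _).
  have l1 k : u k.+1 - u k < d1 by rewrite uk; apply: lt_le_trans hm _; rewrite ge_min lexx.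
  have l2 k : u k.+1 - u k < d2 by rewrite uk; apply: lt_le_trans hm _; rewrite ge_min lexx orbT.
  move=> /(_ l2) b2 /(_ l1); set S := \sum_(k < m.+1) _ in b2 *.
  have [hS _] := E m.+1 u u; rewrite -/S in hS.
  rewrite L2norm_cg; last exact: L2B.
  rewrite cgB// => b1; apply: (le_trans (nrm_tri (cg S) _ _)).
  rewrite [nrm (cg G - _)]nrmBC; move: b1 b2; lra.
split=> // e e0; have [d d0 hd] := conv (e / 2) (divr_gt0 e0 (ltr0n _ 2)).
exists d => // m u v u0 um h; have [hS _] := E m u v.
rewrite L2norm_cg; last exact: L2B.
by rewrite cgB// EG; apply: le_lt_trans (hd m u v u0 um h) _; lra.
Qed.

End Classes.

(** * Duhamel solutions and the interaction picture *)

Section Dynamics.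
Context {R : realType} (L Z : R) (N : nat).
Hypothesis Z0 : Z < 0.
Notation HH := (HH L N). Notation VV := (VV L N Z0).
Notation gfun := (gfun R N). Notation lam := (lam Z N).
Notation JV := (JV L N Z0). Notation BV := (BV L N Z0). Notation JH := (JH L N). Notation BH := (BH L N Z0).
Implicit Types U F W G : gfun.
Notation fL2 := (Defs.L2 L). Notation fH1 := (Defs.H1 L).
Notation cg := (@cg R L N). Notation rg := (@rg R L N).
Variables (TH : R -> HH -> HH) (TV : R -> VV -> VV).
Hypotheses (gH : unitary_group JH BH lam TH) (gV : unitary_group JV BV lam TV)
  (iotT : forall t q, iot (TV t q) = TH t (iot q)).
Let aH := admH L N Z0.
Let aV := admV L N Z0.

Lemma graphP U F : fL2 U -> fL2 F -> (deltap_graph L Z U F <-> cg U = BH (cg F + lam *: cg U)).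
Proof. by move=> hU hF; split; [exact: graph_domain|exact: domain_graph]. Qed.

Lemma cvg0P (f : R -> R) (t : R) : (f s @[s --> t] --> (0 : R)) <->
  forall e : R, 0 < e -> \forall s \near t, `|f s| <= e.
Proof.
split=> [/cvgrPdist_le h e e0|h].
  by apply: filterS (h e e0) => s; rewrite sub0r normrN.
by apply/cvgrPdist_le => e e0; apply: filterS (h e e0) => s; rewrite sub0r normrN.
Qed.

Lemma dnbhs0P (f : R -> R) : (f h @[h --> (0 : R)^'] --> (0 : R)) <->
  forall e : R, 0 < e -> \forall h \near (0 : R), h != 0 -> `|f h| <= e.
Proof.
split=> [/cvgrPdist_le H e e0|H].
  have := H e e0; rewrite near_withinE; apply: filterS => h H' h0.
  by have := H' h0; rewrite sub0r normrN.
apply/cvgrPdist_le => e e0; rewrite near_withinE; apply: filterS (H e e0) => h H' h0.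
by rewrite sub0r normrN; exact: H'.
Qed.

Definition T0 (t : R) U : gfun := rg (TH t (cg U)).

Lemma quot_der (S : R -> gfun -> gfun) (k : R -> HH) U F : fL2 U -> fL2 F ->
  (forall h, fL2 (S h U)) -> (forall h, cg (S h U) = k h) -> k 0 = cg U ->
  (L2norm L ((h^-1)%:C%C *: (S h U - U) + 'i%C *: F) @[h --> (0 : R)^'] --> (0 : R))
  <-> der k 0 (- JH (cg F)).
Proof.
move=> hU hF hS cS k0.
have E h : L2norm L ((h^-1)%:C%C *: (S h U - U) + 'i%C *: F) = nrm (h^-1 *: (k h - k 0) + JH (cg F)).
  rewrite L2norm_cg; last by apply: L2D_; apply: L2Z => //; exact: L2B.
  rewrite cgD; [|by apply: L2Z; exact: L2B|exact: L2Z].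
  by rewrite cgZ ?cgB ?cgI ?cS ?k0//; exact: L2B.
have E2 h : h != 0 -> nrm (k h - k 0 - (h - 0) *: (- JH (cg F))) =
    nrm (h^-1 *: (k h - k 0) + JH (cg F)) * `|h - 0|.
  move=> h0; rewrite subr0 [RHS]mulrC -nrmZ scalerDr scalerA divff// scale1r scalerN opprK//.
split=> [/dnbhs0P H e e0|H].
  apply: filterS (H e e0) => h; have [->|h0] := eqVneq h 0.
    by rewrite !subrr scale0r subrr nrm0 normr0 mulr0.
  by move=> /(_ isT); rewrite E ger0_norm ?nrm_ge0// E2// => h1; rewrite ler_wpM2r.
apply/dnbhs0P => e e0; apply: filterS (H e e0) => h + h0; rewrite E E2// (ger0_norm (nrm_ge0 _)).
by rewrite ler_pM2r// normr_gt0 subr0.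
Qed.

(** The domain of the generator is the range of [BH]: if [x] has a derivative, differentiate
    [BH (TH t x) = TH t (BH x)] in two ways. *)
Lemma der_domain x f : der (fun t => TH t x) 0 (- JH f) <-> x = BH (f + lam *: x).
Proof.
split=> [d|E].
  have d1 : der (fun t => BH (TH t x)) 0 (BH (- JH f)).
    apply: (@der_op _ _ _ BH 1 (fun t => TH t x)) d; first exact: linearP.
    by move=> y; rewrite mul1r; exact: nrm_admB aH y.
  have d2 := ug_der gH x 0.
  have d3 : der (fun t => TH t (BH x)) 0 (BH (- JH f)).
    by apply: eq_der d1 => s; rewrite (ugB gH).
  have := der_unique d2 d3; rewrite (ug0 gH) (linearN BH) (admBJ aH) => /oppr_inj h.
  have := congr1 JH h; rewrite !(admJJ aH) => /oppr_inj {}h.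
  by rewrite (linearD BH) (linearZ_LR BH) -h subrK.
have := ug_der gH (f + lam *: x) 0; rewrite (ug0 gH) -E addrK => d.
exact: d.
Qed.

Lemma T0_L2 t U : fL2 (T0 t U). Proof. exact: rg_L2. Qed.
Lemma T0_cg t U : cg (T0 t U) = TH t (cg U). Proof. exact: rgK. Qed.

Lemma T0_group : deltap_group L Z T0.
Proof.
split.
- by move=> t U _; exact: T0_L2.
- move=> t a U V hU hV; apply/cg_eq; [exact: T0_L2|exact: L2_lin (T0_L2 _ _) (T0_L2 _ _)|].
  rewrite T0_cg cg_lin// cg_lin; [|exact: T0_L2|exact: T0_L2].
  rewrite !T0_cg (linD (ug_lin gH t)) (linD (ug_lin gH t)) !(linZ (ug_lin gH t)) (ugJ gH)//.
- by move=> t U hU; rewrite !L2norm_cg ?T0_cg ?(ug_nrm gH)//; exact: T0_L2.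
- by move=> U hU; apply/cg_eq; rewrite ?T0_cg ?(ug0 gH)//; exact: T0_L2.
- move=> s t U hU; apply/cg_eq; rewrite ?T0_cg ?(ugD gH)//; exact: T0_L2.
- move=> U hU; apply/cvg0P => e e0.
  have := @ug_cont _ _ _ _ _ _ gH (cg U) 0 e e0; apply: filterS => s.
  rewrite (ug0 gH) L2norm_cg; last exact: L2B (T0_L2 _ _) hU.
  by rewrite cgB ?T0_cg// ?ger0_norm ?nrm_ge0//; exact: T0_L2.
- move=> U F hU hF; rewrite (graphP hU hF); apply: iff_trans (der_domain (cg U) (cg F)).
  apply: quot_der => //; [by move=> h; exact: T0_L2|by move=> h; exact: T0_cg|exact: (ug0 gH)].
Qed.

(** Uniqueness in Stone's theorem. The action [S] induced on classes commutes with its generator,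
    hence with [BH], and [group_unique] identifies [BH (S t x)] with [TH t (BH x)]. *)
Lemma group_cg T : deltap_group L Z T -> forall t U, fL2 U -> cg (T t U) = TH t (cg U).
Proof.
move=> gT t U hU.
pose S (t : R) (x : HH) := cg (T t (rg x)).
have L2T s V : fL2 V -> fL2 (T s V) by exact: (deltap_group_L2 gT).
(* Linearity and isometry force [T s] to respect equality almost everywhere. *)
have Sc s V : fL2 V -> cg (T s V) = S s (cg V).
  move=> hV; apply/eqP; rewrite -subr_eq0; apply/eqP; apply: nrm_eq0.
  have h := deltap_group_linear gT s (-1) (rg_L2 (cg V)) hV.
  have e : cg (-1 *: T s (rg (cg V)) + T s V) = cg (T s V) - S s (cg V).
    rewrite scaleN1r addrC cgB//; [exact: L2T|by apply: L2T; exact: rg_L2].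
  rewrite -e; move/cg_eq: h => <-; last first.
  - by rewrite scaleN1r addrC; apply: L2B; apply: L2T => //; exact: rg_L2.
  - by apply: L2T; apply: L2_lin => //; exact: rg_L2.
  have h0 : fL2 (-1 *: rg (cg V) + V) by apply: L2_lin => //; exact: rg_L2.
  rewrite -L2norm_cg; last exact: L2T.
  rewrite (deltap_group_isometry gT)// L2norm_cg// scaleN1r addrC cgB//; last exact: rg_L2.
  by rewrite rgK subrr nrm0.
have SZ s (a : R[i]) x y : S s (complex.Re a *: x + complex.Im a *: JH x + y) =
    complex.Re a *: S s x + complex.Im a *: JH (S s x) + S s y.
  rewrite -{1 2}(rgK x) -{1}(rgK y) -cg_lin; try exact: rg_L2.
  rewrite -Sc; last by apply: L2_lin; exact: rg_L2.
  have /cg_eq -> := deltap_group_linear gT s a (rg_L2 x) (rg_L2 y).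
  - by rewrite cg_lin//; apply: L2T; exact: rg_L2.
  - by apply: L2T; apply: L2_lin; exact: rg_L2.
  - by apply: L2_lin; apply: L2T; exact: rg_L2.
have Slin s : linear (S s).
  by move=> a x y; have := SZ s a%:C%C x y; rewrite /= !scale0r !addr0.
have S0 s : S s 0 = 0 by have := Slin s (-1) 0 0; rewrite scaler0 addr0 scaleN1r addNr.
have SJ s x : S s (JH x) = JH (S s x).
  by have := SZ s 'i%C x 0; rewrite /= !scale0r !add0r !scale1r S0 !addr0.
have Snrm s x : nrm (S s x) = nrm x.
  rewrite -{2}(rgK x) -!L2norm_cg ?(deltap_group_isometry gT)//; try exact: rg_L2.
  by apply: L2T; exact: rg_L2.
have S00 x : S 0 x = x.
  rewrite -{2}(rgK x); apply/cg_eq; [by apply: L2T; exact: rg_L2|exact: rg_L2|].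
  exact: (deltap_group0 gT) (rg_L2 x).
have SD s r x : S (s + r) x = S s (S r x).
  have h := deltap_groupD gT s r (rg_L2 x).
  rewrite -[RHS]Sc; last by apply: L2T; exact: rg_L2.
  by apply/cg_eq => //; [by apply: L2T; exact: rg_L2|exact: (L2T _ _ (L2T _ _ (rg_L2 x)))].
have gen x f : der (fun s => S s x) 0 (- JH f) <-> x = BH (f + lam *: x).
  have := graphP (rg_L2 x) (rg_L2 f); rewrite !rgK => <-.
  have := deltap_group_generator gT (rg_L2 x) (rg_L2 f) => <-.
  apply: iff_sym; rewrite -{2}(rgK f); apply: quot_der; try exact: rg_L2.
  - by move=> h; apply: L2T; exact: rg_L2.
  - by move=> h; rewrite /= Sc ?rgK//; exact: rg_L2.
  - by rewrite rgK; exact: S00.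
have derB0 y s : der (fun r => S r (BH y)) s (S s (- JH (y - lam *: BH y))).
  have d0 : der (fun r => S r (BH y)) 0 (- JH (y - lam *: BH y)).
    by apply/gen; rewrite subrK.
  have d1 : der (fun r => S s (S r (BH y))) 0 (S s (- JH (y - lam *: BH y))).
    apply: (@der_op _ _ _ (S s) 1 (fun r => S r (BH y))) d0; first exact: Slin.
    by move=> z; rewrite mul1r Snrm.
  have d2 : der (fun r => S (r + s) (BH y)) 0 (S s (- JH (y - lam *: BH y))).
    by apply: eq_der d1 => r; rewrite addrC SD.
  have := @der_shift _ _ (fun r => S (r + s) (BH y)) (- s) s _; rewrite subrr => /(_ _ d2).
  by apply: eq_der => r; rewrite subrK.
have SB s y : BH (S s y) = S s (BH y).
  have d0 : der (fun r => S r (S s (BH y))) 0 (- JH (S s (y - lam *: BH y))).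
    have d1 : der (fun r => S (r + s) (BH y)) 0 (S s (- JH (y - lam *: BH y))).
      apply: (@der_shift _ _ (fun r => S r (BH y)) s 0); rewrite add0r; exact: derB0.
    by have := eq_der (fun r => SD r s (BH y)) d1; rewrite (linN (Slin s)) SJ.
  have := (gen _ _).1 d0; rewrite (linB (Slin s)) (linZ (Slin s)) subrK => <-//.
have k s : der (fun s => BH (S s (cg U))) s (- JH (S s (cg U) - lam *: BH (S s (cg U)))).
  have -> : - JH (S s (cg U) - lam *: BH (S s (cg U))) = S s (- JH (cg U - lam *: BH (cg U))).
    by rewrite (linN (Slin s)) SJ (linB (Slin s)) (linZ (Slin s)) SB.
  by apply: eq_der (derB0 (cg U) s) => r; rewrite SB.
have := group_unique gH k t; rewrite S00 (ugB gH) => h.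
rewrite (Sc t U hU); apply/eqP; rewrite -subr_eq0; apply/eqP; apply: (admBinj aH).
by rewrite (linearB BH) h subrr.
Qed.

Lemma foCubic (q : VV) k x : L <= x -> fo (cubic (gf (ev q))) k x = ev (mV q q q) k x.
Proof.
move=> Lx; rewrite evm//; case: k => j b; rewrite /fo /cubic /gf /mf /dot /sqnormc /=.
by case: b => /=; field.
Qed.

Lemma cubic_cls (U : gfun) : fH1 U ->
  fL2 (cubic U) /\ cg (cubic U) = iot (nl (mV (Z0 := Z0)) (toVg L Z0 U)).
Proof.
move=> hU; set q := toVg L Z0 U.
have E k : aeqL L (fo (cubic U) k) (ev (mV q q q) k).
  apply: ae_on => x Lx; rewrite -foCubic//.
  rewrite /fo /cubic /gf /sqnormc /= !ev_toVg//; case: k => j b /=.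
  by case: b => /=; rewrite /fo /=; case: (U j x).
have m1 k : sq2 L (fo (cubic U) k).
  apply: ae_sq2 (evD (mV q q q) k) (E k).
  case: k => j b; have /L2P h := H1_L2 hU; have [mr _] := h (j, false); have [mi _] := h (j, true).
  rewrite /fo /= in mr mi; rewrite /fo /cubic /sqnormc /=.
  have mm : measurable_fun `[L, +oo[ (fun x => complex.Re (U j x) ^+ 2 + complex.Im (U j x) ^+ 2).
    by apply: measurable_funD; exact: measurable_funX.
  case: b.
    have := measurable_funM mm mi; congr (measurable_fun _); apply/funext => x.
    by rewrite /GRing.mul_fun; case: (U j x) => c d /=; ring.
  have := measurable_funM mm mr; congr (measurable_fun _); apply/funext => x.
  by rewrite /GRing.mul_fun; case: (U j x) => c d /=; ring.
split; first exact/L2P.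
by apply/clsH_eq => //; exact: evD.
Qed.

Notation nls := (nls_sol JV TV (mV (Z0 := Z0))).
Notation nlV := (nl (mV (Z0 := Z0))).

Lemma H1_lin (a : R[i]) U F : fH1 U -> fH1 F -> fH1 (a *: U + F).
Proof.
move=> [V /H1_derivP hV] [W /H1_derivP hW]; exists (a *: V + W); apply/H1_derivP.
rewrite !foD !foZ -!addrA.
have h1 := JfH1 hV; have := H1D_lin (complex.Re a) hV (H1D_lin (complex.Im a) h1 hW).
by [].
Qed.
Lemma H1B U F : fH1 U -> fH1 F -> fH1 (U - F).
Proof. by move=> hU hF; rewrite addrC -scaleN1r; exact: H1_lin. Qed.
Lemma toVg_lin (a : R[i]) U F : fH1 U -> fH1 F ->
  toVg L Z0 (a *: U + F) = complex.Re a *: toVg L Z0 U + complex.Im a *: JV (toVg L Z0 U) + toVg L Z0 F.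
Proof.
move=> hU hF; apply: ev_ext => -[j b] x Lx; rewrite ev_toVg//; last exact: H1_lin.
rewrite !evD_// !evZ// evJ// !ev_toVg// foD foZ /Jf /=.
by case: b; rewrite !fctE /= !ev_toVg.
Qed.
Lemma toVgB U F : fH1 U -> fH1 F -> toVg L Z0 (U - F) = toVg L Z0 U - toVg L Z0 F.
Proof.
move=> hU hF; have := toVg_lin (-1) hF hU; rewrite scaleN1r addrC => ->.
have -> : complex.Im (-1 : R[i]) = 0 by rewrite /= oppr0.
have -> : complex.Re (-1 : R[i]) = -1 by [].
by rewrite scale0r addr0 scaleN1r addrC.
Qed.

(** For fixed [t] the Duhamel integrand is, up to the factor i, the derivative of [TV t (w s)] in
    [s]. Its integral is therefore an increment, which is the Duhamel formula. *)
Lemma sol_of_nls (w : R -> VV) (U0 : gfun) : fH1 U0 -> w 0 = toVg L Z0 U0 -> nls w ->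
  global_solution L Z U0 (fun t => gf (ev (TV t (w t)))).
Proof.
move=> hU0 w0 hw; pose u t := TV t (w t); have [Cm cf] := cubic_cf L N Z0.
have cu : cont u by move=> t; exact: (cont_sol gV (hw t)).
have hU t : fH1 (gf (ev (u t))) by exact: gf_ev_H1.
have tU t : toVg L Z0 (gf (ev (u t))) = u t by exact: toVgK.
split=> //.
  move=> t; apply/cvg0P => e e0; have e2 : 0 < e / 2 by rewrite divr_gt0.
  apply: filterS (cu t (e / 2) e2) => s h; rewrite ger0_norm; last exact: sqrtr_ge0.
  apply: (le_trans (H1norm_le Z0 (H1B (hU s) (hU t))).1); rewrite toVgB// !tU; lra.
exists T0; first exact: T0_group.
move=> t; pose A (x : VV) := - JH (iot (TV t x)).
have lA : linear A.
  move=> a x y; rewrite /A (linD (ug_lin gV t)) (linZ (ug_lin gV t)) (linD (@iot_lin _ _ _ _ Z0)) (linZ (@iot_lin _ _ _ _ Z0)).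
  by rewrite (linearD JH) (linearZ_LR JH) opprD scalerN.
have bA x : nrm (A x) <= 1 * nrm x.
  by rewrite /A nrmN (nrmJ aH) mul1r; apply: (le_trans (iot_nrm _)); rewrite (ug_nrm gV).
pose f s := TH (t - s) (iot (nlV (u s))).
have AJ x : A (JV x) = iot (TV t x).
  by rewrite /A (ugJ gV) iotJ (admJJ aH) opprK.
have fE s : f s = A (JV (TV (- s) (nlV (u s)))) by rewrite AJ -(ugD gV) iotT.
have dP s : der (fun s => A (w s)) s (f s) by rewrite fE; exact: der_op lA bA (hw s).
have cf_ : cont f.
  move=> s; have c1 : cont_at (fun s => TV (- s) (nlV (u s))) s.
    by apply: (cont_TN gV); exact: cont_nl cf _ _ (cu s).
  have c2 : cont_at (fun s => A (JV (TV (- s) (nlV (u s))))) s.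
    apply: (@cont_op _ _ _ (fun x => A (JV x)) 1 (fun s => TV (- s) (nlV (u s)))) c1.
      by move=> a x y; rewrite (linearP JV) lA.
    by move=> x; apply: (le_trans (bA _)); rewrite (nrmJ aV).
  by move=> e e0; apply: filterS (c2 e e0) => r; rewrite !fE.
have hc s := cubic_cls (hU s).
exists (rg (A (w t) - A (w 0))).
  apply/(@L2_integralP _ _ _ (fun s => T0 (t - s) (cubic (gf (ev (u s))))) f (fun s => A (w s))) => //.
  - by move=> s; exact: T0_L2.
  - by move=> s; rewrite T0_cg (hc s).2 tU.
  - exact: rg_L2.
  - exact: rgK.
have hI := rg_L2 (A (w t) - A (w 0)).
apply/cg_eq; [exact: H1_L2 (hU t)|by apply: L2D_; [exact: T0_L2|exact: L2Z]|].
have e0 : cg U0 = iot (toVg L Z0 U0) := esym (iot_toVg Z0 hU0).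
rewrite cgD; [|exact: T0_L2|exact: L2Z].
rewrite T0_cg cgI// rgK e0 -w0 -iotT.
have -> : cg (gf (ev (u t))) = iot (u t) by have := iot_toVg Z0 (hU t); rewrite tU.
have JA x : JH (A x) = iot (TV t x) by rewrite /A (linearN JH) (admJJ aH) opprK.
by rewrite (linearB JH) (JA (w t)) (JA (w 0)) addrC subrK.
Qed.

(** Here [w] is defined through a primitive in the energy space and so is differentiable there by
    construction. The identity [u t = TV t (w t)] needs checking only in L^2, as [iot] is
    injective. *)
Lemma nls_of_sol (U0 : gfun) (U : R -> gfun) : fH1 U0 -> global_solution L Z U0 U ->
  exists w, [/\ w 0 = toVg L Z0 U0, nls w & forall t, toVg L Z0 (U t) = TV t (w t)].
Proof.
move=> hU0 [hU cU [T gT hT]]; have [Cm cf] := cubic_cf L N Z0.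
pose u t := toVg L Z0 (U t); have l0 : 0 < lam by exact: lt_le_trans ltr01 (lam_ge1 Z N).
have cu : cont u.
  move=> t e e0; have := cU t; move=> /cvg0P/(_ _ (divr_gt0 e0 l0)); apply: filterS => s.
  rewrite ger0_norm; last exact: sqrtr_ge0.
  rewrite ler_pdivlMr// mulrC => h; rewrite /u -toVgB//.
  exact: le_trans (H1norm_le Z0 (H1B (hU s) (hU t))).2 h.
have cg_ : cont (fun s => TV (- s) (nlV (u s))).
  by move=> s; apply: (cont_TN gV); exact: cont_nl cf _ _ (cu s).
have [P0 [P00 dP0]] := primitive cg_.
pose w t := toVg L Z0 U0 + JV (P0 t).
have uw t : u t = TV t (w t).
  have [I hI /cg_eq E] := hT t; have hI2 : fL2 I by case: hI.
  pose A (x : VV) := iot (TV t x).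
  have lA : linear A.
    by move=> a x y; rewrite /A (linD (ug_lin gV t)) (linZ (ug_lin gV t)) (linD (@iot_lin _ _ _ _ Z0)) (linZ (@iot_lin _ _ _ _ Z0)).
  have bA x : nrm (A x) <= 1 * nrm x.
    by rewrite mul1r; apply: (le_trans (iot_nrm _)); rewrite (ug_nrm gV).
  pose f s := TH (t - s) (iot (nlV (u s))).
  have fE s : f s = A (TV (- s) (nlV (u s))) by rewrite /A -(ugD gV) iotT.
  have hc s := cubic_cls (hU s).
  have := @L2_integralP _ L N (fun s => T (t - s) (cubic (U s))) f (fun s => A (P0 s)) 0 t I.
  move=> H; have {H} EI : cg I = A (P0 t) - A (P0 0).
    apply/H => //.
    - by move=> s; apply: (deltap_group_L2 gT); exact: (hc s).1.
    - by move=> s; rewrite (group_cg gT)// ?(hc s).2//; exact: (hc s).1.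
    - by move=> s; rewrite fE; exact: der_op lA bA (dP0 s).
    - move=> s e e0; apply: filterS (cont_op lA bA (cg_ s) e0) => r; rewrite !fE//.
  have hT0 : fL2 (T t U0) by apply: (deltap_group_L2 gT); exact: H1_L2.
  have {}E : cg (U t) = TH t (cg U0) + JH (cg I).
    rewrite E; [|exact: H1_L2|by apply: L2D_ => //; exact: L2Z].
    by rewrite cgD ?cgI// ?(group_cg gT)//; [exact: H1_L2|exact: L2Z].
  apply/eqP; rewrite -subr_eq0; apply/eqP; apply: iot_inj.
  rewrite (linB (@iot_lin _ _ _ _ Z0)) iot_toVg// -/(cg (U t)) E EI P00.
  have e0 : cg U0 = iot (toVg L Z0 U0) := esym (iot_toVg Z0 hU0).
  rewrite /A (lin0 (ug_lin gV t)) (lin0 (@iot_lin _ _ _ _ Z0)) subr0 e0 -iotT -iotJ -(ugJ gV).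
  by rewrite /w (linD (ug_lin gV t)) (linD (@iot_lin _ _ _ _ Z0)) subrr.
exists w; split=> [|t|t]; last exact: uw.
- by rewrite /w P00 (linear0 JV) addr0.
rewrite -uw /w -[JV _]add0r; apply: derD; first exact: der_cst.
apply: (@der_op _ _ _ JV 1 P0) (dP0 t); first exact: linearP.
by move=> x; rewrite mul1r (nrmJ aV).
Qed.

End Dynamics.

(** * Symmetric subspaces *)

Section Transfer.
Context {R : realType} (L Z : R) (N : nat).
Hypothesis Z0 : Z < 0.
Notation HH := (HH L N). Notation VV := (VV L N Z0).
Notation gfun := (gfun R N). Notation lam := (lam Z N).
Notation JV := (JV L N Z0). Notation BV := (BV L N Z0). Notation JH := (JH L N). Notation BH := (BH L N Z0).
Implicit Types U F W G : gfun.
Notation fL2 := (Defs.L2 L). Notation fH1 := (Defs.H1 L).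
Notation toVg := (toVg L Z0). Notation mV := (@mV R L Z N Z0).

Section Stable.
Variables (TH : R -> HH -> HH) (TV : R -> VV -> VV).
Hypotheses (gH : unitary_group JH BH lam TH) (gV : unitary_group JV BV lam TV)
  (iotT : forall t q, iot (TV t q) = TH t (iot q)).

Definition stableV (Y : VV -> Prop) (Th : VV) : Prop :=
  forall eps : R, 0 < eps -> exists2 eta : R, 0 < eta & forall u0, Y u0 -> nrm (u0 - Th) < eta ->
    exists w : R -> VV, [/\ w 0 = u0, nls_sol JV TV mV w &
      forall t, exists th, nrm (TV t (w t) - rot JV th Th) <= eps].

Lemma H1_0 : fH1 (0 : gfun).
Proof. by exists 0; apply/H1_derivP; rewrite fo0 => k; exact: H1s0. Qed.
Lemma toVg_cis th U : fH1 U -> fH1 (cis th *: U) /\ toVg (cis th *: U) = rot JV th (toVg U).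
Proof.
move=> hU; split; first by rewrite -[_ *: U]addr0; exact: H1_lin hU H1_0.
apply: ev_ext => k x Lx; rewrite /rot.
have h : fH1 (cis th *: U) by rewrite -[_ *: U]addr0; exact: H1_lin hU H1_0.
rewrite ev_toVg// foZ evD_// !evZ//.
have -> : ev (JV (toVg U)) k x = Jf (fo U) k x.
  by rewrite evJ//; case: k => j b; rewrite /Jf /=; case: b; rewrite ev_toVg.
by rewrite ev_toVg.
Qed.

Lemma orbitally_stable_of (X : set gfun) (Y : VV -> Prop) (G : gfun) : fH1 G ->
  (forall U, X U -> fH1 U /\ Y (toVg U)) -> stableV Y (toVg G) -> orbitally_stable L Z X G.
Proof.
(* [H1norm_le] costs a factor 2, and the remaining factor 2 keeps the inequality strict after the
   supremum over time. *)
move=> hG hX st eps e0; have e4 : 0 < eps / 4 by rewrite divr_gt0.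
have [eta eta0 h] := st _ e4; have l0 : 0 < lam by exact: lt_le_trans ltr01 (lam_ge1 Z N).
exists (eta / lam); first by rewrite divr_gt0.
move=> U0 /hX[hU0 YU0]; rewrite ltr_pdivlMr// mulrC => hn.
have [|w [w0 hw hd]] := h _ YU0.
  by rewrite -toVgB//; apply: le_lt_trans hn; exact: (H1norm_le Z0 (H1B hU0 hG)).2.
exists (fun t => gf (ev (TV t (w t)))); first exact: sol_of_nls gH gV iotT _ _ hU0 w0 hw.
apply: (@le_lt_trans _ _ (eps / 2)%:E); last by rewrite lte_fin; lra.
apply: ge_ereal_sup => _ [t _ <-]; have [th hth] := hd t.
apply: le_trans (ereal_inf_lbound _) _; first by exists th.
rewrite lee_fin; have hU : fH1 (gf (ev (TV t (w t)))) by exact: gf_ev_H1.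
have [hc ec] := toVg_cis th hG.
apply: (le_trans (H1norm_le Z0 (H1B hU hc)).1); rewrite toVgB// ec toVgK; lra.
Qed.

(** Stability in H^1 passes to every subset [Y], so instability may be proved in a symmetric
    subspace of choice. *)
Lemma stableV_of (Y : VV -> Prop) (G : gfun) : fH1 G ->
  orbitally_stable L Z fH1 G -> stableV Y (toVg G).
Proof.
move=> hG st eps e0; have l0 : 0 < lam by exact: lt_le_trans ltr01 (lam_ge1 Z N).
have [eta eta0 h] := st _ (divr_gt0 e0 l0); exists (eta / 2); first by rewrite divr_gt0.
move=> u0 _; rewrite ltr_pdivlMr// mulrC => hn.
have hU0 : fH1 (gf (ev u0)) by exact: gf_ev_H1.
have [|U sU] := h _ hU0.
  apply: le_lt_trans hn; apply: (le_trans (H1norm_le Z0 (H1B hU0 hG)).1).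
  by rewrite (toVgB Z0 hU0 hG) toVgK mulrC.
have [w [w0 hw uw]] := nls_of_sol gH gV iotT hU0 sU; rewrite toVgK in w0.
move=> hs; exists w; split=> // t.
have : (ereal_inf (range (fun theta : R => (H1norm L (U t - cis theta *: G))%:E)) < (eps / lam)%:E)%E.
  by apply: le_lt_trans hs; apply: ereal_sup_ubound; exists t.
move=> /ereal_inf_lt[_ [th _ <-]]; rewrite lte_fin ltr_pdivlMr// mulrC => hth.
have [hU _ _] := sU; have [hc ec] := toVg_cis th hG.
exists th; rewrite -uw -ec -toVgB//; apply: le_trans (ltW hth).
exact: (H1norm_le Z0 (H1B (hU t) hc)).2.
Qed.
End Stable.

Section Transposition.
Variables (i j : 'I_N).
Let s (k : comp N) : comp N := (tperm i j k.1, k.2).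
Let sK : involutive s.
Proof. by case=> a b; rewrite /s /= tpermK. Qed.

Definition Pf (u : field_ N) : @field_ R N := fun k => u (s k).
Lemma Pf_L2s u v : L2s L (Pf u) (Pf v) = L2s L u v.
Proof. by rewrite /L2s [RHS](reindex_inj (inv_inj sK)). Qed.
Lemma Pf_vsum u b : vsum L (Pf u) b = vsum L u b.
Proof.
rewrite /vsum [RHS](reindex_inj (h := tperm i j))//.
exact: (inv_inj (tpermK i j)).
Qed.
Lemma Pf_H1 p : H1D L p -> H1D L ((Pf p.1, Pf p.2) : pair_ N).
Proof. by move=> h k; exact: h. Qed.
Definition PVf (q : VV) : VV := clsV L Z0 (Pf (repV q).1, Pf (repV q).2).
Lemma evP q k x : L <= x -> ev (PVf q) k x = ev q (s k) x.
Proof. by move=> Lx; rewrite evE//; apply: Pf_H1; exact: repVD. Qed.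
Lemma PVlin : linear PVf.
Proof. by move=> a x y; apply: ev_ext => k t Lt; rewrite ev_lin// !evP// ev_lin. Qed.
Definition PV : {linear VV -> VV} := lin_of PVlin.
Lemma PV_ip x y : ip (PV x) (PV y) = ip x y.
Proof.
rewrite [LHS](ipV_cls Z0 (Pf_H1 (repVD x)) (Pf_H1 (repVD y))) ipV /H1a /= !Pf_L2s.
by congr (_ + _ * _); apply: eq_bigr => b _; rewrite !Pf_vsum.
Qed.
Lemma PVK x : PV (PV x) = x.
Proof. by apply: ev_ext => k t Lt; rewrite !evP// sK. Qed.
Lemma L2s_ev_eq (x y : VV) (u v : @field_ R N) : (forall k t, L <= t -> ev x k t = u k t) ->
  (forall k t, L <= t -> ev y k t = v k t) -> L2s L (ev x) (ev y) = L2s L u v.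
Proof.
move=> h1 h2; apply: eq_bigr => k _; apply: int_eq => t; rewrite /= in_itv /= andbT => Lt.
by rewrite h1// h2.
Qed.
Lemma PV_symmetry : symmetry JV BV mV PV.
Proof.
split.
- by move=> x; rewrite /nrm PV_ip.
- by move=> x; apply: ev_ext => k t Lt; rewrite evP// !evJ// /Jf /=; case: k => a [] /=; rewrite evP.
- move=> x; apply: ip_ext => q; rewrite -{1}(PVK q) PV_ip.
  apply: (etrans (ipBE x (PV q))); apply: (etrans _ (esym (ipBE (PV x) q))).
  rewrite -Pf_L2s; apply/esym; apply: L2s_ev_eq => k t Lt; first by rewrite evP.
  by rewrite /Pf evP// sK.
- by move=> x; apply: ev_ext => k t Lt; rewrite evP// !evm// /mf /dot /= !evP.
Qed.
Lemma PV_fixed q : PV q = q <-> forall b x, L <= x -> ev q (i, b) x = ev q (j, b) x.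
Proof.
split=> [h b x Lx|h].
  by rewrite -{1}h evP// /s /= tpermL.
apply: ev_ext => -[a b] x Lx; rewrite evP// /s /=.
by case: tpermP => [->|->|//]; rewrite h.
Qed.
End Transposition.

Variable rel : 'I_N -> 'I_N -> bool.
(** Agreement on related edges is invariance under the transpositions exchanging them, and
    [symmetry] applies to each transposition. The empty relation gives the whole space. *)
Definition relT := {p : 'I_N * 'I_N | rel p.1 p.2}.
Definition PR (p : relT) : {linear VV -> VV} := PV (val p).1 (val p).2.
Definition YR (q : VV) := forall p : relT, PR p q = q.
Lemma YRP q : YR q <-> forall i j b x, rel i j -> L <= x -> ev q (i, b) x = ev q (j, b) x.
Proof.
split=> [h i j b x r Lx|h [[i j] r]]; last by apply/PV_fixed => b x Lx; exact: h.
by have := h (exist _ (i, j) r); move/PV_fixed; apply.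
Qed.
Lemma PR_symmetry p : symmetry JV BV mV (PR p). Proof. exact: PV_symmetry. Qed.

End Transfer.

Section MeanSpace.
Context {R : realType} (L Z : R) (N n : nat).
Hypothesis Z0 : Z < 0.
Definition rel_mean (i j : 'I_N) : bool := (i < n)%N == (j < n)%N.
Lemma Xmean_YR (U : gfun R N) : (Xmean L n `&` Defs.H1 L) U ->
  Defs.H1 L U /\ YR rel_mean (toVg L Z0 U).
Proof.
move=> [[_ h] hU]; split=> //; apply/YRP => i j b x /eqP r Lx; rewrite !ev_toVg//.
have [F hF] := H1P hU.
have ae : aeqL L (fun x => -1 * fo U (j, b) x + fo U (i, b) x) (fun=> 0).
  apply: aeS (h i j r) => t ht Lt; rewrite /fo /= (ht Lt).
  by case: b; ring.
have [ai _ _] := hF (i, b); have [aj _ _] := hF (j, b).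
have := cont_ae0 (AC_lin (-1) aj ai) ae Lx => /=; lra.
Qed.
End MeanSpace.

(** * Factorized quadratic forms *)

Section SmoothAC.
Context {R : realType} (L : R).
Notation sq2 := (sq2 L). Notation sip := (sip L). Notation H1s := (H1s L). Notation AC := (AC L).
Notation D := (`[L, +oo[%classic : set R).
Notation mu := (@lebesgue_measure R).
Implicit Types f g b u v : R -> R.
Let mD : measurable D. Proof. exact: measurable_itv. Qed.

Lemma AC_smooth f f' : (forall x, L <= x -> is_derive x (1 : R) f (f' x)) ->
  (forall x, L <= x -> derivable f' x 1) -> AC f f'.
Proof.
move=> df df'.
have cf' a M : L <= a -> {within `[a, M], continuous f'}.
  move=> La; apply: derivable_within_continuous => x; rewrite in_itv /= => /andP[ax _].
  by apply: df'; exact: le_trans ax.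
have lf' : loc L f'.
  move=> M; apply: continuous_compact_integrable; first exact: segment_compact.
  exact: cf'.
split=> // x; rewrite le_eqVlt => /predU1P[<-|Lx]; first by rewrite Int0 addr0.
have cf a : L <= a -> {for a, continuous f}.
  by move=> La; apply: differentiable_continuous; apply/derivable1_diffP; case: (df a La).
have dfo : derivable_oo_LRcontinuous f L x.
  split.
  - by move=> y; rewrite in_itv /= => /andP[Ly _]; case: (df y (ltW Ly)).
  - by apply: cvg_at_right_filter; exact: cf.
  - by apply: cvg_at_left_filter; apply: cf; exact: ltW.
have dE : {in `]L, x[, (f^`())%classic =1 f'}.
  move=> y; rewrite in_itv /= => /andP[Ly _]; rewrite derive1E.
  by have := df y (ltW Ly); case.
have := continuous_FTC2 Lx (cf' L x (lexx L)) dfo dE.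
by rewrite /Int /Rintegral => ->; rewrite -EFinB /= addrC subrK.
Qed.

Lemma itg_mul_bdd b f C : measurable_fun D b -> (forall x, L <= x -> `|b x| <= C) -> itg D f ->
  itg D (fun x => b x * f x).
Proof.
move=> mb bC hf; apply: (@itg_le _ _ _ (fun x => C * `|f x|)) => //.
- by apply: measurable_funM => //; exact: itg_meas hf.
- by move=> x; rewrite /= in_itv /= andbT => Lx; rewrite normrM ler_wpM2r// bC.
- by apply: itgZ => //; exact: itg_norm.
Qed.

Definition bdd b := exists C : R, forall x, L <= x -> `|b x| <= C.

Lemma weighted_ibp b b' u u' v v' : AC b b' -> bdd b -> bdd b' -> H1s u u' -> H1s v v' ->
  [/\ itg D (fun x => b' x * (u x * v x)), itg D (fun x => b x * (u' x * v x + u x * v' x)) &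
  \int[mu]_(x in D) (b' x * (u x * v x)) + \int[mu]_(x in D) (b x * (u' x * v x + u x * v' x)) =
    - (b L * (u L * v L))].
Proof.
move=> ab [C1 h1] [C2 h2] [au hu hu'] [av hv hv'].
have i1 := sq2_mul hu hv; have i2 := sq2_mul hu' hv; have i3 := sq2_mul hu hv'.
have mb := AC_meas ab; have mb' := loc_meas ab.1.
have j1 := itg_mul_bdd mb' h2 i1; have j2 := itg_mul_bdd mb h1 (itgD mD i2 i3).
split=> //; rewrite -intD//.
by rewrite -(ibp_infty (AC_mul ab (AC_mul au av)) (itg_mul_bdd mb h1 i1) (itgD mD j1 j2)).
Qed.

Lemma sq2_bmul b f : measurable_fun D b -> bdd b -> sq2 f -> sq2 (fun x => b x * f x).
Proof. by move=> mb [C hC] hf; exact: (sq2_bdd_mul mb hC hf). Qed.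

(** In the product of [u' - g u] and [v' - g v] the mixed terms form [- g (u v)']; integration by
    parts turns them into the potential [g'] and a vertex term. *)
Lemma factor_bilin g g' u u' v v' : AC g g' -> bdd g -> bdd g' -> H1s u u' -> H1s v v' ->
  itg D (fun x => (g x ^+ 2 + g' x) * (u x * v x)) /\
  sip u' v' + \int[mu]_(x in D) ((g x ^+ 2 + g' x) * (u x * v x)) =
  sip (fun x => u' x - g x * u x) (fun x => v' x - g x * v x) - g L * (u L * v L).
Proof.
move=> ag bg bg' Hu Hv; have [j1 j2 E] := weighted_ibp ag bg bg' Hu Hv.
have [au hu hu'] := Hu; have [av hv hv'] := Hv; have mg := AC_meas ag.
have gu := sq2_bmul mg bg hu; have gv := sq2_bmul mg bg hv.
have k1 := sq2_mul gu gv.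
have e1 : (fun x => (g x ^+ 2 + g' x) * (u x * v x)) = (fun x => (g x * u x) * (g x * v x) + g' x * (u x * v x)).
  by apply/funext => x; ring.
have i1 : itg D (fun x => (g x ^+ 2 + g' x) * (u x * v x)) by rewrite e1; exact: itgD.
split=> //.
have k2 := sq2_mul hu' hv'.
have ru := sq2B hu' gu; have rv := sq2B hv' gv.
suff : sip (fun x => u' x - g x * u x) (fun x => v' x - g x * v x) +
   \int[mu]_(x in D) (g x * (u' x * v x + u x * v' x)) = sip u' v' + \int[mu]_(x in D) ((g x * u x) * (g x * v x)).
  have -> : \int[mu]_(x in D) ((g x ^+ 2 + g' x) * (u x * v x)) =
    \int[mu]_(x in D) ((g x * u x) * (g x * v x)) + \int[mu]_(x in D) (g' x * (u x * v x)).
    by rewrite -intD//; apply: int_eq => x _; ring.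
  by move: E; set a := \int[mu]_(x in D) (g' x * _); set b := \int[mu]_(x in D) (g x * (_ + _)); set c := \int[mu]_(x in D) _; set d := sip _ _; set e := sip _ _; lra.
rewrite /sip -!intD//; last exact: sq2_mul.
by apply: int_eq => x _; ring.
Qed.

(* Integrating [(rho v^2)'] controls [v] by its initial value and by [v' - g v],
   as soon as the weight [rho] satisfies [rho' + 2 rho g <= - gam]. *)
Lemma energy_bound g rho rho' (C gam : R) : 0 < gam -> 0 <= C -> measurable_fun D g -> bdd g ->
  AC rho rho' -> bdd rho' -> (forall x, L <= x -> 0 <= rho x <= C) ->
  (forall x, L <= x -> rho' x + 2 * rho x * g x <= - gam) ->
  forall v v', H1s v v' ->
  gam / 2 * sip v v <= C * v L ^+ 2 + 2 * C ^+ 2 / gam * sip (fun x => v' x - g x * v x) (fun x => v' x - g x * v x).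
Proof.
move=> g0 C0 mg bg ar br' rC hr v v' Hv.
have br : bdd rho by exists C => x Lx; have /andP[r0 rc] := rC x Lx; rewrite ger0_norm.
have [j1 j2 E] := weighted_ibp ar br br' Hv Hv.
have [av hv hv'] := Hv; have r2 := sq2B hv' (sq2_bmul mg bg hv).
have k1 := sq2_mul hv hv; have k2 := sq2_mul r2 r2.
have h : - (C * v L ^+ 2) <= - (rho L * (v L * v L)).
  by rewrite lerN2 -expr2 ler_wpM2r ?sqr_ge0//; have /andP[] := rC L (lexx L).
have : - (rho L * (v L * v L)) <= - (gam / 2) * sip v v +
   2 * C ^+ 2 / gam * sip (fun x => v' x - g x * v x) (fun x => v' x - g x * v x).
  rewrite -E -intD// /sip -!intZ// -intD//; try exact: itgZ.
  apply: int_le => //; [exact: itgD|by apply: itgD => //; exact: itgZ|].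
  move=> x; rewrite /= in_itv /= andbT => Lx; have /andP[r0 rc] := rC x Lx.
  set r := v' x - g x * v x; set V := v x.
  have -> : v' x = r + g x * V by rewrite /r /V; ring.
  have e1 : rho' x * (V * V) + rho x * ((r + g x * V) * V + V * (r + g x * V)) =
     (rho' x + 2 * rho x * g x) * V ^+ 2 + 2 * rho x * (r * V) by ring.
  rewrite e1; have e2 := ler_wpM2r (sqr_ge0 V) (hr x Lx).
  have e3 : 2 * rho x * (r * V) <= gam / 2 * V ^+ 2 + 2 * rho x ^+ 2 / gam * r ^+ 2.
    have : 0 <= (gam * V - 2 * rho x * r) ^+ 2 / (2 * gam) by rewrite divr_ge0 ?sqr_ge0// mulr_ge0// ltW.
    rewrite (_ : (gam * V - 2 * rho x * r) ^+ 2 / (2 * gam) = gam / 2 * V ^+ 2 + 2 * rho x ^+ 2 / gam * r ^+ 2 - 2 * rho x * (r * V)); first lra.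
    by field; rewrite gt_eqF.
  have e4 : 2 * rho x ^+ 2 / gam * r ^+ 2 <= 2 * C ^+ 2 / gam * r ^+ 2.
    rewrite ler_wpM2r ?sqr_ge0// ler_wpM2r ?invr_ge0 ?(ltW g0)// ler_wpM2l//.
    by rewrite ler_sqr ?nnegrE// (le_trans r0).
  rewrite -!expr2; lra.
lra.
Qed.

Lemma sq2_of_bound f (C : R) : measurable_fun D f -> (forall b : R, L <= b -> Int L b (fun x => f x ^+ 2) <= C) ->
  loc L (fun x => f x ^+ 2) -> sq2 f /\ sip f f <= C.
Proof.
move=> mf hC lf.
have m2 : measurable_fun D (fun x => f x ^+ 2) by exact: measurable_funX.
have lim := nonneg_exhaust m2 (fun x _ => sqr_ge0 (f x)).
have b : (\int[mu]_(x in D) (f x ^+ 2)%:E <= C%:E)%E.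
  rewrite -(cvg_lim _ lim)//; apply: lime_le; first by apply/cvg_ex; eexists; exact: lim.
  apply: nearW => n; rewrite -[leLHS]fineK; last exact: integrable_fin_num (lf _).
  by rewrite lee_fin; apply: hC; rewrite lerDl.
have sf : sq2 f.
  split=> //; apply/integrableP; split; first exact/measurable_EFinP.
  apply: le_lt_trans (ltry C); apply: le_trans b; rewrite le_eqVlt; apply/orP; left; apply/eqP.
  by apply: eq_integral => x _; rewrite /= ger0_norm ?sqr_ge0.
by split=> //; rewrite -lee_fin -sipE.
Qed.
End SmoothAC.

(** * The soliton profile *)

Section PointDerivative.
Context {R : realType}.
Implicit Types (f g : R -> R) (x a b : R).
Definition dv x f a := is_derive x (1 : R) f a.

Lemma dv_eq x f a b : dv x f a -> a = b -> dv x f b.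
Proof. by move=> h <-. Qed.
Lemma dv_cst x a : dv x (fun=> a) 0.
Proof. exact: is_derive_cst. Qed.
Lemma dv_id x : dv x (fun y => y) 1.
Proof. exact: is_derive_id. Qed.
Lemma dvD x f g a b : dv x f a -> dv x g b -> dv x (fun y => f y + g y) (a + b).
Proof. by move=> h h'; exact: (is_deriveD h h'). Qed.
Lemma dvM x f g a b : dv x f a -> dv x g b -> dv x (fun y => f y * g y) (a * g x + f x * b).
Proof. by move=> h h'; apply: dv_eq (is_deriveM h h') _; rewrite /GRing.scale /= addrC (mulrC (g x)). Qed.
Lemma dvZ x f a b : dv x f a -> dv x (fun y => b * f y) (b * a).
Proof. by move=> h; apply: dv_eq (dvM (dv_cst x b) h) _; rewrite mul0r add0r. Qed.
Lemma dvB x f g a b : dv x f a -> dv x g b -> dv x (fun y => f y - g y) (a - b).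
Proof. by move=> h h'; exact: (is_deriveB h h'). Qed.
Lemma dv_sqr x f a : dv x f a -> dv x (fun y => f y ^+ 2) (2 * (f x * a)).
Proof. by move=> h; apply: dv_eq (dvM h h) _; ring. Qed.
Lemma dvV x f a : f x != 0 -> dv x f a -> dv x (fun y => (f y)^-1) (- a / f x ^+ 2).
Proof. by move=> f0 h; apply: dv_eq (is_deriveV f0 h) _; rewrite /GRing.scale /= mulNr mulrC mulNr. Qed.
Lemma dv_exp x f a : dv x f a -> dv x (fun y => expR (f y)) (a * expR (f x)).
Proof. by move=> h; apply: dv_eq (is_derive1_comp (is_derive_expR (f x)) h) _; rewrite mulrC. Qed.
Lemma dv_derivable x f a : dv x f a -> derivable f x 1.
Proof. by case. Qed.
End PointDerivative.

Section Profile.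
Context {R : realType} (L om : R).
Notation sq2 := (sq2 L). Notation sip := (sip L). Notation H1s := (H1s L). Notation AC := (AC L).
Notation D := (`[L, +oo[%classic : set R).
Notation mu := (@lebesgue_measure R).
Notation k := (Num.sqrt om).
Let mD : measurable D. Proof. exact: measurable_itv. Qed.

(** Here [tau] is the hyperbolic tangent of the argument of the soliton and [psi] the soliton
    itself. The later computations use only these differential and algebraic relations. *)
Record profile (t : R) (tau psi : R -> R) : Prop := Profile {
  pr_t : 0 < t < 1;
  pr_dtau : forall x, dv x tau (k * (1 - tau x ^+ 2));
  pr_dpsi : forall x, dv x psi (- k * tau x * psi x);
  pr_gt0 : forall x, 0 < psi x;
  pr_sqr : forall x, psi x ^+ 2 = 2 * om * (1 - tau x ^+ 2);
  pr_L : tau L = t }.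

Hypothesis om0 : 0 < om.
Let k0 : 0 < k. Proof. by rewrite sqrtr_gt0. Qed.
Let kk : k ^+ 2 = om. Proof. by rewrite sqr_sqrtr// ltW. Qed.

Lemma profile_Psi t : 0 < t < 1 -> exists tau, profile t tau (Psi L om (artanh t)).
Proof.
move=> /andP[t0 t1].
pose a := artanh t; pose E (x : R) := k * (x + - L) + a.
pose p (x : R) := expR (E x); pose q (x : R) := expR (- 1 * E x).
have p0 x : 0 < p x by exact: expR_gt0.
have q0 x : 0 < q x by exact: expR_gt0.
have pq x : p x * q x = 1 by rewrite /p /q -expRD mulN1r subrr expR0.
have s0 x : 0 < p x + q x by rewrite addr_gt0.
have sn x : p x + q x != 0 by rewrite gt_eqF.
have dE x : dv x E k.
  by apply: dv_eq (dvD (dvZ k (dvD (dv_id x) (dv_cst x _))) (dv_cst x _)) _; ring.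
have dp x : dv x p (k * p x) by exact: dv_exp.
have dq x : dv x q (- k * q x) by apply: dv_eq (dv_exp (dvZ (-1) (dE x))) _; rewrite mulN1r.
have ds x : dv x (fun x => (p x + q x)^-1) (- (k * p x + - k * q x) / (p x + q x) ^+ 2).
  exact: (dvV (f := fun x => p x + q x) (sn x) (dvD (dp x) (dq x))).
pose tau (x : R) := (p x + -1 * q x) * (p x + q x)^-1.
have PsiE x : Psi L om a x = Num.sqrt (2 * om) * 2 * (p x + q x)^-1.
  by rewrite /Psi /sech /p /q mulN1r mulrA.
have tE x : 1 - tau x ^+ 2 = 4 * ((p x + q x)^-1) ^+ 2.
  have -> : 1 - tau x ^+ 2 = 4 * (p x * q x) * (p x + q x)^-1 ^+ 2 by rewrite /tau; field.
  by rewrite pq mulr1.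
exists tau; split.
- by rewrite t0.
- move=> x; apply: dv_eq (dvM (dvD (dp x) (dvZ (-1) (dq x))) (ds x)) _.
  by rewrite /tau; field.
- move=> x; rewrite (_ : Psi L om (artanh t) = fun x => Num.sqrt (2 * om) * 2 * (p x + q x)^-1).
    by apply: dv_eq (dvZ _ (ds x)) _; rewrite /tau; field.
  by apply/funext => y; exact: PsiE.
- by move=> x; rewrite PsiE !mulr_gt0 ?invr_gt0// sqrtr_gt0 mulr_gt0.
- move=> x; rewrite PsiE tE !exprMn sqr_sqrtr; last by rewrite mulr_ge0// ltW.
  by ring.
- have pL : p L ^+ 2 = (1 + t) / (1 - t).
    rewrite /p /E subrr mulr0 add0r -expRM_natl /a /artanh (_ : 2 * _ = ln ((1 + t) / (1 - t))); last by field.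
    by rewrite lnK// posrE divr_gt0//; lra.
  have qL : q L = (p L)^-1 by apply: (mulfI (lt0r_neq0 (p0 L))); rewrite pq divff ?gt_eqF.
  have pn : p L != 0 by rewrite gt_eqF.
  have -> : tau L = (p L ^+ 2 - 1) / (p L ^+ 2 + 1).
    rewrite /tau qL; field; rewrite pn andbT; have := sqr_ge0 (p L); lra.
  by rewrite pL; field; apply/andP; split; lra.
Qed.

Section Calculus.
Variables (t : R) (tau psi : R -> R).
Hypothesis P : profile t tau psi.
Let t0 : 0 < t. Proof. by case/andP: (pr_t P). Qed.
Let t1 : t < 1. Proof. by case/andP: (pr_t P). Qed.
Let dtau := pr_dtau P. Let dpsi := pr_dpsi P. Let psi0 := pr_gt0 P. Let psi2 := pr_sqr P.

Lemma tau_sqr_lt1 x : 0 < 1 - tau x ^+ 2.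
Proof. by have := exprn_gt0 2 (psi0 x); rewrite psi2 pmulr_rgt0// mulr_gt0. Qed.
Lemma tau_lt1 x : tau x < 1.
Proof. have := tau_sqr_lt1 x; rewrite (_ : 1 - _ = (1 - tau x) * (1 + tau x)); [nra|ring]. Qed.
Lemma AC_tau : AC tau (fun x => k * (1 - tau x ^+ 2)).
Proof.
apply: AC_smooth => [x _|x _]; first exact: dtau.
by apply: dv_derivable; exact: dvZ (dvB (dv_cst x 1) (dv_sqr (dtau x))).
Qed.
Lemma tau_ge x : L <= x -> t <= tau x.
Proof.
move=> Lx; have [_ ->//] := AC_tau; rewrite (pr_L P) lerDl.
by apply: Int_ge0 => y _; rewrite mulr_ge0 ?(ltW k0) ?(ltW (tau_sqr_lt1 y)).
Qed.
Lemma tau_gt0 x : L <= x -> 0 < tau x.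
Proof. by move=> /tau_ge; exact: lt_le_trans. Qed.
Lemma AC_psi : AC psi (fun x => - k * tau x * psi x).
Proof.
apply: AC_smooth => [x _|x _]; first exact: dpsi.
by apply: dv_derivable; exact: dvM (dvZ _ (dtau x)) (dpsi x).
Qed.
Lemma AC_inv : AC (fun x => (tau x)^-1) (fun x => - (k * (1 - tau x ^+ 2)) / tau x ^+ 2).
Proof.
apply: AC_smooth => x Lx; have t0x := lt0r_neq0 (tau_gt0 Lx); first exact: dvV.
apply: dv_derivable; apply: dvM; first exact: (is_deriveN (dvZ _ (dvB (dv_cst x 1) (dv_sqr (dtau x))))).
by apply: dvV (dv_sqr (dtau x)); rewrite expf_neq0.
Qed.
Lemma bdd_tau : bdd L tau.
Proof. by exists 1 => x Lx; rewrite gtr0_norm ?tau_gt0// ltW// tau_lt1. Qed.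
Lemma bdd_inv : bdd L (fun x => (tau x)^-1).
Proof.
exists t^-1 => x Lx; rewrite gtr0_norm ?invr_gt0 ?tau_gt0//.
by rewrite lef_pV2 ?posrE ?tau_gt0// tau_ge.
Qed.

(* [psi^2 = 2 k tau'], so the mass is bounded by the variation of [tau]. *)
Lemma psi_sq2 : sq2 psi.
Proof.
have mp := AC_meas AC_psi.
have ap2 := AC_mul AC_psi AC_psi.
suff [//] : sq2 psi /\ sip psi psi <= 2 * k; apply: sq2_of_bound => //; last first.
  rewrite (_ : (fun x => _) = (fun x => psi x * psi x)); last by apply/funext => x; rewrite expr2.
  exact: AC_loc ap2.
move=> b Lb; have [lt E] := AC_tau.
have -> : Int L b (fun x => psi x ^+ 2) = Int L b (fun x => 2 * k * (k * (1 - tau x ^+ 2))).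
  by apply: Int_eq => x _; rewrite psi2; move: kk; set K := k => <-; ring.
rewrite (IntZ (2 * k) b lt (lexx L)) ger_pMr ?mulr_gt0//.
have := E b Lb; have := tau_lt1 b; have := pr_L P; have := t0; move=> ? ? ? ?; lra.
Qed.

Lemma AC_eqd (f g h : R -> R) : AC f g -> (forall x, L <= x -> g x = h x) -> AC f h.
Proof.
move=> [lg E] gh; split=> [M|x Lx].
  by apply: itg_eq (lg M) => //= x; rewrite in_itv /= => /andP[/gh].
by rewrite E//; congr (_ + _); apply: Int_eq => y /andP[/gh].
Qed.
Lemma sq2_eq (f g : R -> R) : (forall x, L <= x -> f x = g x) -> sq2 f -> sq2 g.
Proof.
move=> e [mf hf]; have e' x : D x -> f x = g x by rewrite /= in_itv /= andbT; exact: e.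
split; first by apply: eq_measurable_fun mf => x; rewrite inE; exact: e'.
by apply: itg_eq hf => // x /e' ->.
Qed.
Lemma H1s_eqd (f g h : R -> R) : H1s f g -> (forall x, L <= x -> g x = h x) -> H1s f h.
Proof. by move=> [af sf sg] e; split=> //; [exact: AC_eqd af e|exact: sq2_eq e sg]. Qed.
Lemma bddM (f g : R -> R) : bdd L f -> bdd L g -> bdd L (fun x => f x * g x).
Proof.
move=> [C hC] [C' hC']; exists (C * C') => x Lx; rewrite normrM ler_pM//; [exact: hC|exact: hC'].
Qed.
Lemma bddD (f g : R -> R) : bdd L f -> bdd L g -> bdd L (fun x => f x + g x).
Proof.
move=> [C hC] [C' hC']; exists (C + C') => x Lx; apply: le_trans (ler_normD _ _) _.
by apply: lerD; [exact: hC|exact: hC'].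
Qed.
Lemma bddC (a : R) : bdd L (fun=> a).
Proof. by exists `|a|. Qed.
Lemma bdd_eq (f g : R -> R) : (forall x, L <= x -> f x = g x) -> bdd L f -> bdd L g.
Proof. by move=> e [C hC]; exists C => x Lx; rewrite -e// hC. Qed.
Lemma H1s_bmul (b b' f f' : R -> R) : AC b b' -> bdd L b -> bdd L b' -> H1s f f' ->
  H1s (fun x => b x * f x) (fun x => b' x * f x + b x * f' x).
Proof.
move=> ab bb bb' [af sf sf']; have mb := AC_meas ab; have mb' := loc_meas ab.1.
by split; [exact: AC_mul|exact: sq2_bmul|apply: sq2D; exact: sq2_bmul].
Qed.

Lemma bdd_dtau : bdd L (fun x => k * (1 - tau x ^+ 2)).
Proof.
apply: bdd_eq (bddM (bddC k) (bddD (bddC 1) (bddM (bddC (-1)) (bddM bdd_tau bdd_tau)))) => x _; ring.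
Qed.
Lemma bdd_dinv : bdd L (fun x => - (k * (1 - tau x ^+ 2)) / tau x ^+ 2).
Proof.
apply: bdd_eq (bddM (bddM (bddC (-1)) bdd_dtau) (bddM bdd_inv bdd_inv)) => x Lx.
by field; rewrite gt_eqF// tau_gt0.
Qed.
Lemma H1s_psi : H1s psi (fun x => - k * tau x * psi x).
Proof.
split; [exact: AC_psi|exact: psi_sq2|].
apply: sq2_bmul psi_sq2; first by apply: measurable_funM => //; exact: AC_meas AC_tau.
exact: bddM (bddC _) bdd_tau.
Qed.
Lemma H1s_dpsi : H1s (fun x => - k * tau x * psi x) (fun x => (om - psi x ^+ 2) * psi x).
Proof.
have a : AC (fun x => - k * tau x) (fun x => - k * (k * (1 - tau x ^+ 2))).
  have := AC_lin (- k - 1) AC_tau AC_tau.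
  rewrite (_ : (fun x => (- k - 1) * tau x + tau x) = (fun x => - k * tau x)); last by apply/funext => x; ring.
  by move=> h; apply: (AC_eqd h) => x _; ring.
apply: H1s_eqd (H1s_bmul a (bddM (bddC _) bdd_tau) (bddM (bddC _) bdd_dtau) H1s_psi) _ => x _.
by rewrite psi2; move: kk; set K := k => <-; ring.
Qed.
(** The function [w = psi / tau] solves [w' + gplus w = - 2 k psi]. So integration by parts
    expresses the pairing of [psi] with [v] by the vertex value of [v] and the pairing of [w] with
    [v' - gplus v] ([sip_psi]). *)
Definition prw x := psi x / tau x.
Lemma prwE : prw = (fun x => (tau x)^-1 * psi x).
Proof. by apply/funext => x; rewrite /prw mulrC. Qed.
Lemma H1s_w : H1s prw (fun x => - k * psi x / tau x ^+ 2).
Proof.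
rewrite prwE; apply: H1s_eqd (H1s_bmul AC_inv bdd_inv bdd_dinv H1s_psi) _ => x Lx.
by field; rewrite gt_eqF// tau_gt0.
Qed.
(** The function [q = (x - L) psi] satisfies [q' = psi - k tau q] with [tau >= t > 0], so
    integrating the derivative of [q ^ 2] bounds its square integral by that of [psi]. *)
Lemma xpsi_H1s : H1s (fun x => (x - L) * psi x) (fun x => psi x + (x - L) * (- k * tau x * psi x)).
Proof.
have ai : AC (fun x => x - L) (fun=> 1).
  apply: AC_smooth => x _; last exact: dv_derivable (dv_cst x 1).
  by apply: dv_eq (dvB (dv_id x) (dv_cst x L)) _; rewrite subr0.
set q := (fun x => (x - L) * psi x).
have aq : AC q (fun x => psi x + - k * tau x * q x).
  by apply: AC_eqd (AC_mul ai AC_psi) _ => x _; rewrite /q; ring.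
have sp := psi_sq2.
have sq : sq2 q.
  suff [//] : sq2 q /\ sip q q <= (k * t)^-1 ^+ 2 * sip psi psi.
  have a2 := AC_sqr aq; have kt0 : 0 < k * t by rewrite mulr_gt0.
  have l1 : loc L (fun x => q x ^+ 2) by exact: AC_loc a2.
  apply: (sq2_of_bound (AC_meas aq)) => // b Lb.
  have l2 : loc L (fun x => psi x ^+ 2) by apply: itg_loc; exact: sp.2.
  have h : 0 <= Int L b (fun x => (k * t)^-1 * psi x ^+ 2 + (- (k * t)) * q x ^+ 2).
    apply: (@le_trans _ _ (q b ^+ 2)); first exact: sqr_ge0.
    rewrite (a2.2 b Lb) (_ : q L = 0) ?expr0n/= ?add0r; last by rewrite /q subrr mul0r.
    apply: Int_le => //; [exact: a2.1|by apply: locD; exact: locZ|].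
    move=> x /andP[Lx _]; have tx := tau_ge Lx.
    have e1 : k * t * q x ^+ 2 <= k * tau x * q x ^+ 2 by rewrite ler_wpM2r ?sqr_ge0// ler_pM2l.
    have : 0 <= (psi x - k * t * q x) ^+ 2 / (k * t) by rewrite divr_ge0 ?sqr_ge0// ltW.
    rewrite (_ : (psi x - k * t * q x) ^+ 2 / (k * t) = (k * t)^-1 * psi x ^+ 2 + k * t * q x ^+ 2 - 2 * (psi x * q x)); last first.
      by field; rewrite !gt_eqF.
    have -> : 2 * (q x * (psi x + - k * tau x * q x)) = 2 * (psi x * q x) - 2 * (k * tau x * q x ^+ 2) by ring.
    move: e1; move: (k * tau x * q x ^+ 2) (psi x * q x) (_^-1 * _) => A B C; lra.
  move: h; rewrite (IntD b (locZ _ l2) (locZ _ l1) (lexx L)).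
  rewrite (IntZ _ b l2 (lexx L)) (IntZ _ b l1 (lexx L)) mulNr subr_ge0 expr2 -mulrA => h.
  rewrite -(ler_pM2l kt0) [leRHS]mulrA divff ?gt_eqF// mul1r.
  apply: le_trans h _; rewrite ler_pM2l ?invr_gt0//; exact: Int_sip_le.
split=> //; first by apply: AC_eqd aq _ => x _; rewrite /q; ring.
have s2 := sq2_bmul (measurable_funM (measurable_cst (- k)) (AC_meas AC_tau)) (bddM (bddC (- k)) bdd_tau) sq.
by apply: sq2_eq (sq2D sp s2) => x _; rewrite /q /=; ring.
Qed.
(** [2 om] times the derivative of the profile in the frequency, the shift being fixed. Its residual
    [rplus] is [- k * prw] ([H1s_phi]). *)
Definition prphi x := (x - L) * (- k * tau x * psi x) + psi x.
Lemma H1s_phi : exists2 dphi, H1s prphi dphi &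
  forall x, L <= x -> dphi x = - k * (2 * tau x - (tau x)^-1) * prphi x - k * prw x.
Proof.
have a : AC (fun x => - k * tau x) (fun x => - k * (k * (1 - tau x ^+ 2))).
  have := AC_lin (- k - 1) AC_tau AC_tau.
  rewrite (_ : (fun x => (- k - 1) * tau x + tau x) = (fun x => - k * tau x)); last by apply/funext => x; ring.
  by move=> h; apply: (AC_eqd h) => x _; ring.
have h1 := H1s_bmul a (bddM (bddC _) bdd_tau) (bddM (bddC _) bdd_dtau) xpsi_H1s.
have h := H1s_lin 1 h1 H1s_psi.
rewrite (_ : (fun x => 1 * (- k * tau x * ((x - L) * psi x)) + psi x) = prphi) in h; last first.
  by apply/funext => x; rewrite /prphi; ring.
eexists; first exact: h.
by move=> x Lx; rewrite /prphi /prw -kk; field; rewrite gt_eqF// tau_gt0.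
Qed.
Lemma AC_cst (c : R) : AC (fun=> c) (fun=> 0).
Proof. by apply: AC_smooth => x _; exact: dv_derivable (dv_cst x 0). Qed.

Lemma energy_H1 g rho rho' (C gam : R) : 0 < gam -> 0 <= C -> measurable_fun D g -> bdd L g ->
  AC rho rho' -> bdd L rho' -> (forall x, L <= x -> 0 <= rho x <= C) ->
  (forall x, L <= x -> rho' x + 2 * rho x * g x <= - gam) ->
  exists2 K : R, 0 < K & forall v v', H1s v v' ->
  sip v v + sip v' v' <= K * (v L ^+ 2 + sip (fun x => v' x - g x * v x) (fun x => v' x - g x * v x)).
Proof.
move=> g0 C0 mg bg ar br' rC hr; have [G hG] := bg.
have G0 : 0 <= G by apply: le_trans (hG L (lexx L)).
pose A := 2 / gam * C + 2 / gam * (2 * C ^+ 2 / gam).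
have A0 : 0 <= A by rewrite addr_ge0// !mulr_ge0 ?invr_ge0 ?exprn_ge0// ltW.
exists (A + 2 + 2 * G ^+ 2 * A).
  by rewrite ltr_wpDr ?mulr_ge0 ?exprn_ge0// ltr_wpDl.
move=> v v' Hv; have [av sv sv'] := Hv; have sgv := sq2_bmul mg bg sv.
have sr := sq2B sv' sgv.
have h1 := energy_bound g0 C0 mg bg ar br' rC hr Hv.
have h2 := sip_sum_le sr sgv; have h3 := sip_mul_le G0 mg hG sv.
rewrite (_ : (fun x => v' x - g x * v x + g x * v x) = v') in h2; last by apply/funext => x; rewrite subrK.
set S := sip (fun x => v' x - _) _ in h1 h2 *; set W := sip (fun x => g x * v x) _ in h2 h3.
have S0 : 0 <= S := sip_ge0 _ _; have y0 := sqr_ge0 (v L).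
have h4 : sip v v <= A * (v L ^+ 2 + S).
  have a1 : 0 <= C by []. have a2 : 0 <= 2 * C ^+ 2 / gam by rewrite !mulr_ge0 ?invr_ge0 ?exprn_ge0// ltW.
  have gn : gam != 0 by rewrite gt_eqF.
  have e : sip v v = 2 / gam * (gam / 2 * sip v v) by field.
  have g2 : 0 <= 2 / gam by rewrite divr_ge0// ltW.
  rewrite e; apply: le_trans (ler_wpM2l g2 h1) _.
  rewrite (_ : A * _ = 2 / gam * ((C + 2 * C ^+ 2 / gam) * (v L ^+ 2 + S))); last by rewrite /A; ring.
  rewrite ler_wpM2l//.
  have := mulr_ge0 a1 S0; have := mulr_ge0 a2 y0.
  move: (2 * C ^+ 2 / gam) => B; rewrite mulrDl !mulrDr; lra.
have h5 := ler_wpM2l (exprn_ge0 2 G0) h4; rewrite mulrA in h5.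
have q0 : 0 <= v L ^+ 2 + S by rewrite addr_ge0.
have -> : (A + 2 + 2 * G ^+ 2 * A) * (v L ^+ 2 + S) =
  A * (v L ^+ 2 + S) + 2 * v L ^+ 2 + 2 * S + 2 * (G ^+ 2 * A * (v L ^+ 2 + S)) by ring.
move: h5 h4 h3 h2 y0; set a := G ^+ 2 * A * _; set b := A * _; set c := G ^+ 2 * _; lra.
Qed.

(* [gplus = psi'' / psi'] and [gminus = psi' / psi]: they factor the operators
   [- d^2 + om - 3 psi^2] and [- d^2 + om - psi^2]. *)
Definition gplus x := - k * (2 * tau x - (tau x)^-1).
Definition gminus x := - k * tau x.
Definition rplus (v v' : R -> R) x := v' x - gplus x * v x.
Definition rminus (v v' : R -> R) x := v' x - gminus x * v x.

Lemma AC_gplus : exists g', [/\ AC gplus g', bdd L gplus, bdd L g' &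
  forall x, L <= x -> gplus x ^+ 2 + g' x = om - 3 * psi x ^+ 2].
Proof.
have h := AC_lin k AC_inv (AC_lin (- 2 * k - 1) AC_tau AC_tau).
exists (fun x => k * (- (k * (1 - tau x ^+ 2)) / tau x ^+ 2) + - 2 * k * (k * (1 - tau x ^+ 2))); split.
- rewrite (_ : gplus = fun x => k * (tau x)^-1 + ((-2 * k - 1) * tau x + tau x)); last by apply/funext => x; rewrite /gplus; ring.
  by apply: (AC_eqd h) => x _; ring.
- apply: bdd_eq (bddM (bddC (- k)) (bddD (bddM (bddC 2) bdd_tau) (bddM (bddC (-1)) bdd_inv))) => x _.
  by rewrite /gplus; ring.
- exact: bddD (bddM (bddC _) bdd_dinv) (bddM (bddC _) bdd_dtau).
- move=> x Lx; rewrite /gplus psi2; have := tau_gt0 Lx; move: kk; set K := k => <- tx.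
  by field; rewrite gt_eqF.
Qed.
Lemma AC_gminus : exists g', [/\ AC gminus g', bdd L gminus, bdd L g' &
  forall x, L <= x -> gminus x ^+ 2 + g' x = om - psi x ^+ 2].
Proof.
have h := AC_lin (- k - 1) AC_tau AC_tau.
exists (fun x => - k * (k * (1 - tau x ^+ 2))); split.
- rewrite (_ : gminus = fun x => (- k - 1) * tau x + tau x); last by apply/funext => x; rewrite /gminus; ring.
  by apply: (AC_eqd h) => x _; ring.
- exact: bddM (bddC (- k)) bdd_tau.
- exact: bddM (bddC _) bdd_dtau.
- move=> x Lx; rewrite /gminus psi2; move: kk; set K := k => <-; ring.
Qed.

Lemma edge_plus u u' v v' : H1s u u' -> H1s v v' -> [/\ itg D (fun x => (om - 3 * psi x ^+ 2) * (u x * v x)),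
  sq2 (rplus u u') & sip u' v' + \int[mu]_(x in D) ((om - 3 * psi x ^+ 2) * (u x * v x)) =
  sip (rplus u u') (rplus v v') + k * ((2 * t ^+ 2 - 1) / t) * (u L * v L)].
Proof.
move=> hu hv; have [g' [a b b' e]] := AC_gplus; have [i E] := factor_bilin a b b' hu hv.
have e2 x : D x -> (gplus x ^+ 2 + g' x) * (u x * v x) = (om - 3 * psi x ^+ 2) * (u x * v x).
  by rewrite /= in_itv /= andbT => /e ->.
split; first exact: (itg_eq e2 mD i).
- have [_ su su'] := hu; exact: sq2B su' (sq2_bmul (AC_meas a) b su).
rewrite -(int_eq e2) E /gplus (pr_L P); congr (_ + _); field; exact: lt0r_neq0.
Qed.
Lemma edge_minus u u' v v' : H1s u u' -> H1s v v' -> [/\ itg D (fun x => (om - psi x ^+ 2) * (u x * v x)),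
  sq2 (rminus u u') & sip u' v' + \int[mu]_(x in D) ((om - psi x ^+ 2) * (u x * v x)) =
  sip (rminus u u') (rminus v v') + k * t * (u L * v L)].
Proof.
move=> hu hv; have [g' [a b b' e]] := AC_gminus; have [i E] := factor_bilin a b b' hu hv.
have e2 x : D x -> (gminus x ^+ 2 + g' x) * (u x * v x) = (om - psi x ^+ 2) * (u x * v x).
  by rewrite /= in_itv /= andbT => /e ->.
split; first exact: (itg_eq e2 mD i).
- have [_ su su'] := hu; exact: sq2B su' (sq2_bmul (AC_meas a) b su).
rewrite -(int_eq e2) E /gminus (pr_L P); congr (_ + _); ring.
Qed.

(** The weight is [tau ^ -2], because [gplus] is positive where [tau ^ 2 < 1 / 2]: for it,
    [rho' + 2 rho gplus] equals [- 2 k / tau], which is at most [- 2 k]. *)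
Lemma energy_plus : exists2 K : R, 0 < K & forall v v', H1s v v' ->
  sip v v + sip v' v' <= K * (v L ^+ 2 + sip (rplus v v') (rplus v v')).
Proof.
have [g' [a b _ _]] := AC_gplus; have tt : 0 <= (t^-1) ^+ 2 by rewrite exprn_ge0// invr_ge0 ltW.
have hb := bddM (bddM (bddC 2) bdd_inv) bdd_dinv.
have ar := AC_sqr AC_inv.
apply: (energy_H1 (gam := 2 * k) _ tt (AC_meas a) b ar _).
- by rewrite mulr_gt0.
- apply: bdd_eq hb => x _; ring.
- move=> x Lx; have i0 : 0 <= (tau x)^-1 by rewrite invr_ge0 ltW// tau_gt0.
  rewrite exprn_ge0//= ler_sqr ?nnegrE ?invr_ge0 ?(ltW t0) ?(ltW (tau_gt0 Lx))//.
  by rewrite lef_pV2 ?posrE ?tau_gt0// tau_ge.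
- move=> x Lx; have tx := tau_gt0 Lx; have i1 : 1 <= (tau x)^-1 by rewrite invf_ge1// ltW// tau_lt1.
  have -> : 2 * ((tau x)^-1 * (- (k * (1 - tau x ^+ 2)) / tau x ^+ 2)) + 2 * (tau x)^-1 ^+ 2 * gplus x = - (2 * k) * (tau x)^-1.
    by rewrite /gplus; field; rewrite gt_eqF.
  by rewrite mulNr lerN2 ler_peMr// mulr_ge0// ltW.
Qed.
Lemma energy_minus : exists2 K : R, 0 < K & forall v v', H1s v v' ->
  sip v v + sip v' v' <= K * (v L ^+ 2 + sip (rminus v v') (rminus v v')).
Proof.
have [g' [a b _ _]] := AC_gminus.
have a1 := AC_cst 1.
apply: (energy_H1 (gam := 2 * k * t) _ ler01 (AC_meas a) b a1 (bddC 0)).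
- by rewrite !mulr_gt0.
- by move=> x _; rewrite ler01 lexx.
- move=> x Lx; rewrite /gminus add0r mulr1 mulrA -!mulNr mulrN -!mulrA !mulNr lerN2.
  by rewrite mulrA ler_pM2l ?mulr_gt0// tau_ge.
Qed.

Lemma psi2_itg u u' v v' : H1s u u' -> H1s v v' -> itg D (fun x => psi x ^+ 2 * (u x * v x)).
Proof.
move=> [_ su _] [_ sv _]; have [C C0 hC] := H1s_bdd H1s_psi.
apply: (itg_mul_bdd (C := C ^+ 2)).
- by apply: measurable_funX; exact: AC_meas AC_psi.
- by move=> x Lx; rewrite normrX ler_sqr ?nnegrE// hC.
- exact: sq2_mul.
Qed.
Lemma form_plus u u' v v' : H1s u u' -> H1s v v' ->
  sip u' v' + om * sip u v - 3 * \int[mu]_(x in D) (psi x ^+ 2 * (u x * v x)) =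
  sip (rplus u u') (rplus v v') + k * ((2 * t ^+ 2 - 1) / t) * (u L * v L).
Proof.
move=> hu hv; have [_ _ <-] := edge_plus hu hv; have i := psi2_itg hu hv.
have [_ su _] := hu; have [_ sv _] := hv; have j := sq2_mul su sv.
rewrite -addrA; congr (_ + _); rewrite /sip -!intZ// -intB//; try exact: itgZ.
by apply: int_eq => x _; ring.
Qed.
Lemma form_minus u u' v v' : H1s u u' -> H1s v v' ->
  sip u' v' + om * sip u v - \int[mu]_(x in D) (psi x ^+ 2 * (u x * v x)) =
  sip (rminus u u') (rminus v v') + k * t * (u L * v L).
Proof.
move=> hu hv; have [_ _ <-] := edge_minus hu hv; have i := psi2_itg hu hv.
have [_ su _] := hu; have [_ sv _] := hv; have j := sq2_mul su sv.
rewrite -addrA; congr (_ + _); rewrite /sip -!intZ// -intB//; try exact: itgZ.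
by apply: int_eq => x _; ring.
Qed.

Lemma sip_psi v v' : H1s v v' -> 2 * k * sip psi v = psi L / t * v L + sip prw (rplus v v').
Proof.
move=> hv; have [g' [a b _ _]] := AC_gplus; have E := H1s_ibp H1s_w hv.
have [_ sw sw'] := H1s_w; have [_ sv sv'] := hv; have sgv := sq2_bmul (AC_meas a) b sv.
have sgw := sq2_bmul (AC_meas a) b sw.
have -> : sip prw (rplus v v') = sip prw v' - sip prw (fun x => gplus x * v x).
  rewrite /sip -intB//; [|exact: sq2_mul|exact: sq2_mul].
  by apply: int_eq => x _; rewrite /rplus; ring.
have -> : sip prw (fun x => gplus x * v x) = - (2 * k * sip psi v) - sip (fun x => - k * psi x / tau x ^+ 2) v.
  rewrite /sip -mulNr -intZ//; last exact: sq2_mul psi_sq2 sv.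
  rewrite -intB//; [|apply: itgZ => //; exact: sq2_mul psi_sq2 sv|exact: sq2_mul].
  apply: int_eq => x; rewrite /= in_itv /= andbT => Lx; rewrite /gplus /prw.
  by field; rewrite gt_eqF// tau_gt0.
have : prw L * v L = psi L / t * v L by rewrite /prw (pr_L P).
lra.
Qed.

(** Since [psi ^ 2 = 2 k tau'], the integrand is [- 2 k] times the derivative of [1 / tau], and
    [tau] tends to 1. *)
Lemma sip_w : sip prw prw = 2 * k * (t^-1 - 1).
Proof.
have tp x : L <= x -> 0 < tau x by exact: tau_gt0.
have ac : AC (fun x => (tau x)^-1 - 1) (fun x => - (k * (1 - tau x ^+ 2)) / tau x ^+ 2).
  have a1 := AC_cst (-1).
  have := AC_lin 1 AC_inv a1; rewrite (_ : (fun x => 1 * (tau x)^-1 + -1) = fun x => (tau x)^-1 - 1).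
    by move=> h; apply: AC_eqd h _ => x _; rewrite mul1r addr0.
  by apply/funext => x; rewrite mul1r.
have [_ sw _] := H1s_w.
have iw := sq2_mul sw sw; have k2 : 0 < 2 * k by rewrite mulr_gt0.
have i2 : itg D (fun x => - (k * (1 - tau x ^+ 2)) / tau x ^+ 2).
  apply: itg_eq (itgZ (- (2 * k)^-1) mD iw) => // x; rewrite /= in_itv /= andbT => Lx.
  rewrite /prw mulf_div -!expr2 psi2; have := tp _ Lx; move: kk k0; set K := k => <- K0 tx.
  by field; rewrite !gt_eqF.
have i1 : itg D (fun x => (tau x)^-1 - 1).
  have [C hC] := bdd_inv; have := itgZ (2 * om)^-1 mD (itg_mul_bdd (AC_meas AC_inv) hC (sq2_mul psi_sq2 psi_sq2)).
  move=> h; apply: itg_le h => //; first exact: AC_meas ac.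
  move=> x; rewrite /= in_itv /= andbT => Lx; have tx := tp _ Lx; have t1x := tau_lt1 x.
  have i1 : 1 <= (tau x)^-1 by rewrite invf_ge1// ltW.
  rewrite ger0_norm ?subr_ge0// -expr2 psi2.
  have -> : (2 * om)^-1 * ((tau x)^-1 * (2 * om * (1 - tau x ^+ 2))) = ((tau x)^-1 - 1) * (1 + tau x).
    by field; rewrite !gt_eqF.
  by rewrite ler_peMr ?subr_ge0// lerDl ltW.
have := ibp_infty ac i1 i2; rewrite (pr_L P) => E.
have -> : sip prw prw = - (2 * k) * \int[mu]_(x in D) (- (k * (1 - tau x ^+ 2)) / tau x ^+ 2).
  rewrite /sip -intZ//; apply: int_eq => x; rewrite /= in_itv /= andbT => Lx.
  rewrite /prw mulf_div -!expr2 psi2; have := tp _ Lx; move: kk k0; set K := k => <- K0 tx.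
  by field; rewrite !gt_eqF.
rewrite E; ring.
Qed.
Lemma psi_L_sqr : psi L ^+ 2 = 2 * om * (1 - t ^+ 2).
Proof. by rewrite psi2 (pr_L P). Qed.
Lemma rplus_dpsi x : L <= x -> rplus (fun x => - k * tau x * psi x) (fun x => (om - psi x ^+ 2) * psi x) x = 0.
Proof.
move=> Lx; rewrite /rplus /gplus psi2; have := tau_gt0 Lx; move: kk; set K := k => <- tx.
by field; rewrite gt_eqF.
Qed.
Lemma rminus_psi x : rminus psi (fun x => - k * tau x * psi x) x = 0.
Proof. by rewrite /rminus /gminus subrr. Qed.
End Calculus.
End Profile.

(** * The Hessian of the action *)

(* Young's inequality for [ey = l - w], weighted so that only a part
   [1 - e ^ 2] of [rho] is spent on the bound [w ^ 2 <= S * rho]. *)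
Lemma absorb_functional (R : realFieldType) (rho b y2 ey w l S c0 be h : R) : 0 < S -> 0 < c0 -> 0 <= be ->
  0 <= h -> 0 <= y2 -> 0 <= rho -> - (be * y2) <= b -> w ^+ 2 <= S * rho -> l = ey + w ->
  c0 * y2 <= b + ey ^+ 2 / S + h ->
  let e := c0 / (2 * (c0 + be)) in
  e ^+ 2 * rho + c0 / 2 * y2 <= rho + b + (1 + e^-1) / S * l ^+ 2 + h.
Proof.
move=> S0 c00 be0 hh0 y0 r0 hb hw lE hc /=; set e := c0 / _.
have cb0 : 0 < c0 + be by rewrite ltr_pwDl.
have e0 : 0 < e by rewrite divr_gt0 ?mulr_gt0.
have e1 : e <= 1 by rewrite /e ler_pdivrMr ?mulr_gt0//; lra.
have eE : e * (c0 + be) = c0 / 2 by rewrite /e; field; rewrite gt_eqF.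
have h1 : ey ^+ 2 <= (1 + e^-1) * l ^+ 2 + (1 + e) * w ^+ 2.
  have -> : ey = l - w by rewrite lE addrK.
  have : 0 <= (l + e * w) ^+ 2 / e by rewrite divr_ge0 ?sqr_ge0// ltW.
  have -> : (l + e * w) ^+ 2 / e = (1 + e^-1) * l ^+ 2 + (1 + e) * w ^+ 2 - (l - w) ^+ 2.
    by field; rewrite gt_eqF.
  by rewrite subr_ge0.
have h2 : ey ^+ 2 / S <= (1 + e^-1) / S * l ^+ 2 + (1 + e) * rho.
  rewrite ler_pdivrMr// mulrDl.
  have -> : (1 + e^-1) / S * l ^+ 2 * S = (1 + e^-1) * l ^+ 2 by field; rewrite !gt_eqF.
  have := ler_wpM2l (ltW (ltr_pwDl ltr01 (ltW e0))) hw; lra.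
have e1' : 0 <= 1 - e by rewrite subr_ge0.
have p0 : 0 <= (1 + e^-1) / S * l ^+ 2.
  have i0 : 0 <= 1 + e^-1 by rewrite addr_ge0// invr_ge0 ltW.
  by rewrite mulr_ge0 ?sqr_ge0// mulr_ge0// invr_ge0 ltW.
have a1 := ler_wpM2l e1' hc; have a2 := ler_wpM2l (ltW e0) hb; rewrite mulrN in a2; have a3 := ler_wpM2l e1' h2.
have a4 : e * (c0 * y2) + e * (be * y2) = c0 / 2 * y2 by rewrite -mulrDr -mulrDl mulrA eE.
have a5 := mulr_ge0 (ltW e0) p0; have a6 := mulr_ge0 (ltW e0) hh0.
move: a1 a2 a3 a4 a5 a6; move: ((1 + e^-1) / S * l ^+ 2) (ey ^+ 2 / S) => p q.
rewrite !mulrBl !mulrDr; move: (e * (c0 * y2)) (e * (be * y2)) (e * p) (e * q) (e * h) (e * b) => *.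
have : e ^+ 2 * rho = rho - ((1 + e) * rho - e * ((1 + e) * rho)) by ring.
lra.
Qed.

Lemma sqrD_le (R : realFieldType) (a b : R) : (a + b) ^+ 2 <= 2 * (a ^+ 2 + b ^+ 2).
Proof. by have := sqr_ge0 (a - b); rewrite !expr2; nra. Qed.

Section Graph.
Context {R : realType} (L Z : R) (N : nat).
Hypothesis Z0 : Z < 0.
Notation mu := (@lebesgue_measure R).
Notation D := (`[L, +oo[%classic : set R).
Notation sq2 := (sq2 L). Notation sip := (sip L). Notation H1s := (H1s L).
Notation VV := (VV L N Z0). Notation clsV := (@clsV R L Z N Z0).
Notation H1D := (@H1D R L N).
Notation L2s := (@L2s R L N). Notation H1a := (@H1a R L Z N).
Notation field_ := (@field_ R N). Notation pair_ := (@pair_ R N). Notation lam := (lam Z N).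
Notation JV := (JV L N Z0). Notation BV := (BV L N Z0). Notation mV := (@mV R L Z N Z0).
Let mD : measurable D. Proof. exact: measurable_itv. Qed.

Variables (om : R) (tt : 'I_N -> R) (tau psi : 'I_N -> R -> R).
Hypothesis om0 : 0 < om.
Hypothesis P : forall j, profile L om (tt j) (tau j) (psi j).
Notation k := (Num.sqrt om).
(** Both delta' conditions at once: the right-hand side is [Z] times the derivative of [psi i] at
    [L], for every [i]. *)
Hypothesis vertex : forall i, \sum_j psi j L = Z * (- k * tt i * psi i L).
Hypothesis N0 : (0 < N)%N.
Let k0 : 0 < k. Proof. by rewrite sqrtr_gt0. Qed.
Let tt0 j : 0 < tt j. Proof. by case/andP: (pr_t (P j)). Qed.
Let tt1 j : tt j < 1. Proof. by case/andP: (pr_t (P j)). Qed.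
Let psi0 j x : 0 < psi j x. Proof. exact: pr_gt0 (P j) x. Qed.

Definition dpsi (j : 'I_N) x := - k * tau j x * psi j x.
Definition standing : gfun R N := fun j x => (psi j x)%:C%C.
Definition pTh : pair_ := ((fun kk x => if kk.2 then 0 else psi kk.1 x), (fun kk x => if kk.2 then 0 else dpsi kk.1 x)).
Lemma pThD : H1D pTh.
Proof. by move=> [j []]; [exact: H1s0|have := H1s_psi om0 (P j)]. Qed.
Definition Th : VV := clsV pTh.
Lemma H1_standing : H1 L standing.
Proof.
exists (fun j x => (dpsi j x)%:C%C); apply/H1_derivP.
by move=> [j []]; [exact: H1s0|have := H1s_psi om0 (P j)].
Qed.
Lemma Th_standing : toVg L Z0 standing = Th.
Proof.
by apply: ev_ext => -[j b] x Lx; rewrite (ev_toVg Z0 _ H1_standing Lx) (evE Z0 _ pThD Lx); case: b.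
Qed.

Definition rp (p : pair_) j := rplus om (tau j) (p.1 (j, false)) (p.2 (j, false)).
Definition rm (p : pair_) j := rminus om (tau j) (p.1 (j, true)) (p.2 (j, true)).
Definition bd (p : pair_) b : 'I_N -> R := fun j => p.1 (j, b) L.
Definition bform (y y' : 'I_N -> R) : R :=
  \sum_j k * ((2 * tt j ^+ 2 - 1) / tt j) * (y j * y' j) + Z^-1 * ((\sum_j y j) * (\sum_j y' j)).
Definition cform (y y' : 'I_N -> R) : R :=
  \sum_j k * tt j * (y j * y' j) + Z^-1 * ((\sum_j y j) * (\sum_j y' j)).
Definition ee j := psi j L / tt j.
(** By [sip_w], the total squared norm of the functions [psi / tau]. *)
Definition SS : R := \sum_j 2 * k * ((tt j)^-1 - 1).
(* What remains of the Hessian, as a function of the vertex values, when the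
   interior of the edges is eliminated subject to orthogonality to [Th]. *)
Definition Mform (y y' : 'I_N -> R) : R :=
  bform y y' + (\sum_j ee j * y j) * (\sum_j ee j * y' j) / SS.

Notation hs := (hess BV lam mV Th om).
Lemma bool_sum (F : bool -> R) : \sum_(b : bool) F b = F true + F false.
Proof. exact: big_bool. Qed.

Lemma ipB_cls p q : H1D p -> H1D q -> ip (BV (clsV p)) (clsV q) = L2s p.1 q.1.
Proof.
move=> hp hq; apply: (etrans (ipBE _ _)); apply: L2s_ev_eq => kk t Lt; exact: evE.
Qed.

Lemma q4_cls p q : H1D p -> H1D q -> 3 * q4 BV mV Th Th (clsV p) (clsV q) =
  \sum_j (3 * \int[mu]_(x in D) (psi j x ^+ 2 * (p.1 (j, false) x * q.1 (j, false) x))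
    + \int[mu]_(x in D) (psi j x ^+ 2 * (p.1 (j, true) x * q.1 (j, true) x))).
Proof.
move=> hp hq; rewrite /q4; apply: (etrans (congr1 (fun r : R => 3 * r) (ipB_m Th Th (clsV p) (clsV q)))).
rewrite mulr_sumr; apply: eq_bigr => j _.
have i1 := psi2_itg om0 (P j) (hp (j, false)) (hq (j, false)).
have i2 := psi2_itg om0 (P j) (hp (j, true)) (hq (j, true)).
rewrite (@int_eq _ _ _ (fun x => psi j x ^+ 2 * (p.1 (j, false) x * q.1 (j, false) x) +
   3^-1 * (psi j x ^+ 2 * (p.1 (j, true) x * q.1 (j, true) x)))).
  rewrite intD//; last exact: itgZ.
  by rewrite intZ// mulrDr mulrA divff ?mul1r.
move=> x; rewrite /= in_itv /= andbT => Lx.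
rewrite /Th /dot /mf /dot /= !(evE Z0 _ pThD Lx) !(evE Z0 _ hp Lx) !(evE Z0 _ hq Lx).
by rewrite /pTh /=; field.
Qed.

Lemma hessE p q : H1D p -> H1D q -> hs (clsV p) (clsV q) =
  (\sum_j sip (rp p j) (rp q j) + bform (bd p false) (bd q false)) +
  (\sum_j sip (rm p j) (rm q j) + cform (bd p true) (bd q true)).
Proof.
move=> hp hq; rewrite /hess ipB_cls// q4_cls// (ipV_cls Z0 hp hq) /H1a !L2s_pair.
rewrite bool_sum /vsum /bform /cform.
have e1 : \sum_j sip (rp p j) (rp q j) + \sum_j k * ((2 * tt j ^+ 2 - 1) / tt j) * (bd p false j * bd q false j) =
  \sum_j (sip (p.2 (j, false)) (q.2 (j, false)) + om * sip (p.1 (j, false)) (q.1 (j, false)) -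
    3 * \int[mu]_(x in D) (psi j x ^+ 2 * (p.1 (j, false) x * q.1 (j, false) x))).
  by rewrite -big_split; apply: eq_bigr => j _; rewrite (form_plus om0 (P j) (hp _) (hq _)).
have e2 : \sum_j sip (rm p j) (rm q j) + \sum_j k * tt j * (bd p true j * bd q true j) =
  \sum_j (sip (p.2 (j, true)) (q.2 (j, true)) + om * sip (p.1 (j, true)) (q.1 (j, true)) -
    \int[mu]_(x in D) (psi j x ^+ 2 * (p.1 (j, true) x * q.1 (j, true) x))).
  by rewrite -big_split; apply: eq_bigr => j _; rewrite (form_minus om0 (P j) (hp _) (hq _)).
set A := \sum_j (sip (p.2 (j, false)) _ + _); set B := \sum_j (sip (p.1 (j, false)) _ + _); set C := \sum_j (3 * _ + _).
have key : A + om * B - C = \sum_j (sip (p.2 (j, false)) (q.2 (j, false)) + om * sip (p.1 (j, false)) (q.1 (j, false)) -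
    3 * \int[mu]_(x in D) (psi j x ^+ 2 * (p.1 (j, false) x * q.1 (j, false) x))) +
  \sum_j (sip (p.2 (j, true)) (q.2 (j, true)) + om * sip (p.1 (j, true)) (q.1 (j, true)) -
    \int[mu]_(x in D) (psi j x ^+ 2 * (p.1 (j, true) x * q.1 (j, true) x))).
  rewrite /A /B /C mulr_sumr -sumrN -!big_split; apply: eq_bigr => j _ /=; ring.
rewrite -e1 -e2 /bd in key; rewrite /bd.
transitivity (A + om * B - C + Z^-1 * ((\sum_(j < N) p.1 (j, true) L) * \sum_(j < N) q.1 (j, true) L) +
   Z^-1 * ((\sum_(j < N) p.1 (j, false) L) * \sum_(j < N) q.1 (j, false) L)); first by ring.
rewrite key; ring.
Qed.

Lemma Th_mass : 0 < mass BV Th.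
Proof.
rewrite massE; pose j := Ordinal N0.
have e : L2s (ev Th) (ev Th) = L2s pTh.1 pTh.1 by apply: L2s_ev_eq => kk t Lt; exact: evE pThD Lt.
rewrite e lt_neqAle L2s_ge0 andbT; apply/eqP => z0.
have s0 : sip (psi j) (psi j) = 0.
  apply/eqP; rewrite eq_le sip_ge0 andbT [leRHS]z0.
  exact: (L2s_term L pTh.1 (j, false)).
have := cont_ae0 (AC_psi (P j)) (sip_ae0 (psi_sq2 om0 (P j)) s0) (lexx L).
by move/eqP; rewrite gt_eqF.
Qed.

Lemma vertex_sum (y : 'I_N -> R) : \sum_j k * tt j * (psi j L * y j) + Z^-1 * ((\sum_j psi j L) * \sum_j y j) = 0.
Proof.
rewrite !mulr_sumr -big_split big1// => j _ /=; rewrite (vertex j); field; exact: ltr0_neq0.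
Qed.

Definition pJTh : pair_ := (Jf pTh.1, Jf pTh.2).
Lemma JTh_cls : JV Th = clsV pJTh.
Proof.
by apply: ev_ext => -[j b] x Lx; rewrite evJ// evE//; [rewrite /Jf; case: b; rewrite /= (evE Z0 _ pThD Lx)|exact: JfH1 pThD].
Qed.
Lemma pJThD : H1D pJTh. Proof. exact: JfH1 pThD. Qed.

Lemma hess_JTh q : H1D q -> hs (JV Th) (clsV q) = 0.
Proof.
move=> hq; rewrite JTh_cls hessE//; last exact: pJThD.
have r0 j : rp pJTh j = fun=> 0.
  by apply/funext => x; rewrite /rp /rplus /pJTh /Jf /=; ring.
have m0 j : rm pJTh j = fun=> 0.
  apply/funext => x; rewrite /rm -(rminus_psi om (tau j) (psi j) x); congr (_ _ _ _).
have z0 g : sip (fun=> 0) g = 0.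
  by rewrite /sip (@int_eq _ _ _ (fun=> 0)) ?Rintegral_cst ?mul0r// => x _; rewrite mul0r.
rewrite !big1 ?add0r; try by move=> j _; rewrite ?r0 ?m0 z0.
have b0 : bd pJTh false = fun=> 0 by apply/funext => j; rewrite /bd /pJTh /Jf /= oppr0.
have b1 : bd pJTh true = fun j => psi j L by [].
rewrite /bform /cform b0 b1 vertex_sum addr0 big1 ?add0r; last by move=> j _; rewrite mul0r mulr0.
by rewrite big1// mul0r mulr0.
Qed.

Definition lmul (p : pair_) : R := \sum_j sip (psi j) (p.1 (j, false)).
Lemma ipBTh p : H1D p -> ip (BV Th) (clsV p) = lmul p.
Proof.
move=> hp; rewrite ipB_cls//; last exact: pThD.
rewrite L2s_pair; apply: eq_bigr => j _.
rewrite [X in _ + X](_ : _ = 0) ?addr0// /sip (@int_eq _ _ _ (fun=> 0)) ?Rintegral_cst ?mul0r// => x _.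
by rewrite /pTh /= mul0r.
Qed.

Definition wres p : R := \sum_j sip (prw (tau j) (psi j)) (rp p j).
Lemma lmulE p : H1D p -> 2 * k * lmul p = \sum_j ee j * bd p false j + wres p.
Proof.
move=> hp; rewrite /lmul /wres mulr_sumr -big_split; apply: eq_bigr => j _.
exact: (sip_psi om0 (P j) (hp (j, false))).
Qed.

Lemma SS_gt0 : 0 < SS.
Proof.
have h j : 0 < 2 * k * ((tt j)^-1 - 1) by rewrite !mulr_gt0// subr_gt0 invf_gt1.
apply: lt_le_trans (h (Ordinal N0)) _.
by apply: (term_le_sum (F := fun j => 2 * k * ((tt j)^-1 - 1))) => j; exact: ltW.
Qed.
Lemma rp_sq2 p j : H1D p -> sq2 (rp p j).
Proof. by move=> hp; have [_ ] := edge_plus om0 (P j) (hp (j, false)) (hp (j, false)). Qed.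
Lemma prw_sq2 j : sq2 (prw (tau j) (psi j)).
Proof. by have [] := H1s_w om0 (P j). Qed.

Lemma wres_CS p : H1D p -> wres p ^+ 2 <= SS * \sum_j sip (rp p j) (rp p j).
Proof.
move=> hp; have S0 := SS_gt0; set rho := \sum_j _; set a := - wres p / SS.
have : 0 <= \sum_j sip (fun x => a * prw (tau j) (psi j) x + rp p j x) (fun x => a * prw (tau j) (psi j) x + rp p j x).
  by apply: sumr_ge0 => j _; exact: sip_ge0.
have -> : \sum_j sip (fun x => a * prw (tau j) (psi j) x + rp p j x) (fun x => a * prw (tau j) (psi j) x + rp p j x)
   = a ^+ 2 * SS + 2 * a * wres p + rho.
  rewrite /SS /wres /rho !mulr_sumr -!big_split; apply: eq_bigr => j _ /=.
  have w2 := prw_sq2 j; have r2 := rp_sq2 j hp; have l2 := sq2_lin a w2 r2.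
  rewrite sip_lin// ![sip _ (fun x => a * _ + _)]sipC !sip_lin// (sip_w om0 (P j)) (sipC _ (rp p j)); ring.
have -> : a ^+ 2 * SS + 2 * a * wres p + rho = (SS * rho - wres p ^+ 2) / SS by rewrite /a; field; rewrite gt_eqF.
by rewrite pmulr_lge0 ?invr_gt0// subr_ge0.
Qed.

Definition beta : R := \sum_j `|k * ((2 * tt j ^+ 2 - 1) / tt j)| + - Z^-1 * N%:R.
Lemma beta_ge0 : 0 <= beta.
Proof. by rewrite addr_ge0 ?sumr_ge0// mulr_ge0// oppr_ge0 invr_le0 ltW. Qed.
Lemma bform_ge y : - (beta * \sum_j y j ^+ 2) <= bform y y.
Proof.
rewrite /beta mulrDl opprD; apply: lerD.
  rewrite mulr_sumr -sumrN; apply: ler_sum => j _.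
  set c := k * _; have e : `|c| <= \sum_i `|k * ((2 * tt i ^+ 2 - 1) / tt i)|.
    exact: (term_le_sum (F := fun i => `|k * ((2 * tt i ^+ 2 - 1) / tt i)|)).
  rewrite -expr2 -mulNr ler_wpM2r ?sqr_ge0//.
  by apply: le_trans (lerNnormlW (lexx _)); rewrite lerN2.
have z : 0 <= - Z^-1 by rewrite oppr_ge0 invr_le0 ltW.
have := ler_wpM2l z (sum_sqr_le y); rewrite card_ord -expr2 => h.
by rewrite -mulrA !mulNr opprK; rewrite !mulNr lerN2 in h.
Qed.

(** The real part combines [absorb_functional] with [energy_plus]. For the imaginary part, zero sum
    of the vertex values removes the negative term of [cform] and leaves a positive diagonal
    form. *)
Lemma coercive_restricted (YS : ('I_N -> R) -> Prop) (c0 K0 : R) eta : 0 < c0 -> 0 <= K0 ->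
  (forall y, YS y -> c0 * \sum_j y j ^+ 2 <= Mform y y + K0 * Mform y eta ^+ 2) ->
  exists c K : R, [/\ 0 < c, 0 <= K & forall p, H1D p -> YS (bd p false) -> \sum_j bd p true j = 0 ->
   c * nrm (clsV p) ^+ 2 <= hs (clsV p) (clsV p) + K * lmul p ^+ 2 + K0 * Mform (bd p false) eta ^+ 2].
Proof.
move=> c00 K00 hM.
have /choice[Kp hKp] : forall j, exists K : R, 0 < K /\ forall v v', H1s v v' ->
   sip v v + sip v' v' <= K * (v L ^+ 2 + sip (rplus om (tau j) v v') (rplus om (tau j) v v')).
  by move=> j; have [K] := energy_plus om0 (P j); exists K.
have /choice[Km hKm] : forall j, exists K : R, 0 < K /\ forall v v', H1s v v' ->
   sip v v + sip v' v' <= K * (v L ^+ 2 + sip (rminus om (tau j) v v') (rminus om (tau j) v v')).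
  by move=> j; have [K] := energy_minus om0 (P j); exists K.
pose KK := \sum_j Kp j + \sum_j Km j.
have KpK j : Kp j <= KK.
  rewrite -[Kp j]addr0 lerD ?sumr_ge0//; last by move=> i _; exact: ltW (hKm i).1.
  by apply: (term_le_sum (F := Kp)) => i; exact: ltW (hKp i).1.
have KmK j : Km j <= KK.
  rewrite -[Km j]add0r lerD ?sumr_ge0//; first by move=> i _; exact: ltW (hKp i).1.
  by apply: (term_le_sum (F := Km)) => i; exact: ltW (hKm i).1.
have KK0 : 0 < KK := lt_le_trans (hKp (Ordinal N0)).1 (KpK _).
(* A positive lower bound of all the [tt j]. *)
pose tm := (\sum_j (tt j)^-1)^-1.
have ts0 : 0 < \sum_j (tt j)^-1.
  apply: (@lt_le_trans _ _ (tt (Ordinal N0))^-1); first by rewrite invr_gt0.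
  by apply: (term_le_sum (F := fun j => (tt j)^-1)) => i; rewrite invr_ge0 ltW.
have tm0 : 0 < tm by rewrite invr_gt0.
have tmE j : tm <= tt j.
  rewrite -[tt j]invrK lef_pV2 ?posrE ?invr_gt0//.
  by apply: (term_le_sum (F := fun j => (tt j)^-1)) => i; rewrite invr_ge0 ltW.
pose e := c0 / (2 * (c0 + beta)).
have e0 : 0 < e by rewrite divr_gt0// mulr_gt0// ltr_pwDl// beta_ge0.
pose c1 := Num.min (Num.min (e ^+ 2) (c0 / 2)) (Num.min 1 (k * tm)).
have c10 : 0 < c1 by rewrite /c1 !lt_min exprn_gt0// divr_gt0// ltr01 mulr_gt0.
have lam0 : 0 < lam := lt_le_trans ltr01 (lam_ge1 Z N).
have lK : 0 < lam * KK by rewrite mulr_gt0.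
exists (c1 / (lam * KK)), ((1 + e^-1) / SS * (2 * k) ^+ 2); split.
- by rewrite divr_gt0.
- by rewrite mulr_ge0 ?sqr_ge0// divr_ge0 ?(ltW SS_gt0)// addr_ge0// invr_ge0 ltW.
move=> p hp hY ht.
have := absorb_functional SS_gt0 c00 beta_ge0 (mulr_ge0 K00 (sqr_ge0 (Mform (bd p false) eta)))
  (sumr_ge0 _ (fun j _ => sqr_ge0 (bd p false j))) (sumr_ge0 _ (fun j _ => sip_ge0 _ (rp p j)))
  (bform_ge (bd p false)) (wres_CS hp) (lmulE hp).
have -> : bform (bd p false) (bd p false) + (\sum_j ee j * bd p false j) ^+ 2 / SS = Mform (bd p false) (bd p false).
  by rewrite /Mform expr2.
move=> /(_ (hM _ hY)); rewrite -/e => main.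
set rho := \sum_j sip (rp p j) _ in main; set y2 := \sum_j _ ^+ 2 in main.
pose rho' := \sum_j sip (rm p j) (rm p j); pose z2 := \sum_j bd p true j ^+ 2.
have rho0 : 0 <= rho by apply: sumr_ge0 => j _; exact: sip_ge0.
have rho'0 : 0 <= rho' by apply: sumr_ge0 => j _; exact: sip_ge0.
have y20 : 0 <= y2 by apply: sumr_ge0 => j _; exact: sqr_ge0.
have z20 : 0 <= z2 by apply: sumr_ge0 => j _; exact: sqr_ge0.
have hn : nrm (clsV p) ^+ 2 <= lam * KK * (rho + y2 + rho' + z2).
  rewrite nrm2 (ipV_cls Z0 hp hp) -mulrA; apply: le_trans (H1a_le L Z0 p) _; rewrite ler_pM2l//.
  rewrite /H1n !L2s_pair -big_split /= /rho /y2 /rho' /z2 -!big_split mulr_sumr; apply: ler_sum => j _ /=.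
  have h1 := (hKp j).2 _ _ (hp (j, false)); have h2 := (hKm j).2 _ _ (hp (j, true)).
  have q1 : 0 <= bd p false j ^+ 2 + sip (rp p j) (rp p j) by rewrite addr_ge0 ?sqr_ge0 ?sip_ge0.
  have q2 : 0 <= bd p true j ^+ 2 + sip (rm p j) (rm p j) by rewrite addr_ge0 ?sqr_ge0 ?sip_ge0.
  have h3 := le_trans h1 (ler_wpM2r q1 (KpK j)); have h4 := le_trans h2 (ler_wpM2r q2 (KmK j)).
  move: h3 h4; rewrite /rp /rm /bd !mulrDr; lra.
have hc : rho' + cform (bd p true) (bd p true) >= c1 * rho' + c1 * z2.
  rewrite /cform ht !mul0r mulr0 addr0; apply: lerD.
    by rewrite -[leRHS]mul1r ler_wpM2r// /c1 !ge_min lexx !orbT.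
  rewrite /z2 mulr_sumr; apply: ler_sum => j _; rewrite -expr2 ler_wpM2r ?sqr_ge0//.
  apply: (@le_trans _ _ (k * tm)); first by rewrite /c1 !ge_min lexx !orbT.
  by rewrite ler_pM2l.
have h1 : c1 * rho <= e ^+ 2 * rho by rewrite ler_wpM2r// /c1 !ge_min lexx.
have h2 : c1 * y2 <= c0 / 2 * y2 by rewrite ler_wpM2r// /c1 !ge_min lexx !orbT.
have h3 : c1 / (lam * KK) * nrm (clsV p) ^+ 2 <= c1 * rho + c1 * y2 + c1 * rho' + c1 * z2.
  rewrite -!mulrDr -mulrA ler_pM2l// ler_pdivrMl//.
have e3 : (1 + e^-1) / SS * (2 * k * lmul p) ^+ 2 = (1 + e^-1) / SS * (2 * k) ^+ 2 * lmul p ^+ 2 by ring.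
rewrite hessE// -/rho -/rho'; rewrite /= e3 in main.
apply: le_trans h3 _; lra.
Qed.

(** The imaginary form has potential [om - psi ^ 2], the one of the stationary equation. Hence
    [hess_JTh], tested with the rotated vector [J r], is the weak form of that equation tested with
    [r]. *)
Lemma stat_Th : Th + (om - lam) *: BV Th = BV (nl mV Th).
Proof.
apply: ip_ext => r; rewrite -(repVK r); set q := repV r; have hq : H1D q := repVD r.
have hJ : H1D ((Jf q.1, Jf q.2) : pair_) := JfH1 hq.
have a1 : ip (JV Th) (clsV (Jf q.1, Jf q.2)) = H1a pJTh (Jf q.1, Jf q.2).
  by rewrite JTh_cls; exact: ipV_cls pJThD hJ.
have a2 : ip (BV (JV Th)) (clsV (Jf q.1, Jf q.2)) = L2s pJTh.1 (Jf q.1).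
  by rewrite JTh_cls; exact: ipB_cls pJThD hJ.
have a3 := q4_cls pJThD hJ; rewrite -JTh_cls in a3.
have E : forall A B C : R, ip (JV Th) (clsV (Jf q.1, Jf q.2)) = A -> ip (BV (JV Th)) (clsV (Jf q.1, Jf q.2)) = B ->
    3 * q4 BV mV Th Th (JV Th) (clsV (Jf q.1, Jf q.2)) = C -> A + (om - lam) * B - C = 0.
  by move=> A B C <- <- <-; exact: hess_JTh hJ.
have {a1 a2 a3} {}E := E _ _ _ a1 a2 a3.
have e1 : H1a pJTh (Jf q.1, Jf q.2) = ip Th (clsV q).
  rewrite (ipV_cls Z0 pThD hq) /H1a /= !Jf_L2s; congr (_ + _ * _).
  by rewrite !bool_sum !vsumJ /=; ring.
have e2 : L2s pJTh.1 (Jf q.1) = ip (BV Th) (clsV q) by rewrite ipB_cls ?Jf_L2s//; exact: pThD.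
have e3 := q4_cls pThD hq; rewrite -/Th in e3.
rewrite e1 e2 in E; rewrite ipDl ipZl.
suff h : ip Th (clsV q) + (om - lam) * ip (BV Th) (clsV q) = q4 BV mV Th Th Th (clsV q) by exact: h.
apply: (etrans (subr0_eq E)).
apply: (@mulfI _ 3) => //; rewrite e3 mulr_sumr; apply: eq_bigr => j _.
have z : \int[mu]_(x in D) (0 : R) = 0 by rewrite Rintegral_cst// mul0r.
rewrite (@int_eq _ _ (fun x => _ * (pJTh.1 (j, false) x * _)) (fun=> 0)); last first.
  by move=> x _; rewrite /pJTh /Jf /=; ring.
rewrite z mulr0 add0r [X in _ = _ + X](@int_eq _ _ _ (fun=> 0)); last by move=> x _ /=; ring.
by rewrite z addr0; congr (_ * _); apply: int_eq => x _; rewrite /pJTh /Jf /=.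
Qed.

(** A multiple of [J Th] is subtracted to reach the case of [coercive_restricted]. It lies in the
    kernel of the Hessian, and its size is controlled by the pairing with [J Th] and by the norm of
    the rest. *)
Lemma coercive (YS : ('I_N -> R) -> Prop) (c0 K0 : R) eta : 0 < c0 -> 0 <= K0 ->
  (forall y, YS y -> c0 * \sum_j y j ^+ 2 <= Mform y y + K0 * Mform y eta ^+ 2) ->
  exists c K : R, [/\ 0 < c, 0 <= K & forall p, H1D p -> YS (bd p false) ->
   c * nrm (clsV p) ^+ 2 <= hs (clsV p) (clsV p) + K * lmul p ^+ 2 + K * ip (JV Th) (clsV p) ^+ 2
     + K0 * Mform (bd p false) eta ^+ 2].
Proof.
move=> c00 K00 /(coercive_restricted c00 K00)[c [K [c1 K1 h]]].
have [Cm cf] := cubic_cf L N Z0; have adm := admV L N Z0.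
set T := nrm (JV Th) ^+ 2.
have T0 : 0 < T.
  rewrite /T exprn_gt0// lt_neqAle nrm_ge0 andbT eq_sym; apply/eqP => /nrm_eq0 z.
  have Th0 : Th = 0 by apply/oppr_inj; rewrite -(JVJV Th) z linear0 oppr0.
  by have := Th_mass; rewrite Th0 /mass linear0 ip0l ltxx.
exists (c / 6), (K + c / T); split; [by rewrite divr_gt0|by rewrite addr_ge0// divr_ge0// ltW|].
(* Chosen to cancel the sum of the imaginary vertex values; the decomposition is not orthogonal,
   which costs the factor 6. *)
move=> p hp hY; pose s := (\sum_j bd p true j) / (\sum_j psi j L).
have ps0 : 0 < \sum_j psi j L.
  apply: lt_le_trans (psi0 (Ordinal N0) L) _.
  by apply: (term_le_sum (F := fun j => psi j L)) => i; exact: ltW.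
pose q : pair_ := - s *: pJTh + p.
have hq : H1D q by apply: H1D_lin => //; exact: pJThD.
have qf j x : q.1 (j, false) x = p.1 (j, false) x.
  by rewrite /q /= !fctE /Jf /= /GRing.scale /= oppr0 mulr0 add0r.
have bq : bd q false = bd p false by apply/funext => j; rewrite /bd qf.
have lq : lmul q = lmul p.
  by apply: eq_bigr => j _; apply: int_eq => x _; rewrite qf.
have tq : \sum_j bd q true j = 0.
  have -> : \sum_j bd q true j = - s * \sum_j psi j L + \sum_j bd p true j.
    by rewrite mulr_sumr -big_split; apply: eq_bigr => j _.
  by rewrite /s mulNr divfK ?gt_eqF// addNr.
have xq : clsV p = clsV q + s *: JV Th.
  rewrite JTh_cls /q clsV_lin//; last exact: pJThD.
  by rewrite scaleNr addrC addrA subrr add0r.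
have hh : hs (clsV p) (clsV p) = hs (clsV q) (clsV q).
  have z r : H1D r -> hs (s *: JV Th) (clsV r) = 0 by move=> hr; rewrite (hessZ lam cf) hess_JTh// mulr0.
  rewrite {1}xq (hessD lam cf) z// addr0 (hessC lam adm cf) xq (hessD lam cf) z// addr0.
  by [].
have := h q hq; rewrite bq lq -hh => /(_ hY tq) main.
have n1 : nrm (clsV p) <= nrm (clsV q) + `|s| * nrm (JV Th) by rewrite xq -nrmZ; exact: nrmD.
have n2 : s * T = ip (JV Th) (clsV p) - ip (JV Th) (clsV q).
  by rewrite /T nrm2 xq ipDr ipZr; ring.
have n3 : s ^+ 2 * T <= 2 / T * ip (JV Th) (clsV p) ^+ 2 + 2 * nrm (clsV q) ^+ 2.
  have cs : ip (JV Th) (clsV q) ^+ 2 <= T * nrm (clsV q) ^+ 2.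
    by rewrite /T -exprMn -real_normK ?num_real// ler_sqr ?nnegrE ?mulr_ge0 ?nrm_ge0// CS.
  have -> : s ^+ 2 * T = (ip (JV Th) (clsV p) - ip (JV Th) (clsV q)) ^+ 2 / T by rewrite -n2; field; rewrite gt_eqF.
  rewrite ler_pdivrMr//; set a := ip _ _; set b := ip _ _ in cs *.
  have -> : (2 / T * a ^+ 2 + 2 * nrm (clsV q) ^+ 2) * T = 2 * a ^+ 2 + 2 * (T * nrm (clsV q) ^+ 2) by field; rewrite gt_eqF.
  have := sqr_ge0 (a + b); rewrite !expr2 in cs *; nra.
have n4 : nrm (clsV p) ^+ 2 <= 2 * nrm (clsV q) ^+ 2 + 2 * (s ^+ 2 * T).
  have e : nrm (clsV p) ^+ 2 <= (nrm (clsV q) + `|s| * nrm (JV Th)) ^+ 2.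
    by rewrite ler_sqr ?nnegrE ?addr_ge0 ?mulr_ge0 ?nrm_ge0.
  apply: le_trans e _; have := sqr_ge0 (nrm (clsV q) - `|s| * nrm (JV Th)).
  rewrite -[s ^+ 2]real_normK ?num_real// /T -exprMn; nra.
have n5 : c / 6 * nrm (clsV p) ^+ 2 <= c * nrm (clsV q) ^+ 2 + c / T * ip (JV Th) (clsV p) ^+ 2.
  have n6 : nrm (clsV p) ^+ 2 <= 6 * (nrm (clsV q) ^+ 2 + T^-1 * ip (JV Th) (clsV p) ^+ 2).
    have ti : 0 <= T^-1 by rewrite invr_ge0 ltW.
    have tp := mulr_ge0 ti (sqr_ge0 (ip (JV Th) (clsV p))).
    rewrite -mulrA in n3; lra.
  have := ler_wpM2l (ltW (divr_gt0 c1 (ltr0n R 6))) n6.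
  have -> : c / 6 * (6 * (nrm (clsV q) ^+ 2 + T^-1 * ip (JV Th) (clsV p) ^+ 2)) =
    c * nrm (clsV q) ^+ 2 + c / T * ip (JV Th) (clsV p) ^+ 2 by field; rewrite gt_eqF.
  by [].
have p1 : 0 <= c / T * lmul p ^+ 2 by rewrite mulr_ge0 ?sqr_ge0// divr_ge0// ltW.
have p2 : 0 <= K * ip (JV Th) (clsV p) ^+ 2 by rewrite mulr_ge0 ?sqr_ge0.
rewrite !mulrDl; lra.
Qed.

Section Direction.
Variable eta : 'I_N -> R.
Definition amp : R := (\sum_j ee j * eta j) / (k * SS).
Definition nu j : R := (eta j - amp * psi j L) / dpsi j L.

(* [amp] makes the direction orthogonal to [Th], and [nu] gives it the vertex
   values [eta]; its residual is proportional to [psi / tau]. *)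
Lemma direction : exists ps : pair_, [/\ H1D ps, forall j, ps.1 (j, false) =
    (fun x => amp * prphi L om (tau j) (psi j) x + (nu j * dpsi j x + 0)),
   forall j, ps.1 (j, true) = (fun=> 0), bd ps false = eta & forall j x, L <= x ->
   rp ps j x = - amp * k * prw (tau j) (psi j) x /\ rm ps j x = 0].
Proof.
have /choice[dphi hphi] : forall j, exists dphi : R -> R, H1s (prphi L om (tau j) (psi j)) dphi /\
  forall x, L <= x -> dphi x = - k * (2 * tau j x - (tau j x)^-1) * prphi L om (tau j) (psi j) x - k * prw (tau j) (psi j) x.
  by move=> j; have [d] := H1s_phi om0 (P j); exists d.
exists ((fun kk => if kk.2 then (fun=> 0) else fun x => amp * prphi L om (tau kk.1) (psi kk.1) x + (nu kk.1 * dpsi kk.1 x + 0)),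
  (fun kk => if kk.2 then (fun=> 0) else fun x => amp * dphi kk.1 x + (nu kk.1 * ((om - psi kk.1 x ^+ 2) * psi kk.1 x) + 0))).
split=> //=.
- move=> [j []] /=; first exact: H1s0.
  exact: (H1s_lin amp (hphi j).1 (H1s_lin (nu j) (H1s_dpsi om0 (P j)) (H1s0 L))).
- apply/funext => j; rewrite /bd /= /prphi subrr mul0r add0r /nu divfK; first by ring.
  by rewrite /dpsi !mulf_neq0 ?oppr_eq0 ?(gt_eqF k0) ?(gt_eqF (psi0 _ _))// (pr_L (P j)) gt_eqF.
- move=> j x Lx; split; last by rewrite /rm /rminus /= mulr0 subrr.
  have := rplus_dpsi om0 (P j) Lx; rewrite /rp /rplus /= (hphi j).2// /gplus /dpsi => E.
  set g := - k * (_ - _) in E *; set u := prphi _ _ _ _ _; set v := - k * tau j x * _ in E *.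
  have -> : (om - psi j x ^+ 2) * psi j x = g * v by move/eqP: E; rewrite subr_eq0 => /eqP.
  ring.
Qed.

Variable ps : pair_.
Hypotheses (hps : H1D ps) (pst : forall j, ps.1 (j, true) = (fun=> 0)) (bps : bd ps false = eta)
  (rps : forall j x, L <= x -> rp ps j x = - amp * k * prw (tau j) (psi j) x /\ rm ps j x = 0).

Let ampE : amp * k * SS = \sum_j ee j * eta j.
Proof. by rewrite /amp; field; rewrite !gt_eqF ?SS_gt0. Qed.
Let sip_rps p j : H1D p -> sip (rp p j) (rp ps j) = - amp * k * sip (prw (tau j) (psi j)) (rp p j).
Proof.
move=> hp; rewrite /sip -intZ//; last exact: sq2_mul (prw_sq2 j) (rp_sq2 j hp).
by apply: int_eq => x; rewrite /= in_itv /= andbT => Lx; rewrite (rps j Lx).1; ring.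
Qed.
Lemma lmul_direction : lmul ps = 0.
Proof.
apply: (@mulfI _ (2 * k)); first by rewrite gt_eqF// mulr_gt0.
rewrite lmulE// bps mulr0 /wres -ampE (_ : \sum_j _ = - amp * k * SS); first by ring.
rewrite /SS mulr_sumr; apply: eq_bigr => j _; rewrite -(sip_w om0 (P j)) /sip -intZ//; last first.
  exact: sq2_mul (prw_sq2 j) (prw_sq2 j).
by apply: int_eq => x; rewrite /= in_itv /= andbT => Lx; rewrite (rps j Lx).1; ring.
Qed.
(** Because the residual of [ps] is a multiple of [psi / tau], the Hessian sees the interior of [p]
    only through the constraint functional. So on the constraint it reduces to [Mform]. *)
Lemma hess_direction p : H1D p -> hs (clsV p) (clsV ps) = Mform (bd p false) eta - 2 * (amp * k ^+ 2) * lmul p.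
Proof.
move=> hp; rewrite hessE// bps.
have -> : \sum_j sip (rm p j) (rm ps j) = 0.
  apply: big1 => j _; rewrite /sip (@int_eq _ _ _ (fun=> 0)) ?Rintegral_cst ?mul0r// => x.
  by rewrite /= in_itv /= andbT => Lx; rewrite (rps j Lx).2 mulr0.
have -> : cform (bd p true) (bd ps true) = 0.
  rewrite /cform /bd big1 ?add0r => [|j _]; last by rewrite pst !mulr0.
  by rewrite [\sum_j ps.1 (j, true) L]big1 ?mulr0// => j _; rewrite pst.
have -> : \sum_j sip (rp p j) (rp ps j) = - amp * k * wres p.
  by rewrite /wres mulr_sumr; apply: eq_bigr => j _; exact: sip_rps.
have -> : wres p = 2 * k * lmul p - \sum_j ee j * bd p false j by rewrite lmulE// addrC addKr.
rewrite /Mform -ampE; have := SS_gt0; set y := \sum_j ee j * _; set b := bform _ _ => s0.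
by field; rewrite gt_eqF.
Qed.
End Direction.

Variable rel : 'I_N -> 'I_N -> bool.
Hypothesis relP : forall i j, rel i j -> tau i = tau j /\ psi i = psi j.
Definition compatible (y : 'I_N -> R) := forall i j, rel i j -> y i = y j.

Lemma YR_compatible (q : VV) : YR rel q -> compatible (bd (repV q) false).
Proof. by move=> /YRP h i j r; exact: (h i j false L r (lexx L)). Qed.
Lemma Th_YR (p : relT rel) : PR L Z0 p Th = Th.
Proof.
move: p; apply/(YRP rel Th) => i j b x r Lx; rewrite !(evE Z0 _ pThD Lx) /=.
by case: b => //; rewrite (relP r).2.
Qed.

Theorem graph_stable (c0 : R) (X : set (gfun R N)) : 0 < c0 ->
  (forall y, compatible y -> c0 * \sum_j y j ^+ 2 <= Mform y y) ->
  (forall U, X U -> H1 L U /\ YR rel (toVg L Z0 U)) -> orbitally_stable L Z X standing.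
Proof.
move=> c00 hM hX; have [Cm cf] := cubic_cf L N Z0; have adm := admV L N Z0.
have [TH [TV [gH gV iT]]] := groups L N Z0.
apply: (orbitally_stable_of gH gV iT H1_standing hX); rewrite Th_standing.
have hM' y : compatible y -> c0 * \sum_j y j ^+ 2 <= Mform y y + 0 * Mform y (fun=> 0) ^+ 2.
  by move=> hy; rewrite mul0r addr0; exact: hM.
have [c [K [c1 K0 h]]] := coercive c00 (lexx 0) hM'.
apply: (orbital_stability adm gV cf stat_Th (PR_symmetry L Z0 (rel := rel)) Th_YR c1 K0) => x Yx.
have hx : H1D (repV x) := repVD x.
have := h _ hx (YR_compatible Yx); rewrite mul0r addr0 -(ipBTh hx).
by rewrite !repVK.
Qed.

(** The negative vector [eta] of the reduced form lifts to a real direction orthogonal to [Th] in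
    L^2. [hess_direction] replaces [Mform y eta] by the pairing with that direction, at the price of
    a multiple of the constraint. *)
Theorem graph_unstable (c0 K0 : R) eta : 0 < c0 -> 0 <= K0 -> compatible eta -> Mform eta eta < 0 ->
  (forall y, compatible y -> c0 * \sum_j y j ^+ 2 <= Mform y y + K0 * Mform y eta ^+ 2) ->
  ~ orbitally_stable L Z (H1 L) standing.
Proof.
move=> c00 K00 he eneg hM st; have [Cm cf] := cubic_cf L N Z0; have adm := admV L N Z0.
have [TH [TV [gH gV iT]]] := groups L N Z0.
have := stableV_of gH gV iT (YR rel) H1_standing st; rewrite Th_standing.
have [ps [hps psf pst bps rps]] := direction eta.
have lps := lmul_direction hps bps rps; have hps2 := hess_direction hps pst bps rps.
have Yy : YR rel (clsV ps).
  apply/YRP => i j b x r Lx; rewrite !(evE Z0 _ hps Lx); case: b; first by rewrite !pst.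
  have [et ep] := relP r; rewrite !psf et ep /nu /dpsi et ep (he _ _ r); congr (_ + (_ / _ * _ + _)).
have yTh : ip (BV Th) (clsV ps) = 0 by rewrite ipBTh.
have Jps : JV (clsV ps) = clsV ((Jf ps.1, Jf ps.2) : pair_).
  apply: ev_ext => -[j b] x Lx; rewrite evJ// (evE Z0 _ (JfH1 hps) Lx) /Jf.
  by case: b; rewrite /= (evE Z0 _ hps Lx).
have yJTh : ip (BV Th) (JV (clsV ps)) = 0.
  rewrite Jps (ipBTh (JfH1 hps)); apply: big1 => j _; rewrite /sip (@int_eq _ _ _ (fun=> 0)) ?Rintegral_cst ?mul0r// => x _.
  by rewrite /Jf /= pst oppr0 mulr0.
have yneg : hs (clsV ps) (clsV ps) < 0 by rewrite hps2// lps mulr0 subr0 bps.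
have [c [K [c1 K1 h]]] := coercive c00 K00 hM.
pose G := 2 * (amp eta * k ^+ 2).
have K2 : 0 <= K + 2 * K0 * (1 + G ^+ 2).
  by rewrite addr_ge0// !mulr_ge0// addr_ge0 ?sqr_ge0.
apply: (orbital_instability adm gV cf stat_Th (PR_symmetry L Z0 (rel := rel)) Th_YR Yy yTh yJTh yneg Th_mass c1 K2) => x Yx.
have hx : H1D (repV x) := repVD x.
have := h _ hx (YR_compatible Yx); have := hps2 _ hx; rewrite -(ipBTh hx) !repVK -/G.
set a := ip (BV Th) x; set b := ip (JV Th) x; set M := Mform _ _; set h1 := hs x _; set h2 := hs x x.
move=> e h3; have eM : M = h1 + G * a by rewrite e subrK.
apply: (le_trans h3).
have q : M ^+ 2 <= 2 * (h1 ^+ 2 + G ^+ 2 * a ^+ 2).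
  by rewrite eM -exprMn; exact: sqrD_le.
have q2 := ler_wpM2l K00 q.
have r1 := mulr_ge0 K00 (sqr_ge0 a); have r2 := mulr_ge0 K00 (sqr_ge0 b).
have r3 := mulr_ge0 r2 (sqr_ge0 G); have r4 := mulr_ge0 (mulr_ge0 K00 (sqr_ge0 G)) (sqr_ge0 h1).
have r5 := mulr_ge0 K1 (sqr_ge0 h1).
have e1 : (K + 2 * K0 * (1 + G ^+ 2)) * a ^+ 2 = K * a ^+ 2 + 2 * (K0 * a ^+ 2) + 2 * (K0 * (G ^+ 2 * a ^+ 2)) by ring.
have e2 : (K + 2 * K0 * (1 + G ^+ 2)) * b ^+ 2 = K * b ^+ 2 + 2 * (K0 * b ^+ 2) + 2 * (K0 * b ^+ 2 * G ^+ 2) by ring.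
have e3 : (K + 2 * K0 * (1 + G ^+ 2)) * h1 ^+ 2 = K * h1 ^+ 2 + 2 * (K0 * h1 ^+ 2) + 2 * (K0 * G ^+ 2 * h1 ^+ 2) by ring.
have e4 : K0 * (2 * (h1 ^+ 2 + G ^+ 2 * a ^+ 2)) = 2 * (K0 * h1 ^+ 2) + 2 * (K0 * (G ^+ 2 * a ^+ 2)) by ring.
rewrite e1 e2 e3; rewrite e4 in q2; lra.
Qed.
End Graph.

(** * Reduction to vertex values *)

Section PlaneForm.
Context {R : realFieldType}.
Variables (a b c : R).
Definition pform (x y x' y' : R) := a * (x * x') + b * (x * y' + x' * y) + c * (y * y').

(* The smallest eigenvalue is at least determinant over trace. *)
Lemma pform_pos x y : 0 < a + c -> (a * c - b ^+ 2) / (a + c) * (x ^+ 2 + y ^+ 2) <= pform x y x y.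
Proof.
move=> t0; have : 0 <= ((a * x + b * y) ^+ 2 + (b * x + c * y) ^+ 2) / (a + c).
  by rewrite divr_ge0 ?(ltW t0)// addr_ge0 ?sqr_ge0.
rewrite (_ : _ / _ = pform x y x y - (a * c - b ^+ 2) / (a + c) * (x ^+ 2 + y ^+ 2)); first by rewrite subr_ge0.
by rewrite /pform; field; rewrite gt_eqF.
Qed.

(** A positive determinant makes the matrix definite. Were it negative definite, subtracting a
    nonnegative rank-one matrix would keep it so, and the determinant [dA] would be positive. *)
Lemma trace_pos (g v w : R) : 0 <= g -> (a - g * v ^+ 2) * (c - g * w ^+ 2) - (b - g * (v * w)) ^+ 2 < 0 ->
  0 < a * c - b ^+ 2 -> 0 < a + c.
Proof.
move=> g0 dA dM; rewrite ltNge; apply/negP => tr.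
have ac : 0 < a * c by have := sqr_ge0 b; lra.
have a0 : a < 0.
  rewrite ltNge; apply/negP => a0; have a1 : 0 < a by rewrite lt_neqAle a0 andbT; apply/eqP => e; move: ac; rewrite -e mul0r ltxx.
  by have := ac; rewrite pmulr_rgt0//; lra.
have h : 0 <= (a * w - b * v) ^+ 2 + (a * c - b ^+ 2) * v ^+ 2 by rewrite addr_ge0 ?sqr_ge0// mulr_ge0 ?sqr_ge0 ?ltW.
have e : (a * w - b * v) ^+ 2 + (a * c - b ^+ 2) * v ^+ 2 = a * (c * v ^+ 2 - 2 * b * v * w + a * w ^+ 2) by ring.
rewrite e nmulr_rge0// in h; have := mulr_ge0_le0 g0 h.
have : (a - g * v ^+ 2) * (c - g * w ^+ 2) - (b - g * (v * w)) ^+ 2 = a * c - b ^+ 2 - g * (c * v ^+ 2 - 2 * b * v * w + a * w ^+ 2) by ring.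
lra.
Qed.

Lemma pform_neg_direction : a * c - b ^+ 2 < 0 -> exists x y, pform x y x y < 0.
Proof.
move=> d; have [a0|a0|a0] := ltgtP a 0.
- by exists 1, 0; rewrite /pform; lra.
- exists (- b), a; rewrite /pform (_ : _ + _ = a * (a * c - b ^+ 2)); last by ring.
  by rewrite pmulr_rlt0.
- have b0 : b != 0 by apply/eqP => e; move: d; rewrite a0 e; lra.
  exists (- (c + 1) / (2 * b)), 1; rewrite /pform a0.
  by rewrite (_ : _ + _ = -1) ?ltrN10//; field.
Qed.

(** In signature (1, 1) the form times its value [q] at the negative vector is [u ^ 2] plus the
    negative determinant times [w ^ 2], where [u] is the pairing and [w] the area with that vector.
    So a multiple of [u ^ 2] makes the form positive, and [C] bounds [x] and [y] in terms of [u] and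
    [w]. *)
Lemma pform_lorentz x0 y0 : a * c - b ^+ 2 < 0 -> pform x0 y0 x0 y0 < 0 ->
  exists c0 K : R, [/\ 0 < c0, 0 <= K & forall x y,
    c0 * (x ^+ 2 + y ^+ 2) <= pform x y x y + K * pform x y x0 y0 ^+ 2].
Proof.
move=> d q0; set q := pform x0 y0 x0 y0 in q0.
have qn : q != 0 by rewrite lt_eqF.
pose D := (a * c - b ^+ 2) / q; have D0 : 0 < D by rewrite nmulr_rgt0// invr_lt0.
pose al := a * x0 + b * y0; pose be := b * x0 + c * y0.
pose C := 2 * (x0 ^+ 2 + y0 ^+ 2) + 2 * (al ^+ 2 + be ^+ 2) / D.
have hp : 0 < x0 ^+ 2 + y0 ^+ 2.
  rewrite lt_neqAle addr_ge0 ?sqr_ge0// andbT eq_sym paddr_eq0 ?sqr_ge0// !sqrf_eq0.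
  by apply/negP => /andP[/eqP xz /eqP yz]; move: q0; rewrite /q /pform xz yz !(mulr0, mul0r, addr0) ltxx.
have C0 : 0 < C by rewrite ltr_wpDr// ?mulr_gt0// divr_ge0 ?(ltW D0)// mulr_ge0// addr_ge0 ?sqr_ge0.
exists (q ^+ 2 / C), (1 - q^-1); split.
- by rewrite divr_gt0// exprn_even_gt0.
- by rewrite subr_ge0 (le_trans _ ler01)// invr_le0 ltW.
move=> x y; set u := pform x y x0 y0; set w := x * y0 - y * x0.
have E : pform x y x y * q = u ^+ 2 + (a * c - b ^+ 2) * w ^+ 2 by rewrite /u /w /q /pform; ring.
have -> : pform x y x y + (1 - q^-1) * u ^+ 2 = u ^+ 2 + D * w ^+ 2.
  have -> : pform x y x y = (u ^+ 2 + (a * c - b ^+ 2) * w ^+ 2) / q by rewrite -E mulfK.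
  by rewrite /D; move: qn; set z := q => qn; field.
have ex : q * x = x0 * u + be * w by rewrite /q /u /w /be /pform; ring.
have ey : q * y = y0 * u - al * w by rewrite /q /u /w /al /pform; ring.
rewrite mulrAC ler_pdivrMr// mulrDr -!exprMn ex ey.
have e : (u ^+ 2 + D * w ^+ 2) * C = 2 * (x0 ^+ 2 + y0 ^+ 2) * u ^+ 2 + 2 * (al ^+ 2 + be ^+ 2) * w ^+ 2 +
   (2 * D * (x0 ^+ 2 + y0 ^+ 2) * w ^+ 2 + 2 * (al ^+ 2 + be ^+ 2) / D * u ^+ 2).
  by rewrite /C; field; rewrite gt_eqF.
have p : 0 <= 2 * D * (x0 ^+ 2 + y0 ^+ 2) * w ^+ 2 + 2 * (al ^+ 2 + be ^+ 2) / D * u ^+ 2.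
  have D1 := ltW D0.
  apply: addr_ge0; first by rewrite mulr_ge0 ?sqr_ge0// mulr_ge0 ?(ltW hp)// mulr_ge0.
  by rewrite mulr_ge0 ?sqr_ge0// divr_ge0// mulr_ge0// addr_ge0 ?sqr_ge0.
rewrite e; have h1 := sqrD_le (x0 * u) (be * w); have h2 := sqrD_le (y0 * u) (- (al * w)).
rewrite sqrrN in h2; rewrite !exprMn in h1 h2; lra.
Qed.
End PlaneForm.

(** * The reduced form on vectors constant on the two blocks *)

Section BlockForm.
Context {R : realFieldType}.
Variables (n m t s : R).
Hypotheses (n0 : 0 < n) (m0 : 0 < m) (t0 : 0 < t) (s0 : 0 < s).
(** For the standing wave, [vq] is [- Z k t s] by the vertex condition, and [SS] is
    [2 k vsig / (t s)]. *)
Definition vq := n * s + m * t.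
Definition vsig := n * s * (1 - t) + m * t * (1 - s).
(** Up to the factor [k], the [A] entries are the matrix of [bform] in the two block values; the [M]
    entries add the rank-one term of the constraint. *)
Definition A11 := n * (t ^+ 2 - s ^+ 2) / t - n ^+ 2 * (t * s) / vq.
Definition A12 := - (n * m * (t * s) / vq).
Definition A22 := m * (s ^+ 2 - t ^+ 2) / s - m ^+ 2 * (t * s) / vq.
Definition M11 := A11 + n ^+ 2 * (s / t) ^+ 2 * (t * s) / vsig.
Definition M12 := A12 + n * m * (t * s) / vsig.
Definition M22 := A22 + m ^+ 2 * (t / s) ^+ 2 * (t * s) / vsig.
(** The function N_n of the statement, written with [s] for the square root of [1 - t ^ 2]. *)
Definition cN := (n + m) * (m * t ^+ 3 - n * s ^+ 3) - n * m * (t ^+ 2 - s ^+ 2).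
Lemma vq_gt0 : 0 < vq. Proof. by rewrite addr_gt0// mulr_gt0. Qed.
Lemma detA : A11 * A22 - A12 ^+ 2 = - (n * m * (s ^+ 2 - t ^+ 2) * (n * s ^+ 3 - m * t ^+ 3)) / (t * s * vq).
Proof. by have := vq_gt0; rewrite /A11 /A22 /A12 /vq => ?; field; rewrite !gt_eqF. Qed.
Lemma detM : 0 < vsig -> M11 * M22 - M12 ^+ 2 = - (n * m * (s ^+ 2 - t ^+ 2) * cN) / (vq * vsig).
Proof. by have := vq_gt0; rewrite /M11 /M22 /M12 /A11 /A22 /A12 /vq /vsig /cN => ? ?; field; rewrite !gt_eqF. Qed.

(** [detM > 0] leaves the sign of the form open; [detA < 0], which is where [t] below [t_star]
    enters, excludes a negative definite one by [trace_pos]. *)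
Lemma block_pos : 0 < vsig -> t < s -> m * t ^+ 3 < n * s ^+ 3 -> cN < 0 ->
  exists2 c0 : R, 0 < c0 & forall x y, c0 * (x ^+ 2 + y ^+ 2) <= pform M11 M12 M22 x y x y.
Proof.
move=> sig0 ts h c; have q0 := vq_gt0.
have de : 0 < s ^+ 2 - t ^+ 2 by rewrite subr_gt0 ltr_sqr ?nnegrE ?ltW.
have dA : A11 * A22 - A12 ^+ 2 < 0.
  by rewrite detA mulNr oppr_lt0 divr_gt0 ?mulr_gt0// subr_gt0.
have dM : 0 < M11 * M22 - M12 ^+ 2.
  rewrite detM// divr_gt0 ?mulr_gt0// oppr_gt0 pmulr_rlt0//; by rewrite !mulr_gt0.
have tr : 0 < M11 + M22.
  apply: (@trace_pos _ _ M12 _ (t * s / vsig) (n * (s / t)) (m * (t / s))) => //.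
    by rewrite divr_ge0 ?ltW// mulr_gt0.
  apply: le_lt_trans dA; rewrite le_eqVlt; apply/orP; left; apply/eqP.
  by rewrite /M11 /M12 /M22; congr (_ * _ - _ ^+ 2); field; rewrite !gt_eqF.
exists ((M11 * M22 - M12 ^+ 2) / (M11 + M22)); first by rewrite divr_gt0.
by move=> x y; exact: pform_pos.
Qed.

Lemma block_lorentz : 0 < vsig -> 0 < (s ^+ 2 - t ^+ 2) * cN ->
  exists x0 y0 c0 K : R, [/\ pform M11 M12 M22 x0 y0 x0 y0 < 0, 0 < c0, 0 <= K & forall x y,
    c0 * (x ^+ 2 + y ^+ 2) <= pform M11 M12 M22 x y x y + K * pform M11 M12 M22 x y x0 y0 ^+ 2].
Proof.
move=> sig0 h; have q0 := vq_gt0.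
have dM : M11 * M22 - M12 ^+ 2 < 0.
  by rewrite detM// mulNr oppr_lt0 -(mulrA (n * m)) divr_gt0 ?(mulr_gt0 q0 sig0)// (pmulr_rgt0 _ (mulr_gt0 n0 m0)).
have [x0 [y0 q]] := pform_neg_direction dM; have [c0 [K [? ? ?]]] := pform_lorentz dM q.
by exists x0, y0, c0, K.
Qed.
End BlockForm.

(* This form shows the sign of [cN] for [t < s], [m <= n] and for [s <= t], [n < m]. *)
Lemma cN_circle (R : realFieldType) (n m t s : R) : s ^+ 2 + t ^+ 2 = 1 ->
  cN n m t s = m ^+ 2 * t ^+ 3 - n ^+ 2 * s ^+ 3 + n * m * ((t - s) * ((1 - t) * (1 - s))).
Proof.
move=> h; transitivity (m ^+ 2 * t ^+ 3 - n ^+ 2 * s ^+ 3 + n * m * ((t - s) * ((1 - t) * (1 - s)))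
  - n * m * (t - s) * (1 - (s ^+ 2 + t ^+ 2))); first by rewrite /cN; ring.
by rewrite h subrr mulr0 subr0.
Qed.

(** * Monotonicity of alpha_n and signs of N_n *)

Section Threshold.
Context {R : realType}.
Variables (n m : R).
Hypotheses (n0 : 0 < n) (m0 : 0 < m).
Notation sg t := (Num.sqrt (1 - t ^+ 2)).
Implicit Types t u : R.
Definition al t := n / t + m / sg t.
Definition cC t := cN n m t (sg t).
(** Numerator of the derivative of [al] over [t ^ 3]-type denominators: [al' = hC / (t ^ 2 s ^ 3)]
    with [s = sg t]. *)
Definition hC t := m * t ^+ 3 - n * sg t ^+ 3.

Lemma sg2 t : 0 <= t <= 1 -> sg t ^+ 2 = 1 - t ^+ 2.
Proof. by move=> /andP[t0 t1]; rewrite sqr_sqrtr// subr_ge0 expr_le1. Qed.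
Lemma sg_gt0 t : 0 <= t < 1 -> 0 < sg t.
Proof. by move=> /andP[t0 t1]; rewrite sqrtr_gt0 subr_gt0 expr_lt1. Qed.
Lemma sg_lt1 t : 0 < t < 1 -> sg t < 1.
Proof.
move=> /andP[t0 t1]; have t01 : 0 <= t <= 1 by rewrite !ltW.
by rewrite -(@expr_lt1 _ 2) ?sqrtr_ge0// sg2// ltrBlDr ltrDl exprn_gt0.
Qed.
Lemma sg_dec t u : 0 <= t -> t < u -> u <= 1 -> sg u < sg t.
Proof.
move=> t0 tu u1; have u0 : 0 <= u by lra.
rewrite ltr_sqrt; last by rewrite subr_gt0 expr_lt1//; lra.
by rewrite ltrD2l ltrN2 ltr_sqr.
Qed.
Lemma al_gt0 t : 0 < t < 1 -> 0 < al t.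
Proof.
move=> /andP[t0 t1]; rewrite addr_gt0// divr_gt0// sg_gt0//; by rewrite ltW.
Qed.

(** The difference of the values has the factor [u - t]. The sign of the other factor follows from
    the chain [m (u + t) t u < 2 m u ^ 3 <= 2 n r ^ 3 < n r s (s + r)], whose middle is [hC u <= 0];
    here [s = sg t] and [r = sg u]. *)
Lemma al_dec t u : 0 < t -> t < u -> u < 1 -> hC u <= 0 -> al u < al t.
Proof.
move=> t0 tu u1 hu; have u0 : 0 < u by lra. have t1 : t < 1 by lra.
have s0 : 0 < sg t by rewrite sg_gt0// ltW. have r0 : 0 < sg u by rewrite sg_gt0// ltW.
have rs := sg_dec (ltW t0) tu (ltW u1).
have e : sg t ^+ 2 - sg u ^+ 2 = u ^+ 2 - t ^+ 2 by rewrite !sg2 ?ltW//; ring.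
move: hu; rewrite /hC subr_le0 /al; move: s0 r0 rs e; set s := sg t; set r := sg u => s0 r0 rs e hu.
have key : m * (u + t) * (t * u) < n * (r * s) * (s + r).
  have h1 : (u + t) * (t * u) < 2 * u ^+ 3.
    have : t * u < u * u by rewrite ltr_pM2r.
    have : 0 < t * u by rewrite mulr_gt0.
    rewrite exprS expr2; nra.
  have h2 : 2 * r ^+ 3 < r * s * (s + r).
    have : r * r < r * s by rewrite ltr_pM2l.
    have : 0 < r * r by rewrite mulr_gt0.
    rewrite exprS expr2; nra.
  have h3 := ltr_pM2l m0 ((u + t) * (t * u)) (2 * u ^+ 3); rewrite h1 in h3.
  have h4 := ltr_pM2l n0 (2 * r ^+ 3) (r * s * (s + r)); rewrite h2 in h4.
  move: h3 h4 => /idP h3 /idP h4; rewrite !mulrA in h3 h4 *; lra.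
rewrite -subr_gt0.
have -> : n / t + m / s - (n / u + m / r) = (u - t) * (n * (r * s) * (s + r) - m * (u + t) * (t * u)) / (t * u * (r * s) * (s + r)).
  have e' : m * (s - r) * (s + r) = m * (u - t) * (u + t) by rewrite -mulrA -subr_sqr e subr_sqr mulrA.
  transitivity ((n * (u - t) * (r * s) * (s + r) - (m * (s - r) * (s + r)) * (t * u)) / (t * u * (r * s) * (s + r))).
    by field; rewrite !gt_eqF// addr_gt0.
  by rewrite e'; congr (_ / _); ring.
apply: divr_gt0; first by rewrite mulr_gt0// subr_gt0.
by rewrite mulr_gt0 ?addr_gt0// mulr_gt0 ?(mulr_gt0 t0 u0)// mulr_gt0.
Qed.

Lemma hC_inc t u : 0 <= t -> t < u -> u <= 1 -> hC t < hC u.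
Proof.
move=> t0 tu u1; rewrite /hC; have h := sg_dec t0 tu u1.
apply: ltrB; rewrite ltr_pM2l// ltr_pXn2r ?nnegrE ?sqrtr_ge0//; lra.
Qed.

(* As a function of [t ^ 2], [cC] is convex on [0, 1/2] and equals [- n ^ 2] at 0;
   this is the chord inequality between 0, [t ^ 2] and [u ^ 2]. *)
Lemma chord t u : n <= m -> 0 < t -> t < u -> u <= sg u ->
  u ^+ 2 * cC t + n ^+ 2 * (u ^+ 2 - t ^+ 2) <= t ^+ 2 * cC u.
Proof.
move=> nm t0 tu ur; have u0 : 0 < u by lra.
have u1 : u < 1.
  rewrite ltNge; apply/negP => u1; move: ur; rewrite ler0_sqrtr; first by lra.
  by rewrite subr_le0 expr_ge1// ltW.
have rs := sg_dec (ltW t0) tu (ltW u1).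
have et : sg t ^+ 2 = 1 - t ^+ 2 by rewrite sg2// !ltW//; lra.
have eu : sg u ^+ 2 = 1 - u ^+ 2 by rewrite sg2// !ltW.
have s1 : sg t < 1 by rewrite sg_lt1// t0/=; lra.
rewrite /cC /cN; move: rs et eu ur s1; set s := sg t; set r := sg u => rs et eu ur s1.
have tt : t ^+ 2 = 1 - s ^+ 2 by rewrite et; ring.
have uu : u ^+ 2 = 1 - r ^+ 2 by rewrite eu; ring.
have r0 : 0 < r by lra.
have k1 : u ^+ 2 * (1 - s ^+ 3) - t ^+ 2 * (1 - r ^+ 3) <= t ^+ 2 * u ^+ 2 * (s - r).
  rewrite tt uu -subr_ge0 (_ : _ - _ = (1 - r) * (1 - s) * (s - r)); last by ring.
  by rewrite !mulr_ge0 ?subr_ge0//; lra.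
have k2 : s - r <= u - t.
  have e : (s - r) * (s + r) = (u - t) * (u + t) by rewrite -!subr_sqr et eu; ring.
  have sr : 0 < s + r by lra.
  rewrite -(ler_pM2r sr) e ler_pM2l ?subr_gt0//; lra.
have k3 : t ^+ 2 * u ^+ 2 * (s - r) <= t ^+ 2 * u ^+ 2 * (u - t).
  by rewrite ler_wpM2l// mulr_ge0 ?sqr_ge0.
have k4 : n * (u ^+ 2 * (1 - s ^+ 3) - t ^+ 2 * (1 - r ^+ 3)) <= m * (t ^+ 2 * u ^+ 2 * (u - t)).
  apply: (@le_trans _ _ (n * (t ^+ 2 * u ^+ 2 * (u - t)))).
    by rewrite ler_pM2l// (le_trans k1).
  have d0 : 0 <= u - t by lra.
  have X0 : 0 <= t ^+ 2 * u ^+ 2 * (u - t) by rewrite mulr_ge0// mulr_ge0 ?sqr_ge0.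
  exact: ler_wpM2r.
rewrite -subr_ge0 (_ : _ - _ = (n + m) * (m * (t ^+ 2 * u ^+ 2 * (u - t)) - n * (u ^+ 2 * (1 - s ^+ 3) - t ^+ 2 * (1 - r ^+ 3)))).
  have nm0 : 0 <= n + m by apply: addr_ge0; exact: ltW.
  by rewrite mulr_ge0 ?subr_ge0.
by rewrite et eu; ring.
Qed.

Lemma cC_cross t u : n <= m -> 0 < t -> t < u -> u <= sg u -> 0 <= cC t -> 0 < cC u.
Proof.
move=> nm t0 tu ur h; have := chord nm t0 tu ur => c; have u0 : 0 < u by lra.
rewrite -(pmulr_rgt0 _ (exprn_gt0 2 t0)); apply: lt_le_trans c.
apply: ltr_wpDl; first by rewrite mulr_ge0 ?sqr_ge0.
by rewrite mulr_gt0 ?exprn_gt0// subr_gt0 ltr_pXn2r ?nnegrE ?ltW.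
Qed.

Lemma circ t : 0 < t < 1 -> sg t ^+ 2 + t ^+ 2 = 1.
Proof. by move=> /andP[t0 t1]; rewrite sg2 ?subrK// !ltW. Qed.
(** Excludes zeros of N_n at or beyond [t_star]. For [t < sg t] the value is a positive multiple of
    [hC t] plus a positive term; for [sg t <= t] the form [cN_circle] is visibly positive as
    [n < m]. *)
Lemma cC_pos t : n < m -> 0 < t < 1 -> 0 <= hC t -> 0 < cC t.
Proof.
move=> nm t01 h; have /andP[t0 t1] := t01; have s1 := sg_lt1 t01.
have s0 : 0 < sg t by rewrite sg_gt0// ltW.
have t0' := ltW t0; have s0' := ltW s0; have n0' := ltW n0; have m0' := ltW m0; have nm' := ltW nm.
have nm0 := mulr_gt0 n0 m0; have [ts|st] := ltP t (sg t).
  have -> : cC t = (n + m) * hC t + n * m * (sg t ^+ 2 - t ^+ 2) by rewrite /cC /cN /hC; ring.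
  apply: ltr_wpDl; first by rewrite mulr_ge0// addr_ge0.
  by rewrite mulr_gt0// subr_gt0 ltr_pXn2r.
rewrite /cC cN_circle ?circ//; apply: ltr_wpDr.
  by apply: mulr_ge0; [exact: ltW|apply: mulr_ge0; [rewrite subr_ge0|apply: mulr_ge0; rewrite subr_ge0 ltW]].
rewrite subr_gt0; apply: (@lt_le_trans _ _ (m ^+ 2 * sg t ^+ 3)).
  by rewrite ltr_pM2r ?exprn_gt0// ltr_pXn2r.
by rewrite ler_pM2l ?exprn_gt0// lerXn2r.
Qed.
Lemma cC_neg_diag t : m <= n -> 0 < t < 1 -> t < sg t -> cC t < 0.
Proof.
move=> nm t01 ts; have /andP[t0 t1] := t01; have s1 := sg_lt1 t01.
have s0 : 0 < sg t by rewrite sg_gt0// ltW.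
have t0' := ltW t0; have s0' := ltW s0; have n0' := ltW n0; have m0' := ltW m0; have ts' := ltW ts.
rewrite /cC cN_circle ?circ// -[ltRHS](addr0 0) ler_ltD//; last first.
  by rewrite pmulr_rlt0 ?mulr_gt0// pmulr_llt0 ?subr_lt0// mulr_gt0 ?subr_gt0.
rewrite subr_le0; apply: (@le_trans _ _ (n ^+ 2 * t ^+ 3)).
  by rewrite ler_wpM2r ?exprn_ge0// lerXn2r.
by rewrite ler_pM2l ?exprn_gt0// lerXn2r.
Qed.
Lemma cC_neg t : 0 < t < 1 -> sg t <= t -> hC t < 0 -> cC t < 0.
Proof.
move=> /andP[t0 t1] st h; have t0' := ltW t0; have nm0 := ltW (mulr_gt0 n0 m0).
have -> : cC t = (n + m) * hC t + - (n * m * (t ^+ 2 - sg t ^+ 2)) by rewrite /cC /cN /hC; ring.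
rewrite -[ltRHS](addr0 0) ltr_leD//; first by rewrite pmulr_rlt0// addr_gt0.
by rewrite oppr_le0 mulr_ge0// subr_ge0 lerXn2r ?nnegrE ?sqrtr_ge0.
Qed.
Lemma vsig_gt0 t : 0 < t < 1 -> 0 < vsig n m t (sg t).
Proof.
move=> t01; have /andP[t0 t1] := t01; have s1 := sg_lt1 t01.
have s0 : 0 < sg t by rewrite sg_gt0// ltW.
by rewrite /vsig addr_gt0// !mulr_gt0// subr_gt0.
Qed.

Lemma continuous_sg : continuous (fun t : R => sg t).
Proof.
move=> t; apply: (@continuous_comp _ _ _ (fun t : R => 1 - t ^+ 2) Num.sqrt); last exact: sqrt_continuous.
by apply: cvgB; [exact: cvg_cst|exact: exprn_continuous].
Qed.
(** The value is [- n ^ 2] at 0 and positive at [1 / sqrt 2], where [t] and [sg t] coincide. *)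
Lemma cC_zero : n < m -> exists2 t, 0 < t < 1 & cC t = 0.
Proof.
move=> nm; pose c : R := Num.sqrt (1 / 2).
have c2 : c ^+ 2 = 1 / 2 by rewrite sqr_sqrtr// divr_ge0.
have c0 : 0 < c by rewrite sqrtr_gt0 divr_gt0.
have c1 : c < 1 by rewrite -(@expr_lt1 _ 2) ?ltW// c2; lra.
have sc : sg c = c by rewrite c2 (_ : 1 - 1 / 2 = 1 / 2 :> R)//; lra.
have cont : continuous cC.
  move=> t; rewrite /cC /cN; have e k : continuous (fun t : R => sg t ^+ k).
    by move=> x; apply: (@continuous_comp _ _ _ (fun t : R => sg t) (fun y => y ^+ k)); [exact: continuous_sg|exact: exprn_continuous].
  apply: cvgB; apply: cvgM; try exact: cvg_cst; apply: cvgB.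
  - by apply: cvgM; [exact: cvg_cst|exact: exprn_continuous].
  - by apply: cvgM; [exact: cvg_cst|exact: e].
  - exact: exprn_continuous.
  - exact: e.
have s00 : sg (0 : R) = 1 by rewrite expr0n /= subr0 sqrtr1.
have v0 : cC 0 = - n ^+ 2 by rewrite /cC /cN s00; ring.
have vc : 0 < cC c.
  rewrite /cC /cN sc (_ : _ - _ = (n + m) * (m - n) * c ^+ 3); last by ring.
  by rewrite !mulr_gt0 ?exprn_gt0 ?subr_gt0 ?addr_gt0.
have [|t tc ct] := @IVT R cC 0 c 0 (ltW c0) (continuous_subspaceT cont).
  by rewrite v0 ge_min le_max oppr_le0 sqr_ge0 (ltW vc) orbT.
exists t => //; move: tc; rewrite in_itv /= => /andP[t0 tc]; apply/andP; split; last by lra.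
rewrite lt_neqAle t0 andbT eq_sym; apply/eqP => e; move: ct; rewrite e v0 => /eqP.
by rewrite oppr_eq0 expf_eq0 /= gt_eqF.
Qed.
Lemma al_solve u y : 0 < u < 1 -> al u < y -> exists2 t, 0 < t < u & al t = y.
Proof.
move=> /andP[u0 u1] uy; have su : 0 < sg u by rewrite sg_gt0// ltW.
have y0 : 0 < y by apply: lt_trans uy; rewrite al_gt0// u0.
(* The first term of [al] alone takes the value [y] at [v]. *)
pose v := n / y; have v0 : 0 < v by rewrite divr_gt0.
have vu : v < u.
  rewrite /v ltr_pdivrMr// mulrC -ltr_pdivrMr//; apply: lt_trans uy.
  by rewrite /al ltrDl divr_gt0.
have av : y < al v.
  rewrite /al /v invf_div mulrCA divff ?gt_eqF// mulr1 ltrDl divr_gt0// sg_gt0// (ltW v0)/=.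
  exact: lt_trans vu u1.
have cont : {within `[v, u], continuous al}.
  apply: continuous_in_subspaceT => x; rewrite inE /= in_itv /= => /andP[vx xu].
  have x0 : 0 < x by lra. have sx : 0 < sg x by rewrite sg_gt0// (ltW x0)/=; lra.
  apply: cvgD; apply: cvgM; try exact: cvg_cst.
    by apply: cvgV; [rewrite gt_eqF|exact: cvg_id].
  by apply: cvgV; [rewrite gt_eqF|exact: continuous_sg].
have [|t tc ct] := @IVT R al v u y (ltW vu) cont.
  by rewrite ge_min le_max (ltW uy) (ltW av) orbT.
exists t => //; move: tc; rewrite in_itv /= => /andP[t0 tc]; apply/andP; split; first by lra.
by rewrite lt_neqAle tc andbT; apply/eqP => e; move: uy; rewrite -ct e ltxx.
Qed.
End Threshold.

(** * Threshold frequencies *)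

Section Frequencies.
Context {R : realType} (Z : R) (N n : nat).
Hypotheses (Z0 : Z < 0) (n_gt0 : (0 < n)%N) (nN : (n < N)%N).
Notation nr := (n%:R : R). Notation mr := ((N - n)%:R : R).
Notation sg t := (Num.sqrt (1 - t ^+ 2)).
Notation tst := (@t_star R N n).
Let n0 : 0 < nr. Proof. by rewrite ltr0n. Qed.
Let m0 : 0 < mr. Proof. by rewrite ltr0n subn_gt0. Qed.
Lemma small_lt : (2 * n < N)%N -> nr < mr.
Proof. by rewrite ltr_nat ltn_subRL addnn -mul2n. Qed.
Lemma large_lt : (N < 2 * n)%N -> mr < nr.
Proof. by rewrite ltr_nat ltn_subLR ?(ltnW nN)// addnn -mul2n. Qed.
Lemma small_le : (2 * n < N)%N -> nr <= mr. Proof. by move/small_lt/ltW. Qed.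
Lemma large_le : (N < 2 * n)%N -> mr <= nr. Proof. by move/large_lt/ltW. Qed.
Lemma NE : N%:R = nr + mr.
Proof. by rewrite -natrD subnKC// ltnW. Qed.

Lemma powR_two_thirds (x : R) : 0 < x -> (x `^ (2 / 3)) ^+ 3 = x ^+ 2.
Proof.
move=> x0; rewrite -powR_mulrn ?powR_ge0// -powRrM (_ : 2 / 3 * 3 = 2 :> R); last by field.
by rewrite powR_mulrn// ltW.
Qed.
Lemma calNE (t : R) : 0 < t < 1 -> calN N n t = cC nr mr t.
Proof.
move=> /andP[t0 t1]; have u0 : 0 <= 1 - t ^+ 2 by rewrite subr_ge0 expr_le1// ltW.
have -> : calN N n t = N%:R * (mr * t ^+ 3 - nr * sg t ^+ 3) - nr * mr * (2 * t ^+ 2 - 1).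
  rewrite /calN (_ : 3 / 2 = 2^-1 * 3 :> R); last by field.
  by rewrite powRrM powR12_sqrt// powR_mulrn// sqrtr_ge0.
by rewrite /cC /cN sg2 ?ltW// NE; ring.
Qed.

Lemma t_starP : 0 < tst < 1 /\ hC nr mr tst = 0.
Proof.
rewrite /t_star; set a := nr `^ (2 / 3); set b := mr `^ (2 / 3).
have a0 : 0 < a by exact: powR_gt0. have b0 : 0 < b by exact: powR_gt0.
have ab : 0 < a + b by rewrite addr_gt0.
have q0 : 0 < a / (a + b) by rewrite divr_gt0.
have q1 : a / (a + b) < 1 by rewrite ltr_pdivrMr// mul1r ltrDl.
have t1 : 0 < Num.sqrt (a / (a + b)) < 1.
  rewrite sqrtr_gt0 q0 -(@expr_lt1 _ 2) ?sqrtr_ge0// sqr_sqrtr//; exact: ltW.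
split=> //; set t := Num.sqrt (a / (a + b)) in t1 *.
have t2 : t ^+ 2 = a / (a + b) by rewrite sqr_sqrtr// ltW.
have /andP[t0 _] := t1; have s0 : 0 <= sg t by exact: sqrtr_ge0.
have s2 : sg t ^+ 2 = b / (a + b).
  by rewrite sqr_sqrtr t2; [field; rewrite gt_eqF|rewrite subr_ge0 ltW].
apply/eqP; rewrite /hC subr_eq0; apply/eqP; apply: (@pexpIrn _ 2) => //; rewrite ?nnegrE ?mulr_ge0 ?exprn_ge0 ?(ltW n0) ?(ltW m0) ?(ltW t0)//.
have e6 (x y : R) : (x * y ^+ 3) ^+ 2 = x ^+ 2 * (y ^+ 2) ^+ 3 by ring.
by rewrite !e6 s2 t2 !expr_div_n !powR_two_thirds//; ring.
Qed.
Let ts01 : 0 < tst < 1. Proof. exact: t_starP.1. Qed.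
Let ts0 : 0 < tst. Proof. by case/andP: ts01. Qed.
Let ts1 : tst < 1. Proof. by case/andP: ts01. Qed.

Lemma hC_lt0 (t : R) : 0 < t -> t < tst -> hC nr mr t < 0.
Proof. by move=> t0 h; rewrite -t_starP.2; apply: hC_inc => //; exact: ltW. Qed.

Lemma al_lt_star (t u : R) : 0 < t -> t < u -> u <= tst -> al nr mr u < al nr mr t.
Proof.
move=> t0 tu us; apply: al_dec => //; first exact: le_lt_trans us ts1.
move: us; rewrite le_eqVlt => /predU1P[->|h]; first by rewrite t_starP.2.
by apply/ltW/hC_lt0 => //; exact: lt_trans tu.
Qed.

Section Frequency.
Variable om : R.
Hypothesis omP : omega_star Z N n < om.
Notation t1 := (@t_one R Z N n om).
Notation k := (Num.sqrt om).
Let om0 : 0 < om.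
Proof. by apply: le_lt_trans omP; rewrite divr_ge0 ?sqr_ge0. Qed.
Lemma om_gt0 : 0 < om. Proof. exact: om0. Qed.
Let zk0 : 0 < - Z * k. Proof. by rewrite mulr_gt0 ?oppr_gt0 ?sqrtr_gt0. Qed.
Let zk2 : (- Z * k) ^+ 2 = Z ^+ 2 * om. Proof. by rewrite exprMn sqrrN sqr_sqrtr// ltW. Qed.
Let Z2 : 0 < Z ^+ 2. Proof. by rewrite exprn_even_gt0//= lt_eqF. Qed.

Lemma t_oneP : [/\ 0 < t1, t1 < tst & al nr mr t1 = - Z * k].
Proof.
have h : al nr mr tst < - Z * k.
  have := omP; rewrite /omega_star ltr_pdivrMr// mulrC -zk2 ltr_pXn2r ?nnegrE ?(ltW zk0)//.
  exact: ltW (al_gt0 n0 m0 ts01).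
have [t tt e] := al_solve n0 m0 ts01 h.
have : exists t : R, 0 < t < tst /\ alpha N n t = - Z * k by exists t.
by move=> /(xgetPex 0)[/andP[? ?] ?].
Qed.
Let p1 : 0 < t1. Proof. by case: t_oneP. Qed.
Let p2 : t1 < tst. Proof. by case: t_oneP. Qed.
Let pal : al nr mr t1 = - Z * k. Proof. by case: t_oneP. Qed.
Lemma t_one01 : 0 < t1 < 1. Proof. by rewrite p1 (lt_trans p2 ts1). Qed.

(** Strict decrease of [al] up to [t_star] reverses inequalities between frequencies into
    inequalities between parameters. *)
Lemma om_gt (u : R) : 0 < u -> u < tst -> al nr mr u ^+ 2 / Z ^+ 2 < om -> t1 < u.
Proof.
move=> u0 us; rewrite ltr_pdivrMr// mulrC -zk2 -pal; have u01 : 0 < u < 1 by rewrite u0 (lt_trans us ts1).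
rewrite ltr_pXn2r ?nnegrE ?(ltW (al_gt0 n0 m0 u01)) ?(ltW (al_gt0 n0 m0 t_one01))// => h.
rewrite ltNge le_eqVlt; apply/negP => /predU1P[e|ut]; first by move: h; rewrite e ltxx.
by have := al_lt_star u0 ut (ltW p2); rewrite ltNge (ltW h).
Qed.
Lemma om_lt (u : R) : 0 < u -> u < tst -> om < al nr mr u ^+ 2 / Z ^+ 2 -> u < t1.
Proof.
move=> u0 us; rewrite ltr_pdivlMr// mulrC -zk2 -pal; have u01 : 0 < u < 1 by rewrite u0 (lt_trans us ts1).
rewrite ltr_pXn2r ?nnegrE ?(ltW (al_gt0 n0 m0 u01)) ?(ltW (al_gt0 n0 m0 t_one01))// => h.
rewrite ltNge le_eqVlt; apply/negP => /predU1P[e|ut]; first by move: h; rewrite e ltxx.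
by have := al_lt_star p1 ut (ltW us); rewrite ltNge (ltW h).
Qed.

Lemma below_diag (t : R) : 0 < t < 1 -> nr <= mr -> hC nr mr t < 0 -> t < sg t.
Proof.
move=> /andP[t0 tl1] nm; rewrite /hC subr_lt0 => h; have t0' := ltW t0.
have s0 : 0 < sg t by rewrite sg_gt0// t0'.
rewrite ltNge; apply/negP => st; have : nr * sg t ^+ 3 <= mr * t ^+ 3.
  have s0' := ltW s0; have n0' := ltW n0.
  by apply: ler_pM => //; rewrite ?exprn_ge0// lerXn2r.
by rewrite leNgt h.
Qed.
(** The coefficient [2 t ^ 2 - 1] changes sign at [1 / sqrt 2]; the value of [al] there produces the
    threshold [2 N ^ 2 / Z ^ 2]. *)
Lemma half_gt : (N < 2 * n)%N -> let c : R := Num.sqrt (1 / 2) in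
  [/\ 0 < c, c < tst & al nr mr c ^+ 2 = 2 * N%:R ^+ 2].
Proof.
move=> nN2 c; have mn := large_lt nN2.
have c2 : c ^+ 2 = 1 / 2 by rewrite sqr_sqrtr// divr_ge0.
have c0 : 0 < c by rewrite sqrtr_gt0 divr_gt0.
have c1 : c < 1 by rewrite -(@expr_lt1 _ 2) ?ltW// c2; lra.
have sc : sg c = c by rewrite c2 (_ : 1 - 1 / 2 = 1 / 2 :> R)//; lra.
split=> //.
- rewrite ltNge; apply/negP => h; have : hC nr mr c < 0.
    by rewrite /hC sc -mulrBl pmulr_llt0 ?exprn_gt0// subr_lt0.
  rewrite ltNge => /negP; apply; rewrite -t_starP.2; move: h; rewrite le_eqVlt => /predU1P[->//|h].
  by apply/ltW/hC_inc => //; exact: ltW.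
- by rewrite /al sc -mulrDl -NE exprMn exprVn c2; field.
Qed.
(** [cC_pos] puts the chosen zero below [t_star], where [t < sg t], and [cC_cross] lets the sign
    change only once in that range. *)
Lemma t_sharpP : (2 * n < N)%N -> let u := @t_sharp R N n in
  [/\ 0 < u, u < tst, (forall t, 0 < t -> t < u -> cC nr mr t < 0) &
      (forall t, u < t -> t < tst -> 0 < cC nr mr t)].
Proof.
move=> nN2 u; have nm := small_lt nN2.
have [u01 cu] : 0 < u < 1 /\ calN N n u = 0.
  have [t t01 ct] := cC_zero n0 m0 nm.
  have : exists t : R, 0 < t < 1 /\ calN N n t = 0 by exists t; rewrite calNE.
  by move=> /(xgetPex 0).
rewrite calNE// in cu; have /andP[u0 ul1] := u01.
have us : u < tst.
  rewrite ltNge; apply/negP => h; have : 0 <= hC nr mr u.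
    rewrite -t_starP.2; move: h; rewrite le_eqVlt => /predU1P[->//|h].
    by apply/ltW/hC_inc => //; exact: ltW.
  by move=> /(cC_pos n0 m0 nm u01); rewrite cu ltxx.
have nm' := ltW nm; split=> // [t t0 tu|t ut tts].
- rewrite ltNge; apply/negP => h; have := cC_cross n0 m0 nm' t0 tu.
  by rewrite cu ltxx => /(_ (ltW (below_diag u01 nm' (hC_lt0 u0 us))) h).
- have t0 : 0 < t := lt_trans u0 ut.
  apply: (cC_cross n0 m0 nm' u0 ut); last by rewrite cu.
  by apply/ltW/below_diag => //; [rewrite t0 (lt_trans tts ts1)|exact: hC_lt0].
Qed.

Lemma definite_half : (2 * n = N)%N -> t1 < sg t1 /\ cC nr mr t1 < 0.
Proof.
move=> e; have nm : nr = mr by rewrite -e mul2n -addnn addnK.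
have le_nm : nr <= mr by rewrite nm.
have h := below_diag t_one01 le_nm (hC_lt0 p1 p2).
by split=> //; apply: cC_neg_diag => //; [rewrite nm|exact: t_one01].
Qed.
Lemma definite_large : (N < 2 * n)%N -> 2 * N%:R ^+ 2 / Z ^+ 2 < om -> t1 < sg t1 /\ cC nr mr t1 < 0.
Proof.
move=> nN2; have [c0 cs <-] := half_gt nN2; move=> /(om_gt c0 cs) tc.
have h : t1 < sg t1.
  apply: (lt_trans tc); rewrite -(@ltr_pXn2r _ 2) ?nnegrE ?sqrtr_ge0// sg2 ?ltW ?p1//; last by case/andP: t_one01.
  have : t1 ^+ 2 < Num.sqrt (1 / 2) ^+ 2 :> R by rewrite ltr_pXn2r ?nnegrE ?ltW ?p1.
  rewrite sqr_sqrtr ?divr_ge0//; lra.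
split=> //; apply: cC_neg_diag => //; last exact: t_one01.
exact: large_le.
Qed.
Lemma definite_small : (2 * n < N)%N -> omega_sharp Z N n < om -> t1 < sg t1 /\ cC nr mr t1 < 0.
Proof.
move=> nN2; have [u0 us h _] := t_sharpP nN2; move=> /(om_gt u0 us) tu.
split; last exact: h.
by apply: below_diag; [exact: t_one01|exact: small_le|exact: hC_lt0].
Qed.
Lemma indefinite_small : (2 * n < N)%N -> om < omega_sharp Z N n ->
  0 < (sg t1 ^+ 2 - t1 ^+ 2) * cC nr mr t1.
Proof.
move=> nN2; have [u0 us _ h] := t_sharpP nN2; move=> /(om_lt u0 us) tu.
rewrite mulr_gt0 ?h// subr_gt0 ltr_pXn2r ?nnegrE ?sqrtr_ge0 ?ltW//.
by apply: below_diag; [exact: t_one01|exact: small_le|exact: hC_lt0].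
Qed.
Lemma indefinite_large : (N < 2 * n)%N -> om < 2 * N%:R ^+ 2 / Z ^+ 2 ->
  0 < (sg t1 ^+ 2 - t1 ^+ 2) * cC nr mr t1.
Proof.
move=> nN2; have [c0 cs <-] := half_gt nN2; move=> /(om_lt c0 cs) tc.
have h : sg t1 < t1.
  apply: (lt_trans _ tc); rewrite -(@ltr_pXn2r _ 2) ?nnegrE ?sqrtr_ge0// sg2; last by have /andP[? ?] := t_one01; rewrite !ltW.
  have : Num.sqrt (1 / 2) ^+ 2 < t1 ^+ 2 :> R by rewrite ltr_pXn2r ?nnegrE ?sqrtr_ge0 ?(ltW p1).
  rewrite sqr_sqrtr ?divr_ge0//; lra.
rewrite nmulr_rgt0; first by apply: cC_neg => //; [exact: t_one01|exact: ltW|exact: hC_lt0].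
by rewrite subr_lt0 ltr_pXn2r ?nnegrE ?sqrtr_ge0 ?ltW.
Qed.
End Frequency.
End Frequencies.

(** * Stability and instability of the standing waves *)

Section Assembly.
Context {R : realType} (L Z : R) (N n : nat) (om : R).
Hypotheses (Z0 : Z < 0) (n_gt0 : (0 < n)%N) (nN : (n < N)%N) (omP : omega_star Z N n < om).
Notation nr := (n%:R : R). Notation mr := ((N - n)%:R : R).
Notation t := (@t_one R Z N n om). Notation s := (Num.sqrt (1 - t ^+ 2)).
Notation k := (Num.sqrt om). Notation q := (vq nr mr t s). Notation sig := (vsig nr mr t s).
Notation F := (pform (M11 nr mr t s) (M12 nr mr t s) (M22 nr mr t s)).
Let t01 : 0 < t < 1. Proof. exact: (t_one01 Z0 n_gt0 nN omP). Qed.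
Let t0 : 0 < t. Proof. by case/andP: t01. Qed.
Let n0 : 0 < nr. Proof. by rewrite ltr0n. Qed.
Let m0 : 0 < mr. Proof. by rewrite ltr0n subn_gt0. Qed.
Let s0 : 0 < s. Proof. by case/andP: t01 => ? t1; rewrite sg_gt0// ltW. Qed.
Let s01 : 0 < s < 1. Proof. by rewrite s0 sg_lt1. Qed.
Let s2 : s ^+ 2 = 1 - t ^+ 2. Proof. by have /andP[? ?] := t01; rewrite sg2// !ltW. Qed.
Let om0 : 0 < om. Proof. exact: om_gt0 omP. Qed.
Let k0 : 0 < k. Proof. by rewrite sqrtr_gt0. Qed.
Let kk : k ^+ 2 = om. Proof. by rewrite sqr_sqrtr// ltW. Qed.
Let q0 : 0 < q. Proof. exact: vq_gt0. Qed.
Let sig0 : 0 < sig. Proof. exact: vsig_gt0. Qed.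
(** The equation defining [t_one], multiplied by [t * s]. *)
Let Zkts : Z * k * t * s = - q.
Proof.
have [_ _] := t_oneP Z0 n_gt0 nN omP; rewrite /al => E.
have E2 : Z * k = - (nr / t + mr / s) by rewrite E; ring.
by rewrite E2 /vq; field; rewrite !gt_eqF.
Qed.
Let Zinv : Z^-1 = - (k * t * s / q).
Proof.
have zn : Z != 0 by rewrite lt_eqF.
apply: (mulfI zn); by rewrite divff// mulrN !mulrA Zkts mulNr opprK divff// gt_eqF.
Qed.

Definition edge_t (j : 'I_N) : R := if (j < n)%N then t else s.
Definition edge_psi (j : 'I_N) : R -> R := Psi L om (if (j < n)%N then artanh t else artanh s).
Lemma edges : exists tau : 'I_N -> R -> R, (forall j, profile L om (edge_t j) (tau j) (edge_psi j)) /\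
  (forall i j : 'I_N, (i < n)%N = (j < n)%N -> tau i = tau j /\ edge_psi i = edge_psi j).
Proof.
have [t1 h1] := profile_Psi L om0 t01; have [t2 h2] := profile_Psi L om0 s01.
exists (fun j => if (j < n)%N then t1 else t2); split=> [j|i j e].
  by rewrite /edge_t /edge_psi; case: ifP.
by rewrite /edge_psi e.
Qed.

Let c2 : R := Num.sqrt (2 * om).
Let c20 : 0 < c2. Proof. by rewrite sqrtr_gt0 mulr_gt0. Qed.
Lemma edge_psi_L j : edge_psi j L = c2 * (if (j < n)%N then s else t).
Proof.
have [tau [P _]] := edges; apply: (@pexpIrn _ 2) => //; rewrite ?nnegrE.
- exact/ltW/(pr_gt0 (P j)).
- by rewrite mulr_ge0 ?(ltW c20)//; case: ifP => _; exact: ltW.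
rewrite (psi_L_sqr (P j)) exprMn sqr_sqrtr; last by rewrite mulr_ge0// ltW.
by rewrite /edge_t; case: ifP => _; congr (_ * _); rewrite s2//; ring.
Qed.

Definition S1 (f : 'I_N -> R) := \sum_(j < N | (j < n)%N) f j.
Definition S2 (f : 'I_N -> R) := \sum_(j < N | ~~ (j < n)%N) f j.
Lemma S12 f : \sum_j f j = S1 f + S2 f.
Proof. by rewrite (bigID (fun j : 'I_N => (j < n)%N)). Qed.
Lemma S1_cst c : S1 (fun=> c) = nr * c.
Proof. by rewrite /S1 -(big_ord_widen N (fun=> c)) ?(ltnW nN)// sumr_const card_ord mulr_natl. Qed.
Lemma S2_cst c : S2 (fun=> c) = mr * c.
Proof.
have := S12 (fun=> c); rewrite S1_cst sumr_const card_ord -(mulr_natl c N) (NE nN : N%:R = nr + mr); lra.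
Qed.
Lemma S1_eq f g : (forall j : 'I_N, (j < n)%N -> f j = g j) -> S1 f = S1 g.
Proof. exact: eq_bigr. Qed.
Lemma S2_eq f g : (forall j : 'I_N, ~~ (j < n)%N -> f j = g j) -> S2 f = S2 g.
Proof. exact: eq_bigr. Qed.
Lemma S1Z c f : S1 (fun j => c * f j) = c * S1 f. Proof. by rewrite /S1 mulr_sumr. Qed.
Lemma S2Z c f : S2 (fun j => c * f j) = c * S2 f. Proof. by rewrite /S2 mulr_sumr. Qed.
Lemma S1D f g : S1 (fun j => f j + g j) = S1 f + S1 g. Proof. exact: big_split. Qed.
Lemma S2D f g : S2 (fun j => f j + g j) = S2 f + S2 g. Proof. exact: big_split. Qed.

Lemma edge_vertex i : \sum_j edge_psi j L = Z * (- k * edge_t i * edge_psi i L).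
Proof.
rewrite S12 (S1_eq (g := fun=> c2 * s)); last by move=> j h; rewrite edge_psi_L h.
rewrite (S2_eq (g := fun=> c2 * t)); last by move=> j /negbTE h; rewrite edge_psi_L h.
rewrite S1_cst S2_cst edge_psi_L /edge_t.
transitivity (- (Z * k * t * s) * c2); first by rewrite Zkts /vq; ring.
by case: ifP => _; ring.
Qed.

Notation M := (Mform L Z om edge_t edge_psi).
Notation del := (s ^+ 2 - t ^+ 2).
Lemma MformE y y' : M y y' = k * (- (del / t) * S1 (fun j => y j * y' j) + del / s * S2 (fun j => y j * y' j)
  - t * s / q * ((S1 y + S2 y) * (S1 y' + S2 y'))
  + t * s / sig * ((s / t * S1 y + t / s * S2 y) * (s / t * S1 y' + t / s * S2 y'))).
Proof.
have eeE z : \sum_j ee L edge_t edge_psi j * z j = c2 * (s / t * S1 z + t / s * S2 z).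
  rewrite S12 (S1_eq (g := fun j => c2 * (s / t) * z j)); last first.
    by move=> j h; rewrite /ee edge_psi_L /edge_t h mulrA.
  rewrite (S2_eq (g := fun j => c2 * (t / s) * z j)); last first.
    by move=> j /negbTE h; rewrite /ee edge_psi_L /edge_t h mulrA.
  by rewrite S1Z S2Z; ring.
have SSE : SS om edge_t = 2 * k * sig / (t * s).
  rewrite /SS S12 (S1_eq (g := fun=> 2 * k * (t^-1 - 1))); last by move=> j h; rewrite /edge_t h.
  rewrite (S2_eq (g := fun=> 2 * k * (s^-1 - 1))); last by move=> j /negbTE h; rewrite /edge_t h.
  by rewrite S1_cst S2_cst /vsig; field; rewrite !gt_eqF.
have c22 : c2 ^+ 2 = 2 * k ^+ 2 by rewrite kk /c2 sqr_sqrtr// mulr_ge0// ltW.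
have e1 : 2 * t ^+ 2 - 1 = - del by rewrite s2; ring.
have e2 : 2 * s ^+ 2 - 1 = del by rewrite s2; ring.
rewrite /Mform /bform !eeE SSE S12 !(S12 y) !(S12 y').
rewrite (S1_eq (g := fun j => k * (- del / t) * (y j * y' j))); last by move=> j h; rewrite /edge_t h e1.
rewrite (S2_eq (g := fun j => k * (del / s) * (y j * y' j))); last by move=> j /negbTE h; rewrite /edge_t h e2.
rewrite S1Z S2Z; set u := s / t * S1 y + _; set v := s / t * S1 y' + _.
have -> : c2 * u * (c2 * v) = 2 * k ^+ 2 * (u * v) by rewrite -c22; ring.
rewrite Zinv; move: (S1 _) (S2 _) (S1 y) (S2 y) (S1 y') (S2 y') u v => a b c d c' d' u v.
by field; rewrite !gt_eqF.
Qed.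

(** Sum of squared deviations from the mean over the first block; [V2] is that of the second. *)
Definition V1 y := S1 (fun j => y j ^+ 2) - (S1 y) ^+ 2 / nr.
Definition V2 y := S2 (fun j => y j ^+ 2) - (S2 y) ^+ 2 / mr.
Lemma V1_shift y c : V1 y = S1 (fun j => (y j - c) ^+ 2) - (S1 y - nr * c) ^+ 2 / nr.
Proof.
have -> : S1 (fun j => (y j - c) ^+ 2) = S1 (fun j => y j ^+ 2) + - 2 * c * S1 y + nr * c ^+ 2.
  by rewrite -S1Z -S1_cst -!S1D; apply: eq_bigr => j _; ring.
by rewrite /V1; field; rewrite gt_eqF.
Qed.
Lemma V2_shift y c : V2 y = S2 (fun j => (y j - c) ^+ 2) - (S2 y - mr * c) ^+ 2 / mr.
Proof.
have -> : S2 (fun j => (y j - c) ^+ 2) = S2 (fun j => y j ^+ 2) + - 2 * c * S2 y + mr * c ^+ 2.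
  by rewrite -S2Z -S2_cst -!S2D; apply: eq_bigr => j _; ring.
by rewrite /V2; field; rewrite gt_eqF.
Qed.
Lemma V1_ge0 y : 0 <= V1 y.
Proof.
rewrite (V1_shift y (S1 y / nr)) (_ : S1 y - _ = 0); last by field; rewrite gt_eqF.
by rewrite expr0n /= mul0r subr0; apply: sumr_ge0 => j _; exact: sqr_ge0.
Qed.
Lemma V2_ge0 y : 0 <= V2 y.
Proof.
rewrite (V2_shift y (S2 y / mr)) (_ : S2 y - _ = 0); last by field; rewrite gt_eqF.
by rewrite expr0n /= mul0r subr0; apply: sumr_ge0 => j _; exact: sqr_ge0.
Qed.
Lemma sum_sqrE y : \sum_j y j ^+ 2 = nr * (S1 y / nr) ^+ 2 + mr * (S2 y / mr) ^+ 2 + V1 y + V2 y.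
Proof. by rewrite S12 /V1 /V2; field; rewrite !gt_eqF. Qed.
Lemma sum_sqr_le2 y : \sum_j y j ^+ 2 <= N%:R * ((S1 y / nr) ^+ 2 + (S2 y / mr) ^+ 2) + V1 y + V2 y.
Proof.
rewrite sum_sqrE (NE nN : N%:R = nr + mr) !lerD2r; have := mulr_ge0 (ltW n0) (sqr_ge0 (S2 y / mr)).
have := mulr_ge0 (ltW m0) (sqr_ge0 (S1 y / nr)); lra.
Qed.
Lemma Mform_split y : M y y = k * F (S1 y / nr) (S2 y / mr) (S1 y / nr) (S2 y / mr) - k * (del / t) * V1 y + k * (del / s) * V2 y.
Proof.
rewrite MformE /V1 /V2 (S1_eq (g := fun j => y j ^+ 2)); last by move=> j _; rewrite expr2.
rewrite (S2_eq (g := fun j => y j ^+ 2)); last by move=> j _; rewrite expr2.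
rewrite /pform /M11 /M12 /M22 /A11 /A12 /A22.
move: (S1 _) (S2 _) (S1 y) (S2 y) q0 sig0; move: q sig => Q SI a b c d Q0 SI0.
by field; rewrite !gt_eqF.
Qed.

(** The case where the block means contribute a positive form and the second variance is positive,
    so that the only negative directions are differences inside the first block. *)
Definition definite := t < s /\ cC nr mr t < 0.
Lemma definiteP : definite -> 0 < del /\ exists2 c0 : R, 0 < c0 & forall x y, c0 * (x ^+ 2 + y ^+ 2) <= F x y x y.
Proof.
move=> [ts c]; split; first by rewrite subr_gt0 ltr_pXn2r ?nnegrE ?(ltW t0) ?(ltW s0).
apply: block_pos => //; have [h1 h2 _] := t_oneP Z0 n_gt0 nN omP.
by have := hC_lt0 n_gt0 nN h1 h2; rewrite /hC subr_lt0.
Qed.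
Let N0 : (0 < N)%N. Proof. exact: leq_trans nN. Qed.
Lemma block_const y : compatible (@rel_mean N n) y -> V1 y = 0 /\ V2 y = 0 /\
  exists a b : R, [/\ S1 y = nr * a, S2 y = mr * b, forall j : 'I_N, (j < n)%N -> y j = a &
   forall j : 'I_N, ~~ (j < n)%N -> y j = b].
Proof.
move=> hy; pose a := y (Ordinal N0); pose b := y (Ordinal nN).
have ya (j : 'I_N) : (j < n)%N -> y j = a by move=> h; apply: hy; rewrite /rel_mean /= h n_gt0.
have yb (j : 'I_N) : ~~ (j < n)%N -> y j = b.
  by move=> h; apply: hy; rewrite /rel_mean /= (negbTE h) ltnn.
have e1 : S1 y = nr * a by rewrite -S1_cst; exact: S1_eq.
have e2 : S2 y = mr * b by rewrite -S2_cst; exact: S2_eq.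
split; [|split; last by exists a, b].
- rewrite (V1_shift y a) e1 subrr expr0n mul0r subr0 (S1_eq (g := fun=> 0)) ?S1_cst ?mulr0// => j /ya ->.
  by rewrite subrr expr0n.
- rewrite (V2_shift y b) e2 subrr expr0n mul0r subr0 (S2_eq (g := fun=> 0)) ?S2_cst ?mulr0// => j /yb ->.
  by rewrite subrr expr0n.
Qed.
Let Nr0 : 0 < (N%:R : R). Proof. by rewrite ltr0n. Qed.

Theorem stable_mean : definite -> orbitally_stable L Z (Xmean L n `&` H1 L) (Theta L Z N n om).
Proof.
move=> /definiteP[_ [c c0 h]]; have [tau [P relP]] := edges.
have relP' (i j : 'I_N) : rel_mean n i j -> tau i = tau j /\ edge_psi i = edge_psi j by move=> /eqP /relP.
have c1 : 0 < k * c / N%:R by rewrite divr_gt0// mulr_gt0.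
apply: (graph_stable (Z0 := Z0) om0 P edge_vertex N0 relP' c1); last exact: Xmean_YR.
move=> y /block_const[v1 [v2 _]]; rewrite Mform_split v1 v2 !mulr0 subr0 addr0.
have := sum_sqr_le2 y; rewrite v1 v2 !addr0 => h2.
apply: le_trans (ler_wpM2l (ltW c1) h2) _.
by rewrite mulrA divfK ?gt_eqF// -mulrA ler_pM2l.
Qed.

(** In the coefficient of [V1], the term [k * (del / t)] cancels the negative variance of
    [Mform_split] and 1 leaves [V1] itself. *)
Lemma definite_split_bound c : 0 < del -> 0 < c -> (forall x y, c * (x ^+ 2 + y ^+ 2) <= F x y x y) ->
  exists2 c0 : R, 0 < c0 & forall y, c0 * \sum_j y j ^+ 2 <= M y y + (1 + k * (del / t)) * V1 y.
Proof.
move=> d0 cp h; pose e := k * (del / s).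
have e0 : 0 < e by rewrite mulr_gt0// divr_gt0.
pose c1 := k * c / N%:R; have c10 : 0 < c1 by rewrite divr_gt0// mulr_gt0.
exists (Num.min c1 (Num.min 1 e)); first by rewrite !lt_min c10 ltr01.
move=> y; set c' := Num.min _ _; have c'0 : 0 <= c' by rewrite ltW// !lt_min c10 ltr01.
apply: le_trans (ler_wpM2l c'0 (sum_sqr_le2 y)) _; rewrite Mform_split -/e.
have f0 := h (S1 y / nr) (S2 y / mr); move: f0; set f := F _ _ _ _.
move: (V1_ge0 y) (V2_ge0 y) (sqr_ge0 (S1 y / nr)) (sqr_ge0 (S2 y / mr)).
move: ((S1 y / nr) ^+ 2) ((S2 y / mr) ^+ 2) => A B.
move: (V1 y) (V2 y) => v w v0 w0 A0 B0 f0.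
have h1 : c' * (N%:R * (A + B)) <= k * f.
  apply: (@le_trans _ _ (k * (c * (A + B)))); last by rewrite ler_pM2l.
  by rewrite mulrA [leRHS]mulrA ler_wpM2r ?addr_ge0// -ler_pdivlMr// ge_min lexx.
have h2 : c' * v <= v by rewrite -[leRHS]mul1r ler_wpM2r// !ge_min lexx !orbT.
have h3 : c' * w <= e * w by rewrite ler_wpM2r// !ge_min lexx !orbT.
rewrite (mulrDl 1) mul1r; rewrite !(mulrDr c'); lra.
Qed.

Lemma S1_single g (j0 : 'I_N) : (j0 < n)%N -> (forall j : 'I_N, (j < n)%N -> j != j0 -> g j = 0) -> S1 g = g j0.
Proof.
move=> h0 h; rewrite /S1 (bigD1 j0)//= big1 ?addr0// => j /andP[? ?]; exact: h.
Qed.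

(** A first block with a single edge has no variance, hence no negative direction. *)
Theorem stable_full : n = 1%N -> definite -> orbitally_stable L Z (H1 L) (Theta L Z N n om).
Proof.
move=> n1 /definiteP[d0 [c cp h]]; have [tau [P _]] := edges.
have relP (i j : 'I_N) : false -> tau i = tau j /\ edge_psi i = edge_psi j by [].
have [c0 c00 hc] := definite_split_bound d0 cp h.
apply: (graph_stable (Z0 := Z0) om0 P edge_vertex N0 (rel := fun _ _ => false) relP c00).
- move=> y _; have := hc y; suff -> : V1 y = 0 by rewrite mulr0 addr0.
  have z (j : 'I_N) : (j < n)%N -> j != Ordinal N0 -> False.
    by rewrite n1 ltnS leqn0 => /eqP j0 /eqP[]; apply: val_inj.
  rewrite /V1 !(S1_single (j0 := Ordinal N0))//; try by move=> j a b; case: (z j a b).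
  by rewrite n1 divr1 subrr.
- by move=> U hU; split=> //; apply/YRP.
Qed.

(** The form on block means has signature (1, 1), so in the mean space there is exactly one negative
    direction, provided by [block_lorentz]. *)
Theorem unstable_mean : 0 < del * cC nr mr t -> ~ orbitally_stable L Z (H1 L) (Theta L Z N n om).
Proof.
move=> hd; have [tau [P relP]] := edges.
have relP' (i j : 'I_N) : rel_mean n i j -> tau i = tau j /\ edge_psi i = edge_psi j by move=> /eqP /relP.
have [x0 [y0 [c [K [neg c0 K0 h]]]]] := block_lorentz n0 m0 t0 s0 sig0 hd.
pose eta (j : 'I_N) : R := if (j < n)%N then x0 else y0.
have e1 : S1 eta = nr * x0 by rewrite -S1_cst; apply: S1_eq => j h1; rewrite /eta h1.
have e2 : S2 eta = mr * y0 by rewrite -S2_cst; apply: S2_eq => j /negbTE h1; rewrite /eta h1.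
have ME y : M y eta = k * F (S1 y / nr) (S2 y / mr) x0 y0.
  rewrite MformE e1 e2 (S1_eq (g := fun j => x0 * y j)); last by move=> j h1; rewrite /eta h1 mulrC.
  rewrite (S2_eq (g := fun j => y0 * y j)); last by move=> j /negbTE h1; rewrite /eta h1 mulrC.
  rewrite S1Z S2Z /pform /M11 /M12 /M22 /A11 /A12 /A22.
  move: (S1 y) (S2 y) q0 sig0; move: q sig => Q SI a b Q0 SI0.
  by field; rewrite !gt_eqF.
have c1 : 0 < k * c / N%:R by rewrite divr_gt0// mulr_gt0.
have K1 : 0 <= K / k by rewrite divr_ge0// ltW.
apply: (graph_unstable Z0 om0 P edge_vertex N0 relP' c1 K1 (eta := eta)).
- by move=> i j /eqP e; rewrite /eta e.
- rewrite ME e1 e2 ![_ * _ / _]mulrAC !divff ?gt_eqF// !mul1r pmulr_rlt0//.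
move=> y /block_const[v1 [v2 _]]; rewrite ME Mform_split v1 v2 !mulr0 subr0 addr0.
have := sum_sqr_le2 y; rewrite v1 v2 !addr0 => h2.
apply: le_trans (ler_wpM2l (ltW c1) h2) _.
rewrite mulrA divfK ?gt_eqF// -mulrA; set f := F _ _ x0 y0; set g := F _ _ _ _.
have -> : k * g + K / k * (k * f) ^+ 2 = k * (g + K * f ^+ 2) by field; rewrite gt_eqF.
by rewrite ler_pM2l.
Qed.

(** The differences inside the first block span [n - 1] negative directions, too many for the
    criterion when [n > 2]. Requiring equal values on all edges of that block except edge 0 keeps
    just one: [nr - 1] on edge 0 and [-1] on the others, which has mean zero. *)
Theorem unstable_split : (2 <= n)%N -> definite -> ~ orbitally_stable L Z (H1 L) (Theta L Z N n om).
Proof.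
move=> n2 /definiteP[d0 [c cp h]]; have [tau [P relP]] := edges.
pose rel (i j : 'I_N) := ((i < n)%N == (j < n)%N) && ((i == 0 :> nat) == (j == 0 :> nat)).
have relP' (i j : 'I_N) : rel i j -> tau i = tau j /\ edge_psi i = edge_psi j by move=> /andP[/eqP /relP].
have [c0 c00 hc] := definite_split_bound d0 cp h.
pose o0 := Ordinal N0; pose o1 : 'I_N := Ordinal (ltn_trans n2 nN : (1 < N)%N).
pose eta (j : 'I_N) : R := if (j < n)%N then (if (j == 0 :> nat) then nr - 1 else - 1) else 0.
have n1 : 0 < nr - 1 by rewrite subr_gt0 ltr1n.
have he : compatible rel eta by move=> i j /andP[/eqP e1 /eqP e2]; rewrite /eta e1 e2.
have nz (j : 'I_N) : j != o0 -> (j == 0 :> nat) = false by move=> j0; apply/negbTE; apply: contra j0 => /eqP e; apply/eqP/val_inj.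
have e1 : S1 eta = 0.
  have -> : S1 eta = S1 (fun j => eta j + 1) - nr * 1 by rewrite S1D S1_cst addrK.
  rewrite (S1_single (j0 := o0))// => [|j jn j0]; last by rewrite /eta jn nz// addNr.
  by rewrite /eta /= n_gt0 subrK mulr1 subrr.
have e2 : S2 eta = 0.
  by rewrite (S2_eq (g := fun=> 0)) ?S2_cst ?mulr0// => j /negbTE h1; rewrite /eta h1.
have yc (y : 'I_N -> R) (j : 'I_N) : compatible rel y -> (j < n)%N -> j != o0 -> y j = y o1.
  by move=> hy jn j0; apply: hy; rewrite /rel jn nz//= n2.
have e3 y : compatible rel y -> S1 (fun j => y j * eta j) = (nr - 1) * (y o0 - y o1).
  move=> hy; have -> : S1 (fun j => y j * eta j) = S1 (fun j => (y j - y o1) * eta j).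
    apply/esym; transitivity (S1 (fun j => y j * eta j) + - y o1 * S1 eta).
      by rewrite -S1Z -S1D; apply: eq_bigr => j _; ring.
    by rewrite e1 mulr0 addr0.
  rewrite (S1_single (j0 := o0))// => [|j jn j0]; last by rewrite (yc y)// subrr mul0r.
  by rewrite /eta /= n_gt0 mulrC.
have ME y : compatible rel y -> M y eta = - (k * (del / t)) * ((nr - 1) * (y o0 - y o1)).
  move=> hy; rewrite MformE e1 e2 e3// (S2_eq (g := fun=> 0)) ?S2_cst; first by ring.
  by move=> j /negbTE h1; rewrite /eta h1 mulr0.
pose e := k * (del / t); have e0 : 0 < e by rewrite mulr_gt0// divr_gt0.
(* Makes [K * Mform y eta ^+ 2] equal to [1 + e] times the squared difference of [y] at [o0] and
   [o1], which dominates [V1 y]. *)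
pose K := (1 + e) / (e * (nr - 1)) ^+ 2.
have K0 : 0 <= K by rewrite divr_ge0 ?sqr_ge0// addr_ge0// ltW.
apply: (graph_unstable Z0 om0 P edge_vertex N0 relP' c00 K0 he).
- rewrite ME// -/e mulNr oppr_lt0 mulr_gt0// mulr_gt0//.
  by rewrite /eta /= n_gt0 n2 opprK subrK.
move=> y hy; apply: le_trans (hc y) _; rewrite lerD2l ME// -/e.
have v : V1 y <= (y o0 - y o1) ^+ 2.
  rewrite (V1_shift y (y o1)) (S1_single (j0 := o0))// => [|j jn j0]; last by rewrite (yc y)// subrr expr0n.
  by rewrite gerBl divr_ge0 ?sqr_ge0// ltW.
have -> : K * (- e * ((nr - 1) * (y o0 - y o1))) ^+ 2 = (1 + e) * (y o0 - y o1) ^+ 2.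
  by rewrite /K; field; rewrite !gt_eqF.
by rewrite ler_wpM2l// addr_ge0// ltW.
Qed.
End Assembly.

Theorem theorem1p2 (R : realType) (L Z omega : R) (N n : nat)
    (L_ge0 : 0 <= L) (Z_lt0 : Z < 0) (N_ge2 : (2 <= N)%N)
    (n_range : (1 <= n <= N - 1)%N)
    (omega_gt : omega_star Z N n < omega) :
  let Th := Theta L Z N n omega in
  let stable_H1 := orbitally_stable L Z (H1 L) Th in
  let stable_mean := orbitally_stable L Z (Xmean L n `&` H1 L) Th in
  let omega_s := omega_sharp Z N n in
  let omega_c : R := 2 * N%:R ^+ 2 / Z ^+ 2 in
  [/\ [/\ n = 1%N /\ N = 2%N -> stable_H1 &
          [/\ n = 1%N, (2 < N)%N & omega_s < omega] -> stable_H1],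
      [/\ (2 * n = N)%N -> stable_mean,
          (N < 2 * n)%N /\ omega_c < omega -> stable_mean &
          (2 * n < N)%N /\ omega_s < omega -> stable_mean] &
      [/\ (2 * n = N)%N /\ (2 < N)%N -> ~ stable_H1,
          [/\ (2 * n < N)%N, (2 < N)%N, (2 <= n)%N & omega_s < omega] ->
            ~ stable_H1,
          (2 * n < N)%N /\ omega < omega_s -> ~ stable_H1,
          [/\ (N < 2 * n)%N, (2 < N)%N & omega_c < omega] -> ~ stable_H1 &
          (N < 2 * n)%N /\ omega < omega_c -> ~ stable_H1]].
Proof.
move=> Th stable_H1 st_mean omega_s omega_c.
have /andP[n_gt0 nN1] := n_range.
have nN : (n < N)%N by apply: leq_ltn_trans nN1 _; rewrite subn1 ltn_predL ltnW.
have half := definite_half Z_lt0 n_gt0 nN omega_gt.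
have large := definite_large Z_lt0 n_gt0 nN omega_gt.
have small := definite_small Z_lt0 n_gt0 nN omega_gt.
(* Guarantees that the first block contains a difference of edges, as [unstable_split] requires. *)
have n2 : (2 < N)%N -> (N <= 2 * n)%N -> (2 <= n)%N.
  by move=> N3 h; have : (2 * 1 < 2 * n)%N := leq_trans N3 h; rewrite ltn_pmul2l.
split; split.
- by move=> [e1 e2]; apply: stable_full => //; apply: half; rewrite e1 e2.
- by move=> [e1 N3 h]; apply: stable_full => //; apply: small => //; rewrite e1.
- by move=> /half; exact: stable_mean.
- by move=> [nn /(large nn)]; exact: stable_mean.
- by move=> [nn /(small nn)]; exact: stable_mean.
- by move=> [e N3]; apply: unstable_split => //; [apply: n2; rewrite ?e|exact: half].
- by move=> [nn _ n2' h]; apply: unstable_split => //; exact: small.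
- by move=> [nn h]; apply: unstable_mean => //; exact: indefinite_small.
- by move=> [nn N3 h]; apply: unstable_split => //; [apply: n2 => //; exact: ltnW|exact: large].
- by move=> [nn h]; apply: unstable_mean => //; exact: indefinite_large.
Qed.
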